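(* Let $\alpha,\beta>-1$ and $w(x)=(1-x)^\alpha(1+x)^\beta$. Consider the Jacobi operator $$Lf(x)=\frac{\big[w(x)(1-x^2)f'(x)\big]'}{w(x)}$$ with domain $D(L)$ the set of all real algebraic polynomials restricted to $[-1,1]$, as a densely defined operator in $L^2([-1,1],\mu)$, where $d\mu(x)=w(x)dx$. Then $L$ is essentially self-adjoint and $-L$ is positive. Moreover, for $t>0$, $e^{tL}$ is an integral operator whose kernel $e^{tL}(x,y)$ has Gaussian upper and lower bounds: there exist constants $c_1,c_2,c_3,c_4>0$ such that for any $x,y\in[-1,1]$ and $t>0$ $$\frac{c_1\exp\{-\frac{\rho(x,y)^2}{c_2t}\}}{\big[V(x,\sqrt t)V(y,\sqrt t)\big]^{1/2}}\le e^{tL}(x,y)\le\frac{c_3\exp\{-\frac{\rho(x,y)^2}{c_4t}\}}{\big[V(x,\sqrt t)V(y,\sqrt t)\big]^{1/2}}.$$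
   Context: All functions are real-valued. The distance on $[-1,1]$ is $\rho(x,y)=|\arccos x-\arccos y|$; $B(x,r)=\{y\in[-1,1]:\rho(x,y)<r\}$ and $V(x,r)=\mu(B(x,r))$. ''Positive'' means $-\int fLf\,d\mu\ge0$ for all $f\in D(L)$. Let $P_k$, $k\ge0$, be the Jacobi polynomials (the orthogonal polynomials of degree $k$ with respect to $\mu$) normalized in $L^2([-1,1],\mu)$. It is well known that $LP_k=-\lambda_kP_k$ with $\lambda_k=k(k+\alpha+\beta+1)$. The semigroup $e^{tL}$, $t>0$, is the one generated by the closure of $L$, and its (heat) kernel is $e^{tL}(x,y)=\sum_{k=0}^\infty e^{-\lambda_kt}P_k(x)P_k(y)$. *)

(* Defs.v *)
From HB Require Import structures.
From mathcomp Require Import all_boot all_order all_algebra.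
From mathcomp Require Import all_classical all_reals all_analysis.
From mathcomp Require Import measurable_realfun.

Set Implicit Arguments.
Unset Strict Implicit.
Unset Printing Implicit Defensive.

Import Order.TTheory GRing.Theory Num.Theory.
Import numFieldNormedType.Exports.

Local Open Scope classical_set_scope.
Local Open Scope ring_scope.

(* Unbounded operators on the real Hilbert space L^2(mu).  Elements of L^2 are
   represented by functions in [Lfun mu 2]; two of them denote the same element
   when they are equal mu-a.e.  An operator is given by (representatives of)
   its graph, a set of pairs of functions. *)
Section L2_operators.
Context d (X : measurableType d) (R : realType).
Variable mu : {measure set X -> \bar R}.
Implicit Types (f g u v : X -> R) (A : set ((X -> R) * (X -> R))).

Definition L2 : set (X -> R) := [set f | f \in Lfun mu 2%:E].

Definition L2norm f : \bar R := 'N[mu]_(2%:E) [EFin \o f].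

Definition L2dot f g : R := \int[mu]_x (f x * g x).

Definition densely_defined A : Prop :=
  A `<=` L2 `*` L2 /\
  forall f, L2 f -> forall e : R, 0 < e ->
    exists2 uv, A uv & (L2norm (f \- uv.1)%R < e%:E)%E.

Definition op_closure A : set ((X -> R) * (X -> R)) :=
  [set fg | (L2 `*` L2) fg /\
    exists s : nat -> (X -> R) * (X -> R),
      [/\ forall n, A (s n),
          L2norm ((s n).1 \- fg.1) @[n --> \oo] --> 0%E &
          L2norm ((s n).2 \- fg.2) @[n --> \oo] --> 0%E]].

Definition op_adjoint A : set ((X -> R) * (X -> R)) :=
  [set fg | (L2 `*` L2) fg /\
    forall u v, A (u, v) -> L2dot v fg.1 = L2dot u fg.2].

Definition self_adjoint A : Prop := densely_defined A /\ A = op_adjoint A.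

Definition essentially_self_adjoint A : Prop :=
  densely_defined A /\ self_adjoint (op_closure A).

(* [T t] is unconstrained for [t < 0]. *)
Record c0_semigroup (T : R -> (X -> R) -> (X -> R)) : Prop := C0Semigroup {
  c0_L2 : forall t f, 0 <= t -> L2 f -> L2 (T t f);
  c0_linear : forall t (a : R) f g, 0 <= t -> L2 f -> L2 g ->
    T t (fun x => a * f x + g x)
      = (fun x => a * T t f x + T t g x) %[ae mu];
  c0_bounded : forall t, 0 <= t ->
    exists M : R, forall f, L2 f -> (L2norm (T t f) <= M%:E * L2norm f)%E;
  c0_id : forall f, L2 f -> T 0 f = f %[ae mu];
  c0_add : forall s t f, 0 <= s -> 0 <= t -> L2 f ->
    T (s + t) f = T s (T t f) %[ae mu];
  c0_continuous : forall f, L2 f ->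
    L2norm (T t f \- f) @[t --> 0^'+] --> 0%E
}.

Definition generator (T : R -> (X -> R) -> (X -> R)) :
    set ((X -> R) * (X -> R)) :=
  [set fg | (L2 `*` L2) fg /\
    L2norm (fun x => t^-1 * (T t fg.1 x - fg.1 x) - fg.2 x) @[t --> 0^'+]
      --> 0%E].

Definition generates A (T : R -> (X -> R) -> (X -> R)) : Prop :=
  c0_semigroup T /\ generator T = A.

(* The kernel [K x y] is only meaningful for [x] and [y] in [D]; [mu] is meant to
   be null outside [D]. *)
Definition integral_operator (D : set X) (S : (X -> R) -> (X -> R))
    (K : X -> X -> R) : Prop :=
  forall f, L2 f -> {ae mu, forall x, D x ->
    mu.-integrable D (fun y => (K x y * f y)%:E) /\
    S f x = \int[mu]_(y in D) (K x y * f y)}.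

End L2_operators.

Section jacobi.
Variables (R : realType) (a b : R).

Definition jacobi_weight (x : R) : R := (1 - x) `^ a * (1 + x) `^ b.

(* The measure w(x)dx on [-1, 1], as a measure on R null outside [-1, 1]. *)
Definition jacobi_measure (A : set (measurableTypeR R)) : \bar R :=
  (\int[lebesgue_measure]_(x in A `&` `[(-1)%R, 1%R]) (jacobi_weight x)%:E)%E.

Lemma jacobi_weight_ge0 x : 0 <= jacobi_weight x.
Proof. by rewrite mulr_ge0// powR_ge0. Qed.

Lemma measurable_jacobi_weight : measurable_fun setT jacobi_weight.
Proof.
apply: measurable_funM.
- apply: (measurableT_comp (measurable_powR _)).
  exact: measurable_funB.
- apply: (measurableT_comp (measurable_powR _)).
  exact: measurable_funD.
Qed.

Let jacobi_measure0 : jacobi_measure set0 = 0%E.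
Proof. by rewrite /jacobi_measure set0I integral_set0. Qed.

Let jacobi_measure_ge0 A : (0 <= jacobi_measure A)%E.
Proof. by apply: integral_ge0 => x _; rewrite lee_fin jacobi_weight_ge0. Qed.

Let jacobi_measure_sigma_additive : semi_sigma_additive jacobi_measure.
Proof.
move=> /= F mF tF mUF; rewrite /jacobi_measure setI_bigcupl.
rewrite ge0_integral_bigcup//=.
- by apply: is_cvg_ereal_nneg_natsum_cond => n _ _; exact: jacobi_measure_ge0.
- by move=> k; exact: measurableI.
- apply/measurable_EFinP/measurable_funTS; exact: measurable_jacobi_weight.
- by move=> x _; rewrite lee_fin jacobi_weight_ge0.
- by apply: trivIset_setIr.
Qed.

HB.instance Definition _ := isMeasure.Build _ _ _ jacobi_measure
  jacobi_measure0 jacobi_measure_ge0 jacobi_measure_sigma_additive.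

(* The value at the endpoints, where w may vanish, is irrelevant: they are null. *)
Definition jacobi_op (f : R -> R) : R -> R :=
  (fun x => derive1 (fun y => jacobi_weight y * (1 - y ^+ 2) * derive1 f y) x
            / jacobi_weight x) \_ `]-1, 1[.

Definition jacobi_dom : set (R -> R) :=
  [set f | exists p : {poly R}, f = (horner p) \_ `[-1, 1]].

Definition jacobi_graph : set ((R -> R) * (R -> R)) :=
  [set (f, jacobi_op f) | f in jacobi_dom].

(* Determines each [P k] up to its sign, hence [jacobi_heat_kernel] below. *)
Definition jacobi_polynomials (P : nat -> {poly R}) : Prop :=
  (forall k, size (P k) = k.+1) /\
  forall i j, L2dot jacobi_measure (horner (P i)) (horner (P j)) = (i == j)%:R.

Definition jacobi_eigenvalue (k : nat) : R := k%:R * (k%:R + a + b + 1).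

Definition jacobi_heat_term (P : nat -> {poly R}) (t x y : R) (k : nat) : R :=
  expR (- jacobi_eigenvalue k * t) * (P k).[x] * (P k).[y].

Definition jacobi_heat_kernel (P : nat -> {poly R}) (t x y : R) : R :=
  limn (series (jacobi_heat_term P t x y)).

Definition jacobi_dist (x y : R) : R := `|acos x - acos y|.

Definition jacobi_ball (x r : R) : set R :=
  [set y | -1 <= y <= 1 /\ jacobi_dist x y < r].

Definition jacobi_vol (x r : R) : R := fine (jacobi_measure (jacobi_ball x r)).

Definition gaussian (c t x y : R) : R :=
  expR (- (jacobi_dist x y ^+ 2 / (c * t))) /
  Num.sqrt (jacobi_vol x (Num.sqrt t) * jacobi_vol y (Num.sqrt t)).

End jacobi.

(* Main.v *)
Require Import Defs.
From HB Require Import structures.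
From mathcomp Require Import all_boot all_order all_algebra.
From mathcomp Require Import all_classical all_reals all_analysis.
From mathcomp Require Import measurable_realfun ring lra.
Import Order.TTheory GRing.Theory Num.Theory.
Import numFieldNormedType.Exports.
Set Implicit Arguments.
Unset Strict Implicit.
Unset Printing Implicit Defensive.
Local Open Scope classical_set_scope.
Local Open Scope ring_scope.

(** Write w(x) = (1-x)^a (1+x)^b and mu = w dx. On polynomials the operator is
    L p = (1-x^2) p'' + (b - a - (a+b+2) x) p', and w L p is the derivative of
    the flux w (1-x^2) p', which vanishes at both endpoints because a, b > -1
    (Rintegral_jacobi_div). Hence L is symmetric and -L is positive, and
    comparing leading coefficients shows that the orthonormal polynomials P_k
    are eigenfunctions with eigenvalue - lambda_k.

    Polynomials are dense in L^2(mu) (poly_dense), so the P_k form an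
    orthonormal basis, and a bound on sup |P_k| that is polynomial in k
    (P_sup_bound) makes every series sum_k exp(- lambda_k t) P_k(x) P_k(y)
    with t > 0 converge normally. From these two facts everything about the
    operator follows by Fourier coefficients: the closure of L is the diagonal
    operator with coefficients - lambda_k, which is self-adjoint, and a
    strongly continuous semigroup with this generator must multiply the k-th
    coefficient by exp(- lambda_k t) (essentially_self_adjoint_sums, S_heat).

    The Gaussian bounds rest on four properties of the kernel K_t.

    - Volume doubling. In the angular variable t = arccos x the measure of
      B(x,r) with x >= 0 and r <= 1/8 is comparable to r (t+r) ((t+r)^2)^a
      (vol_doubling).

    - Positivity, unit mass and exponential tails. The mass is 1 because
      constants are eigenfunctions; the rest comes from a maximum principle:
      at a maximum of u on [-1,1] one has L u <= 0, including at the
      endpoints, where L has no second order term and its first order term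
      points inwards (jacobi_op2_max). Applied to the resolvent and iterated,
      it turns L G <= M G into exp(tL) G <= exp(2Mt) G. With G the exponential
      of l times a smoothed chord length, for which M is of order l^2, this
      bounds the integral of K_t(x,.) exp(l rho(x,.)/4) by a constant times
      exp(C l^2 t) (heat_poly_le, kernel_tail).

    - A local regularity estimate. If |u| <= A and r^2 |L u| <= A on B(x,4r),
      with r <= 1/8, then |u(y) - u(x)| <= C eps A whenever rho(x,y) <= eps r
      and eps <= 1/2. It is an elementary integration of the flux identity,
      done from the endpoint when x is within 2r of it and from a nearby mean
      value point otherwise (lipschitz_local, kernel_lipschitz).

    - An a priori bound K_t(x,x) <= C t^(-Q), with no control on Q, from the
      polynomial bound on sup |P_k|.

    Regularity and unit mass give K_t(x,x) V(x, sqrt t) <= C_eps + C eps sup_z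
    K_(t/2)(z,z) V(z, sqrt(t/2)); iterating with eps small absorbs the a
    priori bound and yields the diagonal upper bound. The semigroup law, the
    tails and the weights exp(k rho / sqrt t) then give the Gaussian factor
    (gaussian_upper). For the lower bound, unit mass and the tails put half of
    the mass of K_(t/2)(x,.) in a ball of radius comparable to sqrt t, the
    Cauchy-Schwarz inequality gives the lower bound on the diagonal,
    regularity extends it to rho(x,y) <= eps sqrt t, and a chain of short
    geodesic steps reaches every pair of points (gaussian_lower). *)

(** * The Jacobi measure *)

Section weight.
Context {R : realType}.
Notation leb := (@lebesgue_measure R).
Implicit Types a b c d x y K : R.

(** One inequality replaces the case distinction on the sign of the exponent:
    comparable bases have comparable powers, whatever that sign is. *)
Lemma powR_ratio b K x y : 0 < x -> 0 < y -> 1 <= K -> x <= K * y -> y <= K * x ->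
  x `^ b <= K `^ `|b| * y `^ b.
Proof.
move=> x0 y0 K1 xy yx; have K0 : 0 < K by lra.
have [b0|b0] := leP 0 b.
  rewrite ger0_norm// -(powRM _ (ltW K0) (ltW y0)).
  by apply: (ge0_ler_powR b0) => //; rewrite nnegrE ltW// mulr_gt0.
rewrite ltr0_norm// -(opprK b) powRN (powRN y) opprK.
rewrite -(ler_pM2r (powR_gt0 (-b) x0)) mulVf ?gt_eqF ?powR_gt0//.
rewrite -(ler_pM2l (powR_gt0 (-b) y0)) mulr1.
have yn : y `^ (- b) != 0 by rewrite gt_eqF// powR_gt0.
rewrite (_ : _ * (_ * _) = K `^ (- b) * x `^ (- b)); last by field.
rewrite -(powRM _ (ltW K0) (ltW x0)).
apply: ge0_ler_powR => //; rewrite ?nnegrE ?oppr_ge0 ltW//.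
by rewrite mulr_gt0.
Qed.

Lemma is_derive_powR_onem a x : -1 < a -> x < 1 ->
  is_derive x 1 (fun x => - ((1 - x) `^ (a + 1) / (a + 1))) ((1 - x) `^ a).
Proof.
move=> a1 x1.
have h : is_derive (1 - x) 1 (fun y : R => y `^ (a+1)) ((a+1) * (1-x) `^ (a + 1 - 1)).
  by apply: is_derive1_powR; lra.
have h2 := @is_derive1_comp R _ (fun x => 1 - x) _ _ _ h.
have -> : (fun x => - ((1 - x) `^ (a + 1) / (a + 1))) =
   (- (a+1)^-1) \*: ((fun y : R => y `^ (a+1)) \o (fun x => 1 - x)).
  by apply/funext => z /=; rewrite /GRing.scale/= mulNr mulrC.
apply: is_derive_eq.
rewrite /GRing.scale/= addrK; field; lra.
Qed.

Lemma continuous_powR_gt0 a x : 0 < x -> {for x, continuous (fun y : R => y `^ a)}.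
Proof.
move=> x0; apply: differentiable_continuous; apply/derivable1_diffP.
by apply: derivable_powR; rewrite in_itv/= andbT.
Qed.

Lemma continuous_onem_powR a x : x < 1 ->
  {for x, continuous (fun x : R => (1 - x) `^ a)}.
Proof.
move=> x1; apply: (@continuous_comp _ _ _ (fun y : R => 1 - y) (fun y : R => y `^ a)); last by apply: continuous_powR_gt0; lra.
by apply: cvgB; [exact: cvg_cst|exact: cvg_id].
Qed.

(** Monotone convergence along intervals exhausting [c, 1) turns the primitive
    - (1-x)^(a+1)/(a+1) into a bound for an integrand that may be unbounded at 1.
    This is where a > -1 enters. *)
Lemma integral_onem_powR_le a c : -1 < a -> c < 1 ->
  (\int[leb]_(x in `[c, 1%R]) ((1 - x) `^ a)%:E <= ((1 - c) `^ (a + 1) / (a + 1))%:E)%E.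
Proof.
move=> a1 c1.
have mf : measurable_fun setT (fun x : R => ((1 - x) `^ a)%:E).
  apply/measurable_EFinP; apply: (measurableT_comp (measurable_powR _)).
  exact: measurable_funB.
rewrite -integral_itv_bndo_bndc; last exact: measurable_funTS.
pose e (n : nat) : R := (1 - c) / n.+2%:R.
pose F (n : nat) : set R := `[c, 1 - e n]%classic.
have n0 (n : nat) : 0 < n.+2%:R :> R by [].
have n1 (n : nat) : e n < 1 - c.
  by rewrite /e ltr_pdivrMr// -subr_gt0 -{2}(mulr1 (1-c)) -mulrBr mulr_gt0 ?subr_gt0 ?ltr1n.
have n2 (n : nat) : 0 < e n by rewrite divr_gt0// subr_gt0.
have -> : `[c, 1[%classic = \bigcup_i F i.
  apply/seteqP; split=> x /=.
    rewrite in_itv/= => /andP[cx x1].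
    have r0 : 0 <= (1-c)/(1-x) by rewrite divr_ge0//; lra.
    have /andP[_ +] := truncn_itv r0.
    rewrite ltr_pdivrMr; last lra. move=> h.
    exists (Num.trunc ((1-c)/(1-x))) => //=; rewrite /F/= in_itv/= cx/=.
    rewrite lerBrDr -lerBrDl /e ler_pdivrMr// mulrC (le_trans (ltW h))// ler_pM2r; last lra.
    by rewrite ler_nat.
  move=> [n _]; rewrite /F/= !in_itv/= => /andP[-> /= h]; have := n2 n; lra.
have /cvg_lim <- // : (\int[leb]_(x in F i) ((1 - x) `^ a)%:E)%E @[i --> \oo]
   --> (\int[leb]_(x in \bigcup_i F i) ((1 - x) `^ a)%:E)%E.
  apply: ge0_nondecreasing_set_cvg_integral.
  - move=> m n mn; apply/subsetPset => x; rewrite /F/= !in_itv/= => /andP[-> /=] h.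
    apply: (le_trans h); rewrite /e lerD2l lerN2 ler_wpM2l//; first lra.
    by rewrite lef_pV2 ?posrE// ler_nat.
  - by move=> i; exact: measurable_itv.
  - by move=> i; exact: measurable_funTS.
  - by move=> i x _; rewrite lee_fin powR_ge0.
apply: lime_le.
  apply: ereal_nondecreasing_is_cvgn.
  apply: ge0_nondecreasing_set_nondecreasing_integral.
  - move=> m n mn; apply/subsetPset => x; rewrite /F/= !in_itv/= => /andP[-> /=] h.
    apply: (le_trans h); rewrite /e lerD2l lerN2 ler_wpM2l//; first lra.
    by rewrite lef_pV2 ?posrE// ler_nat.
  - by move=> i; exact: measurable_itv.
  - by move=> i; exact: measurable_funTS.
  - by move=> i x _; rewrite lee_fin powR_ge0.
apply: nearW => n.
pose G x := - ((1 - x) `^ (a + 1) / (a + 1)).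
have cG x : x < 1 -> {for x, continuous G}.
  move=> x1; apply: differentiable_continuous; apply/derivable1_diffP.
  by have [] := @is_derive_powR_onem a x a1 x1.
rewrite (@continuous_FTC2 R _ G); first last.
- move=> x; rewrite in_itv/= => /andP[_ h].
  have x1 : x < 1 by have := n2 n; lra.
  have := @is_derive_powR_onem a x a1 x1.
  by rewrite derive1E => /@derive_val ->.
- split.
  + move=> x; rewrite in_itv/= => /andP[_ h].
    have [] // := @is_derive_powR_onem a x a1 _; have := n2 n; lra.
  + apply: cvg_at_right_filter; apply: cG; lra.
  + apply: cvg_at_left_filter; apply: cG; have := n2 n; lra.
- apply: continuous_in_subspaceT => x; rewrite inE/= in_itv/= => /andP[_ h].
  by apply: continuous_onem_powR; have := n2 n; lra.
- by have := n1 n; lra.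
rewrite /G -EFinB lee_fin opprK gerDr oppr_le0 divr_ge0 ?powR_ge0//; lra.
Qed.

(** The reflection x -> -x exchanges the two exponents, so that every estimate
    needs a proof only near the right endpoint. *)
Lemma measure_jacobiN a b (A : set R) : measurable A ->
  jacobi_measure b a A = jacobi_measure a b ((-%R : R -> R) @^-1` A).
Proof.
move=> mA; rewrite /jacobi_measure.
have mD : measurable (A `&` `[(-1)%R, 1%R]) by exact: measurableI.
have -> : (-%R : R -> R) @^-1` A `&` `[(-1)%R, 1%R] =
    (-%R : measurableTypeR R -> measurableTypeR R) @^-1` (A `&` `[(-1)%R, 1%R]).
  apply/seteqP; split => x /=; rewrite !in_itv/= => -[Ax /andP[? ?]]; split => //; lra.
transitivity (\int[leb]_(x in (-%R : measurableTypeR R -> measurableTypeR R) @^-1` (A `&` `[(-1)%R, 1%R]))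
   ((fun y => (jacobi_weight b a y)%:E) \o (-%R : measurableTypeR R -> measurableTypeR R)) x)%E; last first.
  by apply: eq_integral => x _ /=; rewrite /jacobi_weight opprK mulrC.
rewrite -ge0_integral_pushforward//=.
- by apply: eq_measure_integral => //= B mB _; exact/esym/lebesgue_measureN.
- by apply/measurable_EFinP/measurable_funTS; exact: measurable_jacobi_weight.
- by move=> x _; rewrite lee_fin jacobi_weight_ge0.
Qed.

Lemma measure_jacobi_le_cst a b M (A : set (measurableTypeR R)) : measurable A -> 0 <= M ->
  (forall x, A x -> -1 <= x <= 1 -> jacobi_weight a b x <= M) ->
  (jacobi_measure a b A <= M%:E * leb (A `&` `[(-1)%R, 1%R]))%E.
Proof.
move=> mA M0 h; rewrite /jacobi_measure.
have mD : measurable (A `&` `[(-1)%R, 1%R]) by exact: measurableI.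
rewrite -(integral_cst _ mD); apply: ge0_le_integral => //=.
- by move=> x _; rewrite lee_fin jacobi_weight_ge0.
- by apply/measurable_EFinP/measurable_funTS; exact: measurable_jacobi_weight.
- by move=> x [Ax]; rewrite in_itv/= => xD; rewrite lee_fin h.
Qed.

Lemma measure_jacobi_ge_cst a b M (A : set (measurableTypeR R)) : measurable A -> 0 <= M ->
  (forall x, A x -> -1 <= x <= 1 -> M <= jacobi_weight a b x) ->
  (M%:E * leb (A `&` `[(-1)%R, 1%R]) <= jacobi_measure a b A)%E.
Proof.
move=> mA M0 h; rewrite /jacobi_measure.
have mD : measurable (A `&` `[(-1)%R, 1%R]) by exact: measurableI.
rewrite -(integral_cst _ mD); apply: ge0_le_integral => //=.
- by apply/measurable_EFinP/measurable_funTS; exact: measurable_jacobi_weight.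
- by move=> x [Ax]; rewrite in_itv/= => xD; rewrite lee_fin h.
Qed.

(** On [-1/2, 1] the factor (1+x)^b lies between 2^(-|b|) and 2^|b|. *)
Lemma jacobi_weight_le a b x : -2^-1 <= x <= 1 ->
  jacobi_weight a b x <= 2 `^ `|b| * (1 - x) `^ a.
Proof.
move=> /andP[x0 x1]; rewrite /jacobi_weight mulrC ler_wpM2r ?powR_ge0//.
have := @powR_ratio b 2 (1 + x) 1; rewrite powR1 !mulr1; apply=> //; lra.
Qed.

Lemma jacobi_weight_ge a b x : -2^-1 <= x <= 1 ->
  (1 - x) `^ a <= 2 `^ `|b| * jacobi_weight a b x.
Proof.
move=> /andP[x0 x1]; rewrite /jacobi_weight mulrCA ler_peMr ?powR_ge0//.
have := @powR_ratio b 2 1 (1 + x); rewrite powR1; apply=> //; lra.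
Qed.

Lemma measure_jacobi_cap a b c : -1 < a -> -2^-1 <= c -> c < 1 ->
  (jacobi_measure a b `[c, 1%R] <= (2 `^ `|b| * ((1 - c) `^ (a + 1) / (a + 1)))%:E)%E.
Proof.
move=> a1 c0 c1; rewrite /jacobi_measure.
have -> : (`[c, 1%R] `&` `[(-1)%R, 1%R])%classic = `[c, 1%R]%classic :> set R.
  by apply/setIidPl => x /=; rewrite !in_itv/= => /andP[? ->]; rewrite andbT; lra.
have mp : measurable_fun setT (fun x : R => ((1 - x) `^ a)%:E).
  apply/measurable_EFinP; apply: (measurableT_comp (measurable_powR _)).
  exact: measurable_funB.
apply: (@le_trans _ _ (\int[leb]_(x in `[c, 1%R]) ((2 `^ `|b|)%:E * ((1 - x) `^ a)%:E))%E).
  apply: ge0_le_integral => //=.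
  - by move=> x _; rewrite lee_fin jacobi_weight_ge0.
  - by apply/measurable_EFinP/measurable_funTS; exact: measurable_jacobi_weight.
  - by apply: measurable_funTS; apply: measurable_funeM.
  - move=> x; rewrite in_itv/= => /andP[h h1]; rewrite -EFinM lee_fin jacobi_weight_le//.
    by rewrite h1 andbT; lra.
rewrite ge0_integralZl//=; first last.
- by move=> x _; rewrite lee_fin powR_ge0.
- exact: measurable_funTS.
rewrite EFinM; apply: lee_wpmul2l; first by rewrite lee_fin powR_ge0.
exact: integral_onem_powR_le.
Qed.

Lemma measure_jacobi_setTE a b (A : set R) : jacobi_measure a b (A `&` `[(-1)%R, 1%R]) = jacobi_measure a b A.
Proof. by rewrite /jacobi_measure -setIA setIid. Qed.

Lemma measure_jacobi_fin a b : -1 < a -> -1 < b -> (jacobi_measure a b setT < +oo)%E.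
Proof.
move=> a1 b1; rewrite -measure_jacobi_setTE setTI.
have -> : `[(-1)%R, 1%R]%classic = `[0%R, 1%R] `|` ((-%R : R -> R) @^-1` `[0%R, 1%R]) :> set R.
  apply/seteqP; split => x /=; rewrite !in_itv/=; last by case=> /andP[? ?]; lra.
  by move=> /andP[? ?]; have [?|?] := leP 0 x; [left|right]; lra.
have mN : measurable ((-%R : R -> R) @^-1` `[0%R, 1%R]).
  by rewrite opp_preimage_itvbndbnd; exact: measurable_itv.
apply: le_lt_trans (measureU2 _ _ _) _ => //.
apply: lte_add_pinfty.
  by apply: le_lt_trans (measure_jacobi_cap _ _ _ _) _; rewrite ?ltry//; lra.
rewrite [X in (X < _)%E](_ : _ = jacobi_measure b a `[0%R, 1%R]); last first.
  by rewrite measure_jacobiN.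
by apply: le_lt_trans (measure_jacobi_cap _ _ _ _) _; rewrite ?ltry//; lra.
Qed.

Lemma measure_jacobi_onD a b : jacobi_measure a b (~` `[(-1)%R, 1%R]) = 0%E.
Proof. by rewrite -measure_jacobi_setTE setICl measure0. Qed.

End weight.

(** * The flux identity and integration of polynomials *)

Section poly_integral.
Context {R : realType} (a b : R).
Notation leb := (@lebesgue_measure R).
Notation TR := (measurableTypeR R).
Notation mu := (jacobi_measure a b).
Notation w := (jacobi_weight a b).
Notation DD := (`[(-1)%R, 1%R]%classic : set TR).
Hypotheses (ha : -1 < a) (hb : -1 < b).

Lemma measure_jacobi_fin_num (A : set TR) : measurable A -> (mu A < +oo)%E.
Proof.
move=> mA; apply: le_lt_trans (measure_jacobi_fin ha hb).
by apply: le_measure; rewrite ?inE.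
Qed.

Lemma integrable_jacobi_bounded (A : set TR) (f : TR -> R) (M : R) :
  measurable A -> measurable_fun A f -> (forall x, A x -> `|f x| <= M) ->
  mu.-integrable A (EFin \o f).
Proof.
move=> mA mf fM; apply: measurable_bounded_integrable => //.
  exact: measure_jacobi_fin_num.
by exists M; split; [exact: num_real|move=> N MN x /fM h]; apply: (le_trans h); exact: ltW.
Qed.

Lemma measurable_horner (A : set TR) (p : {poly R}) : measurable_fun A (fun x : TR => p.[x]).
Proof.
by apply: measurable_funTS; apply: continuous_measurable_fun; exact: continuous_horner.
Qed.

Lemma horner_bounded (p : {poly R}) : exists2 M : R, 0 < M & forall x : R, -1 <= x <= 1 -> `|p.[x]| <= M.
Proof.
have cp : {within `[(-1)%R, 1%R], continuous (fun x : R => `|p.[x]|)}.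
  apply: continuous_subspaceT => x.
  apply: (@continuous_comp _ _ _ (fun y => p.[y]) (fun y => `|y|)); first exact: continuous_horner.
  exact: norm_continuous.
have [|c _ h] := @EVT_max R _ _ _ _ cp; first lra.
exists (`|p.[c]| + 1); first by have := normr_ge0 p.[c]; lra.
by move=> x xD; have := h x; rewrite in_itv/= => /(_ xD); lra.
Qed.

Lemma integrable_horner (p : {poly R}) (A : set TR) : measurable A -> A `<=` DD ->
  mu.-integrable A (EFin \o (fun x : TR => p.[x])).
Proof.
move=> mA AD; have [M M0 h] := horner_bounded p.
apply: (@integrable_jacobi_bounded _ _ M) => //; first exact: measurable_horner.
by move=> x /AD; rewrite /= in_itv/=; apply: h.
Qed.

Lemma measurable_EFin_jacobi_weight (E : set TR) : measurable_fun E (fun x => (w x)%:E).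
Proof. by apply/measurable_EFinP/measurable_funTS; exact: measurable_jacobi_weight. Qed.

Lemma integrable_jacobi_weight : leb.-integrable DD (EFin \o w).
Proof.
apply/integrableP; split; first exact: measurable_EFin_jacobi_weight.
under eq_integral do rewrite /= ger0_norm ?jacobi_weight_ge0//.
have := measure_jacobi_fin ha hb; rewrite /jacobi_measure setTI.
by [].
Qed.

(** The measure is finite and absolutely continuous, and its Radon-Nikodym density
    agrees with the weight almost everywhere, since both have the same integrals
    over all measurable subsets. *)
Lemma ge0_integral_jacobi (f : TR -> \bar R) : (forall x, 0 <= f x)%E -> measurable_fun DD f ->
  (\int[mu]_(x in DD) f x = \int[leb]_(x in DD) (f x * (w x)%:E))%E.
Proof.
move=> f0 mf; have mD : measurable DD by exact: measurable_itv.
have fin : fin_num_fun mu.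
  by move=> A mA; rewrite ge0_fin_numE ?measure_ge0//; exact: measure_jacobi_fin_num.
pose nu : {finite_measure set TR -> \bar R} :=
  HB.pack (jacobi_measure a b) (@Measure_isFinite.Build _ _ _ (jacobi_measure a b) fin).
have dom : nu `<< leb.
  apply/null_content_dominatesP => A mA A0; rewrite /nu/= /jacobi_measure.
  apply: null_set_integral => //; first exact: measurableI.
  - exact: measurable_EFin_jacobi_weight.
  - apply/eqP; rewrite eq_le measure_ge0 andbT -A0.
    by apply: le_measure; rewrite ?inE//; exact: measurableI.
have dint := Radon_Nikodym_SigmaFinite.f_integrable dom.
have ae : ae_eq leb DD (Radon_Nikodym_SigmaFinite.f nu leb) (fun x => (w x)%:E).
  apply: integral_ae_eq => //.
  - exact: integrableS dint.
  - exact: measurable_EFin_jacobi_weight.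
  - move=> E ED mE; rewrite -(Radon_Nikodym_SigmaFinite.f_integral dom mE).
    by rewrite /nu/= /jacobi_measure (setIidl ED).
rewrite -[LHS]/(\int[nu]_(x in DD) f x)%E -(Radon_Nikodym_SigmaFinite.change_of_variables dom)//.
apply: ae_eq_integral => //.
- apply: emeasurable_funM => //; apply: measurable_funTS; exact: measurable_int dint.
- by apply: emeasurable_funM => //; exact: measurable_EFin_jacobi_weight.
- by apply: filterS ae => x h xD; rewrite h.
Qed.

Lemma integrable_horner_weight (p : {poly R}) :
  leb.-integrable DD (EFin \o (fun x => p.[x] * w x)).
Proof.
have [M M0 h] := horner_bounded p.
have mm : measurable_fun DD (fun x : TR => p.[x] * w x).
  by apply: measurable_funM; [exact: measurable_horner|apply: measurable_funTS; exact: measurable_jacobi_weight].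
apply: (@le_integrable _ TR R leb DD _ _ (fun x => (M * w x)%:E)) => //; first exact/measurable_EFinP.
  move=> x /=; rewrite in_itv/= => /h hx.
  rewrite !lee_fin !normrM ler_wpM2r// (le_trans hx)// ler_norm//.
rewrite (_ : (fun x : TR => (M * w x)%:E) = (fun x => M%:E * (EFin \o w) x)%E); last first.
  by apply/funext => x; rewrite EFinM.
by apply: integrableZl => //; exact: integrable_jacobi_weight.
Qed.

Lemma Rintegral_jacobi_horner (p : {poly R}) :
  \int[mu]_(x in DD) p.[x] = \int[leb]_(x in DD) (p.[x] * w x).
Proof.
have [M M0 h] := horner_bounded p.
pose q := p + M%:P.
have key (r : {poly R}) : (forall x, -1 <= x <= 1 -> 0 <= r.[x]) ->
    \int[mu]_(x in DD) r.[x] = \int[leb]_(x in DD) (r.[x] * w x).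
  move=> r0; rewrite /Rintegral; congr fine.
  transitivity (\int[mu]_(x in DD) (Num.max 0 r.[x])%:E)%E.
    apply: eq_integral => x; rewrite inE/= in_itv/= => /r0 h0.
    by rewrite max_r.
  rewrite ge0_integral_jacobi//; first last.
  - apply/measurable_EFinP; apply: measurable_maxr => //; exact: measurable_horner.
  - by move=> x; rewrite lee_fin le_max lexx.
  apply: eq_integral => x; rewrite inE/= in_itv/= => /r0 h0.
  by rewrite max_r// EFinM.
have h1 : \int[mu]_(x in DD) (p + M%:P).[x] = \int[leb]_(x in DD) ((p + M%:P).[x] * w x).
  by apply: key => x /h; rewrite ler_norml hornerD hornerC => /andP[]; lra.
have h2 : \int[mu]_(x in DD) (M%:P).[x] = \int[leb]_(x in DD) ((M%:P).[x] * w x).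
  by apply: key => x /h _; rewrite hornerC ltW.
move: h1.
under eq_Rintegral do rewrite hornerD.
under [RHS]eq_Rintegral do rewrite hornerD mulrDl.
rewrite !RintegralD//; [|exact: integrable_horner_weight..|exact: integrable_horner|exact: integrable_horner].
by rewrite h2 => /addIr.
Qed.

(** The polynomial M r such that w M r is the derivative of w (1-x^2) r; the
    operator itself is M applied to the derivative. *)
Definition jacobi_div (r : {poly R}) : {poly R} :=
  (1 - 'X^2) * r^`() + ((b - a)%:P - (a + b + 2) *: 'X) * r.

(** The function w (1-x^2), written with the exponents a+1 and b+1 so that it is
    visibly continuous, and zero, at the endpoints. *)
Definition jacobi_wplus (x : R) : R := (1 - x) `^ (a + 1) * (1 + x) `^ (b + 1).

Let a1 : 0 < a + 1. Proof. by rewrite -ltrBlDr sub0r. Qed.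
Let b1 : 0 < b + 1. Proof. by rewrite -ltrBlDr sub0r. Qed.

Lemma jacobi_wplusE (x : R) : -1 <= x <= 1 -> jacobi_wplus x = w x * (1 - x ^+ 2).
Proof.
move=> /andP[x0 x1]; rewrite /jacobi_wplus /jacobi_weight.
have h1 : (1 - x) * (1 - x) `^ a = (1 - x) `^ (a + 1).
  by rewrite -[in LHS](addrK 1 a) mulr_powRB1//; lra.
have h2 : (1 + x) * (1 + x) `^ b = (1 + x) `^ (b + 1).
  by rewrite -[in LHS](addrK 1 b) mulr_powRB1//; lra.
rewrite -h1 -h2; ring.
Qed.

Lemma is_derive_jacobi_wplus (r : {poly R}) (x : R) : -1 < x < 1 ->
  is_derive x 1 (fun x => jacobi_wplus x * r.[x]) (w x * (jacobi_div r).[x]).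
Proof.
move=> /andP[x0 x1].
have h1 : is_derive x 1 (fun x => (1 - x) `^ (a + 1)) (- (a + 1) * (1 - x) `^ a).
  have h : is_derive (1 - x) 1 (fun y : R => y `^ (a+1)) ((a+1) * (1-x) `^ (a + 1 - 1)).
    by apply: is_derive1_powR; lra.
  have h2 := @is_derive1_comp R _ (fun x => 1 - x) _ _ _ h.
  apply: is_derive_eq; rewrite /GRing.scale/= addrK; ring.
have h2 : is_derive x 1 (fun x => (1 + x) `^ (b + 1)) ((b + 1) * (1 + x) `^ b).
  have h : is_derive (1 + x) 1 (fun y : R => y `^ (b+1)) ((b+1) * (1+x) `^ (b + 1 - 1)).
    by apply: is_derive1_powR; lra.
  have h2 := @is_derive1_comp R _ (fun x => 1 + x) _ _ _ h.
  apply: is_derive_eq; rewrite /GRing.scale/= addrK; ring.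
have h3 : is_derive x 1 (fun x => r.[x]) (r^`()).[x].
  apply: DeriveDef; first exact: derivable_horner.
  by rewrite -derive1E derivE.
have h4 : is_derive x 1 (jacobi_wplus \* (fun x => r.[x])) (w x * (jacobi_div r).[x]).
  have h5 : is_derive x 1 jacobi_wplus _ := is_deriveM h1 h2.
  have h6 := is_deriveM h5 h3.
  apply: is_derive_eq; rewrite /GRing.scale/= {1}/jacobi_wplus.
  have e1 : (1 - x) * (1 - x) `^ a = (1 - x) `^ (a + 1).
    by rewrite -[in LHS](addrK 1 a) mulr_powRB1//; lra.
  have e2 : (1 + x) * (1 + x) `^ b = (1 + x) `^ (b + 1).
    by rewrite -[in LHS](addrK 1 b) mulr_powRB1//; lra.
  rewrite /jacobi_div /jacobi_weight -e1 -e2 !hornerE /=; ring.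
exact: h4.
Qed.

Lemma cvg_onem_left (f : R -> R) (l : R) : f y @[y --> 0^'+] --> l -> f (1 - x) @[x --> 1^'-] --> l.
Proof.
move=> h; apply/cvgrPdist_lt => e e0.
move/cvgrPdist_lt : h => /(_ _ e0) [d /= d0 hd].
exists d => //= x /=; rewrite distrC => xd x1.
apply: hd; last by rewrite /=; lra.
by rewrite /= sub0r normrN ltr_norml; move: xd; rewrite ltr_norml; lra.
Qed.

Lemma cvg_onep_right (f : R -> R) (l : R) : f y @[y --> 0^'+] --> l -> f (1 + x) @[x --> (-1)^'+] --> l.
Proof.
move=> h; apply/cvgrPdist_lt => e e0.
move/cvgrPdist_lt : h => /(_ _ e0) [d /= d0 hd].
exists d => //= x /=; rewrite distrC => xd x1.
apply: hd; last by rewrite /=; lra.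
by rewrite /= sub0r normrN ltr_norml; move: xd; rewrite ltr_norml; lra.
Qed.

Lemma jacobi_wplus1 : jacobi_wplus 1 = 0.
Proof. by rewrite /jacobi_wplus subrr powR0 ?mul0r// gt_eqF. Qed.

Lemma jacobi_wplusN1 : jacobi_wplus (-1) = 0.
Proof. by rewrite /jacobi_wplus subrr powR0 ?mulr0// gt_eqF. Qed.

Lemma continuous_jacobi_wplus (r : {poly R}) :
  {within `[(-1)%R, 1%R], continuous (fun x => jacobi_wplus x * r.[x])}.
Proof.
apply/continuous_within_itvP; first lra.
split.
- move=> x; rewrite in_itv/= => xD.
  apply: differentiable_continuous; apply/derivable1_diffP.
  by have [] := is_derive_jacobi_wplus r xD.
- rewrite jacobi_wplusN1 mul0r.
  have h : (1 - x) `^ (a + 1) * (1 + x) `^ (b + 1) * r.[x] @[x --> (-1)^'+] --> (2 `^ (a+1) * 0) * r.[-1].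
    apply: cvgM; last by apply: cvg_at_right_filter; exact: continuous_horner.
    apply: cvgM; last by apply: (@cvg_onep_right (fun y => y `^ (b+1))); exact: powR_cvg0.
    rewrite (_ : 2 = 1 - (-1)); last lra.
    by apply: cvg_at_right_filter; apply: continuous_onem_powR; lra.
  by rewrite mulr0 mul0r in h.
- rewrite jacobi_wplus1 mul0r.
  have h : (1 - x) `^ (a + 1) * (1 + x) `^ (b + 1) * r.[x] @[x --> 1^'-] --> (0 * 2 `^ (b+1)) * r.[1].
    apply: cvgM; last by apply: cvg_at_left_filter; exact: continuous_horner.
    apply: cvgM; first by apply: (@cvg_onem_left (fun y => y `^ (a+1))); exact: powR_cvg0.
    rewrite (_ : 2 = 1 + 1); last lra.
    apply: cvg_at_left_filter.
    apply: (@continuous_comp _ _ _ (fun y : R => 1 + y) (fun y : R => y `^ (b+1))); last by apply: continuous_powR_gt0; lra.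
    by apply: cvgD; [exact: cvg_cst|exact: cvg_id].
  by rewrite !mul0r in h.
Qed.

Lemma continuous_jacobi_weight (x : R) : -1 < x < 1 -> {for x, continuous w}.
Proof.
move=> /andP[x0 x1]; apply: cvgM; first exact: continuous_onem_powR.
apply: (@continuous_comp _ _ _ (fun y : R => 1 + y) (fun y : R => y `^ b)); last by apply: continuous_powR_gt0; lra.
by apply: cvgD; [exact: cvg_cst|exact: cvg_id].
Qed.

(** The integrand is the derivative of a flux that vanishes at -1 and at 1.  The
    weight may be unbounded at the endpoints, so the fundamental theorem is used
    in the form: the primitive of the integrand minus the flux is continuous on
    [-1,1] and has zero derivative inside. *)
Lemma Rintegral_jacobi_div (r : {poly R}) : \int[mu]_(x in DD) (jacobi_div r).[x] = 0.
Proof.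
rewrite Rintegral_jacobi_horner.
pose f x := (jacobi_div r).[x] * w x.
have fi : leb.-integrable DD (EFin \o f) by exact: integrable_horner_weight.
have N11 : (-1 : R) <= 1 by lra.
have ci := @parameterized_integral_continuous R (-1) 1 f N11 fi.
pose I x := parameterized_integral leb (-1) x f.
pose Phi x := I x - jacobi_wplus x * r.[x].
have cPhi : {within `[(-1)%R, 1%R], continuous Phi}.
  by move=> x; apply: cvgB; [exact: ci|exact: continuous_jacobi_wplus].
have dPhi (x : R) : x \in `]-1, 1[%R -> is_derive x 1 Phi 0.
  rewrite in_itv/= => xD.
  have h1 : is_derive x 1 I (f x).
    have [x0 x1] := andP xD.
    have x2 : (-1 < x)%O by [].
    have fx : {for x, continuous f}.
      by apply: cvgM; [exact: continuous_horner|exact: continuous_jacobi_weight].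
    have [d1 d2] := @continuous_FTC1_closed R f (-1) x 1 x1 fi x2 fx.
    rewrite /I /parameterized_integral; apply: DeriveDef; first exact: d1.
    rewrite -derive1E; exact: d2.
  have h2 := is_derive_jacobi_wplus r xD.
  have h3 := is_deriveB h1 h2.
  apply: is_derive_eq; rewrite /f; ring.
have N11' : (-1 : R) < 1 by lra.
have [c _] := MVT N11' dPhi cPhi.
rewrite mul0r => /eqP; rewrite subr_eq0 => /eqP.
rewrite /Phi jacobi_wplus1 jacobi_wplusN1 !mul0r !subr0 /I /parameterized_integral => ->.
by rewrite set_itv1 Rintegral_set1.
Qed.

End poly_integral.

(** * Geometry of real L2 spaces *)

Section L2_geometry.
Context d (T : measurableType d) (R : realType).
Variable mu : {measure set T -> \bar R}.
Implicit Types (f g h : T -> R).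
Local Notation "<[ f , g ]>" := (L2dot mu f g).

Lemma L2_measurable f : L2 mu f -> measurable_fun setT f.
Proof. by rewrite /L2/= inE => /andP[+ _]; rewrite inE. Qed.

Lemma L2_integrableM f g : L2 mu f -> L2 mu g ->
  mu.-integrable setT (EFin \o (fun x => f x * g x)).
Proof. by move=> hf hg; apply/Lfun1_integrable; exact: Lfun2_mul_Lfun1. Qed.

Lemma L2P f : measurable_fun setT f -> mu.-integrable setT (EFin \o (fun x => f x * f x)) ->
  L2 mu f.
Proof.
move=> mf /integrableP[_ fi]; rewrite /L2/= inE; apply/andP; split; first by rewrite inE.
rewrite inE/= /finite_norm unlock/=.
apply: poweR_lty; apply: le_lt_trans fi.
rewrite le_eqVlt; apply/orP; left; apply/eqP; apply: eq_integral => x _ /=.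
by rewrite powR_mulrn// expr2 normrM.
Qed.

Lemma integrable_EFinZ (D : set T) c f : measurable D -> mu.-integrable D (EFin \o f) ->
  mu.-integrable D (EFin \o (fun x => c * f x)).
Proof.
move=> mD fi; rewrite (_ : EFin \o _ = (fun x => c%:E * (EFin \o f) x)%E).
  exact: integrableZl.
by apply/funext => x /=; rewrite EFinM.
Qed.

Lemma L2_lin c f g : L2 mu f -> L2 mu g -> L2 mu (fun x => c * f x + g x).
Proof.
move=> hf hg; have [_ h] := Lfun_submod_closed mu (lee1n 2).
exact: h c f g hf hg.
Qed.

Lemma L2B f g : L2 mu f -> L2 mu g -> L2 mu (fun x => f x - g x).
Proof.
move=> hf hg; have := L2_lin (-1) hg hf.
by congr (L2 mu); apply/funext => x; rewrite mulN1r addrC.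
Qed.

Lemma L2_0 : L2 mu (fun=> 0).
Proof. by have [h _] := Lfun_submod_closed mu (lee1n 2); exact: h. Qed.

Lemma L2_sum n (c : nat -> R) (e : nat -> T -> R) : (forall k, L2 mu (e k)) ->
  L2 mu (fun x => \sum_(0 <= k < n) c k * e k x).
Proof.
move=> he; elim: n => [|n ih].
  by under eq_fun do rewrite big_geq//; exact: L2_0.
under eq_fun do rewrite big_nat_recr//= addrC.
exact: L2_lin.
Qed.

Lemma L2dotC f g : <[f, g]> = <[g, f]>.
Proof. by rewrite /L2dot; apply: eq_Rintegral => x _; rewrite mulrC. Qed.

Lemma L2dot_linl c f g h : L2 mu f -> L2 mu g -> L2 mu h ->
  <[fun x => c * f x + g x, h]> = c * <[f, h]> + <[g, h]>.
Proof.
move=> hf hg hh; rewrite /L2dot -RintegralZl//; last exact: L2_integrableM.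
rewrite -RintegralD//; [|apply: integrable_EFinZ => //; exact: L2_integrableM|exact: L2_integrableM].
by apply: eq_Rintegral => x _; rewrite mulrDl mulrA.
Qed.

Lemma L2dotBl f g h : L2 mu f -> L2 mu g -> L2 mu h ->
  <[fun x => f x - g x, h]> = <[f, h]> - <[g, h]>.
Proof.
move=> hf hg hh; have := @L2dot_linl (-1) g f h hg hf hh.
rewrite mulN1r addrC => <-; congr L2dot; apply/funext => x; by rewrite mulN1r addrC.
Qed.

Lemma L2dotBr f g h : L2 mu f -> L2 mu g -> L2 mu h ->
  <[h, fun x => f x - g x]> = <[h, f]> - <[h, g]>.
Proof. by move=> *; rewrite L2dotC L2dotBl// !(L2dotC h). Qed.

Lemma L2dot0l h : <[fun=> 0, h]> = 0.
Proof.
rewrite /L2dot; under eq_Rintegral do rewrite mul0r.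
by rewrite /Rintegral integral0.
Qed.

Lemma L2dot_suml n (c : nat -> R) (e : nat -> T -> R) h : (forall k, L2 mu (e k)) -> L2 mu h ->
  <[fun x => \sum_(0 <= k < n) c k * e k x, h]> = \sum_(0 <= k < n) c k * <[e k, h]>.
Proof.
move=> he hh; elim: n => [|n ih].
  by under eq_fun do rewrite big_geq//; rewrite big_geq// L2dot0l.
under eq_fun do rewrite big_nat_recr//= addrC.
rewrite L2dot_linl//; last exact: L2_sum.
by rewrite ih big_nat_recr//= addrC.
Qed.

Lemma L2dot_ge0 f : 0 <= <[f, f]>.
Proof. by apply: Rintegral_ge0 => x _; rewrite -expr2 sqr_ge0. Qed.

Lemma L2normE f : L2 mu f -> L2norm mu f = (Num.sqrt <[f, f]>)%:E.
Proof.
move=> hf; rewrite /L2norm unlock/=.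
rewrite -powR12_sqrt ?L2dot_ge0// -poweR_EFin; congr (_ `^ _)%E.
rewrite /L2dot /Rintegral fineK.
  by apply: eq_integral => x _ /=; rewrite powR_mulrn// expr2 -normrM ger0_norm// -expr2 sqr_ge0.
by apply: integrable_fin_num => //; exact: L2_integrableM.
Qed.

Lemma L2dot_quad s f g : L2 mu f -> L2 mu g ->
  <[fun x => s * f x + g x, fun x => s * f x + g x]> =
  s ^+ 2 * <[f, f]> + 2 * s * <[f, g]> + <[g, g]>.
Proof.
move=> hf hg; have hl := L2_lin s hf hg.
rewrite (L2dot_linl s hf hg hl) (L2dotC f) (L2dotC g) (L2dot_linl s hf hg hf).
rewrite (L2dot_linl s hf hg hg) (L2dotC g f); ring.
Qed.

Lemma L2_cauchy_schwarz f g : L2 mu f -> L2 mu g -> <[f, g]> ^+ 2 <= <[f, f]> * <[g, g]>.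
Proof.
move=> hf hg; have ff := L2dot_ge0 f; have gg := L2dot_ge0 g.
have key s : 0 <= s ^+ 2 * <[f, f]> + 2 * s * <[f, g]> + <[g, g]>.
  by rewrite -L2dot_quad//; exact: L2dot_ge0.
move: ff; rewrite le_eqVlt => /orP[/eqP ff0|ff].
  have fg0 : <[f, g]> = 0.
    apply/eqP/negP => /negP fgN0.
    have := key (- (<[g, g]> + 1) / (2 * <[f, g]>)).
    rewrite -ff0 mulr0 add0r (_ : _ + _ = -1); first lra.
    by field.
  by rewrite fg0 expr0n/= -ff0 mul0r.
have := key (- <[f, g]> / <[f, f]>).
rewrite (_ : _ + _ = (<[f, f]> * <[g, g]> - <[f, g]> ^+ 2) / <[f, f]>); last by field; rewrite gt_eqF.
by rewrite pmulr_lge0 ?invr_gt0// subr_ge0.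
Qed.

Definition L2nrm f : R := Num.sqrt <[f, f]>.

Lemma L2nrm_ge0 f : 0 <= L2nrm f. Proof. exact: sqrtr_ge0. Qed.

Lemma L2nrm_sqr f : L2nrm f ^+ 2 = <[f, f]>.
Proof. by rewrite sqr_sqrtr// L2dot_ge0. Qed.

Lemma ler_L2dot f g : L2 mu f -> L2 mu g -> `|<[f, g]>| <= L2nrm f * L2nrm g.
Proof.
move=> hf hg; rewrite -ler_sqr ?nnegrE ?normr_ge0 ?mulr_ge0 ?L2nrm_ge0//.
by rewrite exprMn !L2nrm_sqr real_normK ?num_real// L2_cauchy_schwarz.
Qed.

Lemma ler_L2nrmD f g : L2 mu f -> L2 mu g -> L2nrm (fun x => f x + g x) <= L2nrm f + L2nrm g.
Proof.
move=> hf hg; rewrite -ler_sqr ?nnegrE ?addr_ge0 ?L2nrm_ge0//.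
rewrite sqrrD !L2nrm_sqr.
have := L2dot_quad 1 hf hg; under eq_fun do rewrite mul1r.
rewrite expr1n !mul1r mulr1 => ->.
have := ler_L2dot hf hg; rewrite ler_norml => /andP[_ h].
rewrite mulr2n mulrDl mul1r; lra.
Qed.

Lemma L2nrm_distC f g : L2nrm (fun x => f x - g x) = L2nrm (fun x => g x - f x).
Proof.
by rewrite /L2nrm /L2dot; congr Num.sqrt; apply: eq_Rintegral => x _; rewrite -mulrNN !opprB.
Qed.

Lemma ler_L2nrm_dist f g h : L2 mu f -> L2 mu g -> L2 mu h ->
  L2nrm (fun x => f x - h x) <= L2nrm (fun x => f x - g x) + L2nrm (fun x => g x - h x).
Proof.
move=> hf hg hh; have := ler_L2nrmD (L2B hf hg) (L2B hg hh).
by under eq_fun do rewrite addrA subrK.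
Qed.

Lemma ler_L2nrm f g : L2 mu f -> L2 mu g ->
  L2nrm f <= L2nrm g + L2nrm (fun x => f x - g x).
Proof.
move=> hf hg; have := ler_L2nrmD hg (L2B hf hg).
by under eq_fun do rewrite addrC subrK.
Qed.

Lemma L2dot_ae f g h : L2 mu f -> L2 mu g -> L2 mu h -> f = g %[ae mu] -> <[f, h]> = <[g, h]>.
Proof.
move=> hf hg hh fg; rewrite /L2dot /Rintegral; congr fine.
apply: ae_eq_integral => //.
- exact: measurable_int (L2_integrableM hf hh).
- exact: measurable_int (L2_integrableM hg hh).
- by apply: filterS fg => x /= h0 _; rewrite h0.
Qed.

Lemma L2nrm_ae f g : L2 mu f -> L2 mu g -> f = g %[ae mu] -> L2nrm f = L2nrm g.
Proof.
by move=> hf hg fg; rewrite /L2nrm (L2dot_ae hf hg hf fg) L2dotC (L2dot_ae hf hg hg fg).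
Qed.

Lemma ae_mono (P Q : T -> Prop) : (forall x, P x -> Q x) ->
  {ae mu, forall x, P x} -> {ae mu, forall x, Q x}.
Proof. by move=> PQ; apply: filterS. Qed.

Lemma L2_ae f g : measurable_fun setT g -> L2 mu f -> f = g %[ae mu] -> L2 mu g.
Proof.
move=> mg hf fg; apply: L2P => //.
have h := L2_integrableM hf hf.
have /integrableP[_ fi] := h; apply/integrableP; split.
  by apply/measurable_EFinP; exact: measurable_funM.
apply: le_lt_trans fi; rewrite le_eqVlt; apply/orP; left; apply/eqP.
apply: ae_eq_integral => //.
- by apply: measurableT_comp => //; apply/measurable_EFinP; exact: measurable_funM.
- by apply: measurableT_comp => //; exact: (measurable_int _ h).
- by apply: filterS fg => x /= h0 _; rewrite h0.
Qed.

Lemma L2nrm_eq0 f : L2 mu f -> L2nrm f = 0 -> f = (fun=> 0) %[ae mu].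
Proof.
move=> hf f0; have := L2normE hf; rewrite -/(L2nrm f) f0 /L2norm => h.
have me : measurable_fun setT (EFin \o f) by apply/measurable_EFinP; exact: L2_measurable.
have /= := Lnorm_eq0_eq0 me _ h.
move=> /(_ (lte0n 2)).
by apply: filterS => x /= /(_ I)[].
Qed.

(** Lets norm convergence be handled with real numbers only. *)
Lemma cvg_L2norm {U : Type} {F : set_system U} {FF : Filter F} (s : U -> T -> R) :
  (forall n, L2 mu (s n)) -> (L2norm mu (s n) @[n --> F] --> 0%E) <->
  (forall e : R, 0 < e -> \forall n \near F, L2nrm (s n) < e).
Proof.
move=> hs; under eq_fun do rewrite L2normE//; rewrite -/(L2nrm _); split.
  move=> /fine_cvgP[_ /=] /cvgrPdist_lt h e e0.
  have := h _ e0; apply: filterS => n /=.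
  by rewrite sub0r normrN ger0_norm// sqrtr_ge0.
move=> h; apply/fine_cvgP; split; first exact: nearW.
apply/cvgrPdist_lt => e e0; apply: filterS (h _ e0) => n /=.
by rewrite sub0r normrN ger0_norm// sqrtr_ge0.
Qed.

End L2_geometry.

(** * Semigroups diagonal in a bounded orthonormal basis *)

Lemma sum_catn (R : realType) (u : nat -> R) (N M : nat) : (N <= M)%N ->
  \sum_(0 <= i < M) u i = \sum_(0 <= i < N) u i + \sum_(N <= i < M) u i.
Proof. by move=> NM; rewrite (big_cat_nat _ NM). Qed.

(** Raising to the n-th power magnifies a distance to 1 by at most what happens
    to 1 + d. *)
Lemma dist_pow_le (R : realType) (x d : R) n : `|x - 1| <= d -> `|x ^+ n - 1| <= (1 + d) ^+ n - 1.
Proof.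
move=> xd; have d0 : 0 <= d by apply: le_trans xd.
elim: n => [|n ih]; first by rewrite !expr0 subrr normr0.
rewrite !exprS.
have -> : x * x ^+ n - 1 = (x - 1) * (x ^+ n - 1) + (x - 1) + (x ^+ n - 1) by ring.
have -> : (1 + d) * (1 + d) ^+ n - 1 = d * ((1 + d) ^+ n - 1) + d + ((1 + d) ^+ n - 1) by ring.
apply: le_trans (ler_normD _ _) _; apply: lerD => //.
apply: le_trans (ler_normD _ _) _; apply: lerD => //.
by rewrite normrM ler_pM.
Qed.

Section normal_convergence.
Context {R : realType}.
Implicit Types u v : nat -> R.

Lemma le_series_lim v n : (forall k, 0 <= v k) -> cvgn (series v) -> series v n <= limn (series v).
Proof.
move=> v0 cv; apply: nondecreasing_cvgn_le => //.
by apply/nondecreasing_seqP => m; rewrite !seriesEnat/= big_nat_recr//= lerDl.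
Qed.

Lemma normal_cvg u v : (forall k, `|u k| <= v k) -> cvgn (series v) -> cvgn (series u).
Proof.
move=> uv cv; apply: normed_cvg; apply: (series_le_cvg _ _ uv cv) => k /=; first exact: normr_ge0.
exact: le_trans (normr_ge0 _) (uv k).
Qed.

Lemma normal_tail u v n : (forall k, `|u k| <= v k) -> cvgn (series v) ->
  `|limn (series u) - series u n| <= limn (series v) - series v n.
Proof.
move=> uv cv; have cu := normal_cvg uv cv.
have v0 k : 0 <= v k by apply: le_trans (uv k).
have h : `|series u m - series u n| @[m --> \oo] --> `|limn (series u) - series u n|.
  by apply: cvg_norm; apply: cvgB => //; exact: cvg_cst.
rewrite -(cvg_lim _ h)//; apply: limr_le; first by apply/cvg_ex; eexists; exact: h.
near=> m; have nm : (n <= m)%N by near: m; exact: nbhs_infty_ge.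
rewrite sub_series_geq//; apply: le_trans (ler_norm_sum _ _ _) _.
apply: le_trans (_ : \sum_(n <= k < m) v k <= _); first by apply: ler_sum => k _.
by rewrite -sub_series_geq// lerD2r le_series_lim.
Unshelve. all: by end_near. Qed.

Lemma normal_lim_le u v : (forall k, `|u k| <= v k) -> cvgn (series v) ->
  `|limn (series u)| <= limn (series v).
Proof.
move=> uv cv; have := normal_tail 0 uv cv.
by rewrite !seriesEnat/= !big_geq// !subr0.
Qed.

Lemma tail_cvg0 v : cvgn (series v) -> limn (series v) - series v n @[n --> \oo] --> 0.
Proof. by move=> cv; rewrite -(subrr (limn (series v))); apply: cvgB => //; exact: cvg_cst. Qed.

End normal_convergence.

Section basis.
Context d (T : measurableType d) (R : realType).
Variable mu : {measure set T -> \bar R}.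
Hypothesis mufin : (mu setT < +oo)%E.
Variables (e : nat -> T -> R) (B lam : nat -> R).
Hypothesis me : forall k, measurable_fun setT (e k).
Hypothesis eB : forall k x, `|e k x| <= B k.
Hypothesis B1 : forall k, 1 <= B k.
Hypothesis orth : forall i j, L2dot mu (e i) (e j) = (i == j)%:R.
Hypothesis dense : forall f, L2 mu f -> forall eps : R, 0 < eps ->
  exists n (c : nat -> R), L2nrm mu (fun x => f x - \sum_(0 <= k < n) c k * e k x) < eps.
Hypothesis lam0 : forall k, 0 <= lam k.
Hypothesis laminj : injective lam.
Hypothesis sumB : forall t : R, 0 < t -> cvgn (series (fun k => expR (- lam k * t) * B k ^+ 2)).

Implicit Types (f g : T -> R).
Local Notation dot := (L2dot mu).
Local Notation nrm := (L2nrm mu).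
Definition hat f k := L2dot mu f (e k).
Definition psum f n (x : T) := \sum_(0 <= k < n) hat f k * e k x.

Lemma bounded_integrable f M : measurable_fun setT f -> (forall x, `|f x| <= M) ->
  mu.-integrable setT (EFin \o f).
Proof.
move=> mf fM; apply: measurable_bounded_integrable => //.
by exists M; split; [exact: num_real|move=> N MN x _]; apply: (le_trans (fM x)); exact: ltW.
Qed.

Lemma bounded_L2 f M : measurable_fun setT f -> (forall x, `|f x| <= M) -> L2 mu f.
Proof.
move=> mf fM; apply: L2P => //; apply: (@bounded_integrable _ (M * M)).
  exact: measurable_funM.
by move=> x; rewrite normrM; apply: ler_pM.
Qed.

Lemma L2_int f : L2 mu f -> mu.-integrable setT (EFin \o f).
Proof.
move=> hf; have h1 : L2 mu (fun=> 1) by apply: (@bounded_L2 _ 1) => // x; rewrite normr1.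
have := L2_integrableM hf h1.
by congr (integrable _ _ _); apply/funext => x /=; rewrite mulr1.
Qed.

Lemma L2_e k : L2 mu (e k).
Proof. exact: bounded_L2 (me k) (eB k). Qed.

Lemma hat_lin c f g k : L2 mu f -> L2 mu g -> hat (fun x => c * f x + g x) k = c * hat f k + hat g k.
Proof. by move=> hf hg; rewrite /hat L2dot_linl//; exact: L2_e. Qed.

Lemma hatB f g k : L2 mu f -> L2 mu g -> hat (fun x => f x - g x) k = hat f k - hat g k.
Proof. by move=> hf hg; rewrite /hat L2dotBl//; exact: L2_e. Qed.

Lemma hatZ c f k : L2 mu f -> hat (fun x => c * f x) k = c * hat f k.
Proof.
move=> hf; have := hat_lin c k hf (L2_0 mu); under eq_fun do rewrite addr0.
by move=> ->; rewrite {2}/hat L2dot0l addr0.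
Qed.

Lemma L2Z c f : L2 mu f -> L2 mu (fun x => c * f x).
Proof. by move=> hf; have := L2_lin c hf (L2_0 mu); under eq_fun do rewrite addr0. Qed.

Lemma L2dotZl c f g : L2 mu f -> L2 mu g -> dot (fun x => c * f x) g = c * dot f g.
Proof.
move=> hf hg; have := L2dot_linl c hf (L2_0 mu) hg; under eq_fun do rewrite addr0.
by rewrite L2dot0l addr0.
Qed.

Lemma hat_e j k : hat (e j) k = (j == k)%:R. Proof. exact: orth. Qed.

Lemma hat_sum n (c : nat -> R) k :
  hat (fun x => \sum_(0 <= i < n) c i * e i x) k = if (k < n)%N then c k else 0.
Proof.
rewrite /hat L2dot_suml; [|exact: L2_e|exact: L2_e].
under eq_bigr do rewrite orth.
case: ltnP => kn.
  rewrite (bigD1_seq k)/= ?mem_index_iota ?iota_uniq//= eqxx mulr1 big1 ?addr0// => i ik.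
  by rewrite (negbTE ik) mulr0.
rewrite big_nat_cond big1// => i /andP[/andP[_ ik] _].
by rewrite (ltn_eqF (leq_trans ik kn)) mulr0.
Qed.

Lemma dot_sum n (c : nat -> R) f : L2 mu f ->
  dot (fun x => \sum_(0 <= i < n) c i * e i x) f = \sum_(0 <= i < n) c i * hat f i.
Proof.
move=> hf; rewrite L2dot_suml//; last exact: L2_e.
by under eq_bigr do rewrite L2dotC.
Qed.

Lemma L2_psum f n : L2 mu (psum f n).
Proof. by apply: L2_sum; exact: L2_e. Qed.

Lemma dist_sum n (c : nat -> R) f : L2 mu f ->
  dot (fun x => f x - \sum_(0 <= i < n) c i * e i x) (fun x => f x - \sum_(0 <= i < n) c i * e i x) =
  dot f f - \sum_(0 <= i < n) hat f i ^+ 2 + \sum_(0 <= i < n) (hat f i - c i) ^+ 2.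
Proof.
move=> hf; have hs : L2 mu (fun x => \sum_(0 <= i < n) c i * e i x) by apply: L2_sum; exact: L2_e.
have hd := L2B hf hs.
rewrite L2dotBl// !L2dotBr// (L2dotC _ f) !dot_sum//.
have -> : \sum_(0 <= i < n) c i * hat (fun x => \sum_(0 <= i < n) c i * e i x) i =
    \sum_(0 <= i < n) c i * c i.
  by apply: eq_big_nat => i /andP[_ ik]; rewrite hat_sum ik.
have -> : \sum_(0 <= i < n) (hat f i - c i) ^+ 2 = \sum_(0 <= i < n) hat f i ^+ 2 -
    2 * \sum_(0 <= i < n) c i * hat f i + \sum_(0 <= i < n) c i * c i.
  by rewrite mulr_sumr -sumrB -big_split/=; apply: eq_bigr => i _; ring.
ring.
Qed.

Lemma bessel f n : L2 mu f -> \sum_(0 <= i < n) hat f i ^+ 2 <= dot f f.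
Proof.
move=> hf; have := dist_sum n (hat f) hf.
rewrite [X in _ + X]big1 ?addr0; last by move=> i _; rewrite subrr expr0n.
move=> h; rewrite -subr_ge0 -h; exact: L2dot_ge0.
Qed.

(** The partial sum is the best approximation by a combination of the first
    vectors of the system, so density makes the defect in Bessel's inequality small. *)
Lemma parseval_eps f (eps : R) : L2 mu f -> 0 < eps ->
  exists N, forall n, (N <= n)%N -> dot f f - \sum_(0 <= i < n) hat f i ^+ 2 < eps.
Proof.
move=> hf e0; have s0 : 0 < Num.sqrt eps by rewrite sqrtr_gt0.
have [N [c hc]] := dense hf s0; exists N => n Nn.
apply: (@le_lt_trans _ _ (dot f f - \sum_(0 <= i < N) hat f i ^+ 2)).
  rewrite lerD2l lerN2 (big_cat_nat _ Nn)//= lerDl; apply: sumr_ge0 => i _; exact: sqr_ge0.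
have h : nrm (fun x => f x - \sum_(0 <= k < N) c k * e k x) ^+ 2 < eps.
  by rewrite -(sqr_sqrtr (ltW e0)) ltr_sqr ?nnegrE ?L2nrm_ge0 ?(ltW s0).
apply: le_lt_trans h; rewrite L2nrm_sqr dist_sum// lerDl.
by apply: sumr_ge0 => i _; exact: sqr_ge0.
Qed.

Lemma psum_cvg f (eps : R) : L2 mu f -> 0 < eps ->
  exists N, forall n, (N <= n)%N -> nrm (fun x => f x - psum f n x) < eps.
Proof.
move=> hf e0; have e2 : 0 < eps ^+ 2 by rewrite exprn_gt0.
have [N hN] := parseval_eps hf e2; exists N => n /hN h.
rewrite -ltr_sqr ?nnegrE ?L2nrm_ge0 ?(ltW e0)// L2nrm_sqr dist_sum//.
by rewrite [X in _ + X]big1 ?addr0// => i _; rewrite subrr expr0n.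
Qed.

(** By Parseval's identity the norm is monotone in the moduli of the coefficients. *)
Lemma nrm_le f g : L2 mu f -> L2 mu g -> (forall k, `|hat f k| <= `|hat g k|) -> nrm f <= nrm g.
Proof.
move=> hf hg fg; rewrite -ler_sqr ?nnegrE ?L2nrm_ge0// !L2nrm_sqr.
apply/ler_addgt0Pr => eps e0; have [N /(_ N (leqnn _)) hN] := parseval_eps hf e0.
have := bessel N hg.
have : \sum_(0 <= i < N) hat f i ^+ 2 <= \sum_(0 <= i < N) hat g i ^+ 2.
  by apply: ler_sum => i _; rewrite -(real_normK (num_real (hat f i))) -(real_normK (num_real (hat g i))) ler_sqr// nnegrE.
lra.
Qed.

Lemma hat_eq f g : L2 mu f -> L2 mu g -> (forall k, hat f k = hat g k) -> f = g %[ae mu].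
Proof.
move=> hf hg fg; have hd := L2B hf hg; have h0 := @L2_0 _ _ _ mu.
have : nrm (fun x => f x - g x) <= nrm (fun=> 0).
  by apply: nrm_le => // k; rewrite hatB// fg subrr normr0.
rewrite {2}/L2nrm L2dot0l sqrtr0 => n0.
have n1 : nrm (fun x => f x - g x) = 0 by apply/eqP; rewrite eq_le n0 L2nrm_ge0.
have := L2nrm_eq0 hd n1; apply: filterS => x /= h hx.
by apply/eqP; rewrite -subr_eq0 h.
Qed.

Lemma hat_ae f g k : L2 mu f -> L2 mu g -> f = g %[ae mu] -> hat f k = hat g k.
Proof. by move=> hf hg; apply: L2dot_ae => //; exact: L2_e. Qed.

(** Dominated convergence for Fourier coefficients: the tail of the coefficients
    of g controls the tails of all the s t uniformly, and the remaining finitely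
    many coefficients converge one by one. *)
Lemma multiplier_cvg {U : Type} {F : set_system U} {FF : Filter F} (s : U -> T -> R) g :
  (forall t, L2 mu (s t)) -> L2 mu g ->
  (\forall t \near F, forall k, `|hat (s t) k| <= `|hat g k|) ->
  (forall k, hat (s t) k @[t --> F] --> (0 : R)) ->
  forall eps : R, 0 < eps -> \forall t \near F, nrm (s t) < eps.
Proof.
move=> hs hg hle h0 eps e0; pose eta := eps ^+ 2 / 4.
have eta0 : 0 < eta by rewrite divr_gt0// exprn_gt0.
have [N hN] := parseval_eps hg eta0.
have : \sum_(0 <= i < N) hat (s t) i ^+ 2 @[t --> F] --> (0 : R).
  elim: {hN} N => [|N ih]; first by under eq_fun do rewrite big_geq//; exact: cvg_cst.
  under eq_fun do rewrite big_nat_recr//= expr2.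
  have h2 : hat (s t) N * hat (s t) N @[t --> F] --> (0 * 0 : R) by apply: cvgM.
  rewrite mulr0 in h2.
  have h3 : \sum_(0 <= i < N) hat (s t) i ^+ 2 + hat (s t) N * hat (s t) N @[t --> F] --> (0 + 0 : R).
    by apply: cvgD.
  by rewrite addr0 in h3.
move=> /cvgrPdist_lt /(_ _ eta0) hsum.
near=> t.
have t1 : `|0 - \sum_(0 <= i < N) hat (s t) i ^+ 2| < eta by near: t.
have t2 : forall k, `|hat (s t) k| <= `|hat g k| by near: t.
rewrite -ltr_sqr ?nnegrE ?L2nrm_ge0 ?(ltW e0)// L2nrm_sqr.
have [M hM] := parseval_eps (hs t) eta0.
have := hM (maxn N M) (leq_maxr _ _); have NM := leq_maxl N M.
have h3 := hN N (leqnn _); have h4 := bessel (maxn N M) hg.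
move: t1; rewrite sub0r normrN ger0_norm; last by apply: sumr_ge0 => i _; exact: sqr_ge0.
move: h4; rewrite (sum_catn (fun i => hat g i ^+ 2) NM) (sum_catn (fun i => hat (s t) i ^+ 2) NM).
have h5 : \sum_(N <= i < maxn N M) hat (s t) i ^+ 2 <= \sum_(N <= i < maxn N M) hat g i ^+ 2.
  by apply: ler_sum => i _; rewrite -(real_normK (num_real (hat (s t) i))) -(real_normK (num_real (hat g i))) ler_sqr// nnegrE.
have : eps ^+ 2 = 4 * eta by rewrite /eta; field.
move: (\sum_(0 <= i < N) _) (\sum_(N <= i < _) _) (\sum_(N <= i < _) _) h5 h3 => A1 A2 A3; lra.
Unshelve. all: by end_near. Qed.

Section normal_sum.
Variable c : nat -> R.
Hypothesis cB : cvgn (series (fun k => `|c k| * B k)).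
Definition nsum (x : T) := limn (series (fun k => c k * e k x)).

Lemma nsum_bound x k : `|c k * e k x| <= `|c k| * B k.
Proof. by rewrite normrM ler_wpM2l. Qed.

Lemma nsum_cvg x : cvgn (series (fun k => c k * e k x)).
Proof. exact: normal_cvg (nsum_bound x) cB. Qed.

Lemma measurable_nsum : measurable_fun setT nsum.
Proof.
apply: (@measurable_fun_cvg _ _ _ setT (fun n x => series (fun k => c k * e k x) n)) => //.
  by move=> n; apply: measurable_sum => k; exact: measurable_funM.
by move=> x _; exact: nsum_cvg.
Qed.

Lemma nsum_le x : `|nsum x| <= limn (series (fun k => `|c k| * B k)).
Proof. exact: normal_lim_le (nsum_bound x) cB. Qed.

Lemma L2_nsum : L2 mu nsum.
Proof. exact: bounded_L2 measurable_nsum nsum_le. Qed.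

Lemma integrable_bM f g M : measurable_fun setT f -> (forall x, `|f x| <= M) ->
  mu.-integrable setT (EFin \o g) -> mu.-integrable setT (EFin \o (fun x => f x * g x)).
Proof.
move=> mf fM gi.
have mg : measurable_fun setT g by apply/measurable_EFinP; exact: measurable_int gi.
apply: (@le_integrable _ T R mu setT _ _ (EFin \o (fun x => M * g x))) => //.
- by apply/measurable_EFinP; exact: measurable_funM.
- move=> x _ /=; rewrite lee_fin !normrM ler_wpM2r//.
  by apply: le_trans (fM x) _; exact: ler_norm.
- exact: integrable_EFinZ.
Qed.

(** The convergence is dominated by a constant multiple of |f|. *)
Lemma nsum_int f : mu.-integrable setT (EFin \o f) ->
  series (fun k => c k * \int[mu]_x (e k x * f x)) n @[n --> \oo] --> \int[mu]_x (nsum x * f x).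
Proof.
move=> fi; have mf : measurable_fun setT f by apply/measurable_EFinP; exact: measurable_int fi.
pose S := limn (series (fun k => `|c k| * B k)).
pose I := \int[mu]_x `|f x|.
have I0 : 0 <= I by apply: Rintegral_ge0.
have fni : mu.-integrable setT (EFin \o (fun x => `|f x|)) by exact: (integrable_norm fi).
have efi k : mu.-integrable setT (EFin \o (fun x => e k x * f x)).
  exact: integrable_bM (me k) (eB k) fi.
have Fi : mu.-integrable setT (EFin \o (fun x => nsum x * f x)).
  exact: integrable_bM measurable_nsum nsum_le fi.
pose s n (x : T) := series (fun k => c k * e k x) n.
have ms n : measurable_fun setT (s n).
  by apply: measurable_sum => k; exact: measurable_funM.
have sE n : series (fun k => c k * \int[mu]_x (e k x * f x)) n = \int[mu]_x (s n x * f x) /\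
    mu.-integrable setT (EFin \o (fun x => s n x * f x)).
  elim: n => [|n [ih1 ih2]].
    rewrite /s !seriesEnat/= big_geq//; split.
      by under eq_Rintegral do rewrite seriesEnat/= big_geq// mul0r; rewrite /Rintegral integral0.
    under eq_fun do rewrite seriesEnat/= big_geq// mul0r.
    exact: integrable0.
  have hs x : s n.+1 x * f x = c n * (e n x * f x) + s n x * f x.
    by rewrite /s !seriesEnat/= big_nat_recr//=; ring.
  have ci := integrable_EFinZ (c n) measurableT (efi n).
  split; last by under eq_fun do rewrite hs; exact: (integrableD measurableT ci ih2).
  under [RHS]eq_Rintegral do rewrite hs.
  rewrite RintegralD// RintegralZl// -ih1 !seriesEnat/= big_nat_recr//= addrC//.
apply/cvgrPdist_lt => eps e0.
have q0 : 0 < eps / (I + 1) by rewrite divr_gt0// ltr_wpDl.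
have := tail_cvg0 cB => /cvgrPdist_lt /(_ _ q0).
apply: filterS => n; rewrite sub0r normrN => hn.
have [-> si] := sE n.
rewrite -RintegralB//.
have hd : (fun x => nsum x * f x - s n x * f x) = (fun x => (nsum x - s n x) * f x).
  by apply/funext => x; rewrite mulrBl.
have di : mu.-integrable setT (EFin \o (fun x => nsum x * f x - s n x * f x)).
  exact: (integrableB measurableT Fi si).
apply: le_lt_trans (le_normr_Rintegral _ di) _ => //.
pose tl := S - series (fun k => `|c k| * B k) n.
have tlE : tl < eps / (I + 1) by apply: le_lt_trans hn; exact: ler_norm.
have tl0 : 0 <= tl.
  by rewrite subr_ge0; apply: le_series_lim => // k; rewrite mulr_ge0// (le_trans ler01).
apply: (@le_lt_trans _ _ (\int[mu]_x (tl * `|f x|))).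
  apply: le_Rintegral => //.
  - exact: (integrable_norm di).
  - exact: integrable_EFinZ.
  - move=> x _; rewrite -mulrBl normrM ler_wpM2r//.
    exact: normal_tail (nsum_bound x) cB.
rewrite RintegralZl// -/I.
apply: (@le_lt_trans _ _ (tl * (I + 1))); first by rewrite ler_wpM2l// lerDl.
by rewrite -ltr_pdivlMr// ltr_wpDl.
Qed.

Lemma hat_nsum k : hat nsum k = c k.
Proof.
have h := nsum_int (L2_int (L2_e k)).
apply/esym/(@cvg_unique _ _ _ _ _ _ _ h) => //.
apply: cvg_near_cst; near=> n.
rewrite seriesEnat/=.
have nk : (k < n)%N by near: n; exact: nbhs_infty_gt.
under eq_bigr do rewrite -/(L2dot mu _ _) orth.
rewrite (bigD1_seq k)/= ?mem_index_iota ?iota_uniq//= eqxx mulr1 big1 ?addr0// => i ik.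
by rewrite (negbTE ik) mulr0.
Unshelve. all: by end_near. Qed.

End normal_sum.

(** One factor B k pays for the coefficient and the other one for the size of e k. *)
Lemma summable_heat (t : R) (h : nat -> R) (M : R) : 0 < t -> (forall k, `|h k| <= M * B k) ->
  cvgn (series (fun k => `|expR (- lam k * t) * h k| * B k)).
Proof.
move=> t0 hM.
have cv : cvgn (series (fun k => M * (expR (- lam k * t) * B k ^+ 2))).
  by apply: is_cvg_seriesZ; exact: sumB.
apply: (series_le_cvg _ _ _ cv) => k /=.
- by rewrite mulr_ge0 ?normr_ge0 ?(le_trans ler01).
- rewrite mulr_ge0//; last by rewrite mulr_ge0 ?expR_ge0 ?sqr_ge0.
  have B0 : 0 < B k by apply: lt_le_trans (B1 k).
  by rewrite -(pmulr_lge0 _ B0) (le_trans (normr_ge0 _) (hM k)).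
- rewrite normrM ger0_norm ?expR_ge0// [leRHS](_ : _ = expR (- lam k * t) * (M * B k) * B k); last by ring.
  by rewrite ler_wpM2r ?(le_trans ler01)// ler_wpM2l ?expR_ge0.
Qed.

Lemma hat_le f k : L2 mu f -> `|hat f k| <= nrm f.
Proof.
move=> hf; apply: le_trans (ler_L2dot hf (L2_e k)) _.
by rewrite {2}/L2nrm orth eqxx sqrtr1 mulr1.
Qed.

Lemma summable_hat (t : R) f : L2 mu f -> 0 < t ->
  cvgn (series (fun k => `|expR (- lam k * t) * hat f k| * B k)).
Proof.
move=> hf t0; apply: (@summable_heat t _ (nrm f)) => // k.
by apply: le_trans (hat_le k hf) _; rewrite ler_peMr ?L2nrm_ge0.
Qed.

Lemma summable_e (t : R) x : 0 < t ->
  cvgn (series (fun k => `|expR (- lam k * t) * e k x| * B k)).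
Proof. by move=> t0; apply: (@summable_heat t _ 1) => // k; rewrite mul1r. Qed.

(** A normally convergent series, hence defined at every point and not only up to
    a null set; at t = 0 there is no convergence and the identity takes its place. *)
Definition heat (t : R) f : T -> R :=
  if 0 < t then nsum (fun k => expR (- lam k * t) * hat f k) else f.

Lemma L2_heat t f : L2 mu f -> L2 mu (heat t f).
Proof.
rewrite /heat; case: ifPn => // t0 hf.
by apply: L2_nsum; exact: summable_hat.
Qed.

Lemma hat_heat t f k : 0 <= t -> L2 mu f -> hat (heat t f) k = expR (- lam k * t) * hat f k.
Proof.
rewrite le_eqVlt /heat => /orP[/eqP <-|t0] hf; first by rewrite ltxx mulr0 expR0 mul1r.
by rewrite t0 hat_nsum//; exact: summable_hat.
Qed.

(** The diagonal operator with entries - lam k on its maximal domain. *)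
Definition heat_generator : set ((T -> R) * (T -> R)) :=
  [set fg | (L2 mu `*` L2 mu) fg /\ forall k, hat fg.2 k = - lam k * hat fg.1 k].

Lemma expR_lam_le1 k (t : R) : 0 <= t -> expR (- lam k * t) <= 1.
Proof. by move=> t0; rewrite -expR0 ler_expR mulNr oppr_le0 mulr_ge0. Qed.

Lemma cvg_expR_lam k : expR (- lam k * t) @[t --> 0^'+] --> (1 : R).
Proof.
have c : {for (0:R), continuous (fun t : R => expR (- lam k * t))}.
  apply: (@continuous_comp _ _ _ (fun t : R => - lam k * t) expR); last exact: continuous_expR.
  by apply: cvgM; [exact: cvg_cst|exact: cvg_id].
have := cvg_at_right_filter c; by rewrite mulr0 expR0.
Qed.

Lemma c0_heat : c0_semigroup mu heat.
Proof.
split.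
- by move=> t f _; exact: L2_heat.
- move=> t c f g t0 hf hg; apply: hat_eq.
  + by apply: L2_heat; exact: L2_lin.
  + by apply: L2_lin; exact: L2_heat.
  + move=> k; rewrite hat_heat//; last exact: L2_lin.
    rewrite !hat_lin//; [|exact: L2_heat|exact: L2_heat].
    rewrite !hat_heat//; ring.
- move=> t t0; exists 1 => f hf; rewrite mul1e !L2normE//; last exact: L2_heat.
  rewrite lee_fin -!/(L2nrm _ _); apply: nrm_le => //; first exact: L2_heat.
  move=> k; rewrite hat_heat// normrM ger0_norm ?expR_ge0// ler_piMl//.
  exact: expR_lam_le1.
- by move=> f hf; rewrite /heat ltxx; apply: aeW.
- move=> s t f s0 t0 hf; apply: hat_eq; [exact: L2_heat|by apply: L2_heat; exact: L2_heat|].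
  move=> k; rewrite !hat_heat ?addr_ge0//; last exact: L2_heat.
  by rewrite mulrA -expRD -mulrDr.
- move=> f hf; apply/cvg_L2norm; first by move=> t; apply: L2B => //; exact: L2_heat.
  apply: (@multiplier_cvg _ _ _ _ f) => //.
  + by move=> t; apply: L2B => //; exact: L2_heat.
  + near=> t => k; have t0 : 0 <= t by [].
    rewrite hatB//; last exact: L2_heat.
    rewrite hat_heat// -{2}(mul1r (hat f k)) -mulrBl normrM ler_piMl//.
    have := expR_lam_le1 k t0; have := expR_ge0 (- lam k * t).
    by rewrite ler_norml; lra.
  + move=> k.
    have h : (expR (- lam k * t) - 1) * hat f k @[t --> 0^'+] --> (1 - 1) * hat f k.
      by apply: cvgM; [apply: cvgB; [exact: cvg_expR_lam|exact: cvg_cst]|exact: cvg_cst].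
    rewrite subrr mul0r in h; apply: cvg_trans h; apply: near_eq_cvg.
    near=> t; have t0 : 0 <= t by [].
    rewrite hatB//; last exact: L2_heat.
    by rewrite hat_heat// mulrBl mul1r.
Unshelve. all: by end_near. Qed.

(** The bounds dominate the difference quotients of the semigroup by the
    coefficients of the generator, uniformly in time. *)
Lemma expR_quot_bound (s : R) : 0 <= s -> 0 <= expR (- s) - 1 + s <= s.
Proof.
move=> s0; have := expR_ge1Dx (- s).
have : expR (- s) <= 1 by rewrite -expR0 ler_expR oppr_le0.
lra.
Qed.

Lemma cvg_expR_quot_gen (m : R) : t^-1 * (expR (m * t) - 1) @[t --> 0^'+] --> m.
Proof.
have h : is_derive (0 : R) 1 (fun t : R => expR (m * t)) m.
  have h1 : is_derive (0 : R) 1 (fun t : R => m * t) m.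
    by apply: is_derive_eq; rewrite /GRing.scale/= mulr1.
  have h2 := is_derive_expR (m * 0).
  have h3 := @is_derive1_comp R expR (fun t => m * t) 0 _ _ h2 h1.
  by move: h3; rewrite mulr0 expR0 mul1r.
have [/= d1 d2] := h.
have := d1; rewrite /derivable => /cvg_ex[l hl].
have : l = m by rewrite -d2 /derive; apply/esym/cvg_lim.
move=> lE; rewrite lE in hl.
have {}hl := cvg_dnbhs_at_right hl; apply: cvg_trans hl.
by apply: near_eq_cvg; near=> t; rewrite /= addr0 mulr0 expR0 /GRing.scale/= mulr1.
Unshelve. all: by end_near. Qed.

Lemma cvg_expR_quot k : t^-1 * (expR (- lam k * t) - 1) @[t --> 0^'+] --> - lam k.
Proof. exact: cvg_expR_quot_gen. Qed.

(** In one direction coefficients pass to the limit in the difference quotient; in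
    the other one the quotients are dominated coefficientwise by those of g. *)
Lemma generator_heat : generator mu heat = heat_generator.
Proof.
apply/seteqP; split=> -[f g] /= [[/= hf hg] H]; split => //=.
- move=> k; move/cvg_L2norm : H.
  move=> H.
  have hq t : L2 mu (fun x => t^-1 * (heat t f x - f x)).
    by apply/L2Z/L2B => //; exact: L2_heat.
  have {}H : forall eps : R, 0 < eps -> \forall t \near 0^'+,
      L2nrm mu (fun x => t^-1 * (heat t f x - f x) - g x) < eps.
    by apply: H => t; apply: L2B.
  have h1 : hat (fun x => t^-1 * (heat t f x - f x) - g x) k @[t --> 0^'+] --> (0 : R).
    apply/cvgrPdist_lt => eps e0; apply: filterS (H _ e0) => t ht.
    rewrite sub0r normrN; apply: le_lt_trans ht; apply: hat_le.
    exact: L2B.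
  have h2 : t^-1 * (expR (- lam k * t) - 1) * hat f k - hat g k @[t --> 0^'+] --> - lam k * hat f k - hat g k.
    by apply: cvgB; [apply: cvgM; [exact: cvg_expR_quot|exact: cvg_cst]|exact: cvg_cst].
  have h3 : hat (fun x => t^-1 * (heat t f x - f x) - g x) k @[t --> 0^'+] --> - lam k * hat f k - hat g k.
    apply: cvg_trans h2; apply: near_eq_cvg; near=> t; have t0 : 0 <= t by [].
    rewrite hatB//; congr (_ - _).
    rewrite hatZ ?hatB ?hat_heat//; [ring|exact: L2_heat|by apply: L2B => //; exact: L2_heat].
  have /eqP : 0 = - lam k * hat f k - hat g k by apply: cvg_unique h1 h3.
  by rewrite eq_sym subr_eq0 => /eqP ->.
- have hq t : L2 mu (fun x => t^-1 * (heat t f x - f x)).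
    by apply/L2Z/L2B => //; exact: L2_heat.
  have hqk (t : R) k : 0 <= t -> hat (fun x => t^-1 * (heat t f x - f x) - g x) k =
       t^-1 * (expR (- lam k * t) - 1) * hat f k + lam k * hat f k.
    move=> t0; rewrite hatB//.
    by rewrite hatZ ?hatB ?hat_heat// ?H; [ring|exact: L2_heat|by apply: L2B => //; exact: L2_heat].
  apply/cvg_L2norm; first by move=> t; exact: L2B.
  apply: (@multiplier_cvg _ _ _ _ g) => //.
  + by move=> t; apply: L2B.
  + near=> t => k; have t0 : 0 < t by [].
    rewrite hqk ?(ltW t0)// -mulrDl H [leLHS]normrM [leRHS]normrM ler_wpM2r// normrN (ger0_norm (lam0 k)).
    have := expR_quot_bound (mulr_ge0 (lam0 k) (ltW t0)); rewrite -mulNr => /andP[q1 q2].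
    rewrite (_ : _ + _ = t^-1 * (expR (- lam k * t) - 1 + lam k * t)); last by field; rewrite gt_eqF.
    rewrite ger0_norm; last by rewrite mulr_ge0// invr_ge0 ltW.
    by rewrite mulrC ler_pdivrMr.
  + move=> k.
    have h2 : t^-1 * (expR (- lam k * t) - 1) * hat f k + lam k * hat f k @[t --> 0^'+] --> - lam k * hat f k + lam k * hat f k.
      by apply: cvgD; [apply: cvgM; [exact: cvg_expR_quot|exact: cvg_cst]|exact: cvg_cst].
    rewrite mulNr addNr in h2; apply: cvg_trans h2; apply: near_eq_cvg.
    by near=> t; rewrite hqk.
Unshelve. all: by end_near. Qed.

(** The eigenvalues are distinct, so all coefficients but the k-th vanish. *)
Lemma eigenvector_multiple h k : (h, fun x => - lam k * h x) \in heat_generator ->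
  h = (fun x => hat h k * e k x) %[ae mu].
Proof.
rewrite inE => -[[/= hh _] H]; apply: hat_eq => //; first by apply: L2Z; exact: L2_e.
move=> j; rewrite hatZ ?hat_e; last exact: L2_e.
have [->|kj] := eqVneq k j; first by rewrite mulr1.
rewrite mulr0; have := H j; rewrite hatZ// => /eqP.
rewrite -subr_eq0 -mulrBl mulf_eq0 => /orP[|/eqP//].
rewrite subr_eq0 eqr_opp => /eqP/laminj kj'.
by rewrite kj' eqxx in kj.
Qed.

Section uniqueness.
Variable S : R -> (T -> R) -> (T -> R).
Hypothesis S0 : c0_semigroup mu S.
Hypothesis SG : generator mu S = heat_generator.

Let S_L2 := c0_L2 S0.

Lemma S_ae t f g : 0 <= t -> L2 mu f -> L2 mu g -> f = g %[ae mu] -> S t f = S t g %[ae mu].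
Proof.
move=> t0 hf hg fg.
have [M hM] := c0_bounded S0 t0.
have hfg := L2B hf hg.
have n0 : nrm (fun x => f x - g x) = 0.
  rewrite (L2nrm_ae hfg (L2_0 mu)); first by rewrite /L2nrm L2dot0l sqrtr0.
  by apply: filterS fg => x /= h0 _; rewrite h0// subrr.
have := hM _ hfg; rewrite !L2normE//; last exact: S_L2.
rewrite -!/(L2nrm _ _) n0 mule0 lee_fin => n1.
have n2 : nrm (S t (fun x => f x - g x)) = 0 by apply/eqP; rewrite eq_le n1 L2nrm_ge0.
have z := L2nrm_eq0 (S_L2 t0 hfg) n2.
have l := c0_linear S0 (-1) t0 hg hf.
have eqf : (fun x => -1 * g x + f x) = (fun x => f x - g x) by apply/funext => x; rewrite mulN1r addrC.
rewrite eqf in l.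
apply: filterS2 z l => x /= z l _.
have := l I; rewrite (z I) mulN1r addrC => /esym/eqP; rewrite subr_eq0 => /eqP ->//.
Qed.

Lemma S_nrm t : 0 <= t -> exists2 M : R, 0 <= M & forall f, L2 mu f -> nrm (S t f) <= M * nrm f.
Proof.
move=> t0; have [M hM] := c0_bounded S0 t0; exists (Num.max 0 M); first by rewrite le_max lexx.
move=> f hf; have := hM f hf; rewrite !L2normE//; last exact: S_L2.
rewrite -!/(L2nrm _ _) -EFinM lee_fin => h; apply: le_trans h _.
by rewrite ler_wpM2r ?L2nrm_ge0// le_max lexx orbT.
Qed.

Lemma S_linE t c f g : 0 <= t -> L2 mu f -> L2 mu g ->
  forall k, hat (S t (fun x => c * f x + g x)) k = c * hat (S t f) k + hat (S t g) k.
Proof.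
move=> t0 hf hg k.
have h1 := S_L2 t0 hf; have h2 := S_L2 t0 hg.
rewrite (hat_ae _ _ _ (c0_linear S0 c t0 hf hg)).
- by rewrite hat_lin.
- by apply: S_L2 => //; exact: L2_lin.
- exact: L2_lin.
Qed.

(** A semigroup commutes with its generator, so it maps an eigenvector to an
    eigenvector for the same eigenvalue. *)
Lemma S_eigen (h : R) k : 0 <= h -> (S h (e k), fun x => - lam k * S h (e k) x) \in heat_generator.
Proof.
move=> h0; have he := L2_e k; have hS := S_L2 h0 he.
rewrite inE -SG; split; first by split => //=; exact: L2Z.
have Lq t : L2 mu (fun x => t^-1 * (S t (e k) x - e k x) - (- lam k * e k x)) \/ t < 0.
  have [t0|t0] := leP 0 t; [left|by right].
  by apply: L2B; [apply/L2Z/L2B => //; exact: S_L2|exact: L2Z].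
have G : generator mu S (e k, fun x => - lam k * e k x).
  rewrite SG; split; first by split => //=; exact: L2Z.
  by move=> j /=; rewrite hatZ// hat_e; case: eqP => [->|]; rewrite ?mulr0.
have [_ /= G2] := G.
have [M M0 hM] := S_nrm h0.
apply/fine_cvgP.
have Lt t : 0 <= t -> L2 mu (fun x => t^-1 * (S t (S h (e k)) x - S h (e k) x) - (- lam k * S h (e k) x)).
  by move=> t0; apply: L2B; [apply/L2Z/L2B => //; exact: S_L2|exact: L2Z].
have Lt' t : 0 <= t -> L2 mu (fun x => t^-1 * (S t (e k) x - e k x) - (- lam k * e k x)).
  by move=> t0; apply: L2B; [apply/L2Z/L2B => //; exact: S_L2|exact: L2Z].
have key t : 0 <= t -> nrm (fun x => t^-1 * (S t (S h (e k)) x - S h (e k) x) - (- lam k * S h (e k) x)) <=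
    M * nrm (fun x => t^-1 * (S t (e k) x - e k x) - (- lam k * e k x)).
  move=> t0; apply: le_trans (hM _ (Lt' _ t0)); apply: nrm_le; [exact: Lt|exact/S_L2/Lt'|].
  move=> j; rewrite le_eqVlt; apply/orP; left; apply/eqP; congr (`|_|).
  have eqf : (fun x => t^-1 * (S t (e k) x - e k x) - (- lam k * e k x)) =
     (fun x => t^-1 * S t (e k) x + ((lam k - t^-1) * e k x + 0)) by apply/funext => x; ring.
  have Se := S_L2 t0 he; have SSe := S_L2 t0 hS; have z := L2_0 mu.
  rewrite eqf (S_linE _ h0)//; last exact: L2_lin.
  rewrite (S_linE _ h0)//.
  have Sz : hat (S h (fun=> 0)) j = 0.
    have := S_linE 1 h0 z z j; under [X in hat (S h X)]eq_fun do rewrite mul1r addr0.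
    by rewrite mul1r => /eqP; rewrite -subr_eq0 opprD addrA subrr sub0r oppr_eq0 => /eqP.
  rewrite Sz addr0 hatB; [|by apply/L2Z/L2B|exact: L2Z].
  rewrite !hatZ ?hatB//; last exact: L2B.
  have -> : hat (S t (S h (e k))) j = hat (S h (S t (e k))) j.
    rewrite -(hat_ae j _ _ (c0_add S0 t0 h0 he))//; last by apply: S_L2 => //; rewrite addr_ge0.
    rewrite addrC (hat_ae j _ _ (c0_add S0 h0 t0 he))//; last exact: S_L2.
    by apply: S_L2 => //; rewrite addr_ge0.
  ring.
move: G2 => /fine_cvgP[_ /= /cvgrPdist_lt G2]; split.
  near=> t; have t0 : 0 <= t by [].
  by rewrite L2normE//; exact: Lt.
apply/cvgrPdist_lt => eps e0.
have q0 : 0 < eps / (M + 1) by rewrite divr_gt0// ltr_wpDl.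
have := G2 _ q0 => {}G2.
near=> t; have t0 : 0 <= t by [].
rewrite /= L2normE; last exact: Lt.
rewrite -/(L2nrm _ _) sub0r normrN ger0_norm ?L2nrm_ge0//.
apply: le_lt_trans (key t t0) _.
have : `|0 - fine (L2norm mu (fun x => t^-1 * (S t (e k) x - e k x) - - lam k * e k x))| < eps / (M + 1) by near: t.
rewrite L2normE; last exact: Lt'.
rewrite -/(L2nrm _ _) sub0r normrN ger0_norm ?L2nrm_ge0// ltr_pdivlMr ?ltr_wpDl// mulrC.
apply: le_lt_trans; rewrite ler_wpM2r ?L2nrm_ge0// lerDl//.
Unshelve. all: by end_near. Qed.

Let c k t := hat (S t (e k)) k.

Lemma S_eigenE k t : 0 <= t -> S t (e k) = (fun x => c k t * e k x) %[ae mu].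
Proof. by move=> t0; exact: eigenvector_multiple (S_eigen k t0). Qed.

Lemma c_add k s t : 0 <= s -> 0 <= t -> c k (s + t) = c k s * c k t.
Proof.
move=> s0 t0; have he := L2_e k; have z := L2_0 mu.
rewrite /c (hat_ae _ _ _ (c0_add S0 s0 t0 he)); [|by apply: S_L2; rewrite ?addr_ge0|by do 2 apply: S_L2 => //].
rewrite (hat_ae _ _ _ (S_ae s0 _ _ (S_eigenE k t0))); first last.
- by apply: L2Z.
- exact: S_L2.
- by apply: S_L2 => //; exact: L2Z.
- by do 2 apply: S_L2 => //.
have := S_linE (c k t) s0 he z k.
under [X in hat (S s X)]eq_fun do rewrite addr0.
have Sz : hat (S s (fun=> 0)) k = 0.
  have := S_linE 1 s0 z z k; under [X in hat (S s X)]eq_fun do rewrite mul1r addr0.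
  by rewrite mul1r => /eqP; rewrite -subr_eq0 opprD addrA subrr sub0r oppr_eq0 => /eqP.
by rewrite Sz addr0 => ->; rewrite mulrC.
Qed.

Lemma c_expr k t n : 0 <= t -> c k (n.+1%:R * t) = c k t ^+ n.+1.
Proof.
move=> t0; elim: n => [|n ih]; first by rewrite mul1r expr1.
by rewrite -natr1 mulrDl mul1r c_add ?mulr_ge0// ih [RHS]exprSr.
Qed.

Lemma c_deriv k : t^-1 * (c k t - 1) @[t --> 0^'+] --> - lam k.
Proof.
have he := L2_e k.
have [_ /= G2] : generator mu S (e k, fun x => - lam k * e k x).
  rewrite SG; split; first by split => //=; exact: L2Z.
  by move=> j /=; rewrite hatZ// hat_e; case: eqP => [->|]; rewrite ?mulr0.
move: G2 => /fine_cvgP[_ /= /cvgrPdist_lt G2].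
apply/cvgrPdist_lt => eps e0; near=> t; have t0 : 0 <= t by [].
have Lt' : L2 mu (fun x => t^-1 * (S t (e k) x - e k x) - (- lam k * e k x)).
  by apply: L2B; [apply/L2Z/L2B => //; exact: S_L2|exact: L2Z].
have : `|0 - fine (L2norm mu (fun x => t^-1 * (S t (e k) x - e k x) - - lam k * e k x))| < eps by near: t; exact: G2.
rewrite L2normE// -/(L2nrm _ _) sub0r normrN ger0_norm ?L2nrm_ge0//.
apply: le_lt_trans; apply: le_trans (hat_le k Lt').
have Se := S_L2 t0 he.
rewrite hatB ?hatZ// ?hatB//; [|exact: L2B|by apply/L2Z/L2B|exact: L2Z].
by rewrite hat_e eqxx mulr1 distrC.
Unshelve. all: by end_near. Qed.

(** The function b(s) = c(s) exp(lam s) is multiplicative and has derivative 0 at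
    0, so b(t) = b(t/n)^n is within a multiple of n times o(1/n) of 1. *)
Lemma S_coef k t : 0 < t -> c k t = expR (- lam k * t).
Proof.
(* The quotient of c by the expected exponential; it has to be identically 1. *)
move=> t0; pose b s := c k s * expR (lam k * s).
have bd : h^-1 * (b h - 1) @[h --> 0^'+] --> (0 : R).
  have e1 : expR (lam k * h) @[h --> 0^'+] --> (1 : R).
    have cc : {for (0:R), continuous (fun t : R => expR (lam k * t))}.
      apply: (@continuous_comp _ _ _ (fun t : R => lam k * t) expR); last exact: continuous_expR.
      by apply: cvgM; [exact: cvg_cst|exact: cvg_id].
    by have := cvg_at_right_filter cc; rewrite mulr0 expR0.
  have e2 : h^-1 * (c k h - 1) * expR (lam k * h) + h^-1 * (expR (lam k * h) - 1) @[h --> 0^'+] --> - lam k * 1 + lam k.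
    by apply: cvgD; [apply: cvgM => //; exact: c_deriv|exact: cvg_expR_quot_gen].
  rewrite mulr1 addNr in e2; apply: cvg_trans e2; apply: near_eq_cvg; near=> h.
  rewrite /b; ring.
have bn n : b t = b (t / n.+1%:R) ^+ n.+1.
  have n0 : n.+1%:R != 0 :> R by rewrite gt_eqF.
  rewrite /b exprMn -c_expr; last by rewrite divr_ge0// ltW.
  rewrite -expRM_natl; congr (c k _ * expR _); first by field.
  by rewrite -mulr_natl; field.
suff b1 : b t = 1.
  by rewrite mulNr expRN; apply: (mulIf (lt0r_neq0 (expR_gt0 (lam k * t)))); rewrite mulVf ?gt_eqF ?expR_gt0.
apply/eqP; rewrite -subr_eq0 -normr_le0; apply/ler_addgt0Pr => eps e0; rewrite add0r.
pose eta := Num.min (2^-1) (eps / 2).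
have eta0 : 0 < eta by rewrite lt_min; apply/andP; split; lra.
have [eta1 eta2] : eta <= 2^-1 /\ eta <= eps / 2 by split; rewrite ge_min lexx ?orbT.
have q0 : 0 < eta / t by rewrite divr_gt0.
move/cvgrPdist_lt : bd => /(_ _ q0) [dl /= d0 hd].
pose n := Num.trunc (t / dl).
have tn0 : 0 < t / n.+1%:R by rewrite divr_gt0.
have tn : t / n.+1%:R < dl.
  have /andP[_ +] := truncn_itv (divr_ge0 (ltW t0) (ltW d0)).
  by rewrite -/n ltr_pdivrMr// mulrC -ltr_pdivrMr.
have := hd (t / n.+1%:R); rewrite /ball_/= sub0r normrN gtr0_norm// => /(_ tn tn0).
rewrite sub0r normrN normrM gtr0_norm ?invr_gt0// mulrC ltr_pdivrMr// => hb.
have {}hb : `|b (t / n.+1%:R) - 1| <= eta / n.+1%:R.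
  apply: le_trans (ltW hb) _; rewrite le_eqVlt; apply/orP; left; apply/eqP.
  by rewrite mulrA divfK// gt_eqF.
rewrite (bn n); apply: le_trans (dist_pow_le _ hb) _.
have h1 : (1 + eta / n.+1%:R) ^+ n.+1 <= expR eta.
  have m0 : n.+1%:R != 0 :> R by rewrite pnatr_eq0.
  have -> : expR eta = expR (eta / n.+1%:R) ^+ n.+1.
    by rewrite -expRM_natl; congr expR; rewrite -mulr_natl mulrCA mulfV ?mulr1.
  apply: lerXn2r; rewrite ?nnegrE ?expR_ge0//; last exact: expR_ge1Dx.
  by rewrite addr_ge0// divr_ge0// ltW.
have h2 : expR eta <= (1 - eta)^-1.
  rewrite -[leLHS]invrK -expRN lef_pV2 ?posrE ?expR_gt0; last lra.
    exact: expR_ge1Dx.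
  lra.
have h3 : (1 - eta)^-1 <= 1 + 2 * eta.
  rewrite -[leLHS]mul1r ler_pdivrMr; last lra.
  have : 0 <= eta * (1 - 2 * eta) by apply: mulr_ge0; lra.
  lra.
lra.
Unshelve. all: by end_near. Qed.

(** Both operators are bounded and agree on finite combinations of the basis. *)
Lemma S_heat t f : 0 < t -> L2 mu f -> S t f = heat t f %[ae mu].
Proof.
move=> t0 hf; have t0' := ltW t0.
have z := L2_0 mu.
have Sz k : hat (S t (fun=> 0)) k = 0.
  have := S_linE 1 t0' z z k; under [X in hat (S t X)]eq_fun do rewrite mul1r addr0.
  by rewrite mul1r => /eqP; rewrite -subr_eq0 opprD addrA subrr sub0r oppr_eq0 => /eqP.
have Ssum n (a : nat -> R) k : hat (S t (fun x => \sum_(0 <= i < n) a i * e i x)) k =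
    if (k < n)%N then a k * expR (- lam k * t) else 0.
  elim: n => [|n ih].
    by under [X in hat (S t X)]eq_fun do rewrite big_geq//; exact: Sz.
  under [X in hat (S t X)]eq_fun do rewrite big_nat_recr//= addrC.
  rewrite S_linE//; [|exact: L2_e|by apply: L2_sum; exact: L2_e].
  rewrite ih (hat_ae k _ _ (S_eigenE n t0')); [|by apply: S_L2 => //; exact: L2_e|by apply: L2Z; exact: L2_e].
  rewrite hatZ ?hat_e; last exact: L2_e.
  rewrite S_coef//.
  have [->|nk] := eqVneq n k; first by rewrite ltnn ltnSn addr0 mulr1.
  rewrite !mulr0 add0r ltnS [in RHS]leq_eqVlt eq_sym (negbTE nk)//.
apply: hat_eq; [exact: S_L2|exact: L2_heat|] => k.
have [M M0 hM] := S_nrm t0'.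
apply/eqP; rewrite -subr_eq0 -normr_le0; apply/ler_addgt0Pr => eps e0; rewrite add0r.
have q0 : 0 < eps / (M + 1) by rewrite divr_gt0// ltr_wpDl.
have [N hN] := psum_cvg hf q0.
have nk : (k < (maxn N k).+1)%N by rewrite ltnS leq_maxr.
have := hN (maxn N k).+1 (leq_trans (leq_maxl _ _) (leqnSn _)).
set n := (maxn N k).+1 => hn.
have hp := L2_psum f n; have hd := L2B hf hp.
have -> : hat (S t f) k - hat (heat t f) k = hat (S t (fun x => f x - psum f n x)) k.
  have := S_linE (-1) t0' hp hf k.
  have -> : (fun x => -1 * psum f n x + f x) = (fun x => f x - psum f n x) by apply/funext => x; ring.
  by move=> ->; rewrite /psum Ssum nk hat_heat//; ring.
apply: le_trans (hat_le k (S_L2 t0' hd)) _.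
apply: le_trans (hM _ hd) _.
rewrite ltr_pdivlMr ?ltr_wpDl// in hn; apply: le_trans (ltW hn).
rewrite mulrC ler_wpM2l ?L2nrm_ge0// lerDl//.
Qed.

End uniqueness.

Section closure.
Variable A : set ((T -> R) * (T -> R)).
Hypothesis AL2 : A `<=` L2 mu `*` L2 mu.
Hypothesis Ahat : forall fg, A fg -> forall k, hat fg.2 k = - lam k * hat fg.1 k.
Hypothesis Asum : forall n (a : nat -> R), exists2 fg, A fg &
  fg.1 = (fun x => \sum_(0 <= i < n) a i * e i x) %[ae mu] /\
  fg.2 = (fun x => \sum_(0 <= i < n) (- lam i * a i) * e i x) %[ae mu].

(** The partial sums of the expansion of f approximate the pair (f, g) within the
    graph, and conversely coefficients are continuous for the norm. *)
Lemma op_closureE : op_closure mu A = heat_generator.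
Proof.
apply/seteqP; split=> -[f g] /= [[/= hf hg] H]; split => //=.
- move=> k; have [s [As s1 s2]] := H.
  have Ls n : L2 mu (s n).1 /\ L2 mu (s n).2 by have [] := AL2 (As n).
  have cv (h : T -> R) (u : nat -> T -> R) : L2 mu h -> (forall n, L2 mu (u n)) ->
      L2norm mu (u n \- h) @[n --> \oo] --> 0%E -> hat (u n) k @[n --> \oo] --> hat h k.
    move=> hh hu /cvg_L2norm hc.
    apply/cvgrPdist_lt => eps e0; have := hc (fun n => L2B (hu n) hh) _ e0.
    apply: filterS => n hn; rewrite distrC -hatB//.
    by apply: le_lt_trans hn; apply: hat_le; exact: L2B.
  have c1 := cv _ _ hf (fun n => (Ls n).1) s1.
  have c2 := cv _ _ hg (fun n => (Ls n).2) s2.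
  have c3 : - lam k * hat (s n).1 k @[n --> \oo] --> - lam k * hat f k.
    by apply: cvgM => //; exact: cvg_cst.
  have c4 : hat (s n).2 k @[n --> \oo] --> - lam k * hat f k.
    by apply: cvg_trans c3; apply: near_eq_cvg; apply: nearW => n /=; rewrite (Ahat (As n)).
  by apply: cvg_unique c2 c4.
- have /choice[s hs] : forall n, exists fg, A fg /\
      fg.1 = (fun x => \sum_(0 <= i < n) hat f i * e i x) %[ae mu] /\
      fg.2 = (fun x => \sum_(0 <= i < n) (- lam i * hat f i) * e i x) %[ae mu].
    by move=> n; have [fg h1 h2] := Asum n (hat f); exists fg.
  exists s; split; first by move=> n; have [] := hs n.
  + apply/cvg_L2norm; first by move=> n; apply: L2B => //; have [/AL2[]] := hs n.
    move=> eps e0; have [N hN] := psum_cvg hf e0; exists N => // n /= /hN.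
    have [/AL2[/= s1 s2] [E _]] := hs n.
    rewrite L2nrm_distC; apply: le_lt_trans; rewrite le_eqVlt; apply/orP; left; apply/eqP.
    apply: L2nrm_ae; [exact: L2B|by apply: L2B => //; exact: L2_psum|].
    by apply: filterS E => x /= h _; rewrite h.
  + apply/cvg_L2norm; first by move=> n; apply: L2B => //; have [/AL2[]] := hs n.
    move=> eps e0; have [N hN] := psum_cvg hg e0; exists N => // n /= /hN.
    have [/AL2[/= s1 s2] [_ E]] := hs n.
    rewrite L2nrm_distC; apply: le_lt_trans; rewrite le_eqVlt; apply/orP; left; apply/eqP.
    apply: L2nrm_ae; [exact: L2B|by apply: L2B => //; exact: L2_psum|].
    apply: filterS E => x /= h _; rewrite h// /psum; congr (_ - _).
    by apply: eq_bigr => i _; rewrite H.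
Qed.

Lemma densely_defined_sums : densely_defined mu A.
Proof.
split => // f hf eps e0.
have [N hN] := psum_cvg hf e0.
have [fg h1 [E _]] := Asum N (hat f); exists fg => //.
have [/= l1 l2] := AL2 h1.
rewrite L2normE; last exact: L2B.
rewrite lte_fin; have := hN N (leqnn _); apply: le_lt_trans.
rewrite -/(L2nrm _ _) le_eqVlt; apply/orP; left; apply/eqP.
apply: L2nrm_ae; [exact: L2B|by apply: L2B => //; exact: L2_psum|].
by apply: filterS E => x /= h _; rewrite h.
Qed.

(** Expand both sides in the basis: the factor - lam k can be moved from one
    function to the other. *)
Lemma heat_generator_sym f g u v : heat_generator (f, g) -> heat_generator (u, v) ->
  L2dot mu v f = L2dot mu u g.
Proof.
move=> [[/= hf hg] H] [[/= hu hv] H'].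
have key h n : L2 mu h -> dot h (psum f n) = \sum_(0 <= i < n) hat f i * hat h i.
  by move=> hh; rewrite L2dotC dot_sum.
apply/eqP; rewrite -subr_eq0 -normr_le0; apply/ler_addgt0Pr => eps e0; rewrite add0r.
have [M M0 ME] : exists2 M : R, 0 < M & nrm v + nrm u <= M.
  by exists (nrm v + nrm u + 1); rewrite ?lerDl// ltr_wpDl// addr_ge0 ?L2nrm_ge0.
have q0 : 0 < eps / M by rewrite divr_gt0.
have [N1 hN1] := psum_cvg hf q0.
have [N2 hN2] := psum_cvg hg q0.
pose n := maxn N1 N2.
have d1 := hN1 n (leq_maxl _ _); have d2 := hN2 n (leq_maxr _ _).
have pf := L2_psum f n; have pg := L2_psum g n.
have -> : dot v f - dot u g = dot v (fun x => f x - psum f n x) - dot u (fun x => g x - psum g n x).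
  rewrite !L2dotBr// ![dot _ (psum _ _)]L2dotC !dot_sum//.
  have -> : \sum_(0 <= i < n) hat g i * hat u i = \sum_(0 <= i < n) hat f i * hat v i.
    by apply: eq_bigr => i _; rewrite H H'; ring.
  ring.
apply: le_trans (ler_normB _ _) _.
have b1 := ler_L2dot hv (L2B hf pf).
have b2 := ler_L2dot hu (L2B hg pg).
have nv := L2nrm_ge0 mu v; have nu := L2nrm_ge0 mu u.
have c1 := ler_wpM2l nv (ltW d1).
have c2 := ler_wpM2l nu (ltW d2).
have : (nrm v + nrm u) * (eps / M) <= eps.
  by rewrite mulrA ler_pdivrMr// mulrC ler_wpM2l// ltW.
rewrite mulrDl => c3; apply: le_trans c3; apply: lerD; [exact: le_trans b1 c1|exact: le_trans b2 c2].
Qed.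

(** An element of the adjoint, tested against the basis vectors, satisfies the
    relation between coefficients that defines the diagonal operator. *)
Lemma essentially_self_adjoint_sums : essentially_self_adjoint mu A.
Proof.
have dA := densely_defined_sums.
split => //; rewrite op_closureE; split; last first.
  apply/seteqP; split=> -[f g] /=.
    move=> H; have [[/= hf hg] _] := H; split => // u v H'.
    by apply: heat_generator_sym H H'.
  move=> [[/= hf hg] H]; split => // k /=.
  have G : heat_generator (e k, fun x => - lam k * e k x).
    split; first by split => //=; [exact: L2_e|apply: L2Z; exact: L2_e].
    by move=> j /=; rewrite hatZ ?hat_e; [case: eqP => [->|]; rewrite ?mulr0|exact: L2_e].
  have := H _ _ G; rewrite /hat (L2dotC _ g) => <-.
  by rewrite L2dotZl//; [rewrite L2dotC|exact: L2_e].
split; first by move=> fg [].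
move=> f hf eps e0; have [uv Auv h] := dA.2 f hf eps e0; exists uv => //.
by split; [exact: AL2|exact: Ahat].
Qed.

End closure.

Definition heat_kernel (t : R) (x y : T) := limn (series (fun k => expR (- lam k * t) * e k x * e k y)).

(** Normal convergence allows the exchange of the sum with the integral at every
    point x. *)
Lemma heat_kernelE (t : R) f x : 0 < t -> L2 mu f ->
  mu.-integrable setT (EFin \o (fun y => heat_kernel t x y * f y)) /\
  heat t f x = \int[mu]_y (heat_kernel t x y * f y).
Proof.
move=> t0 hf; have cv := @summable_e t x t0.
split.
  apply: (integrable_bM (measurable_nsum cv) (nsum_le cv)); exact: L2_int.
have := nsum_int cv (L2_int hf).
rewrite /heat t0 /nsum => /cvg_lim <- //; congr (limn (series _)).
by apply/funext => k; rewrite /hat L2dotC /L2dot; ring.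
Qed.

End basis.

(** * Density of polynomials *)

Section bernstein.
Context {R : realType}.
Implicit Types (g h : nat -> R) (x : R).

(** The Bernstein polynomial of degree n on [-1,1] with the values g 0, ..., g n
    at equally spaced nodes, computed by de Casteljau's recursion; positivity and
    the second moment become inductions without binomial coefficients. *)
Fixpoint bernstein (n : nat) g : {poly R} :=
  if n is m.+1 then 2^-1 *: ((1 + 'X) * bernstein m (fun k => g k.+1) + (1 - 'X) * bernstein m g)
  else (g 0%N)%:P.

Lemma bernsteinS n g x : (bernstein n.+1 g).[x] =
  (1 + x) / 2 * (bernstein n (fun k => g k.+1)).[x] + (1 - x) / 2 * (bernstein n g).[x].
Proof. by rewrite /= !hornerE; field. Qed.

Lemma eq_bernstein n g h : (forall k, g k = h k) -> bernstein n g = bernstein n h.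
Proof. by move=> gh; have -> : g = h by apply/funext. Qed.

Lemma bernstein_lin n c g h x :
  (bernstein n (fun k => c * g k + h k)).[x] = c * (bernstein n g).[x] + (bernstein n h).[x].
Proof.
elim: n g h => [|n ih] g h; first by rewrite /= !hornerC.
by rewrite !bernsteinS !ih; ring.
Qed.

Lemma bernstein_cst n c x : (bernstein n (fun=> c)).[x] = c.
Proof. by elim: n => [|n ih]; rewrite ?bernsteinS ?ih /= ?hornerC//; field. Qed.

(** The second moment of the binomial distribution with success probability
    (1+x)/2; the shift c makes the induction go through. *)
Lemma bernstein_sqr n c x : (bernstein n (fun k => (k%:R + c) ^+ 2)).[x] =
  n%:R * ((1 + x) * (1 - x) / 4) + (n%:R * ((1 + x) / 2) + c) ^+ 2.
Proof.
elim: n c => [|n ih] c; first by rewrite /= hornerC !mul0r !add0r.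
rewrite bernsteinS ih.
rewrite (eq_bernstein n (h := fun k => (k%:R + (c + 1)) ^+ 2)); last by move=> k; rewrite -natr1; ring.
by rewrite ih -natr1; field.
Qed.

Lemma le_bernstein n g h x : -1 <= x <= 1 -> (forall k, (k <= n)%N -> g k <= h k) ->
  (bernstein n g).[x] <= (bernstein n h).[x].
Proof.
move=> /andP[x0 x1]; elim: n g h => [|n ih] g h gh; first by rewrite /= !hornerC gh.
rewrite !bernsteinS; apply: lerD; apply: ler_wpM2l; [lra| |lra|].
- by apply: ih => k kn; exact: gh.
- by apply: ih => k kn; apply: gh; exact: leqW.
Qed.

(** The Bernstein operator is monotone, and |f(x) - f(y)| is at most
    L (eta + (y-x)^2/eta)/2, a quadratic polynomial in y whose Bernstein
    approximation is known exactly. *)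
Lemma weierstrass_lipschitz (f : R -> R) (K eps : R) : 0 < eps ->
  (forall x y, -1 <= x <= 1 -> -1 <= y <= 1 -> `|f x - f y| <= K * `|x - y|) ->
  exists p : {poly R}, forall x, -1 <= x <= 1 -> `|f x - p.[x]| <= eps.
Proof.
move=> e0 fK; pose L := Num.max K 1.
have L1 : 1 <= L by rewrite le_max lexx orbT.
have L0 : 0 < L by lra.
have fL x y : -1 <= x <= 1 -> -1 <= y <= 1 -> `|f x - f y| <= L * `|x - y|.
  by move=> hx hy; apply: le_trans (fK x y hx hy) _; rewrite ler_wpM2r// le_max lexx.
pose eta := eps / L.
have eta0 : 0 < eta by rewrite divr_gt0.
pose n := (Num.trunc (eta ^- 2)).+1.
have nE : eta ^- 2 < n%:R.
  have z : 0 <= eta ^- 2 by rewrite invr_ge0 exprn_ge0// ltW.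
  by have /andP[] := truncn_itv z.
have n0 : 0 < n%:R :> R by [].
pose node (k : nat) : R := 2 * k%:R / n%:R - 1.
have nodeD k : (k <= n)%N -> -1 <= node k <= 1.
  move=> kn; have : 0 <= (k%:R : R) / n%:R <= 1.
    by rewrite divr_ge0//= ler_pdivrMr// mul1r ler_nat.
  rewrite /node -mulrA; lra.
exists (bernstein n (f \o node)) => x xD.
(* The quadratic majorant of L |y-x|, by the arithmetic-geometric mean inequality. *)
pose q (k : nat) : R := L * (eta + (node k - x) ^+ 2 / eta) / 2.
have qE : (bernstein n q).[x] = L * (eta + (1 + x) * (1 - x) / n%:R / eta) / 2.
  rewrite (eq_bernstein n (h := fun k => (2 * L / (n%:R ^+ 2 * eta)) * (k%:R + (- n%:R * (1 + x) / 2)) ^+ 2 + L * eta / 2)).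
    rewrite bernstein_lin bernstein_sqr bernstein_cst; field.
    by rewrite !gt_eqF.
  by move=> k; rewrite /q /node; field; rewrite !gt_eqF.
have fq k : (k <= n)%N -> `|f x - f (node k)| <= q k.
  move=> kn; apply: le_trans (fL _ _ xD (nodeD _ kn)) _.
  rewrite /q -mulrA ler_wpM2l ?(ltW L0)// distrC.
  have h : 0 <= (eta - `|node k - x|) ^+ 2 / eta by rewrite divr_ge0 ?sqr_ge0// ltW.
  rewrite -(real_normK (num_real (node k - x))).
  have : (eta - `|node k - x|) ^+ 2 / eta = eta + `|node k - x| ^+ 2 / eta - 2 * `|node k - x|.
    by field; rewrite gt_eqF.
  lra.
have qeps : (bernstein n q).[x] <= eps.
  rewrite qE.
  have h1 : (1 + x) * (1 - x) <= 1 by rewrite (_ : _ * _ = 1 - x ^+ 2); [rewrite gerBl sqr_ge0|ring].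
  have h2 : (1 + x) * (1 - x) / n%:R / eta <= eta.
    rewrite ler_pdivrMr// ler_pdivrMr//; apply: le_trans h1 _.
    have h3 : 1 <= eta ^+ 2 * n%:R.
      by rewrite -[X in X <= _](mulfV (lt0r_neq0 (exprn_gt0 2 eta0))) ler_pM2l ?exprn_gt0// ltW.
    by rewrite -expr2.
  rewrite ler_pdivrMr// (_ : eps * 2 = L * (eta + eta)); last by rewrite /eta; field; rewrite gt_eqF.
  by rewrite ler_wpM2l ?(ltW L0)// lerD2l.
rewrite ler_norml; apply/andP; split.
- have : (bernstein n (f \o node)).[x] <= (bernstein n (fun k => 1 * q k + f x)).[x].
    apply: le_bernstein => // k kn /=; have := fq k kn; rewrite ler_norml; lra.
  rewrite bernstein_lin bernstein_cst; lra.
- have : (bernstein n (fun k => -1 * q k + f x)).[x] <= (bernstein n (f \o node)).[x].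
    apply: le_bernstein => // k kn /=; have := fq k kn; rewrite ler_norml; lra.
  rewrite bernstein_lin bernstein_cst; lra.
Qed.

End bernstein.

Section density.
Import HBNNSimple.
Context {R : realType} (a b : R).
Notation TR := (measurableTypeR R).
Notation mu := (jacobi_measure a b).
Notation DD := (`[(-1)%R, 1%R]%classic : set TR).
Hypotheses (ha : -1 < a) (hb : -1 < b).
Local Notation nrm := (L2nrm mu).
Local Notation hp p := ((fun x : TR => (horner p) x) \_ DD).
Implicit Types (f g h : TR -> R).

Lemma restrictDE f (x : R) : (f \_ DD) x = if -1 <= x <= 1 then f x else 0.
Proof.
rewrite patchE; case: ifPn => h; first by rewrite inE/= in_itv/= in h; rewrite h.
by case: ifPn => // xD; move/negP : h; case; rewrite inE/= in_itv/=.
Qed.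

Lemma measurable_hp (p : {poly R}) : measurable_fun setT (hp p).
Proof. by apply/(measurable_restrictT _ _).1 => //; exact: measurable_horner. Qed.

Lemma hp_bounded (p : {poly R}) : exists M : R, forall x, `|(hp p) x| <= M.
Proof.
have [M M0 h] := horner_bounded p; exists M => x; rewrite restrictDE.
by case: ifPn => xD; [exact: h|rewrite normr0 ltW].
Qed.

Lemma jacobi_bounded_L2 f (M : R) : measurable_fun setT f -> (forall x, `|f x| <= M) -> L2 mu f.
Proof. exact: bounded_L2 (measure_jacobi_fin ha hb) _ _. Qed.

Lemma L2_hp p : L2 mu (hp p).
Proof. by have [M hM] := hp_bounded p; apply: jacobi_bounded_L2 hM; exact: measurable_hp. Qed.

Lemma ae_jacobi_D : {ae mu, forall x, DD x}.
Proof.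
exists (~` DD); split; first exact: measurableC.
  exact: measure_jacobi_onD.
by move=> x /= h1 h2; apply: h1.
Qed.

Lemma ae_eq_D f g : (forall x : R, -1 <= x <= 1 -> f x = g x) -> f = g %[ae mu].
Proof.
move=> fg; apply: (ae_mono _ ae_jacobi_D) => x /=; rewrite in_itv/= => xD _.
exact: fg.
Qed.

Definition poly_approx f := L2 mu f /\ forall eps : R, 0 < eps -> exists p : {poly R}, nrm (fun x => f x - (hp p) x) < eps.

Lemma poly_approx_lim f : L2 mu f ->
  (forall eps : R, 0 < eps -> exists2 g, poly_approx g & nrm (fun x => f x - g x) < eps) -> poly_approx f.
Proof.
move=> hf H; split => // eps e0; have e2 : 0 < eps / 2 by lra.
have [g [hg G] h1] := H _ e2; have [p h2] := G _ e2; exists p.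
have := ler_L2nrm_dist hf hg (L2_hp p); lra.
Qed.

Lemma poly_approx_lin c f g : poly_approx f -> poly_approx g -> poly_approx (fun x => c * f x + g x).
Proof.
move=> [hf F] [hg G]; split; first exact: L2_lin.
move=> eps e0; have e2 : 0 < eps / 2 by lra.
have q0 : 0 < eps / (2 * (`|c| + 1)) by rewrite divr_gt0// mulr_gt0// ltr_wpDl.
have [p h1] := F _ q0; have [q h2] := G _ e2; exists (c *: p + q).
have d1 := L2B hf (L2_hp p); have d2 := L2B hg (L2_hp q).
have d3 : L2 mu (fun x => c * (f x - (hp p) x)).
  by have := L2_lin c d1 (L2_0 mu); under eq_fun do rewrite addr0.
have -> : (fun x => c * f x + g x - (hp (c *: p + q)) x) = (fun x => c * (f x - (hp p) x) + (g x - (hp q) x)).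
  apply/funext => x; rewrite !restrictDE; case: ifPn => _ /=; last by ring.
  rewrite hornerD hornerZ.
  ring.
apply: le_lt_trans (ler_L2nrmD d3 d2) _.
have -> : nrm (fun x => c * (f x - (hp p) x)) = `|c| * nrm (fun x => f x - (hp p) x).
  rewrite /L2nrm -sqrtr_sqr -sqrtrM ?sqr_ge0//; congr Num.sqrt.
  have := L2dot_linl c d1 (L2_0 mu) d3; under [X in L2dot _ X _ = _]eq_fun do rewrite addr0.
  move=> ->; rewrite L2dot0l addr0 L2dotC.
  have := L2dot_linl c d1 (L2_0 mu) d1; under [X in L2dot _ X _ = _]eq_fun do rewrite addr0.
  by move=> ->; rewrite L2dot0l addr0; ring.
have : `|c| * nrm (fun x => f x - (hp p) x) <= `|c| * (eps / (2 * (`|c| + 1))).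
  by rewrite ler_wpM2l// ltW.
have : `|c| * (eps / (2 * (`|c| + 1))) <= eps / 2.
  have n0 : 0 <= `|c| by [].
  rewrite mulrA ler_pdivrMr; last by rewrite mulr_gt0// ltr_wpDl.
  have : 0 <= eps by lra.
  move: (`|c|) n0 => C C0 E0; have := mulr_ge0 C0 E0; lra.
lra.
Qed.

(** Dominated convergence for |f - s n|^2, with dominating function 4 h^2. *)
Lemma poly_approx_dominated (s : nat -> TR -> R) f h : L2 mu h -> measurable_fun setT f ->
  (forall n, poly_approx (s n)) -> (forall n x, `|s n x| <= h x) ->
  (forall x, s n x @[n --> \oo] --> f x) -> poly_approx f.
Proof.
move=> hh mf ps sh sf.
have fh x : `|f x| <= h x.
  have c : `|s n x| @[n --> \oo] --> `|f x| by apply: cvg_norm.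
  rewrite -(cvg_lim _ c)//.
  by apply: limr_le; [apply/cvg_ex; eexists; exact: c|exact: nearW].
have h0 x : 0 <= h x by apply: le_trans (fh x).
have mh := L2_measurable hh.
have hf : L2 mu f.
  apply: L2P => //; apply: (@le_integrable _ TR R mu setT _ _ (EFin \o (fun x => h x * h x))) => //.
  - by apply/measurable_EFinP; exact: measurable_funM.
  - by move=> x _ /=; rewrite lee_fin !normrM (ger0_norm (h0 x)) ler_pM.
  - exact: L2_integrableM.
apply: poly_approx_lim => // eps e0.
have ms n := L2_measurable (ps n).1.
have md n : measurable_fun setT (fun x => (f x - s n x) ^+ 2).
  by apply: measurable_funX; exact: measurable_funB.
have hi : mu.-integrable setT (EFin \o (fun x => 4 * (h x * h x))).
  by apply: integrable_EFinZ => //; exact: L2_integrableM.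
have := @dominated_convergence _ TR R mu setT measurableT (fun n x => ((f x - s n x) ^+ 2)%:E) (cst 0%E) (fun x => (4 * (h x * h x))%:E).
case => //.
- by move=> n; exact/measurable_EFinP.
- apply: aeW => x _; apply: cvg_EFin; first exact: nearW.
  have c : f x - s n x @[n --> \oo] --> f x - f x by apply: cvgB => //; exact: cvg_cst.
  rewrite subrr in c.
  have c2 : (f x - s n x) * (f x - s n x) @[n --> \oo] --> (0 * 0 : R) by apply: cvgM.
  by rewrite mulr0 in c2; move: c2; under eq_fun do rewrite -expr2.
- apply: aeW => x n _ /=; rewrite lee_fin ger0_norm ?sqr_ge0//.
  have : `|f x - s n x| <= 2 * h x.
    by apply: le_trans (ler_normB _ _) _; have := fh x; have := sh n x; lra.
  move=> hd; rewrite -(real_normK (num_real (f x - s n x))) expr2.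
  rewrite (_ : 4 * _ = (2 * h x) * (2 * h x)); last ring.
  by rewrite ler_pM.
move=> _ _; rewrite integral0 => /fine_cvgP[_ /cvgrPdist_lt].
have e2 : 0 < eps ^+ 2 by rewrite exprn_gt0.
move=> /(_ _ e2) [N _ /(_ N (leqnn N))] /= hN.
exists (s N) => //.
rewrite -ltr_sqr ?nnegrE ?L2nrm_ge0 ?(ltW e0)// L2nrm_sqr.
move: hN; rewrite sub0r normrN; apply: le_lt_trans.
rewrite /L2dot /Rintegral; apply: le_trans (ler_norm _) _.
rewrite le_eqVlt; apply/orP; left; apply/eqP; congr (`|fine _|).
Qed.

Lemma poly_approx_lipschitz f (K M : R) : measurable_fun setT f -> (forall x, `|f x| <= M) ->
  (forall x y : R, -1 <= x <= 1 -> -1 <= y <= 1 -> `|f x - f y| <= K * `|x - y|) -> poly_approx f.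
Proof.
move=> mf fM fK; have hf := jacobi_bounded_L2 mf fM; split => // eps e0.
pose V := fine (mu setT).
have V0 : 0 <= V by apply: fine_ge0.
have q0 : 0 < eps / (V + 2) by rewrite divr_gt0// ltr_wpDl.
have [p hpp] := weierstrass_lipschitz q0 fK; exists p.
have hd := L2B hf (L2_hp p).
rewrite -ltr_sqr ?nnegrE ?L2nrm_ge0 ?(ltW e0)// L2nrm_sqr.
apply: (@le_lt_trans _ _ ((eps / (V + 2)) ^+ 2 * V)).
  rewrite -Rintegral_cst//.
  have -> : L2dot mu (fun x => f x - (hp p) x) (fun x => f x - (hp p) x) =
     L2dot mu ((fun x => f x - (hp p) x) \_ DD) ((fun x => f x - (hp p) x) \_ DD).
    have mm : measurable_fun setT ((fun x => f x - (hp p) x) \_ DD).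
      by apply/(measurable_restrictT _ _).1 => //; apply: measurable_funTS; exact: (L2_measurable hd).
    have E : (fun x => f x - (hp p) x) = (fun x => f x - (hp p) x) \_ DD %[ae mu].
      by apply: ae_eq_D => x xD; rewrite [in RHS]restrictDE xD.
    have hd' := L2_ae mm hd E.
    by rewrite (L2dot_ae hd hd' hd E) L2dotC (L2dot_ae hd hd' hd' E).
  apply: le_Rintegral => //.
  - apply: (@bounded_integrable _ _ _ _ (measure_jacobi_fin ha hb) _ ((eps / (V + 2)) ^+ 2)).
      have mm : measurable_fun setT ((fun x => f x - (hp p) x) \_ DD).
        by apply/(measurable_restrictT _ _).1 => //; apply: measurable_funTS; exact: (L2_measurable hd).
      exact: measurable_funM.
    move=> x; rewrite normrM !restrictDE; case: ifPn => xD.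
      by rewrite xD expr2 ler_pM ?hpp//.
    by rewrite normr0 mulr0 sqr_ge0.
  - apply: (@bounded_integrable _ _ _ _ (measure_jacobi_fin ha hb) _ ((eps / (V + 2)) ^+ 2)) => // x.
    by rewrite ger0_norm ?sqr_ge0.
  - move=> x _; apply: le_trans (ler_norm _) _; rewrite normrM !restrictDE; case: ifPn => xD.
      by rewrite xD expr2 ler_pM ?hpp//.
    by rewrite normr0 mulr0 sqr_ge0.
rewrite exprMn -mulrA -[ltRHS]mulr1 ltr_pM2l ?exprn_gt0//.
rewrite exprVn mulrC ltr_pdivrMr ?mul1r; last by rewrite exprn_gt0// ltr_wpDl.
rewrite expr2; have := mulr_ge0 V0 V0; lra.
Qed.

(** The indicator is the bounded pointwise limit of continuous piecewise linear
    functions. *)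
Lemma poly_approx_ray (c : R) : poly_approx (\1_(`]c, +oo[%classic : set TR)).
Proof.
pose s (n : nat) (x : TR) : R := Num.min 1 (Num.max 0 (n%:R * (x - c))).
have s01 n x : 0 <= s n x <= 1 by rewrite /s le_min ler01 le_max lexx/= ge_min lexx.
have ms n : measurable_fun setT (s n).
  apply: measurable_minr => //; apply: measurable_maxr => //; apply: measurable_funM => //.
  exact: measurable_funB.
apply: (@poly_approx_dominated s _ (fun=> 1)).
- by apply: (@jacobi_bounded_L2 _ 1) => // x; rewrite normr1.
- exact: measurable_indic.
- move=> n; apply: (@poly_approx_lipschitz _ n%:R 1) => //.
    by move=> x; rewrite ger0_norm; case/andP: (s01 n x).
  move=> x y _ _; rewrite /s.
  have : `|n%:R * (x - c) - n%:R * (y - c)| = n%:R * `|x - y|.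
    by rewrite -mulrBr normrM normr_nat; congr (_ * `|_|); ring.
  move=> <-; move: (n%:R * (x - c)) (n%:R * (y - c)) => u v.
  have a1 : u - v <= `|u - v| := ler_norm _.
  have a2 : v - u <= `|u - v| by rewrite distrC ler_norm.
  rewrite /Num.min /Num.max; case: (ltP 0 u) => u0; case: (ltP 0 v) => v0;
   [case: (ltP 1 u) => u1; case: (ltP 1 v) => v1| case: (ltP 1 u) => u1; case: (ltP 1 0) => v1 |
    case: (ltP 1 0) => u1; case: (ltP 1 v) => v1|case: (ltP 1 0) => u1];
   rewrite ?subrr ?normr0//; rewrite ler_norml; apply/andP; split; lra.
- by move=> n x; rewrite ger0_norm; case/andP: (s01 n x).
- move=> x; rewrite indicE; case: (ltP c x) => cx.
    rewrite mem_set/= ?in_itv/= ?cx//.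
    apply: cvg_near_cst; exists (Num.trunc (x - c)^-1).+1 => // n /= hn.
    rewrite /s min_l// le_max; apply/orP; right.
    have xc : 0 < x - c by rewrite subr_gt0.
    rewrite -ler_pdivrMr// mul1r.
    have z : 0 <= (x - c)^-1 by rewrite invr_ge0 ltW.
    have /andP[_ h] := truncn_itv z.
    by apply: ltW; apply: lt_le_trans h _; rewrite ler_nat.
  rewrite memNset/= ?in_itv/= ?andbT; last by apply/negP; rewrite -leNgt.
  apply: cvg_near_cst; apply: nearW => n; rewrite /s max_l ?min_r//.
  by rewrite mulr_ge0_le0// subr_le0.
Qed.

Lemma poly_approx_cst (c : R) : poly_approx (fun=> c).
Proof.
apply: (@poly_approx_lipschitz _ 0 `|c|) => //.
by move=> x y _ _; rewrite subrr normr0 mul0r.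
Qed.

(** Rays are stable under intersection and generate the Borel sets, and the sets
    whose indicator can be approximated form a Dynkin system. *)
Lemma poly_approx_indic (A : set TR) : measurable A -> poly_approx (\1_A).
Proof.
move=> mA.
have hE : @measurable _ TR = <<s [set A : set TR | exists x : R, A = `]x, +oo[%classic] >>.
  exact: RGenOInfty.measurableE.
apply: (dynkin_induction (P := fun A => poly_approx (\1_A)) hE) => //.
- move=> _ _ [x ->] [y ->]; exists (Num.max x y).
  by apply/seteqP; split => z /=; rewrite !in_itv/= !andbT gt_max; [case=> -> ->|case/andP].
- by rewrite indicT; exact: poly_approx_cst.
- by move=> _ [x ->]; exact: poly_approx_ray.
- move=> S mS hS; have := poly_approx_lin (-1) hS (poly_approx_cst 1).
  congr poly_approx; apply/funext => x; rewrite !indicE in_setC.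
  by case: (x \in S); rewrite /=; ring.
- move=> F mF tF hF.
  pose s (n : nat) (x : TR) : R := \1_(\big[setU/set0]_(k < n) F k) x.
  have sS n : s n.+1 = (fun x => 1 * \1_(F n) x + s n x).
    apply/funext => x; rewrite /s big_ord_recr/= mul1r !indicE in_setU.
    case: (boolP (x \in F n)) => xn; last by rewrite orbF add0r.
    rewrite orbT; rewrite (_ : (x \in _) = false) ?addr0//.
    apply/negP; rewrite inE -bigcup_mkord => -[k /= kn Fk].
    move/trivIsetP : tF => /(_ k n I I) ; rewrite ltn_eqF// => /(_ isT) /seteqP[+ _].
    by move=> /(_ x); apply; split => //; rewrite inE in xn.
  apply: (@poly_approx_dominated s _ (fun=> 1)).
  + by apply: (@jacobi_bounded_L2 _ 1) => // x; rewrite normr1.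
  + by apply: measurable_indic; exact: bigcupT_measurable.
  + elim=> [|n ih]; last by rewrite sS; apply: poly_approx_lin.
    by rewrite /s big_ord0 indic0; exact: poly_approx_cst.
  + by move=> n x; rewrite /s indicE; case: (_ \in _); rewrite ?normr1 ?normr0.
  + move=> x; case: (pselect (exists k, F k x)) => [[k Fk]|nF].
      apply: cvg_near_cst; exists k.+1 => // n /= kn.
      rewrite /s !indicE !mem_set//; first by exists k.
      by rewrite -bigcup_mkord; exists k.
    apply: cvg_near_cst; apply: nearW => n; rewrite /s !indicE !memNset//.
      by move=> [k _ Fk]; apply: nF; exists k.
    by rewrite -bigcup_mkord => -[k _ Fk]; apply: nF; exists k.
- by rewrite -hE.
Qed.

Lemma poly_approx_ge0 f : L2 mu f -> (forall x, 0 <= f x) -> poly_approx f.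
Proof.
move=> hf f0; have mf := L2_measurable hf.
have mEf : measurable_fun setT (EFin \o f) by exact/measurable_EFinP.
pose h := nnsfun_approx measurableT mEf.
have cv x : h n x @[n --> \oo] --> f x.
  have := @cvg_nnsfun_approx _ _ _ _ measurableT _ mEf (fun x _ => f0 x) x I.
  by move=> /fine_cvgP[_].
apply: (@poly_approx_dominated (fun n => h n) _ f) => //.
- move=> n; have -> : (h n : TR -> R) = (fun x => \sum_(y <- finmap.enum_fset (fset_set (range (h n)))) (y * \1_(h n @^-1` [set y]) x)).
    by apply/funext => x; rewrite fimfunE fsbig_finite//=.
  elim: (finmap.enum_fset _) => [|y r ih].
    by under eq_fun do rewrite big_nil; exact: poly_approx_cst.
  by under eq_fun do rewrite big_cons; apply: poly_approx_lin => //; apply: poly_approx_indic.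
- move=> n x; rewrite ger0_norm//.
  have nd : nondecreasing_seq (fun n => h n x).
    by move=> i j ij; have /lefP := nd_nnsfun_approx measurableT mEf ij; exact.
  rewrite -(cvg_lim _ (cv x))//; apply: nondecreasing_cvgn_le => //.
  by apply/cvg_ex; exists (f x).
Qed.

Theorem poly_dense f : L2 mu f -> poly_approx f.
Proof.
move=> hf; have mf := L2_measurable hf.
have aux (g : TR -> R) : L2 mu g -> L2 mu (fun x => Num.max 0 (g x)).
  move=> hg; apply: L2P; first by apply: measurable_maxr => //; exact: (L2_measurable hg).
  apply: (@le_integrable _ TR R mu setT _ _ (EFin \o (fun x => g x * g x))) => //.
  - have := L2_measurable hg => mg.
    by apply/measurable_EFinP; apply: measurable_funM; exact: measurable_maxr.
  - move=> x _ /=; rewrite lee_fin !normrM; apply: ler_pM => //;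
      by rewrite /Num.max; case: ifP; rewrite ?normr0.
  - exact: L2_integrableM.
have hN : L2 mu (fun x => - f x).
  by have := L2B (L2_0 mu) hf; under eq_fun do rewrite sub0r.
have p1 : poly_approx (fun x => Num.max 0 (f x)) by apply: poly_approx_ge0; [exact: aux|move=> x; rewrite le_max lexx].
have p2 : poly_approx (fun x => Num.max 0 (- f x)) by apply: poly_approx_ge0; [exact: aux|move=> x; rewrite le_max lexx].
have := poly_approx_lin (-1) p2 p1; congr poly_approx; apply/funext => x.
by rewrite /Num.max oppr_gt0; case: (ltgtP (f x) 0) => [||->]; lra.
Qed.

End density.

(** * The operator on polynomials and gradient bounds *)

Section polynomials.
Context {R : realType}.
Notation TR := (measurableTypeR R).
Implicit Types (p q r : {poly R}) (a b : R).

Definition jacobi_L a b p : {poly R} := jacobi_div a b p^`().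

Lemma jacobi_LE a b p x : (jacobi_L a b p).[x] =
  (1 - x ^+ 2) * (p^`()^`()).[x] + ((b - a) - (a + b + 2) * x) * (p^`()).[x].
Proof. by rewrite /jacobi_L /jacobi_div !hornerE. Qed.

Lemma jacobi_L_lin a b c p q : jacobi_L a b (c *: p + q) = c *: jacobi_L a b p + jacobi_L a b q.
Proof.
rewrite /jacobi_L /jacobi_div !derivD !derivZ !mulrDr -!scalerAr -!mul_polyC; ring.
Qed.

Lemma size_jacobi_L a b p n : (size p <= n)%N -> (size (jacobi_L a b p) <= n)%N.
Proof.
move=> pn; apply/leq_sizeP => j nj.
have pj i : (n <= i)%N -> p`_i = 0 by move=> ni; apply: nth_default; exact: leq_trans pn ni.
have -> : jacobi_L a b p = p^`()^`() - 'X^2 * p^`()^`() + (b - a) *: p^`() - (a + b + 2) *: ('X * p^`()).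
  by rewrite /jacobi_L /jacobi_div -!mul_polyC; ring.
case: j nj => [|[|j]] nj; rewrite !(coefD, coefN, coefZ, coefXnM, coefXM, coef_deriv)/= ?subn2/=.
- by rewrite !pj ?(leq_trans nj)// !mul0rn; ring.
- by rewrite !pj ?(leq_trans nj)// !mul0rn; ring.
- have pk i : (j.+2 <= i)%N -> p`_i = 0 by move=> h; apply: pj; exact: leq_trans h.
  rewrite (pk j.+2 (leqnn _)) (pk j.+3 (leqnSn _)) (pk j.+4 (leqW (leqnSn _))).
  by rewrite !mul0rn; ring.
Qed.

(** The operator does not raise the degree and acts on the leading term through
    - k (k-1) - (a+b+2) k = - k (k+a+b+1). *)
Lemma coef_jacobi_L a b p k : size p = k.+1 ->
  (jacobi_L a b p)`_k = - jacobi_eigenvalue a b k * p`_k.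
Proof.
move=> pk.
have pj i : (k < i)%N -> p`_i = 0 by move=> ni; apply: nth_default; rewrite pk.
have -> : jacobi_L a b p = p^`()^`() - 'X^2 * p^`()^`() + (b - a) *: p^`() - (a + b + 2) *: ('X * p^`()).
  by rewrite /jacobi_L /jacobi_div -!mul_polyC; ring.
rewrite /jacobi_eigenvalue !(coefD, coefN, coefZ, coefXnM, coefXM, coef_deriv).
rewrite !(pj k.+1)// ?(pj k.+2)// !mul0rn.
case: k pk pj => [|[|k]] pk pj /=.
- by ring.
- by ring.
- by rewrite subn2/=; ring.
Qed.

Definition polyN p : {poly R} := p \Po (- 'X).

Lemma horner_polyN p x : (polyN p).[x] = p.[- x].
Proof. by rewrite /polyN horner_comp !hornerE. Qed.

Lemma deriv_polyN p : (polyN p)^`() = - polyN p^`().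
Proof. by rewrite /polyN deriv_comp derivN derivX mulrN1. Qed.

Lemma jacobi_L_polyN a b p x : (jacobi_L b a (polyN p)).[x] = (jacobi_L a b p).[- x].
Proof.
rewrite !jacobi_LE !deriv_polyN derivN deriv_polyN opprK !hornerN !horner_polyN sqrrN; ring.
Qed.

Definition grad_cst a b : R := 2 `^ (`|b| + `|b + 1|) / (a + 1).

Lemma grad_cst_gt0 a b : -1 < a -> 0 < grad_cst a b.
Proof. by move=> ha; rewrite divr_gt0 ?powR_gt0//; lra. Qed.

(** The flux vanishes at 1 and its derivative w L u is at most
    2^|b| A (1-y)^a in modulus; comparison with the primitive of (1-y)^a gives the
    bound.  Monotonicity replaces the integral, as (1-y)^a may be unbounded. *)
Lemma le_deriv_flux_right a b (u : {poly R}) (x A : R) : -1 < a -> -1 < b -> -2^-1 <= x < 1 ->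
  (forall y, x <= y <= 1 -> `|(jacobi_L a b u).[y]| <= A) ->
  `|jacobi_wplus a b x * (u^`()).[x]| <= A * 2 `^ `|b| * ((1 - x) `^ (a + 1) / (a + 1)).
Proof.
move=> ha hb /andP[x0 x1] hA.
have A0 : 0 <= A by apply: le_trans (hA 1 _) => //; rewrite ltW//= lexx.
pose K := A * 2 `^ `|b|.
have K0 : 0 <= K by rewrite mulr_ge0// powR_ge0.
pose G := fun y : R => jacobi_wplus a b y * (u^`()).[y].
pose Psi := fun y : R => - ((1 - y) `^ (a + 1) / (a + 1)).
have cG : {within `[x, 1%R], continuous G}.
  have cW := @continuous_jacobi_wplus R a b ha hb (u^`()).
  apply: (@continuous_subspaceW R R `[x, 1%R]%classic `[(-1)%R, 1%R]%classic G _ cW).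
  by move=> y /=; rewrite !in_itv/= => /andP[? ->]; rewrite andbT; lra.
have Psi1 : Psi 1 = 0 by rewrite /Psi subrr powR0 ?mul0r ?oppr0// gt_eqF; lra.
have cPsi : {within `[x, 1%R], continuous Psi}.
  have dPsi y : y < 1 -> {for y, continuous Psi}.
    move=> y1; apply: differentiable_continuous; apply/derivable1_diffP.
    by have [] := is_derive_powR_onem ha y1.
  apply/continuous_within_itvP => //; split.
  - by move=> y; rewrite in_itv/= => /andP[_ y1]; exact: dPsi.
  - by apply: cvg_at_right_filter; exact: dPsi.
  - rewrite Psi1.
    have h : - ((1 - y) `^ (a + 1) / (a + 1)) @[y --> 1^'-] --> - (0 / (a + 1)).
      apply: cvgN; apply: cvgM; last exact: cvg_cst.
      by apply: (@cvg_onem_left _ (fun y => y `^ (a+1))); apply: powR_cvg0; lra.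
    by rewrite mul0r oppr0 in h.
have key (s : R) : `|s| <= 1 -> forall y, x < y < 1 ->
    is_derive y 1 (fun y => K * Psi y + s * G y) (K * (1 - y) `^ a + s * (jacobi_weight a b y * (jacobi_L a b u).[y])).
  move=> s1 y /andP[xy y1].
  have d1 := is_derive_powR_onem ha y1.
  have d2 : is_derive y 1 G (jacobi_weight a b y * (jacobi_L a b u).[y]).
    by apply: is_derive_jacobi_wplus => //; apply/andP; split; lra.
  exact: is_deriveD (is_deriveZ K d1) (is_deriveZ s d2).
have mono (s : R) : `|s| <= 1 -> K * Psi x + s * G x <= 0.
  move=> s1; have E : K * Psi 1 + s * G 1 = 0.
    by rewrite Psi1 /G jacobi_wplus1// mul0r !mulr0 addr0.
  rewrite -E; apply: (@ger0_derive1_le_cc R (fun y => K * Psi y + s * G y) x 1).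
  - by move=> y; rewrite in_itv/= => /(key s s1) [].
  - move=> y; rewrite in_itv/= => xy1; have d := key s s1 y xy1.
    rewrite derive1E (@derive_val _ _ _ _ _ _ _ d).
    have [xy y1] := andP xy1.
    have h1 := @jacobi_weight_le _ a b y; have /h1{}h1 : - 2^-1 <= y <= 1 by apply/andP; split; lra.
    have h2 : `|(jacobi_L a b u).[y]| <= A by apply: hA; rewrite !ltW.
    have h3 : `|s * (jacobi_weight a b y * (jacobi_L a b u).[y])| <= K * (1 - y) `^ a.
      rewrite normrM [`|jacobi_weight _ _ _ * _|]normrM (ger0_norm (jacobi_weight_ge0 a b y)).
      apply: (@le_trans _ _ (1 * ((2 `^ `|b| * (1 - y) `^ a) * A))).
        apply: ler_pM => //; first by rewrite mulr_ge0 ?jacobi_weight_ge0.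
        by apply: ler_pM => //; exact: jacobi_weight_ge0.
      rewrite /K le_eqVlt; apply/orP; left; apply/eqP; ring.
    move: h3; rewrite ler_norml; lra.
  - move=> y; apply: cvgD.
      by apply: cvgM; [exact: cvg_cst|exact: cPsi].
    by apply: cvgM; [exact: cvg_cst|exact: cG].
  - by rewrite in_itv/= lexx ltW.
  - by rewrite in_itv/= lexx ltW.
  - exact: ltW.
have m1 := mono 1; have m2 := mono (-1).
rewrite normr1 in m1; rewrite normrN1 in m2.
have {}m1 := m1 (lexx _); have {}m2 := m2 (lexx _).
rewrite -/(G x) ler_norml; move: m1 m2; rewrite /Psi -/K; lra.
Qed.

(** Divide the flux bound by (1-x)^(a+1).  At x = 1 this is impossible, but there
    L u(1) = - 2 (a+1) u'(1). *)
Lemma le_deriv_right a b (u : {poly R}) (x A : R) : -1 < a -> -1 < b -> -2^-1 <= x <= 1 ->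
  (forall y, x <= y <= 1 -> `|(jacobi_L a b u).[y]| <= A) ->
  `|(u^`()).[x]| <= grad_cst a b * A.
Proof.
move=> ha hb /andP[x0]; rewrite le_eqVlt => /orP[/eqP ->|x1] hA.
  have := hA 1; rewrite lexx/= => /(_ isT); rewrite jacobi_LE.
  have -> : (1 - 1 ^+ 2) * (u^`()^`()).[1] + (b - a - (a + b + 2) * 1) * (u^`()).[1] = - ((2 * (a + 1)) * (u^`()).[1]) by ring.
  rewrite normrN normrM gtr0_norm; last lra.
  move=> h.
  have g1 : 1 <= 2 `^ (`|b| + `|b + 1|) :> R.
    apply: le_trans (_ : 2 `^ 0 <= _); first by rewrite powRr0.
    by apply: ler_powR; rewrite ?addr_ge0//; lra.
  have n0 : 0 <= `|(u^`()).[1]| by [].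
  have h2 : `|(u^`()).[1]| * (a + 1) <= A.
    have : 0 <= (a + 1) * `|(u^`()).[1]| by rewrite mulr_ge0//; lra.
    lra.
  rewrite /grad_cst mulrAC ler_pdivlMr; last lra.
  apply: le_trans h2 _; rewrite ler_peMl//; apply: le_trans h.
  by rewrite mulr_ge0//; lra.
have x01 : -2^-1 <= x < 1 by rewrite x0.
have := le_deriv_flux_right ha hb x01 hA.
rewrite normrM ger0_norm; last by rewrite mulr_ge0 ?powR_ge0.
have p0 : 0 < (1 - x) `^ (a + 1) by rewrite powR_gt0; lra.
have p1 : 0 < (1 + x) `^ (b + 1) by rewrite powR_gt0; lra.
rewrite /jacobi_wplus -[X in X <= _]mulrA [leRHS](_ : _ = (1 - x) `^ (a + 1) * (A * 2 `^ `|b| / (a + 1))); last by ring.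
rewrite ler_pM2l// => h.
have p2 : 1 <= 2 `^ `|b + 1| * (1 + x) `^ (b + 1).
  have := @powR_ratio _ (b + 1) 2 1 (1 + x); rewrite powR1; apply => //; lra.
have p3 : 0 < 2 `^ `|b + 1| :> R by rewrite powR_gt0.
apply: (@le_trans _ _ (2 `^ `|b + 1| * ((1 + x) `^ (b + 1) * `|(u^`()).[x]|))).
  by rewrite mulrA ler_peMl.
apply: le_trans (ler_wpM2l (ltW p3) h) _.
rewrite /grad_cst powRD; last by apply/implyP => _; rewrite pnatr_eq0.
rewrite le_eqVlt; apply/orP; left; apply/eqP; ring.
Qed.

Definition grad_cst2 a b : R := grad_cst a b + grad_cst b a.

Lemma le_deriv_global a b (u : {poly R}) (A : R) : -1 < a -> -1 < b ->
  (forall y, -1 <= y <= 1 -> `|(jacobi_L a b u).[y]| <= A) ->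
  forall x, -1 <= x <= 1 -> `|(u^`()).[x]| <= grad_cst2 a b * A.
Proof.
move=> ha hb hA x /andP[x0 x1].
have A0 : 0 <= A by apply: le_trans (hA 1 _) => //; rewrite lexx andbT; lra.
have g1 := grad_cst_gt0 b ha; have g2 := grad_cst_gt0 a hb.
rewrite /grad_cst2 mulrDl; have [xp|xn] := leP 0 x.
  apply: (@le_trans _ _ (grad_cst a b * A)); last by rewrite lerDl mulr_ge0// ltW.
  apply: le_deriv_right => //; first by apply/andP; split; lra.
  by move=> y /andP[xy y1]; apply: hA; apply/andP; split; lra.
apply: (@le_trans _ _ (grad_cst b a * A)); last by rewrite lerDr mulr_ge0// ltW.
have := @le_deriv_right b a (polyN u) (- x) A hb ha.
rewrite deriv_polyN hornerN horner_polyN opprK normrN; apply; first by apply/andP; split; lra.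
by move=> y /andP[xy y1]; rewrite jacobi_L_polyN; apply: hA; apply/andP; split; lra.
Qed.

Lemma horner_MVT (u : {poly R}) (A x y : R) : -1 <= x <= 1 -> -1 <= y <= 1 ->
  (forall z, Num.min x y <= z <= Num.max x y -> `|(u^`()).[z]| <= A) ->
  `|u.[x] - u.[y]| <= A * `|x - y|.
Proof.
wlog xy : x y / x <= y.
  move=> H xD yD hA; have [xy|yx] := leP x y; first exact: H.
  rewrite distrC [`|x - y|]distrC; apply: H => //; first exact: ltW.
  by rewrite minC maxC.
move=> xD yD hA.
have d (z : R) : z \in `]x, y[ -> is_derive z 1 (horner u) (u^`()).[z].
  by move=> _; apply: DeriveDef; [exact: derivable_horner|rewrite -derive1E derivE].
have [|c cxy] := MVT_segment xy d; first by apply: continuous_subspaceT; exact: continuous_horner.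
rewrite distrC => ->; rewrite normrM distrC ler_wpM2r//; apply: hA.
by rewrite min_l// max_r//; rewrite in_itv/= in cxy.
Qed.

(** The interval keeps the distance h/2 to the endpoint, so the weight is bounded
    below on it by a power of h. *)
Lemma measure_jacobi_ge_right a b (x h : R) : -1 < a -> -1 < b -> 0 <= x <= 1 -> 0 < h <= 2^-1 ->
  h / 2 * (2 `^ (- `|b|) * (4 / h) `^ (- `|a|)) <= fine (jacobi_measure a b `[x - h, x - h / 2]).
Proof.
move=> ha hb /andP[x0 x1] /andP[h0 h1].
have mI : measurable (`[x - h, x - h / 2] : set TR) by exact: measurable_itv.
have h20 : 0 < h / 2 by lra.
have M0 : 0 <= 2 `^ (- `|b|) * (4 / h) `^ (- `|a|) by rewrite mulr_ge0// powR_ge0.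
have key y : (`[x - h, x - h / 2]%classic : set TR) y -> -1 <= y <= 1 -> 2 `^ (- `|b|) * (4 / h) `^ (- `|a|) <= jacobi_weight a b y.
  rewrite /= in_itv/= => /andP[y0 y1] _.
  have k1 := @jacobi_weight_ge _ a b y; have /k1{}k1 : - 2^-1 <= y <= 1 by apply/andP; split; lra.
  have k2 : 1 <= (4 / h) `^ `|a| * (1 - y) `^ a.
    have h4 : 8 <= 4 / h by rewrite ler_pdivlMr//; lra.
    have h5 : 1 <= 4 / h * (1 - y) by rewrite mulrAC ler_pdivlMr//; lra.
    by have := @powR_ratio _ a (4 / h) 1 (1 - y); rewrite powR1; apply => //; lra.
  have q1 : 0 < 2 `^ `|b| :> R by rewrite powR_gt0.
  have q2 : 0 < (4 / h) `^ `|a| by rewrite powR_gt0// divr_gt0.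
  rewrite !powRN -invfM -[X in X <= _]mulr1 ler_pdivrMl ?mulr_gt0//.
  rewrite [leRHS](_ : _ = (4 / h) `^ `|a| * (2 `^ `|b| * jacobi_weight a b y)); last by ring.
  by apply: le_trans k2 _; rewrite ler_wpM2l ?(ltW q2).
have := measure_jacobi_ge_cst mI M0 key.
have -> : `[x - h, x - h / 2]%classic `&` `[(-1), 1]%classic = `[x - h, x - h / 2]%classic :> set TR.
  apply/setIidPl => y /=; rewrite !in_itv/= => /andP[? ?]; apply/andP; split; lra.
have hlt : x - h < x - h / 2 by lra.
rewrite lebesgue_measure_itv/= lte_fin hlt.
rewrite -EFinD -EFinM -lee_fin fineK; last first.
  by rewrite ge0_fin_numE ?measure_ge0// measure_jacobi_fin_num.
apply: le_trans; rewrite lee_fin le_eqVlt; by apply/orP; left; apply/eqP; field.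
Qed.

Lemma fine_measure_jacobi_le a b (A B : set TR) : -1 < a -> -1 < b -> measurable A -> measurable B ->
  A `<=` B -> fine (jacobi_measure a b A) <= fine (jacobi_measure a b B).
Proof.
move=> ha hb mA mB AB; apply: fine_le; try (by rewrite ge0_fin_numE ?measure_ge0// measure_jacobi_fin_num).
by apply: le_measure; rewrite ?inE.
Qed.

(** A crude exponent Q: it is enough to bound the eigenfunctions by a power of k. *)
Lemma measure_jacobi_ge a b : -1 < a -> -1 < b -> exists c (Q : nat), 0 < c /\
  forall x h : R, -1 <= x <= 1 -> 0 < h <= 2^-1 ->
   c * h ^+ Q <= fine (jacobi_measure a b (`[x - h, x + h] `&` `[(-1), 1])).
Proof.
move=> ha hb.
have aux (a' b' : R) : -1 < a' -> -1 < b' -> exists c (Q : nat), 0 < c /\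
  forall x h : R, 0 <= x <= 1 -> 0 < h <= 2^-1 ->
   c * h ^+ Q <= fine (jacobi_measure a' b' (`[x - h, x + h] `&` `[(-1), 1])).
  move=> ha' hb'; pose N := (Num.trunc `|a'|).+1.
  have aN : `|a'| <= N%:R by apply: ltW; have /andP[] := truncn_itv (normr_ge0 a').
  exists (2^-1 * 2 `^ (- `|b'|) * (4 ^- N)), N.+1; split.
    by rewrite mulr_gt0 ?mulr_gt0 ?powR_gt0 ?invr_gt0 ?exprn_gt0.
  move=> x h xD hD; have [h0 h1] := andP hD.
  apply: le_trans (_ : _ <= fine (jacobi_measure a' b' `[x - h, x - h / 2])) _; last first.
    apply: fine_measure_jacobi_le => //; first exact: measurableI.
    move=> y /=; rewrite !in_itv/=; case/andP: xD => ? ? /andP[? ?]; split; apply/andP; split; lra.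
  apply: le_trans (measure_jacobi_ge_right ha' hb' xD hD).
  have p1 : (4 / h) `^ (- N%:R) <= (4 / h) `^ (- `|a'|).
    by apply: ler_powR; [rewrite ler_pdivlMr//; lra|rewrite lerN2].
  have p0 : (0 : R) <= 2 `^ (- `|b'|) by rewrite powR_ge0.
  have h20 : 0 <= h / 2 by lra.
  apply: le_trans (ler_wpM2l h20 (ler_wpM2l p0 p1)).
  rewrite powR_invn; last by rewrite divr_ge0// ltW.
  rewrite exprMn exprVn invfM invrK exprS le_eqVlt; apply/orP; left; apply/eqP; ring.
have [c1 [Q1 [c10 H1]]] := aux a b ha hb.
have [c2 [Q2 [c20 H2]]] := aux b a hb ha.
exists (Num.min c1 c2), (maxn Q1 Q2); split; first by rewrite lt_min c10.
move=> x h /andP[x0 x1] hD; have [h0 h1] := andP hD.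
have hh : 0 <= h <= 1 by lra.
have hQ Q c : (Q <= maxn Q1 Q2)%N -> Num.min c1 c2 <= c -> 0 < c -> Num.min c1 c2 * h ^+ maxn Q1 Q2 <= c * h ^+ Q.
  move=> QQ cc c0; apply: ler_pM => //; rewrite ?exprn_ge0//; try lra.
    by rewrite le_min !ltW.
  by apply: ler_wiXn2l => //; lra.
have [xp|xn] := leP 0 x.
  apply: le_trans (H1 x h _ hD); last by rewrite xp.
  by apply: hQ; rewrite ?leq_maxl// ge_min lexx.
apply: le_trans (_ : c2 * h ^+ Q2 <= _).
  by apply: hQ; rewrite ?leq_maxr// ge_min lexx orbT.
apply: le_trans (H2 (- x) h _ hD) _; first by apply/andP; split; lra.
rewrite (@measure_jacobiN _ a b); last exact: measurableI.
rewrite le_eqVlt; apply/orP; left; apply/eqP; congr (fine (jacobi_measure a b _)).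
apply/seteqP; split => y /=; rewrite !in_itv/= => -[/andP[? ?] /andP[? ?]]; split; apply/andP; split; lra.
Qed.

End polynomials.

(** * Orthonormal Jacobi polynomials *)

Section orthonormal_polynomials.
Context {R : realType} (a b : R).
Hypotheses (ha : -1 < a) (hb : -1 < b).
Notation TR := (measurableTypeR R).
Notation mu := (jacobi_measure a b).
Notation DD := (`[(-1)%R, 1%R]%classic : set TR).
Notation L := (jacobi_L a b).
Notation lam := (jacobi_eigenvalue a b).
Implicit Types (p q r : {poly R}).

Definition pint p : R := \int[mu]_(x in DD) p.[x].
Definition pdot p q : R := pint (p * q).

Lemma measurable_DD : measurable DD. Proof. exact: measurable_itv. Qed.

Lemma pint_lin c p q : pint (c *: p + q) = c * pint p + pint q.
Proof.
have mD := measurable_DD.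
have ip := @integrable_horner _ _ _ ha hb p DD mD (@subset_refl _ _).
have iq := @integrable_horner _ _ _ ha hb q DD mD (@subset_refl _ _).
rewrite /pint; under eq_Rintegral do rewrite hornerD hornerZ.
by rewrite RintegralD ?RintegralZl//; exact: integrable_EFinZ.
Qed.

Lemma pdotC p q : pdot p q = pdot q p. Proof. by rewrite /pdot mulrC. Qed.

Lemma pdot_linl c p q r : pdot (c *: p + q) r = c * pdot p r + pdot q r.
Proof. by rewrite /pdot mulrDl -scalerAl pint_lin. Qed.

Lemma pdot0l q : pdot 0 q = 0.
Proof. by have := pdot_linl (-1) 0 0 q; rewrite scaler0 addr0; lra. Qed.

Lemma pdotZl c p q : pdot (c *: p) q = c * pdot p q.
Proof. by have := pdot_linl c p 0 q; rewrite addr0 pdot0l addr0. Qed.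

Lemma pdotDl p q r : pdot (p + q) r = pdot p r + pdot q r.
Proof. by have := pdot_linl 1 p q r; rewrite scale1r mul1r. Qed.

Lemma pdotZr c p q : pdot q (c *: p) = c * pdot q p.
Proof. by rewrite pdotC pdotZl pdotC. Qed.

Lemma pdot_suml n (c : nat -> R) (P : nat -> {poly R}) q :
  pdot (\sum_(0 <= i < n) c i *: P i) q = \sum_(0 <= i < n) c i * pdot (P i) q.
Proof.
elim: n => [|n ih]; first by rewrite !big_geq// pdot0l.
by rewrite !big_nat_recr//= pdotDl pdotZl ih.
Qed.

Lemma Rintegral_setT_D (f : TR -> R) : measurable_fun setT f ->
  \int[mu]_x f x = \int[mu]_(x in DD) f x.
Proof.
move=> mf; rewrite [RHS]Rintegral_mkcond /Rintegral; congr fine.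
apply: ae_eq_integral => //.
- exact/measurable_EFinP.
- apply/measurable_EFinP; apply/(measurable_restrictT _ measurable_DD).
  exact: measurable_funTS.
- apply: (ae_mono _ (ae_jacobi_D a b)) => x xD _; by rewrite patchE mem_set.
Qed.

Lemma L2dot_horner p q : L2dot mu (horner p) (horner q) = pdot p q.
Proof.
rewrite /L2dot Rintegral_setT_D.
  by apply: eq_Rintegral => x _; rewrite hornerM.
by apply: measurable_funM; exact: measurable_horner.
Qed.

Local Notation hp p := ((fun x : TR => (horner p) x) \_ DD).

Lemma L2dot_hp p q : L2dot mu (hp p) (hp q) = pdot p q.
Proof.
rewrite /L2dot Rintegral_setT_D.
  apply: eq_Rintegral => x; rewrite inE/= in_itv/= => xD.
  by rewrite !restrictDE xD hornerM.
by apply: measurable_funM; exact: measurable_hp.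
Qed.

Lemma jacobi_div_mul p q : jacobi_div a b (p^`() * q) = L p * q + (1 - 'X^2) * p^`() * q^`().
Proof. by rewrite /jacobi_L /jacobi_div derivM; ring. Qed.

(** Integration by parts: the divergence of the flux of p' q has integral 0. *)
Lemma pdot_L p q : pdot (L p) q = - pint ((1 - 'X^2) * p^`() * q^`()).
Proof.
have := Rintegral_jacobi_div ha hb (p^`() * q).
rewrite jacobi_div_mul -/(pint _) -[L p * q]scale1r pint_lin mul1r => /eqP.
by rewrite addr_eq0 => /eqP.
Qed.

Lemma pdot_L_sym p q : pdot (L p) q = pdot p (L q).
Proof. by rewrite [RHS]pdotC !pdot_L; congr (- pint _); ring. Qed.

Lemma pdot_L_le0 p : pdot (L p) p <= 0.
Proof.
rewrite pdot_L oppr_le0; apply: Rintegral_ge0 => x /=; rewrite in_itv/= => xD.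
have E (y : R) : ((1 - 'X^2) * p^`() * p^`()).[y] = (1 - y ^+ 2) * (p^`()).[y] ^+ 2.
  by rewrite 2!hornerM hornerD hornerN hornerXn hornerC expr2 mulrA.
rewrite E.
rewrite mulr_ge0 ?sqr_ge0//.
have : 0 <= (1 - x) * (1 + x) by apply: mulr_ge0; lra.
lra.
Qed.

Lemma pdot_ge_interval (x0 h c : R) p : -1 <= x0 <= 1 -> 0 <= c ->
  (forall y, x0 - h <= y <= x0 + h -> -1 <= y <= 1 -> c <= p.[y] ^+ 2) ->
  c * fine (mu (`[x0 - h, x0 + h]%classic `&` `[(-1), 1]%classic)) <= pdot p p.
Proof.
move=> xD c0 H.
have mI : measurable ((`[x0 - h, x0 + h]%classic `&` `[(-1), 1]%classic) : set TR) by exact: measurableI.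
rewrite -Rintegral_cst// /pdot /pint.
have -> : \int[mu]_(x in DD) (p * p).[x] = \int[mu]_(x in DD) (p.[x] ^+ 2).
  by apply: eq_Rintegral => x _; rewrite hornerM expr2.
have mp (A : set TR) : measurable_fun A (fun x : TR => p.[x] ^+ 2) by apply: measurable_funX; exact: measurable_horner.
have [M M0 hM] := horner_bounded p.
have ip : mu.-integrable DD (EFin \o (fun x : TR => p.[x] ^+ 2)).
  apply: (@integrable_jacobi_bounded _ _ _ ha hb _ _ (M ^+ 2)) => //.
  move=> x /=; rewrite in_itv/= => /hM h1.
  by rewrite normrX; apply: lerXn2r => //; rewrite ?nnegrE// ltW.
apply: (@le_trans _ _ (\int[mu]_(x in (`[x0 - h, x0 + h]%classic `&` `[(-1), 1]%classic)) (p.[x] ^+ 2))).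
  apply: le_Rintegral => //.
  - apply: (@integrable_jacobi_bounded _ _ _ ha hb _ _ c) => // x _; by rewrite ger0_norm.
  - by apply: integrableS ip => // x [].
  - by move=> x [/=]; rewrite !in_itv/= => h1 h2; exact: H.
rewrite /Rintegral; apply: fine_le.
- by apply: integrable_fin_num => //; apply: integrableS ip => // x [].
- by apply: integrable_fin_num.
- apply: ge0_subset_integral => //; try exact/measurable_EFinP.
  by move=> x _; rewrite lee_fin sqr_ge0.
Qed.

(** A nonzero polynomial has finitely many roots, and near any other point its
    square is bounded below on a set of positive measure. *)
Lemma pdot_gt0 p : p != 0 -> 0 < pdot p p.
Proof.
move=> p0.
have [x0 x0D px0] : exists2 x0 : R, -1 <= x0 <= 1 & p.[x0] != 0.
  apply/not_exists2P => H.
  pose s := mkseq (fun i => (i.+1%:R^-1 : R)) (size p).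
  have := @max_poly_roots _ p s p0.
  have -> : all (root p) s.
    apply/allP => _ /mapP[i _ ->]; rewrite rootE.
    have v0 : 0 <= (i.+1%:R^-1 : R) by rewrite invr_ge0.
    have v1 : (i.+1%:R^-1 : R) <= 1 by rewrite invf_le1// ler1n.
    have vD : -1 <= (i.+1%:R^-1 : R) <= 1 by rewrite v1 (le_trans _ v0)// lerN10.
    by have [/(_ vD)//|/negP] := H (i.+1%:R^-1); rewrite negbK.
  have -> : uniq s.
    by apply/mkseq_uniqP => i j _ _ /invr_inj /eqP; rewrite eqr_nat => /eqP[].
  by rewrite size_mkseq ltnn => /(_ isT isT).
have [c [Q [c0 H]]] := measure_jacobi_ge ha hb.
pose A := `|p.[x0]| / 2.
have A0 : 0 < A by rewrite divr_gt0// normr_gt0.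
have := @continuous_horner R p x0 => /cvgrPdist_lt /(_ _ A0)[d /= d0 hd].
pose h := Num.min (d / 2) 2^-1.
have h0 : 0 < h by rewrite lt_min; apply/andP; split; lra.
have [h1 h2] : h <= d / 2 /\ h <= 2^-1 by split; rewrite ge_min lexx ?orbT.
have hh : 0 < h <= 2^-1 by rewrite h0.
have cm := H x0 h x0D hh.
apply: lt_le_trans (_ : A ^+ 2 * (c * h ^+ Q) <= _).
  by apply: mulr_gt0; [exact: exprn_gt0|apply: mulr_gt0 => //; exact: exprn_gt0].
apply: le_trans (ler_wpM2l (sqr_ge0 A) cm) _.
apply: pdot_ge_interval => //; first exact: sqr_ge0.
move=> y /andP[y0 y1] _; rewrite -(real_normK (num_real p.[y])).
apply: lerXn2r; rewrite ?nnegrE ?(ltW A0)//.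
have : `|p.[x0] - p.[y]| < A.
  by apply: hd; rewrite /= ltr_norml; apply/andP; split; lra.
have := ler_normB p.[x0] (p.[x0] - p.[y]); rewrite subKr.
have : `|p.[x0]| <= `|p.[y]| + `|p.[x0] - p.[y]|.
  by have := ler_normD p.[y] (p.[x0] - p.[y]); rewrite addrC subrK.
rewrite /A; lra.
Qed.

Definition gs_step (s : seq {poly R}) : {poly R} :=
  let q := 'X^(size s) - \sum_(r <- s) pdot 'X^(size s) r *: r in (Num.sqrt (pdot q q))^-1 *: q.

Fixpoint gs_seq (n : nat) : seq {poly R} :=
  if n is m.+1 then rcons (gs_seq m) (gs_step (gs_seq m)) else [::].

Definition gs k := gs_step (gs_seq k).

Lemma gs_seqE n : gs_seq n = mkseq gs n.
Proof. by elim: n => // n ih; rewrite /= {1}ih /mkseq -addn1 iotaD map_cat cats1. Qed.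

Lemma gsE n : let q := 'X^n - \sum_(0 <= i < n) pdot 'X^n (gs i) *: gs i in
  gs n = (Num.sqrt (pdot q q))^-1 *: q.
Proof.
have sz : size (gs_seq n) = n by rewrite gs_seqE size_mkseq.
move=> q; have -> : gs n = gs_step (gs_seq n) by [].
by rewrite /gs_step sz gs_seqE /mkseq big_map /q /index_iota subn0.
Qed.

Lemma gs_spec n : (forall k, (k < n)%N -> size (gs k) = k.+1) /\
  (forall i j, (i < n)%N -> (j < n)%N -> pdot (gs i) (gs j) = (i == j)%:R).
Proof.
elim: n => [|n [ih1 ih2]]; first by split.
pose q := 'X^n - \sum_(0 <= i < n) pdot 'X^n (gs i) *: gs i.
have qs : size q = n.+1.
  rewrite /q size_polyDl ?size_polyN size_polyXn// ltnS.
  apply: leq_trans (size_sum _ _ _) _.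
  apply/bigmax_leqP_seq => i; rewrite mem_index_iota => /andP[_ iln] _; apply: leq_trans (size_scale_leq _ _) _; by rewrite ih1.
have q0 : q != 0 by rewrite -size_poly_gt0 qs.
have qq := pdot_gt0 q0.
have s0 : 0 < Num.sqrt (pdot q q) by rewrite sqrtr_gt0.
have qj j : (j < n)%N -> pdot q (gs j) = 0.
  move=> jn; rewrite /q pdotDl -scaleN1r pdotZl pdot_suml.
  have -> : \sum_(0 <= i < n) pdot 'X^n (gs i) * pdot (gs i) (gs j) = pdot 'X^n (gs j).
    rewrite big_nat.
    under eq_bigr => i hi do rewrite ih2//.
    rewrite -big_nat (bigD1_seq j)/= ?mem_index_iota ?iota_uniq//= eqxx mulr1 big1 ?addr0// => i ij.
    by rewrite (negbTE ij) mulr0.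
  ring.
have gq : gs n = (Num.sqrt (pdot q q))^-1 *: q by exact: gsE.
have gj j : (j < n)%N -> pdot (gs n) (gs j) = 0 by move=> jn; rewrite gq pdotZl qj// mulr0.
split.
  move=> k; rewrite ltnS leq_eqVlt => /orP[/eqP ->|]; last exact: ih1.
  by rewrite gq size_scale ?invr_eq0 ?gt_eqF.
move=> i j; rewrite !ltnS (leq_eqVlt i) (leq_eqVlt j) => /orP[/eqP ->|hi] /orP[/eqP ->|hj].
- rewrite eqxx gq pdotZl pdotZr -[X in _ * (_ * X)](sqr_sqrtr (ltW qq)) expr2 mulKf; first by rewrite mulVf// gt_eqF.
  by rewrite gt_eqF.
- by rewrite gj// gtn_eqF.
- by rewrite pdotC gj// ltn_eqF.
- exact: ih2.
Qed.

Lemma jacobi_polynomials_exist : jacobi_polynomials a b gs.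
Proof.
split; first by move=> k; have [h _] := gs_spec k.+1; exact: h.
move=> i j; rewrite L2dot_horner; have [_ h] := gs_spec (maxn i j).+1.
by apply: h; rewrite ltnS ?leq_maxl ?leq_maxr.
Qed.

Lemma lam0 : lam 0 = 0. Proof. by rewrite /jacobi_eigenvalue mul0r. Qed.

Lemma lam_ge0 k : 0 <= lam k.
Proof.
rewrite /jacobi_eigenvalue; case: k => [|k]; first by rewrite mul0r.
have k0 : (0 : R) <= k%:R by [].
have ha' := ha; have hb' := hb; rewrite mulr_ge0// -natr1; lra.
Qed.

Lemma lamB j k : lam j - lam k = (j%:R - k%:R) * (j%:R + k%:R + a + b + 1).
Proof. rewrite /jacobi_eigenvalue; ring. Qed.

Lemma lam_inj : injective lam.
Proof.
move=> j k /eqP; rewrite -subr_eq0 lamB mulf_eq0 => /orP[|].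
  by rewrite subr_eq0 eqr_nat => /eqP.
have := ha; have := hb.
case: j => [|j]; case: k => [|k]// hb' ha' /eqP; rewrite -?natr1;
  try (have j0 : (0 : R) <= j%:R by []).
- have k0 : (0 : R) <= k%:R by []. move=> h; exfalso; lra.
- move=> h; exfalso; lra.
- have k0 : (0 : R) <= k%:R by []. move=> h; exfalso; lra.
Qed.

Definition lam_cst : R := Num.min 2^-1 ((a + b + 2) / 2).

Lemma lam_cst_gt0 : 0 < lam_cst. Proof. by have := ha; have := hb; rewrite lt_min => *; apply/andP; split; lra. Qed.

(** At least linear growth makes the kernel converge; the minimum in the constant
    covers k = 0 and exponents with a+b+1 < 0. *)
Lemma lam_ge k : lam_cst * k.+1%:R <= lam k + 1.
Proof.
have [c1 c2] : lam_cst <= 2^-1 /\ lam_cst <= (a + b + 2) / 2 by split; rewrite ge_min lexx ?orbT.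
have c0 := lam_cst_gt0.
rewrite /jacobi_eigenvalue; case: k => [|k]; first by rewrite mul0r add0r; lra.
have k0 : (0 : R) <= k%:R by [].
have := ha; have := hb; rewrite -(natr1 k.+1) -(natr1 k) => hb' ha'.
have h1 : lam_cst * (k%:R + 1 + 1) <= 2 * lam_cst * (k%:R + 1).
  by rewrite -subr_ge0 (_ : _ - _ = lam_cst * k%:R); [rewrite mulr_ge0// ltW|ring].
have h2 : (k%:R + 1) * (2 * lam_cst) <= (k%:R + 1) * (k%:R + 1 + a + b + 1).
  by rewrite ler_wpM2l//; lra.
lra.
Qed.

Lemma lam_le k : lam k <= (`|a + b + 1| + 1) * k.+1%:R ^+ 2.
Proof.
have k0 : (0 : R) <= k%:R by [].
have n0 := ler_norm (a + b + 1).
have n1 : 0 <= `|a + b + 1| by [].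
rewrite /jacobi_eigenvalue -natr1.
move: (`|a + b + 1|) n0 n1 => C n0 n1.
have h : k%:R * (k%:R + a + b + 1) <= k%:R * (k%:R + C) by rewrite ler_wpM2l//; lra.
apply: le_trans h _; rewrite -subr_ge0.
have -> : (C + 1) * (k%:R + 1) ^+ 2 - k%:R * (k%:R + C) = C * k%:R ^+ 2 + C * k%:R + C + (2 * k%:R + 1) by ring.
by rewrite !addr_ge0 ?mulr_ge0 ?exprn_ge0//; lra.
Qed.

Section fixed_system.
Variable P : nat -> {poly R}.
Hypothesis HP : jacobi_polynomials a b P.

Lemma size_P k : size (P k) = k.+1. Proof. by case: HP. Qed.

Lemma pdot_P i j : pdot (P i) (P j) = (i == j)%:R.
Proof. by rewrite -L2dot_horner; case: HP. Qed.

Lemma lead_P k : (P k)`_k != 0.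
Proof. by rewrite -[X in _`_X]/(k.+1.-1) -(size_P k) -/(lead_coef _) lead_coef_eq0 -size_poly_gt0 size_P. Qed.

Lemma poly_span n p : (size p <= n)%N -> exists c : nat -> R, p = \sum_(0 <= i < n) c i *: P i.
Proof.
elim: n p => [|n ih] p pn.
  by exists (fun=> 0); rewrite big_geq//; apply/eqP; rewrite -size_poly_leq0.
pose c := p`_n / (P n)`_n.
have : (size (p - c *: P n)%R <= n)%N.
  apply/leq_sizeP => j nj; rewrite coefB coefZ.
  move: nj; rewrite leq_eqVlt => /orP[/eqP <-|nj].
    by rewrite /c divfK ?subrr// lead_P.
  by rewrite !nth_default ?mulr0 ?subrr// ?size_P// (leq_trans pn).
move=> /ih [d hd]; exists (fun i => if (i < n)%N then d i else c).
rewrite big_nat_recr//= ltnn.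
rewrite -(subrK (c *: P n) p) hd; congr (_ + _).
by apply: eq_big_nat => i /andP[_ ->].
Qed.

Lemma poly_expand n p : (size p <= n)%N -> p = \sum_(0 <= i < n) pdot p (P i) *: P i.
Proof.
move=> /poly_span [c hc]; rewrite {1}hc.
apply: eq_big_nat => j /andP[_ jn]; congr (_ *: _).
rewrite hc pdot_suml; under eq_bigr do rewrite pdot_P.
rewrite (bigD1_seq j)/= ?mem_index_iota ?iota_uniq//= eqxx mulr1 big1 ?addr0// => i ij.
by rewrite (negbTE ij) mulr0.
Qed.

Lemma pdot_P_small k p : (size p <= k)%N -> pdot p (P k) = 0.
Proof.
move=> /poly_span [c ->]; rewrite pdot_suml big_nat big1// => i /andP[_ ik].
by rewrite pdot_P ltn_eqF// mulr0.
Qed.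

(** The polynomial L P_k has degree at most k and, by symmetry of L, is orthogonal
    to P_j for j < k; the leading coefficient gives the eigenvalue. *)
Lemma L_P k : L (P k) = - lam k *: P k.
Proof.
have sL : (size (L (P k)) <= k.+1)%N by apply: size_jacobi_L; rewrite size_P.
have E : L (P k) = pdot (L (P k)) (P k) *: P k.
  rewrite {1}(poly_expand sL) big_nat_recr//= big_nat big1 ?add0r// => j /andP[_ jk].
  rewrite pdot_L_sym pdotC pdot_P_small ?scale0r//.
  by apply: leq_trans (_ : j.+1 <= k)%N => //; apply: size_jacobi_L; rewrite size_P.
have := coef_jacobi_L a b (size_P k).
rewrite E coefZ => /mulIf -> //; exact: lead_P.
Qed.

(** If M is the maximum of |P_k|, attained at x0, the gradient bound gives
    |P_k'| <= C lambda_k M, so |P_k| >= M/2 at distance less than c/(k+1)^2 from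
    x0.  As P_k has norm 1 and the measure of such an interval is at least a power
    of its length, M is at most a power of k+1. *)
Lemma P_sup_bound : exists C (q : nat), 1 <= C /\
  forall k x, -1 <= x <= 1 -> `|(P k).[x]| <= C * k.+1%:R ^+ q.
Proof.
have [c [Q [c0 H]]] := measure_jacobi_ge ha hb.
pose G := grad_cst2 a b.
have G0 : 0 < G by rewrite /G /grad_cst2 addr_gt0// grad_cst_gt0.
pose N := `|a + b + 1| + 1.
have N1 : 1 <= N by rewrite /N lerDr.
pose D := 2 * (G + 1) * N.
have D2 : 2 <= D.
  have : 0 <= G * N by rewrite mulr_ge0 ?(ltW G0)//; lra.
  rewrite /D; lra.
pose C := 4 * D ^+ Q / c.
have C0 : 0 <= C by rewrite divr_ge0 ?(ltW c0)// mulr_ge0// exprn_ge0//; lra.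
exists (C + 1), (2 * Q)%N; split; first by lra.
move=> k x xD.
have k1 : 1 <= k.+1%:R :> R by rewrite ler1n.
have cP : {within `[(-1)%R, 1%R], continuous (fun x : R => `|(P k).[x]|)}.
  apply: continuous_subspaceT => y.
  apply: (@continuous_comp _ _ _ (fun y => (P k).[y]) (fun y => `|y|)); first exact: continuous_horner.
  exact: norm_continuous.
have [|x0 x0D hx0] := @EVT_max R _ _ _ _ cP; first lra.
rewrite in_itv/= in x0D.
pose M : R := `|(P k).[x0]|; rewrite -/M in hx0.
have hM y : -1 <= y <= 1 -> `|(P k).[y]| <= M by move=> yD; apply: hx0; rewrite in_itv.
apply: le_trans (hM x xD) _.
have M0 : 0 <= M by rewrite normr_ge0.
have hL y : -1 <= y <= 1 -> `|(L (P k)).[y]| <= lam k * M.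
  move=> yD; rewrite L_P hornerZ normrM normrN (ger0_norm (lam_ge0 k)) ler_wpM2l ?lam_ge0//.
  exact: hM.
have hd := le_deriv_global ha hb hL.
(* The length on which |P k| cannot drop from M to less than M/2. *)
pose h := (D * k.+1%:R ^+ 2)^-1.
have kk : 1 <= k.+1%:R ^+ 2 :> R by rewrite exprn_ege1.
have Dk : 2 <= D * k.+1%:R ^+ 2.
  by apply: (le_trans D2); rewrite ler_peMr//; lra.
have h0 : 0 < h by rewrite invr_gt0; lra.
have h2 : h <= 2^-1 by rewrite lef_pV2 ?posrE//; lra.
have hh : 0 < h <= 2^-1 by rewrite h0.
have Gh : G * (lam k * M) * h <= M / 2.
  have g1 : G * lam k * 2 <= D * k.+1%:R ^+ 2.
    have l := lam_le k; rewrite -/N in l.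
    apply: le_trans (_ : G * (N * k.+1%:R ^+ 2) * 2 <= _).
      by rewrite ler_wpM2r// ler_wpM2l// ltW.
    have : 0 <= N * k.+1%:R ^+ 2 by rewrite mulr_ge0//; lra.
    rewrite /D; lra.
  rewrite /h ler_pdivrMr; last lra.
  rewrite [leRHS]mulrAC ler_pdivlMr//.
  rewrite (_ : G * (lam k * M) * 2 = M * (G * lam k * 2)); last ring.
  by rewrite ler_wpM2l.
have low y : x0 - h <= y <= x0 + h -> -1 <= y <= 1 -> (M / 2) ^+ 2 <= (P k).[y] ^+ 2.
  move=> yh yD; rewrite -[leRHS]real_normK ?num_real//.
  apply: lerXn2r; rewrite ?nnegrE ?divr_ge0//.
  have : `|(P k).[x0] - (P k).[y]| <= G * (lam k * M) * `|x0 - y|.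
    apply: horner_MVT => // z /andP[z1 z2]; apply: hd.
    move: z1 z2 x0D yD; rewrite ge_min le_max => /orP z1 /orP z2 /andP[u1 u2] /andP[v1 v2].
    apply/andP; split; [case: z1 => z3|case: z2 => z3].
    - exact: le_trans z3.
    - exact: le_trans z3.
    - exact: le_trans z3 _.
    - exact: le_trans z3 _.
  have GM : 0 <= G * (lam k * M) by rewrite mulr_ge0 ?(ltW G0)// mulr_ge0 ?lam_ge0.
  have : G * (lam k * M) * `|x0 - y| <= G * (lam k * M) * h.
    rewrite ler_wpM2l// ler_norml; case/andP: yh => ? ?; apply/andP; split; lra.
  have : M <= `|(P k).[y]| + `|(P k).[x0] - (P k).[y]|.
    by have := ler_normD (P k).[y] ((P k).[x0] - (P k).[y]); rewrite addrC subrK.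
  lra.
have cm := H x0 h x0D hh.
have := pdot_ge_interval x0D (sqr_ge0 (M / 2)) low.
rewrite pdot_P eqxx => h3.
have h4 : (M / 2) ^+ 2 * (c * h ^+ Q) <= 1 by apply: le_trans (ler_wpM2l (sqr_ge0 _) cm) h3.
have h5 : M ^+ 2 <= C * k.+1%:R ^+ (2 * Q).
  move: h4; rewrite /h exprVn mulrA ler_pdivrMr ?exprn_gt0//; last lra.
  rewrite mul1r (exprMn Q) -exprM => h4.
  rewrite /C (mulrAC _ c^-1) ler_pdivlMr//.
  rewrite expr_div_n in h4; move: h4.
  rewrite (_ : 2 ^+ 2 = 4); last by ring.
  rewrite mulrAC ler_pdivrMr// => h4.
  by rewrite (le_trans h4)// le_eqVlt; apply/orP; left; apply/eqP; ring.
have : M <= M ^+ 2 + 1.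
  have : 0 <= (M - 2^-1) ^+ 2 by rewrite sqr_ge0.
  rewrite sqrrB; lra.
have : 1 <= k.+1%:R ^+ (2 * Q) :> R by rewrite exprn_ege1.
rewrite mulrDl mul1r; lra.
Qed.

End fixed_system.

End orthonormal_polynomials.

(** * The Jacobi semigroup and its kernel *)

Section series_bounds.
Context {R : realType}.

Lemma le_sum_inv_sqr n : \sum_(0 <= k < n.+1) ((k.+1%:R : R) ^+ 2)^-1 <= 2 - (n.+1%:R)^-1.
Proof.
elim: n => [|n ih]; first by rewrite big_nat1 expr1n invr1; lra.
rewrite big_nat_recr//=; apply: le_trans (lerD ih (lexx _)) _.
have n0 : (0 : R) < n.+1%:R by rewrite ltr0n.
have m0 : (0 : R) < n.+2%:R by rewrite ltr0n.
rewrite -subr_ge0 (_ : _ - _ = (n.+1%:R * n.+2%:R ^+ 2)^-1); last first.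
  rewrite -(natr1 n.+1) in m0 *; field; rewrite !gt_eqF//.
by rewrite invr_ge0 mulr_ge0// ?sqr_ge0// ltW.
Qed.

Lemma series_inv_sqr (u : nat -> R) (M : R) : 0 <= M ->
  (forall k, 0 <= u k <= M * (k.+1%:R ^+ 2)^-1) ->
  cvgn (series u) /\ limn (series u) <= 2 * M.
Proof.
move=> M0 H.
have le n : series u n <= 2 * M.
  rewrite seriesEnat/=; apply: le_trans (_ : \sum_(0 <= k < n.+1) u k <= _).
    by rewrite big_nat_recr//= lerDl; have /andP[] := H n.
  apply: le_trans (_ : \sum_(0 <= k < n.+1) M * (k.+1%:R ^+ 2)^-1 <= _).
    by apply: ler_sum => k _; have /andP[] := H k.
  rewrite -mulr_sumr mulrC ler_wpM2r//.
  by apply: (le_trans (le_sum_inv_sqr n)); rewrite gerBl invr_ge0.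
have cv : cvgn (series u).
  apply: nondecreasing_is_cvgn.
    apply/nondecreasing_seqP => m; rewrite !seriesEnat/= big_nat_recr//= lerDl.
    by have /andP[] := H m.
  by exists (2 * M) => _ [n _ <-].
by split => //; apply: limr_le => //; exact: nearW.
Qed.

Lemma expRN_le_pow (s : R) (n : nat) : 0 < s -> expR (- s) <= (n.+1)`!%:R / s ^+ n.+1.
Proof.
move=> s0; rewrite expRN -[leRHS]invf_div lef_pV2 ?posrE ?expR_gt0//; last first.
  by rewrite divr_gt0 ?exprn_gt0// ltr0n fact_gt0.
by have := expR_ge1Dxn n (ltW s0); lra.
Qed.

End series_bounds.

Section jacobi_heat.
Context {R : realType} (a b : R).
Hypotheses (ha : -1 < a) (hb : -1 < b).
Notation TR := (measurableTypeR R).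
Notation mu := (jacobi_measure a b).
Notation DD := (`[(-1)%R, 1%R]%classic : set TR).
Notation L := (jacobi_L a b).
Notation lam := (jacobi_eigenvalue a b).
Variable P : nat -> {poly R}.
Hypothesis HP : jacobi_polynomials a b P.
Variables (C : R) (q : nat).
Hypothesis C1 : 1 <= C.
Hypothesis PB : forall k (x : R), -1 <= x <= 1 -> `|(P k).[x]| <= C * k.+1%:R ^+ q.
Local Notation hp p := ((fun x : TR => (horner p) x) \_ DD).
Local Notation e := (fun k => hp (P k)).
Local Notation hk := (heat_kernel (e : nat -> TR -> R) lam).
Local Notation K := (jacobi_heat_kernel a b P).

Definition sup_bound k : R := C * k.+1%:R ^+ q.
Local Notation B := sup_bound.

Lemma measurable_e k : measurable_fun setT (e k). Proof. exact: measurable_hp. Qed.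

Lemma le_e k x : `|e k x| <= B k.
Proof.
rewrite /= restrictDE; case: ifPn => xD; first exact: PB.
by rewrite normr0 mulr_ge0 ?exprn_ge0// (le_trans ler01).
Qed.

Lemma sup_bound_ge1 k : 1 <= B k.
Proof. by rewrite /sup_bound mulr_ege1// exprn_ege1// ler1n. Qed.

Lemma dot_e i j : L2dot mu (e i) (e j) = (i == j)%:R.
Proof. by rewrite L2dot_hp pdot_P. Qed.

Lemma hp_sum n (c : nat -> R) : hp (\sum_(0 <= k < n) c k *: P k) =
  (fun x => \sum_(0 <= k < n) c k * e k x).
Proof.
apply/funext => x; rewrite restrictDE; case: ifPn => xD.
  rewrite horner_sum; apply: eq_bigr => k _.
  by rewrite hornerZ restrictDE xD.
by rewrite big1// => k _; rewrite restrictDE (negbTE xD) mulr0.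
Qed.

Lemma dense_e f : L2 mu f -> forall eps : R, 0 < eps ->
  exists n (c : nat -> R), L2nrm mu (fun x => f x - \sum_(0 <= k < n) c k * e k x) < eps.
Proof.
move=> hf eps e0; have [_ /(_ eps e0)[p hpp]] := poly_dense ha hb hf.
have E := poly_expand ha hb HP (leqnn (size p)).
exists (size p), (fun k => pdot a b p (P k)); rewrite (_ : (fun x => f x - _) = (fun x => f x - (hp p) x))//.
apply/funext => x; congr (_ - _).
by rewrite -[LHS](congr1 (fun g : TR -> R => g x) (hp_sum (size p) (fun k => pdot a b p (P k)))) -E.
Qed.

(** Any power of k is beaten by exp(- lambda_k t), at the price of a power of 1/t. *)
Lemma heat_weight_le n (t : R) k : 0 < t <= 1 ->
  expR (- lam k * t) <= expR 1 * (n.+1)`!%:R / (lam_cst a b ^+ n.+1) * (t ^+ n.+1)^-1 * (k.+1%:R ^+ n.+1)^-1.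
Proof.
move=> /andP[t0 t1].
have l0 := lam_cst_gt0 ha hb.
have k0 : (0 : R) < k.+1%:R by rewrite ltr0n.
pose s := (lam k + 1) * t; pose s' := lam_cst a b * k.+1%:R * t.
have s'0 : 0 < s' by rewrite !mulr_gt0.
have ss : s' <= s by rewrite ler_wpM2r ?(ltW t0)// lam_ge.
have -> : - lam k * t = t + - s by rewrite /s; ring.
rewrite expRD; apply: (@le_trans _ _ (expR 1 * ((n.+1)`!%:R / s' ^+ n.+1))).
  apply: ler_pM; rewrite ?expR_ge0 ?ler_expR//.
  by apply: (le_trans _ (expRN_le_pow n s'0)); rewrite ler_expR lerN2.
rewrite le_eqVlt; apply/orP; left; apply/eqP.
by rewrite /s' !exprMn !invfM !mulrA; ring.
Qed.

(** Two more powers of k than B k ^ 2 contains leave the summable sequence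
    1/(k+1)^2. *)
Lemma sum_heat_bound : exists A (Q : nat), 0 <= A /\ forall t : R, 0 < t <= 1 ->
  cvgn (series (fun k => expR (- lam k * t) * B k ^+ 2)) /\
  limn (series (fun k => expR (- lam k * t) * B k ^+ 2)) <= A * (t ^+ Q)^-1.
Proof.
(* The power n+1 = 2q+2 compensates (k+1)^(2q) and leaves 1/(k+1)^2. *)
pose n := (2 * q).+1.
pose A1 := expR 1 * (n.+1)`!%:R / (lam_cst a b ^+ n.+1) * C ^+ 2.
have l0 := lam_cst_gt0 ha hb.
have l0' := ltW l0; have A10 : 0 <= A1.
  by apply: mulr_ge0; [apply: mulr_ge0; [apply: mulr_ge0; [exact: expR_ge0|exact: ler0n]|rewrite invr_ge0 exprn_ge0]|exact: sqr_ge0].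
exists (2 * A1), n.+1; split; first by rewrite mulr_ge0.
move=> t tD; have /andP[t0 t1] := tD.
have T0 : 0 <= A1 * (t ^+ n.+1)^-1 by rewrite mulr_ge0// invr_ge0 exprn_ge0// ltW.
rewrite -mulrA; apply: series_inv_sqr => // k.
rewrite mulr_ge0 ?expR_ge0 ?sqr_ge0//=.
have k0 : (k.+1%:R : R) != 0 by rewrite pnatr_eq0.
have h := ler_wpM2r (sqr_ge0 (B k)) (heat_weight_le n k tD).
apply: le_trans h _; rewrite le_eqVlt; apply/orP; left; apply/eqP.
rewrite /A1 /sup_bound /n (_ : (2 * q).+2 = (q * 2 + 2)%N); last by rewrite mulnC addn2.
rewrite (exprD (k.+1%:R)) exprM exprMn; field.
rewrite !expf_neq0 ?gt_eqF//; exact: expf_neq0.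
Qed.

Lemma sumB_cvg (t : R) : 0 < t -> cvgn (series (fun k => expR (- lam k * t) * B k ^+ 2)).
Proof.
move=> t0; have [A [Q [_ H]]] := sum_heat_bound.
have m0 : 0 < Num.min t 1 <= 1 by rewrite lt_min t0 ltr01 ge_min lexx orbT.
have [cv _] := H _ m0.
have Bk k := sqr_ge0 (B k); apply: (series_le_cvg _ _ _ cv) => k /=; try by rewrite mulr_ge0 ?expR_ge0.
rewrite ler_wpM2r ?sqr_ge0// ler_expR !mulNr lerN2 ler_wpM2l ?lam_ge0//.
by rewrite ge_min lexx.
Qed.

Let mufin := measure_jacobi_fin ha hb.

(** The endpoints are negligible. *)
Lemma ae_eq_open (f g : TR -> R) : (forall x : R, -1 < x < 1 -> f x = g x) -> f = g %[ae mu].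
Proof.
move=> fg; exists ([set (-1 : R)] `|` [set (1 : R)] `|` ~` DD); split.
- by apply: measurableU; [apply: measurableU; exact: measurable_set1|exact: measurableC].
- have m1 : measurable ([set (-1 : R)] `|` [set (1 : R)] : set TR).
    by apply: measurableU; exact: measurable_set1.
  apply: null_set_setU => //; [exact: measurableC| |exact: measure_jacobi_onD].
  have l1 : @lebesgue_measure R ([set (-1 : R)] `|` [set (1 : R)]) = 0%E.
    by apply: (@null_set_setU _ _ _ (@lebesgue_measure R)); [exact: measurable_set1|exact: measurable_set1|exact: lebesgue_measure_set1|exact: lebesgue_measure_set1].
  apply: (@null_set_integral _ _ _ (@lebesgue_measure R)).
  + exact: measurableI.
  + apply/measurable_funTS/measurable_EFinP; exact: measurable_jacobi_weight.
  + apply/eqP; rewrite -measure_le0 -l1.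
    by apply: le_measure; rewrite ?inE//; exact: measurableI.
- move=> x /= h; apply: contrapT => /not_orP[/not_orP[x1 x2]] /contrapT.
  rewrite in_itv/= => /andP[x3 x4]; apply: h => _; apply: fg.
  rewrite !lt_neqAle x3 x4 !andbT; apply/andP; split; apply/eqP => //.
  by move=> h; apply: x1.
Qed.

Lemma jacobi_opE (p : {poly R}) (x : R) : -1 < x < 1 -> jacobi_op a b (hp p) x = (L p).[x].
Proof.
move=> xD; have [x0 x1] := andP xD.
rewrite /jacobi_op patchE mem_set; last by rewrite /= in_itv.
have w0 : 0 < jacobi_weight a b x by rewrite mulr_gt0// powR_gt0; lra.
have near_D : \forall y \near x, -1 < y < 1.
  have : x \in `]-1, 1[ by rewrite in_itv.
  by move/near_in_itvoo; apply: filterS => y; rewrite in_itv.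
have E : derive1 (fun y => jacobi_weight a b y * (1 - y ^+ 2) * derive1 (hp p) y) x =
    jacobi_weight a b x * (L p).[x].
  have h := is_derive_jacobi_wplus ha hb p^`() xD.
  rewrite derive1E -[RHS](@derive_val _ _ _ _ _ _ _ h).
  apply: near_eq_derive; near=> y.
  have yD : -1 < y < 1 by near: y.
  have [y0 y1] := andP yD.
  rewrite jacobi_wplusE//; last by rewrite !ltW.
  congr (_ * _); rewrite derivE !derive1E; apply: near_eq_derive.
  have : y \in `]-1, 1[ by rewrite in_itv.
  move/near_in_itvoo; apply: filterS => z; rewrite in_itv/= => /andP[z0 z1].
  by rewrite restrictDE !ltW.
by rewrite E mulrAC mulfV ?mul1r// gt_eqF.
Unshelve. all: by end_near. Qed.

Lemma jacobi_op_ae (p : {poly R}) : jacobi_op a b (hp p) = hp (L p) %[ae mu].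
Proof.
apply: ae_eq_open => x xD; rewrite jacobi_opE// restrictDE.
by have /andP[x0 x1] := xD; rewrite !ltW.
Qed.

Lemma L2_jacobi_op (p : {poly R}) : L2 mu (jacobi_op a b (hp p)).
Proof.
have -> : jacobi_op a b (hp p) = (fun x : TR => (L p).[x]) \_ (`]-1, 1[ : set TR).
  apply/funext => x; rewrite [RHS]patchE; case: ifPn => xD.
    by rewrite jacobi_opE//; move: xD; rewrite inE/= in_itv.
  by rewrite /jacobi_op patchE (negbTE xD).
have [M M0 hM] := horner_bounded (L p).
apply: (@jacobi_bounded_L2 _ _ _ ha hb _ M).
  by apply/(measurable_restrictT _ _).1 => //; exact: measurable_horner.
move=> x; rewrite patchE; case: ifPn => xD; last by rewrite normr0 ltW.
by apply: hM; move: xD; rewrite inE/= in_itv/= => /andP[? ?]; rewrite !ltW.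
Qed.

Lemma jacobi_graph_L2 : jacobi_graph a b `<=` L2 mu `*` L2 mu.
Proof. by move=> _ [_ [p ->] <-]; split => /=; [exact: L2_hp|exact: L2_jacobi_op]. Qed.

Lemma jacobi_graph_hat fg : jacobi_graph a b fg ->
  forall k, hat mu e fg.2 k = - lam k * hat mu e fg.1 k.
Proof.
move=> [_ [p ->] <-] k; rewrite /hat/=.
rewrite (L2dot_ae _ _ _ (jacobi_op_ae p)); [|exact: L2_jacobi_op|exact: L2_hp|exact: L2_hp].
rewrite !L2dot_hp (pdot_L_sym ha hb) (L_P ha hb HP).
by rewrite pdotC (pdotZl ha hb) pdotC.
Qed.

Lemma L_sum n (c : nat -> R) :
  L (\sum_(0 <= k < n) c k *: P k) = \sum_(0 <= k < n) (- lam k * c k) *: P k.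
Proof.
elim: n => [|n ih].
  by rewrite !big_geq// /jacobi_L deriv0 /jacobi_div deriv0 !mulr0 addr0.
rewrite !big_nat_recr//= addrC jacobi_L_lin ih addrC; congr (_ + _).
by rewrite (L_P ha hb HP) scalerA mulrC.
Qed.

Lemma jacobi_graph_sum n (c : nat -> R) : exists2 fg, jacobi_graph a b fg &
  fg.1 = (fun x => \sum_(0 <= i < n) c i * e i x) %[ae mu] /\
  fg.2 = (fun x => \sum_(0 <= i < n) (- lam i * c i) * e i x) %[ae mu].
Proof.
set p := \sum_(0 <= k < n) c k *: P k.
exists (hp p, jacobi_op a b (hp p)); first by exists (hp p) => //; exists p.
split => /=; first by rewrite hp_sum; exact: aeW.
by apply: (ae_mono _ (jacobi_op_ae p)) => x /= h xT; rewrite h// L_sum hp_sum.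
Qed.

Lemma jacobi_essentially_self_adjoint : essentially_self_adjoint mu (jacobi_graph a b).
Proof.
exact: (essentially_self_adjoint_sums mufin measurable_e le_e dot_e dense_e jacobi_graph_L2
  jacobi_graph_hat jacobi_graph_sum).
Qed.

Lemma jacobi_closureE : op_closure mu (jacobi_graph a b) = heat_generator mu e lam.
Proof.
exact: (op_closureE mufin measurable_e le_e dot_e dense_e jacobi_graph_L2
  jacobi_graph_hat jacobi_graph_sum).
Qed.

Lemma jacobi_semigroup_exists : exists T, generates mu (op_closure mu (jacobi_graph a b)) T.
Proof.
have l0 := lam_ge0 ha hb.
exists (heat mu e lam); split; first exact: (c0_heat mufin measurable_e le_e sup_bound_ge1 dot_e dense_e l0 sumB_cvg).
rewrite jacobi_closureE.
exact: (generator_heat mufin measurable_e le_e sup_bound_ge1 dot_e dense_e l0 sumB_cvg).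
Qed.

(** Integration by parts gives the integral of (1-x^2) (p')^2. *)
Lemma jacobi_op_negative f : jacobi_dom f -> 0 <= - \int[mu]_x (f x * jacobi_op a b f x).
Proof.
move=> [p ->]; rewrite -/(L2dot mu _ _) L2dotC.
rewrite (L2dot_ae _ _ _ (jacobi_op_ae p)); [|exact: L2_jacobi_op|exact: L2_hp|exact: L2_hp].
by rewrite L2dot_hp oppr_ge0 pdot_L_le0.
Qed.

Lemma heat_term_cvg (t x y : R) : 0 < t -> cvgn (series (fun k => expR (- lam k * t) * e k x * e k y)).
Proof.
by move=> t0; apply: (nsum_cvg le_e); exact: (summable_e le_e sup_bound_ge1 sumB_cvg).
Qed.

Lemma heat_kernel_D (t x y : R) : -1 <= x <= 1 -> -1 <= y <= 1 -> hk t x y = K t x y.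
Proof.
move=> xD yD; rewrite /heat_kernel /jacobi_heat_kernel; congr (limn (series _)).
by apply/funext => k; rewrite /jacobi_heat_term !restrictDE xD yD.
Qed.

Lemma jacobi_kernel_cvg (t x y : R) : 0 < t -> -1 <= x <= 1 -> -1 <= y <= 1 ->
  cvgn (series (jacobi_heat_term a b P t x y)).
Proof.
move=> t0 xD yD; have := @heat_term_cvg t x y t0.
rewrite (_ : (fun k => _) = jacobi_heat_term a b P t x y)//.
by apply/funext => k; rewrite /jacobi_heat_term !restrictDE xD yD.
Qed.

Lemma measurable_heat_kernel t x : 0 < t -> measurable_fun setT (hk t x).
Proof.
move=> t0; apply: (measurable_nsum measurable_e le_e).
exact: (summable_e le_e sup_bound_ge1 sumB_cvg).
Qed.

Lemma measurable_jacobi_kernel t x (A : set TR) : 0 < t -> -1 <= x <= 1 -> measurable A -> A `<=` DD ->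
  measurable_fun A (K t x : TR -> R).
Proof.
move=> t0 xD mA AD; apply: (eq_measurable_fun (hk t x)).
  by move=> y; rewrite inE => /AD; rewrite /= in_itv/= => yD; rewrite heat_kernel_D.
by apply: measurable_funTS; exact: measurable_heat_kernel.
Qed.

Lemma kernel_bounded t : 0 < t -> exists M, forall x y, -1 <= x <= 1 -> -1 <= y <= 1 -> `|K t x y| <= M.
Proof.
move=> t0; eexists => x y xD yD.
apply: (@normal_lim_le _ _ (fun k => expR (- lam k * t) * B k ^+ 2)); last exact: sumB_cvg.
move=> k; rewrite /jacobi_heat_term !normrM ger0_norm ?expR_ge0// -mulrA ler_wpM2l ?expR_ge0//.
by rewrite expr2 ler_pM// PB.
Qed.

Lemma kernelC t x y : K t x y = K t y x.
Proof.
rewrite /jacobi_heat_kernel; congr (limn (series _)); apply/funext => k.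
by rewrite /jacobi_heat_term mulrAC.
Qed.

Lemma integral_operator_kernel T : generates mu (op_closure mu (jacobi_graph a b)) T ->
  forall t, 0 < t -> integral_operator mu DD (T t) (K t).
Proof.
move=> [cT gT] t t0 f hf.
rewrite jacobi_closureE in gT.
have := S_heat mufin measurable_e le_e sup_bound_ge1 dot_e dense_e (lam_inj ha hb) sumB_cvg cT gT t0 hf.
apply: filterS => x /= Tx; rewrite in_itv/= => xD.
have [i1 i2] := heat_kernelE mufin measurable_e le_e sup_bound_ge1 sumB_cvg x t0 hf.
split.
  apply: (@eq_integrable _ _ _ mu DD _ (EFin \o (fun y => hk t x y * f y))) => //.
    by move=> y; rewrite inE/= in_itv/= => yD; rewrite heat_kernel_D.
  by apply: integrableS i1.
rewrite Tx// i2 Rintegral_setT_D; last first.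
  apply: measurable_funM; first exact: measurable_heat_kernel.
  exact: L2_measurable hf.
by apply: eq_Rintegral => y; rewrite inE/= in_itv/= => yD; rewrite heat_kernel_D.
Qed.

(** Reading the integral through the Fourier coefficients of f, which is how the
    semigroup law reduces to the identity exp(-s) exp(-t) = exp(-(s+t)). *)
Lemma kernel_action t x f : 0 < t -> -1 <= x <= 1 -> L2 mu f ->
  \int[mu]_(y in DD) (K t x y * f y) = limn (series (fun k => expR (- lam k * t) * hat mu e f k * (P k).[x])).
Proof.
move=> t0 xD hf.
have [i1 i2] := heat_kernelE mufin measurable_e le_e sup_bound_ge1 sumB_cvg x t0 hf.
rewrite /heat t0 /nsum in i2.
transitivity (\int[mu]_y (hk t x y * f y)).
  rewrite Rintegral_setT_D; last first.
    by apply: measurable_funM; [exact: measurable_heat_kernel|exact: L2_measurable hf].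
  by apply: eq_Rintegral => y; rewrite inE/= in_itv/= => yD; rewrite heat_kernel_D.
rewrite -i2; congr (limn (series _)); apply/funext => k; by rewrite restrictDE xD.
Qed.

Lemma kernel_semigroup s t x y : 0 < s -> 0 < t -> -1 <= x <= 1 -> -1 <= y <= 1 ->
  \int[mu]_(z in DD) (K s x z * K t z y) = K (s + t) x y.
Proof.
move=> s0 t0 xD yD.
have cB := @summable_e _ _ _ e B lam le_e sup_bound_ge1 sumB_cvg t y t0.
transitivity (\int[mu]_(z in DD) (K s x z * hk t y z)).
  apply: eq_Rintegral => z; rewrite inE/= in_itv/= => zD.
  by rewrite heat_kernel_D// (kernelC t z).
rewrite kernel_action//; last first.
  exact: (L2_nsum mufin measurable_e le_e cB).
rewrite /jacobi_heat_kernel; congr (limn (series _)); apply/funext => k.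
rewrite (hat_nsum mufin measurable_e le_e sup_bound_ge1 dot_e cB).
rewrite /jacobi_heat_term restrictDE yD mulrDr expRD; ring.
Qed.

(** Finite sums, so that the semigroup preserves polynomials and can be evaluated
    pointwise. *)
Definition heat_poly (t : R) (p : {poly R}) : {poly R} :=
  \sum_(0 <= k < size p) (expR (- lam k * t) * pdot a b p (P k)) *: P k.

Lemma kernel_poly t x (p : {poly R}) : 0 < t -> -1 <= x <= 1 ->
  \int[mu]_(y in DD) (K t x y * p.[y]) = (heat_poly t p).[x].
Proof.
move=> t0 xD.
transitivity (\int[mu]_(y in DD) (K t x y * (hp p) y)).
  by apply: eq_Rintegral => y; rewrite inE/= in_itv/= => yD; rewrite restrictDE yD.
rewrite kernel_action//; last exact: L2_hp.
apply/cvg_lim => //; apply: cvg_near_cst.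
exists (size p) => // n /= pn.
rewrite seriesEnat/= (big_cat_nat (n := size p))//= [X in _ + X]big_nat_cond [X in _ + X]big1 ?addr0; last first.
  move=> k; rewrite andbT => /andP[pk _]; rewrite /hat L2dot_hp (pdot_P_small ha hb HP)//.
  by rewrite mulr0 mul0r.
rewrite /heat_poly horner_sum; apply: eq_bigr => k _.
by rewrite /hat L2dot_hp hornerZ.
Qed.

(** The constant polynomial is the eigenfunction for lambda_0 = 0. *)
Lemma kernel_mass t x : 0 < t -> -1 <= x <= 1 -> \int[mu]_(y in DD) K t x y = 1.
Proof.
move=> t0 xD.
have := @kernel_poly t x 1 t0 xD.
under eq_Rintegral do rewrite hornerC mulr1.
move=> ->; rewrite /heat_poly size_poly1 big_nat1 lam0 oppr0 mul0r expR0 mul1r.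
have s1 : (size (1%R : {poly R}) <= 1)%N by rewrite size_poly1.
have := poly_expand ha hb HP s1; by rewrite big_nat1 => <-; rewrite hornerC.
Qed.

Lemma kernel_diag_bound : exists A (Q : nat), 0 <= A /\ forall t x : R, 0 < t <= 1 -> -1 <= x <= 1 ->
  K t x x <= A * (t ^+ Q)^-1.
Proof.
have [A [Q [A0 H]]] := sum_heat_bound; exists A, Q; split => // t x tD xD.
have [cv h] := H t tD; apply: le_trans h; apply: le_trans (ler_norm _) _.
apply: normal_lim_le => // k.
rewrite /jacobi_heat_term !normrM ger0_norm ?expR_ge0// -mulrA ler_wpM2l ?expR_ge0//.
by rewrite expr2 ler_pM// PB.
Qed.

End jacobi_heat.

(** * The maximum principle *)

Section one_variable_maximum.
Context {R : realType}.
Implicit Types (u : R -> R) (x c : R).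

Lemma is_derive_horner (p : {poly R}) x : is_derive x 1 (horner p) (p^`()).[x].
Proof. by apply: DeriveDef; [exact: derivable_horner|rewrite -derive1E derivE]. Qed.

Lemma is_derive_increase u x c : is_derive x 1 u c -> 0 < c ->
  exists2 d : R, 0 < d & forall h, 0 < h < d -> u x < u (x + h) /\ u (x - h) < u x.
Proof.
move=> [dux uxc] c0.
have /= h : h^-1 *: (u (h *: 1 + x) - u x) @[h --> 0^'] --> c by rewrite -uxc; exact: dux.
have : \forall h \near 0^', 0 < h^-1 *: (u (h *: 1 + x) - u x) by exact: cvgr_gt h _ c0.
rewrite /dnbhs /within => -[d /= d0 H]; exists d => // e /andP[e0 ed].
split.
  have : 0 < e^-1 *: (u (e *: 1 + x) - u x).
    by apply: H; rewrite /= ?sub0r ?normrN ?gtr0_norm// gt_eqF.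
  by rewrite /GRing.scale/= mulr1 pmulr_rgt0 ?invr_gt0// subr_gt0 addrC.
have : 0 < (- e)^-1 *: (u ((- e) *: 1 + x) - u x).
  by apply: H; rewrite /= ?sub0r ?opprK ?gtr0_norm// oppr_eq0 gt_eqF.
by rewrite /GRing.scale/= mulr1 nmulr_rgt0 ?invr_lt0 ?oppr_lt0// subr_lt0 addrC.
Qed.

Lemma is_derive_oppr u x c : is_derive x 1 u c -> is_derive x 1 (fun y => - u y) (- c).
Proof. by move=> h; exact: is_deriveN. Qed.

Lemma max_right_deriv u x c : -1 <= x < 1 -> is_derive x 1 u c ->
  (forall y : R, -1 <= y <= 1 -> u y <= u x) -> c <= 0.
Proof.
move=> /andP[x0 x1] du ux; rewrite leNgt; apply/negP => c0.
have [d d0 H] := is_derive_increase du c0.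
pose h := Num.min (d / 2) (1 - x).
have h0 : 0 < h by rewrite lt_min; apply/andP; split; lra.
have [h1 h2] : h <= d / 2 /\ h <= 1 - x by rewrite !ge_min !lexx orbT.
have hd : 0 < h < d by apply/andP; split => //; lra.
have [h3 _] := H h hd.
have : u (x + h) <= u x by apply: ux; apply/andP; split; lra.
lra.
Qed.

Lemma max_left_deriv u x c : -1 < x <= 1 -> is_derive x 1 u c ->
  (forall y : R, -1 <= y <= 1 -> u y <= u x) -> 0 <= c.
Proof.
move=> /andP[x0 x1] du ux; rewrite leNgt; apply/negP => c0.
have c1 : 0 < - c by rewrite oppr_gt0.
have [d d0 H] := is_derive_increase (is_derive_oppr du) c1.
pose h := Num.min (d / 2) (x + 1).
have h0 : 0 < h by rewrite lt_min; apply/andP; split; lra.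
have [h1 h2] : h <= d / 2 /\ h <= x + 1 by rewrite !ge_min !lexx orbT.
have hd : 0 < h < d by apply/andP; split => //; lra.
have [_ h3] := H h hd.
have : u (x - h) <= u x by apply: ux; apply/andP; split; lra.
lra.
Qed.

Lemma max_deriv2 (u u1 u2 : R -> R) (x : R) : -1 < x < 1 ->
  (forall y : R, -1 <= y <= 1 -> is_derive y 1 u (u1 y)) ->
  (forall y : R, -1 <= y <= 1 -> is_derive y 1 u1 (u2 y)) ->
  (forall y : R, -1 <= y <= 1 -> u y <= u x) -> u1 x = 0 /\ u2 x <= 0.
Proof.
move=> /andP[x0 x1] du du1 ux.
have xD : -1 <= x <= 1 by rewrite !ltW.
have u1x : u1 x = 0.
  apply/eqP; rewrite eq_le (max_right_deriv _ (du x xD) ux) ?(ltW x0)//=.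
  by rewrite (max_left_deriv _ (du x xD) ux)// x0 (ltW x1).
split => //; rewrite leNgt; apply/negP => c0.
have [d d0 H] := is_derive_increase (du1 x xD) c0.
pose h := Num.min (d / 2) (1 - x).
have h0 : 0 < h by rewrite lt_min; apply/andP; split; lra.
have [h1 h2] : h <= d / 2 /\ h <= 1 - x by rewrite !ge_min !lexx orbT.
have xh : x < x + h by lra.
have hD (z : R) : z \in `[x, x + h] -> -1 <= z <= 1.
  by rewrite in_itv/= => /andP[? ?]; apply/andP; split; lra.
have dz (z : R) : z \in `]x, (x + h)[ -> is_derive z 1 u (u1 z).
  by move=> zi; apply: du; apply: hD; apply: subset_itv_oo_cc zi.
have [|z] := MVT xh dz.
  by apply: derivable_within_continuous => z /hD zD; case: (du z zD).
rewrite in_itv/= => /andP[z0 z1] E.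
have zd : 0 < z - x < d by apply/andP; split; lra.
have [+ _] := H _ zd; rewrite u1x addrC subrK => uz.
have : u (x + h) <= u x by apply: ux; apply/andP; split; lra.
have : 0 < u1 z * (x + h - x) by rewrite addrAC subrr add0r mulr_gt0.
lra.
Qed.

End one_variable_maximum.

Lemma cvg_sum_nat {R : realType} (f : nat -> nat -> R) (g : nat -> R) N :
  (forall k, f n k @[n --> \oo] --> g k) ->
  \sum_(0 <= k < N) f n k @[n --> \oo] --> \sum_(0 <= k < N) g k.
Proof.
move=> fg; elim: N => [|N ih].
  rewrite big_geq// (_ : (fun n => _) = (fun=> 0)); first exact: cvg_cst.
  by apply/funext => n; rewrite big_geq.
rewrite big_nat_recr//= (_ : (fun n => _) = (fun n => \sum_(0 <= k < N) f n k + f n N)); first exact: cvgD.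
by apply/funext => n; rewrite big_nat_recr.
Qed.

Section maximum_principle.
Context {R : realType} (a b : R).
Hypotheses (ha : -1 < a) (hb : -1 < b).
Notation L := (jacobi_L a b).
Implicit Types (p g : {poly R}) (G : R -> R).

(** The operator as a differential expression in given first and second derivatives,
    so that it applies to functions that are not polynomials. *)
Definition jacobi_op2 (G1 G2 : R -> R) x : R :=
  (1 - x ^+ 2) * G2 x + ((b - a) - (a + b + 2) * x) * G1 x.

Lemma jacobi_L_op2 p x : (L p).[x] = jacobi_op2 (horner p^`()) (horner p^`()^`()) x.
Proof. by rewrite jacobi_LE. Qed.

(** Inside the interval the gradient vanishes and the second derivative is
    nonpositive.  At 1 the expression is - 2 (a+1) u'(1) with u'(1) >= 0, at -1 it is
    2 (b+1) u'(-1) with u'(-1) <= 0; these signs play the part of a boundary condition. *)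
Lemma jacobi_op2_max (u u1 u2 : R -> R) (x : R) : -1 <= x <= 1 ->
  (forall y : R, -1 <= y <= 1 -> is_derive y 1 u (u1 y)) ->
  (forall y : R, -1 <= y <= 1 -> is_derive y 1 u1 (u2 y)) ->
  (forall y : R, -1 <= y <= 1 -> u y <= u x) -> jacobi_op2 u1 u2 x <= 0.
Proof.
move=> xD du du1 ux; have := ha; have := hb => hb' ha'; have [x0 x1] := andP xD.
rewrite /jacobi_op2.
have [x2|x2] := eqVneq x 1.
  have : 0 <= u1 x by apply: (max_left_deriv _ (du x xD) ux); rewrite x2; apply/andP; split; lra.
  rewrite x2 expr1n subrr mul0r add0r => u0.
  by rewrite nmulr_rle0//; lra.
have [x3|x3] := eqVneq x (-1).
  have : u1 x <= 0 by apply: (max_right_deriv _ (du x xD) ux); rewrite x3; apply/andP; split; lra.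
  rewrite x3 sqrrN expr1n subrr mul0r add0r => u0.
  by rewrite pmulr_rle0//; lra.
have xI : -1 < x < 1 by rewrite !lt_neqAle x0 x1 x2 eq_sym x3.
have [-> u2x] := max_deriv2 xI du du1 ux.
rewrite mulr0 addr0 mulr_ge0_le0//.
have : 0 <= (1 - x) * (1 + x) by rewrite mulr_ge0//; lra.
lra.
Qed.

Section test_function.
Variables (G G1 G2 : R -> R) (M : R).
Hypotheses (dG : forall y : R, -1 <= y <= 1 -> is_derive y 1 G (G1 y))
  (dG1 : forall y : R, -1 <= y <= 1 -> is_derive y 1 G1 (G2 y))
  (LG : forall y : R, -1 <= y <= 1 -> jacobi_op2 G1 G2 y <= M * G y).

(** At a maximum of u = g - k G one has L u <= 0, hence L g <= k L G <= k M G there,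
    and g = p + h L g <= (c + h k M) G; the constant k is chosen so that c + h k M = k. *)
Lemma resolvent_le (p g : {poly R}) (h c : R) : 0 < h -> 0 < 1 - h * M -> 0 < c ->
  g = p + h *: L g ->
  (forall y : R, -1 <= y <= 1 -> p.[y] <= c * G y) ->
  forall y : R, -1 <= y <= 1 -> g.[y] <= c / (1 - h * M) * G y.
Proof.
move=> h0 hM c0 Eg pG.
pose k := c / (1 - h * M).
have k0 : 0 < k by rewrite divr_gt0.
have kE : c = k * (1 - h * M) by rewrite /k divfK// gt_eqF.
pose u y := g.[y] - k * G y.
pose u1 y := (g^`()).[y] - k * G1 y.
pose u2 y := (g^`()^`()).[y] - k * G2 y.
have du (y : R) : -1 <= y <= 1 -> is_derive y 1 u (u1 y).
  move=> yD; have h1 := is_derive_horner g y; have h2 := is_deriveZ k (dG yD).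
  exact: is_deriveB h1 h2.
have du1 (y : R) : -1 <= y <= 1 -> is_derive y 1 u1 (u2 y).
  move=> yD; have h1 := is_derive_horner g^`() y; have h2 := is_deriveZ k (dG1 yD).
  exact: is_deriveB h1 h2.
have [||x0 + ux] := @EVT_max R u (-1) 1; first lra.
  by apply: derivable_within_continuous => z; rewrite in_itv/= => zD; case: (du z zD).
rewrite in_itv/= => xD.
have ux' y : -1 <= y <= 1 -> u y <= u x0 by move=> yD; apply: ux; rewrite in_itv.
move=> y yD; rewrite -subr_le0; apply: le_trans (ux' y yD) _.
have Lu := jacobi_op2_max xD du du1 ux'.
have E : jacobi_op2 u1 u2 x0 = (L g).[x0] - k * jacobi_op2 G1 G2 x0.
  by rewrite jacobi_L_op2 /jacobi_op2 /u1 /u2; ring.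
have h1 := LG xD; have h2 := pG x0 xD.
have h3 : g.[x0] = p.[x0] + h * (L g).[x0] by rewrite {1}Eg hornerD hornerZ.
have h4 : (L g).[x0] <= k * (M * G x0).
  by rewrite E subr_le0 in Lu; apply: (le_trans Lu); rewrite ler_pM2l.
have h5 : h * (L g).[x0] <= h * (k * (M * G x0)) by rewrite ler_pM2l.
rewrite /u h3 subr_le0; apply: le_trans (lerD h2 h5) _.
by rewrite kE le_eqVlt; apply/orP; left; apply/eqP; ring.
Qed.

End test_function.

Variable P : nat -> {poly R}.
Hypothesis HP : jacobi_polynomials a b P.
Notation lam := (jacobi_eigenvalue a b).

(** Functions of the operator L, applied to a polynomial. *)
Definition multiplier (c : nat -> R) p : {poly R} :=
  \sum_(0 <= k < size p) (c k * pdot a b p (P k)) *: P k.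

Lemma multiplier_resolvent (c d : nat -> R) p (h : R) :
  (forall k, c k = (1 + h * lam k) * d k) ->
  multiplier d p = multiplier c p + h *: L (multiplier d p).
Proof.
move=> cd; rewrite /multiplier (L_sum ha hb HP) scaler_sumr -big_split/=.
apply: eq_bigr => k _; rewrite scalerA -scalerDl; congr (_ *: _).
by rewrite cd; ring.
Qed.

Lemma multiplier1 p : multiplier (fun=> 1) p = p.
Proof.
rewrite {2}(poly_expand ha hb HP (leqnn (size p))).
by apply: eq_bigr => k _; rewrite mul1r.
Qed.

(** Euler's limit, in the form (1 + s/n)^(-n). *)
Lemma cvg_resolvent_exp (s : R) : 0 <= s ->
  ((1 + s / n.+1%:R)^-1) ^+ n.+1 @[n --> \oo] --> expR (- s).
Proof.
move=> s0.
have upper : expR (- s + s ^+ 2 * harmonic n) @[n --> \oo] --> expR (- s).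
  rewrite -[X in _ --> expR X]addr0.
  have h : - s + s ^+ 2 * harmonic n @[n --> \oo] --> - s + 0.
    apply: cvgD; first exact: cvg_cst.
    rewrite -[X in _ --> X](mulr0 (s ^+ 2)); apply: cvgM; first exact: cvg_cst.
    exact: cvg_harmonic.
  by apply: continuous_cvg h; exact: continuous_expR.
apply: (squeeze_cvgr _ (cvg_cst (expR (- s))) upper).
apply: nearW => n; have n0 : (0 : R) < n.+1%:R by rewrite ltr0n.
have sn : 0 <= s / n.+1%:R by rewrite divr_ge0// ltW.
have q0 : 0 < 1 + s / n.+1%:R := ltr_pwDl ltr01 sn.
apply/andP; split.
  have -> : - s = n.+1%:R * (- (s / n.+1%:R)) by rewrite mulrN mulrC divfK// gt_eqF.
  rewrite expRM_natl; apply: lerXn2r; rewrite ?nnegrE ?expR_ge0// ?invr_ge0 ?(ltW q0)//.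
  by rewrite expRN lef_pV2 ?posrE ?expR_gt0// expR_ge1Dx.
have e1 : (1 + s / n.+1%:R)^-1 <= expR (- (s / (n.+1%:R + s))).
  have := expR_ge1Dx (- (s / (n.+1%:R + s))); apply: le_trans.
  rewrite le_eqVlt; apply/orP; left; apply/eqP; field.
  by rewrite !gt_eqF// ltr_wpDr.
apply: (@le_trans _ _ (expR (- (s / (n.+1%:R + s))) ^+ n.+1)).
  by apply: lerXn2r; rewrite ?nnegrE ?expR_ge0 ?invr_ge0 ?(ltW q0).
rewrite -expRM_natl ler_expR mulrN mulrC.
have ns : 0 < n.+1%:R + s by rewrite ltr_wpDr.
have -> : - (s / (n.+1%:R + s) * n.+1%:R) = - s + s ^+ 2 / (n.+1%:R + s).
  by move: (n.+1%:R) ns => N N0; field; rewrite gt_eqF.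
rewrite lerD2l ler_wpM2l ?sqr_ge0// /harmonic lef_pV2 ?posrE//; lra.
Qed.

Lemma heat_poly_multiplier t p : heat_poly a b P t p = multiplier (fun k => expR (- lam k * t)) p.
Proof. by []. Qed.

(** The semigroup is the limit of n-th powers of the resolvent at step t/n, and
    (1 - h M)^(-1) <= exp(2 h M) as soon as h M <= 1/2. *)
Lemma heat_poly_le (G G1 G2 : R -> R) (M : R) p (t : R) : 0 <= M -> 0 <= t ->
  (forall y : R, -1 <= y <= 1 -> is_derive y 1 G (G1 y)) ->
  (forall y : R, -1 <= y <= 1 -> is_derive y 1 G1 (G2 y)) ->
  (forall y : R, -1 <= y <= 1 -> jacobi_op2 G1 G2 y <= M * G y) ->
  (forall y : R, -1 <= y <= 1 -> 0 <= G y) ->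
  (forall y : R, -1 <= y <= 1 -> p.[y] <= G y) ->
  forall y : R, -1 <= y <= 1 -> (heat_poly a b P t p).[y] <= expR (2 * M * t) * G y.
Proof.
move=> M0 t0 dG dG1 LG G0 pG y yD.
pose h n : R := t / n.+1%:R.
pose r n k : R := (1 + lam k * t / n.+1%:R)^-1.
have step n (m : nat) : 0 < t -> h n * M <= 2^-1 -> forall y : R, -1 <= y <= 1 ->
    (multiplier (fun k => r n k ^+ m) p).[y] <= ((1 - h n * M)^-1) ^+ m * G y.
  move=> t1 hM; have h1 : 0 < 1 - h n * M by lra.
  have n0 : (0 : R) < n.+1%:R by rewrite ltr0n.
  elim: m => [|m ih].
    by move=> z zD; rewrite (_ : (fun _ => _) = (fun=> 1)) ?multiplier1 ?mul1r ?expr0 ?mul1r; [exact: pG|apply/funext => k; rewrite expr0].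
  move=> z zD.
  have E := @multiplier_resolvent (fun k => r n k ^+ m) (fun k => r n k ^+ m.+1) p (h n).
  rewrite exprSr; apply: (resolvent_le dG dG1 LG _ _ _ (E _) ih) => //.
  - by rewrite divr_gt0.
  - by rewrite exprn_gt0// invr_gt0.
  - move=> k; rewrite exprS mulrA /r /h (_ : t / n.+1%:R * lam k = lam k * t / n.+1%:R); last by ring.
    rewrite mulfV ?mul1r// gt_eqF// ltr_wpDr// divr_ge0// mulr_ge0 ?(ltW t1)//; exact: lam_ge0.
move: t0; rewrite le_eqVlt => /orP[/eqP t0|t0].
  rewrite heat_poly_multiplier -t0 mulr0 expR0 mul1r (_ : (fun _ => _) = (fun=> 1)) ?multiplier1; first exact: pG.
  by apply/funext => k; rewrite mulr0 expR0.
have cv : (multiplier (fun k => r n k ^+ n.+1) p).[y] @[n --> \oo] --> (heat_poly a b P t p).[y].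
  rewrite heat_poly_multiplier /multiplier; under eq_fun do rewrite horner_sum.
  rewrite horner_sum; apply: cvg_sum_nat => k; under eq_fun do rewrite hornerZ; rewrite hornerZ.
  apply: cvgM; last exact: cvg_cst.
  apply: cvgM; last exact: cvg_cst.
  rewrite mulNr; apply: cvg_resolvent_exp.
  by rewrite mulr_ge0 ?(ltW t0)//; exact: lam_ge0.
rewrite -(cvg_lim _ cv)//; apply: limr_le; first by apply/cvg_ex; eexists; exact: cv.
have cvh : h n * M @[n --> \oo] --> t * 0 * M.
  apply: cvgM; last exact: cvg_cst.
  apply: cvgM; first exact: cvg_cst.
  exact: cvg_harmonic.
rewrite mulr0 mul0r in cvh.
have : \forall n \near \oo, h n * M < 2^-1 by apply: (cvgr_lt _ cvh).
apply: filterS => n /ltW hM.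
apply: le_trans (step n n.+1 t0 hM y yD) _; rewrite ler_wpM2r ?G0//.
have hM0 : 0 <= h n * M by rewrite mulr_ge0// divr_ge0// ltW.
have h1 : (1 - h n * M)^-1 <= expR (2 * (h n * M)).
  have := expR_ge1Dx (2 * (h n * M)); apply: le_trans.
  have h2 : 0 < 1 - h n * M by lra.
  rewrite -[leLHS]mul1r ler_pdivrMr//.
  have : 0 <= (h n * M) * (1 - 2 * (h n * M)) by rewrite mulr_ge0//; lra.
  lra.
apply: (@le_trans _ _ (expR (2 * (h n * M)) ^+ n.+1)).
  apply: lerXn2r; rewrite ?nnegrE ?expR_ge0 ?invr_ge0//; lra.
rewrite -expRM_natl ler_expR /h le_eqVlt; apply/orP; left; apply/eqP.
have : (n.+1%:R : R) != 0 by rewrite pnatr_eq0.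
by move: (n.+1%:R) => N N0; field.
Qed.

Lemma pdotNl p q : pdot a b (- p) q = - pdot a b p q.
Proof. by rewrite -scaleN1r (pdotZl ha hb) mulN1r. Qed.

(** The supersolution 0 applied to - p. *)
Lemma heat_poly_ge0 (t : R) p : 0 <= t -> (forall y : R, -1 <= y <= 1 -> 0 <= p.[y]) ->
  forall y : R, -1 <= y <= 1 -> 0 <= (heat_poly a b P t p).[y].
Proof.
move=> t0 p0 y yD.
have := @heat_poly_le (fun=> 0) (fun=> 0) (fun=> 0) 0 (- p) t (lexx _) t0.
have E : heat_poly a b P t (- p) = - heat_poly a b P t p.
  by rewrite /heat_poly size_polyN -sumrN; apply: eq_bigr => k _; rewrite pdotNl mulrN scaleNr.
rewrite E => H; rewrite -oppr_le0 -hornerN -(mulr0 (expR (2 * 0 * t))); apply: H => //.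
- by move=> z _; rewrite /jacobi_op2 !mulr0 addr0.
- by move=> z zD; rewrite hornerN oppr_le0 p0.
Qed.

End maximum_principle.

(** * Volumes of balls *)

(** Restricting to the listed hypotheses keeps the linear systems small. *)
Ltac lra_core := intros; repeat match goal with x := _ |- _ => clearbody x end; lra.
Tactic Notation "lra_from" hyp_list(hs) := revert hs; clear; lra_core.

Section trigonometric_bounds.
Context {R : realType}.
Implicit Types x y t u : R.

Lemma sin_MVT x y : x <= y -> exists2 z, x <= z <= y & sin y - sin x = cos z * (y - x).
Proof.
move=> xy; have d (z : R) : z \in `]x, y[ -> is_derive z 1 (@sin R) (cos z) by move=> _; exact: is_derive_sin.
have [|z zi E] := MVT_segment xy d; first by apply: continuous_subspaceT; exact: continuous_sin.
by exists z => //; rewrite in_itv/= in zi.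
Qed.

Lemma cos_MVT x y : x <= y -> exists2 z, x <= z <= y & cos x - cos y = sin z * (y - x).
Proof.
move=> xy; have d (z : R) : z \in `]x, y[ -> is_derive z 1 (@cos R) (- sin z) by move=> _; exact: is_derive_cos.
have [|z zi E] := MVT_segment xy d; first by apply: continuous_subspaceT; exact: continuous_cos.
by exists z; [rewrite in_itv/= in zi|rewrite -opprB E mulNr opprK].
Qed.

Lemma sin_le_id x : 0 <= x -> sin x <= x.
Proof.
move=> x0; have [z _] := sin_MVT x0; rewrite sin0 !subr0 => ->.
by rewrite -[leRHS]mul1r ler_wpM2r// cos_le1.
Qed.

Lemma ler_norm_sin x : 0 <= x -> `|sin x| <= x.
Proof.
move=> x0; rewrite ler_norml sin_le_id// andbT.
have [z _] := sin_MVT x0; rewrite sin0 !subr0 => ->.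
by rewrite lerNl -mulNr -[leRHS]mul1r ler_wpM2r// lerNl cos_geN1.
Qed.

Lemma cos_double x : cos x = 1 - 2 * sin (x / 2) ^+ 2.
Proof.
have -> : cos x = cos ((x / 2) *+ 2) by congr cos; rewrite -mulr_natr; field.
rewrite cos_mulr2n -mulr_natr; have := cos2Dsin2 (x / 2); lra.
Qed.

Lemma sin_double x : sin x = 2 * sin (x / 2) * cos (x / 2).
Proof.
have -> : sin x = sin ((x / 2) *+ 2) by congr sin; rewrite -mulr_natr; field.
by rewrite sin_mulr2n -mulr_natr; ring.
Qed.

Lemma cos_ge_quad x : 0 <= x -> 1 - x ^+ 2 / 2 <= cos x.
Proof.
move=> x0; rewrite cos_double.
have h : 0 <= x / 2 by lra.
have : sin (x / 2) ^+ 2 <= (x / 2) ^+ 2.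
  by rewrite -real_normK ?num_real//; apply: lerXn2r; rewrite ?nnegrE// ler_norm_sin.
rewrite expr_div_n; lra.
Qed.

Lemma sin_ge_half x : 0 <= x <= 1 -> x / 2 <= sin x.
Proof.
move=> /andP[x0 x1]; have [z /andP[z0 zx]] := sin_MVT x0; rewrite sin0 !subr0 => ->.
have := cos_ge_quad z0.
have : z ^+ 2 <= 1 by rewrite expr_le1//; lra.
move=> h1 h2; rewrite mulrC; apply: ler_wpM2r => //; lra.
Qed.

Lemma cos_le x y : 0 <= x -> x <= y -> y <= pi -> cos y <= cos x.
Proof.
move=> x0 xy yp; have [z /andP[z0 zx] E] := cos_MVT xy.
rewrite -subr_ge0 E mulr_ge0 ?subr_ge0// sin_ge0_pi//; apply/andP; split.
  exact: le_trans z0.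
exact: le_trans zx yp.
Qed.

Lemma cos_lt x y : 0 <= x -> x < y -> y <= pi -> cos y < cos x.
Proof.
move=> x0 xy yp; rewrite lt_neqAle cos_le ?(ltW xy)// andbT; apply/negP => /eqP.
have xD : x \in `[0, pi] by rewrite in_itv/= x0 (le_trans (ltW xy)).
have yD : y \in `[0, pi] by rewrite in_itv/= yp andbT (le_trans x0 (ltW xy)).
by move=> /(cos_inj yD xD) E; rewrite E ltxx in xy.
Qed.

Lemma acos_le x y : -1 <= x <= 1 -> -1 <= y <= 1 -> x <= y -> acos y <= acos x.
Proof.
move=> xD yD xy; rewrite leNgt; apply/negP => h.
have := cos_lt (acos_ge0 xD) h (acos_lepi yD).
rewrite !acosK ?in_itv//= => h1; lra.
Qed.

Section half_angle.
Variable t : R.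
Hypotheses (t0 : 0 <= t) (tp : t <= pi) (ct : - 2^-1 <= cos t).

Let cos_half_ge : 2^-1 <= cos (t / 2).
Proof.
have c0 : 0 <= cos (t / 2).
  by apply: cos_ge0_pihalf; have := @pi_gt0 R; have := tp; have := t0 => *; apply/andP; split; lra.
have : (2^-1) ^+ 2 <= cos (t / 2) ^+ 2.
  have := cos2Dsin2 (t / 2); have := cos_double t; have := ct.
  rewrite (_ : (2^-1 : R) ^+ 2 = 4^-1); last by field.
  lra.
by rewrite ler_sqr// nnegrE.
Qed.

Let sin_half : t / 4 <= sin (t / 2) <= t / 2.
Proof.
have h0 : 0 <= t / 2 by rewrite divr_ge0.
rewrite sin_le_id// andbT; have [z /andP[z0 zt]] := sin_MVT h0; rewrite sin0 !subr0 => ->.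
rewrite (_ : t / 4 = 2^-1 * (t / 2)); last by field.
rewrite ler_wpM2r//; apply: (le_trans cos_half_ge); apply: cos_le => //.
by apply: le_trans tp; have := t0; lra.
Qed.

Lemma sin_bounds : t / 4 <= sin t <= t.
Proof.
rewrite sin_le_id// andbT sin_double.
have /andP[h1 _] := sin_half; have h2 := cos_half_ge; have h0 := t0.
have : t / 4 * 2^-1 <= sin (t / 2) * cos (t / 2).
  by apply: ler_pM => //; rewrite ?divr_ge0.
lra.
Qed.

Lemma onem_cos_bounds : t ^+ 2 / 8 <= 1 - cos t <= t ^+ 2 / 2.
Proof.
have /andP[h1 h2] := sin_half; have h0 := t0; rewrite (cos_double t).
have h3 : (t / 4) ^+ 2 <= sin (t / 2) ^+ 2 by apply: lerXn2r; rewrite ?nnegrE//; lra.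
have h4 : sin (t / 2) ^+ 2 <= (t / 2) ^+ 2 by apply: lerXn2r; rewrite ?nnegrE//; lra.
rewrite !expr_div_n in h3 h4.
by apply/andP; split; lra.
Qed.

End half_angle.

(** The mean value theorem, with sin comparable to the angle as long as the cosine
    is at least -1/2. *)
Lemma cos_diff_bounds x y : 0 <= x -> x <= y -> y <= pi -> - 2^-1 <= cos y ->
  x / 4 * (y - x) <= cos x - cos y <= y * (y - x).
Proof.
move=> x0 xy yp cy; have [z /andP[z0 zx] ->] := cos_MVT xy.
have z0' : 0 <= z by exact: le_trans z0.
have zp : z <= pi by exact: le_trans zx yp.
have cz : - 2^-1 <= cos z by apply: (le_trans cy); exact: cos_le.
have /andP[h1 h2] := sin_bounds z0' zp cz.
by rewrite !ler_wpM2r ?subr_ge0//; lra.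
Qed.

(** For x >= 0 the angle is at most pi/2, so that it can be enlarged by a radius
    r <= 1/2 without the cosine dropping below - r. *)
Lemma acos_nneg x r : 0 <= x <= 1 -> 0 <= r <= 2^-1 ->
  [/\ 0 <= acos x, acos x + r <= pi, acos x <= 2 & - r <= cos (acos x + r)].
Proof.
move=> /andP[x0 x1] /andP[r0 r1].
have xD : -1 <= x <= 1 by apply/andP; split; lra.
have a0 := acos_ge0 xD.
have a2 : acos x <= pi / 2.
  rewrite -acos0; apply: acos_le => //; by apply/andP; split; lra.
have p1 := @pihalf_ge1 R; have p2 := @pihalf_lt2 R.
split => //; [lra|lra|].
rewrite cosD acosK ?in_itv//=.
have c0 : 0 <= cos r by apply: cos_ge0_pihalf; apply/andP; split; lra.
have s0 := sin_le_id r0.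
have sr0 : 0 <= sin r by apply: sin_ge0_pi; apply/andP; split; lra.
have : sin (acos x) * sin r <= 1 * sin r by rewrite ler_wpM2r// sin_le1.
have : 0 <= x * cos r by rewrite mulr_ge0.
lra.
Qed.

End trigonometric_bounds.

Section ball_volume.
Context {R : realType}.
Notation TR := (measurableTypeR R).
Notation leb := (@lebesgue_measure R).
Notation DD := (`[(-1)%R, 1%R]%classic : set TR).
Implicit Types a b x y r : R.

(** Balls are intervals, as arccos is monotone. *)
Lemma measurable_jacobi_ball x r : measurable (jacobi_ball x r : set TR).
Proof.
apply: is_interval_measurable => y z /= [yD yr] [zD zr] u /andP[yu uz].
have uD : -1 <= u <= 1.
  by move: yD zD => /andP[? ?] /andP[? ?]; apply/andP; split; lra.
split=> //; have h1 := acos_le yD uD yu; have h2 := acos_le uD zD uz.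
move: yr zr; rewrite /jacobi_dist !ltr_norml => /andP[? ?] /andP[? ?].
by apply/andP; split; lra.
Qed.

Lemma jacobi_ball_sub x r : (jacobi_ball x r : set TR) `<=` DD.
Proof. by move=> y [yD _] /=; rewrite in_itv. Qed.

Lemma jacobi_distN x y : -1 <= x <= 1 -> -1 <= y <= 1 -> jacobi_dist (- x) (- y) = jacobi_dist x y.
Proof. by move=> xD yD; rewrite /jacobi_dist !acosN// distrC; congr (`| _ |); ring. Qed.

Lemma jacobi_volN a b x r : -1 <= x <= 1 -> jacobi_vol b a (- x) r = jacobi_vol a b x r.
Proof.
move=> xD; rewrite /jacobi_vol measure_jacobiN; last exact: measurable_jacobi_ball.
congr (fine (jacobi_measure a b _)); apply/seteqP; split=> y /= [yD] h.
  have yD' : -1 <= y <= 1 by case/andP: yD => ? ?; apply/andP; split; lra.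
  by split => //; rewrite -jacobi_distN.
have yD' : -1 <= - y <= 1 by case/andP: yD => ? ?; apply/andP; split; lra.
by split => //; rewrite jacobi_distN.
Qed.

Section volume.
Variables (a b : R).
Hypotheses (ha : -1 < a) (hb : -1 < b).
Notation mu := (jacobi_measure a b).
Notation V := (jacobi_vol a b).

Lemma mu_itv_le (u v M : R) : -1 <= u -> u <= v -> v <= 1 -> 0 <= M ->
  (forall y, u <= y <= v -> jacobi_weight a b y <= M) -> fine (mu `[u, v]%classic) <= M * (v - u).
Proof.
move=> u1 uv v1 M0 H.
have mI : measurable (`[u, v]%classic : set TR) by exact: measurable_itv.
have := measure_jacobi_le_cst (a := a) (b := b) mI M0.
have -> : `[u, v]%classic `&` `[(-1), 1]%classic = `[u, v]%classic :> set TR.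
  apply/setIidPl => y /=; rewrite !in_itv/= => /andP[? ?]; apply/andP; split; lra.
move=> K; have {K} : (mu `[u, v]%classic <= M%:E * leb `[u, v]%classic)%E.
  by apply: K => y /=; rewrite in_itv/= => yi _; exact: H.
have -> : leb `[u, v]%classic = (v - u)%:E.
  rewrite lebesgue_measure_itv/= lte_fin; case: ifPn => [_|]; first by rewrite -EFinD.
  by rewrite -leNgt => vu; rewrite (le_anti (introT andP (conj uv vu))) subrr.
rewrite -EFinM -[X in (X <= _)%E]fineK ?lee_fin//.
by rewrite ge0_fin_numE ?measure_ge0// measure_jacobi_fin_num.
Qed.

Lemma mu_itv_ge (u v M : R) : -1 <= u -> u <= v -> v <= 1 -> 0 <= M ->
  (forall y, u <= y <= v -> M <= jacobi_weight a b y) -> M * (v - u) <= fine (mu `[u, v]%classic).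
Proof.
move=> u1 uv v1 M0 H.
have mI : measurable (`[u, v]%classic : set TR) by exact: measurable_itv.
have := measure_jacobi_ge_cst (a := a) (b := b) mI M0.
have -> : `[u, v]%classic `&` `[(-1), 1]%classic = `[u, v]%classic :> set TR.
  apply/setIidPl => y /=; rewrite !in_itv/= => /andP[? ?]; apply/andP; split; lra.
move=> K; have {K} : (M%:E * leb `[u, v]%classic <= mu `[u, v]%classic)%E.
  by apply: K => y /=; rewrite in_itv/= => yi _; exact: H.
have -> : leb `[u, v]%classic = (v - u)%:E.
  rewrite lebesgue_measure_itv/= lte_fin; case: ifPn => [_|]; first by rewrite -EFinD.
  by rewrite -leNgt => vu; rewrite (le_anti (introT andP (conj uv vu))) subrr.
rewrite -EFinM -[X in (_ <= X)%E]fineK ?lee_fin//.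
by rewrite ge0_fin_numE ?measure_ge0// measure_jacobi_fin_num.
Qed.

Lemma le_vol x r r' : r <= r' -> V x r <= V x r'.
Proof.
move=> rr; apply: fine_measure_jacobi_le => //; try exact: measurable_jacobi_ball.
by move=> y [yD yr]; split=> //; exact: lt_le_trans rr.
Qed.

Lemma vol_le_total x r : V x r <= fine (mu DD).
Proof.
apply: fine_measure_jacobi_le => //; first exact: measurable_jacobi_ball.
exact: jacobi_ball_sub.
Qed.

(** The size of B(cos t, r) when cos t >= 0: the ball has length of order r (t+r),
    and (t+r)^2 is the order of 1-y on most of it. *)
Definition vol_model (t r : R) : R := r * (t + r) * ((t + r) ^+ 2) `^ a.

Lemma vol_model_ge0 t r : 0 <= t -> 0 <= r -> 0 <= vol_model t r.
Proof. by move=> t0 r0; rewrite /vol_model !mulr_ge0 ?powR_ge0 ?addr_ge0. Qed.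

Lemma cos_acos x : -1 <= x <= 1 -> cos (acos x) = x.
Proof. by move=> xD; rewrite acosK// in_itv. Qed.

Lemma acos_cos (t : R) : 0 <= t <= pi -> acos (cos t) = t.
Proof. by move=> tD; rewrite cosK// in_itv. Qed.

(** When t <= 2r the ball is contained in a cap at 1, whose measure is explicit.
    Otherwise 1-y is comparable to (t+r)^2 on the whole ball. *)
Lemma vol_le x r : 0 <= x <= 1 -> 0 < r <= 8^-1 ->
  V x r <= (2 `^ `|b| * (3 / (a + 1) + 2 * 72 `^ `|a|)) * vol_model (acos x) r.
Proof.
move=> xD /andP[r0 r1]; have [x0 x1] := andP xD.
have rh : 0 <= r <= 2^-1 by apply/andP; split; lra.
have [t0 tp t2 ct] := acos_nneg xD rh.
have xD' : -1 <= x <= 1 by apply/andP; split; lra.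
set t := acos x in t0 tp t2 ct *.
have tr0 : 0 < t + r by lra.
have m0 : 0 < (t + r) ^+ 2 by rewrite exprn_gt0.
have cN : - 2^-1 <= cos (t + r) by lra.
have tr0' : 0 <= t + r by lra.
have /andP[e1 e2] := onem_cos_bounds tr0' tp cN.
have F0 := @vol_model_ge0 t r t0 (ltW r0).
have a1 : 0 < a + 1 by have := ha; lra.
have sub : (jacobi_ball x r : set TR) `<=` `[cos (t + r), 1]%classic.
  move=> y [yD yr] /=; rewrite in_itv/=; have [_ y1] := andP yD; rewrite y1 andbT.
  rewrite -(cos_acos yD); apply: cos_le; rewrite ?acos_ge0//.
  by move: yr; rewrite /jacobi_dist ltr_norml -/t => /andP[? ?]; lra.
have bneg : 0 <= 2 `^ `|b| :> R by rewrite powR_ge0.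
have [near|far] := leP t (2 * r).
  apply: (@le_trans _ _ (2 `^ `|b| * (3 / (a + 1)) * vol_model t r)); last first.
    by rewrite ler_wpM2r// ler_wpM2l// lerDl mulr_ge0 ?powR_ge0.
  apply: (@le_trans _ _ (fine (mu `[cos (t + r), 1]%classic))).
    by apply: fine_measure_jacobi_le => //; exact: measurable_jacobi_ball.
  have c1 : cos (t + r) < 1 by lra.
  have := measure_jacobi_cap b ha cN c1.
  rewrite -[X in (X <= _)%E]fineK ?lee_fin; last first.
    by rewrite ge0_fin_numE ?measure_ge0// measure_jacobi_fin_num.
  move=> h; apply: (le_trans h); rewrite -!mulrA ler_wpM2l//.
  rewrite (_ : 3 * _ = (3 * vol_model t r) / (a + 1)); last by ring.
  rewrite ler_wpM2r ?invr_ge0 ?(ltW a1)//.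
  apply: (@le_trans _ _ (((t + r) ^+ 2) `^ (a + 1))).
    apply: ge0_ler_powR; rewrite ?nnegrE ?(ltW a1) ?(ltW m0)//; lra.
  rewrite powRD; last by rewrite (gt_eqF m0) implybT.
  rewrite powRr1 ?(ltW m0)// /vol_model mulrC [X in _ <= 3 * X]mulrC.
  rewrite [leRHS]mulrCA [leLHS]mulrC; apply: ler_wpM2l; first exact: powR_ge0.
  by rewrite expr2 mulrA ler_wpM2r//; lra.
apply: (@le_trans _ _ (2 `^ `|b| * (2 * 72 `^ `|a|) * vol_model t r)); last first.
  rewrite ler_wpM2r// ler_wpM2l// lerDr; apply: divr_ge0 => //; exact: ltW.
have cle : cos (t + r) <= cos (t - r) by apply: cos_le; [lra_from far r0|lra_from r0|exact: tp].
apply: (@le_trans _ _ (fine (mu `[cos (t + r), cos (t - r)]%classic))).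
  apply: fine_measure_jacobi_le => //; first exact: measurable_jacobi_ball.
  move=> y yB /=; rewrite in_itv/=; have := sub y yB; rewrite /= in_itv/= => /andP[-> _] /=.
  have [yD yr] := yB; rewrite -(cos_acos yD); apply: cos_le; rewrite ?acos_lepi//; first lra.
  by move: yr; rewrite /jacobi_dist ltr_norml -/t => /andP[? ?]; lra.
have tr1 : 0 <= t - r by lra.
have tr2 : t - r <= t + r by lra.
have /andP[_ d2] := cos_diff_bounds tr1 tr2 tp cN.
pose M := 2 `^ `|b| * (72 `^ `|a| * ((t + r) ^+ 2) `^ a).
have M0 : 0 <= M by rewrite /M !mulr_ge0 ?powR_ge0.
apply: (@le_trans _ _ (M * (cos (t - r) - cos (t + r)))).
  apply: mu_itv_le => //; rewrite ?cos_le1 ?cos_geN1// => y /andP[y0 y1].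
  have yD : -1 <= y <= 1 by rewrite (le_trans (cos_geN1 _) y0) (le_trans y1 (cos_le1 _)).
  have yD2 : - 2^-1 <= y <= 1 by rewrite (le_trans cN y0)/=; case/andP: yD.
  apply: le_trans (jacobi_weight_le a b yD2) _; rewrite ler_wpM2l//.
  have p0 := acos_ge0 yD; have p1 := acos_lepi yD.
  have cp : - 2^-1 <= cos (acos y) by rewrite cos_acos//; case/andP: yD2.
  have /andP[q1 q2] := onem_cos_bounds p0 p1 cp.
  have u1 : acos y <= t + r.
    rewrite -(@acos_cos (t + r)) ?tr0'//; apply: acos_le => //.
    by rewrite cos_le1 cos_geN1.
  have u2 : t - r <= acos y.
    rewrite -(@acos_cos (t - r)) ?tr1 ?(le_trans tr2)//; apply: acos_le => //.
    by rewrite cos_le1 cos_geN1.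
  rewrite cos_acos// in q1 q2.
  have u3 : (t + r) / 3 <= acos y by lra_from u2 far.
  have s1 : ((t + r) / 3) ^+ 2 <= acos y ^+ 2 by apply: lerXn2r; rewrite ?nnegrE//; lra_from u3 tr0.
  have s2 : acos y ^+ 2 <= (t + r) ^+ 2 by apply: lerXn2r; rewrite ?nnegrE.
  rewrite expr_div_n in s1.
  by apply: powR_ratio => //; lra_from q1 q2 s1 s2 m0.
apply: (@le_trans _ _ (M * ((t + r) * (2 * r)))).
  by rewrite ler_wpM2l//; lra.
by rewrite /M /vol_model le_eqVlt; apply/orP; left; apply/eqP; ring.
Qed.

(** Only the angles between t + r/2 and t + 3r/4 are used: there 1-y is comparable
    to (t+r)^2 even when t = 0. *)
Lemma vol_ge x r : 0 <= x <= 1 -> 0 < r <= 8^-1 ->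
  vol_model (acos x) r <= (32 * 2 `^ `|b| * 32 `^ `|a|) * V x r.
Proof.
move=> xD /andP[r0 r1]; have [x0 x1] := andP xD.
have rh : 0 <= r <= 2^-1 by apply/andP; split; lra.
have [t0 tp t2 ct] := acos_nneg xD rh.
have xD' : -1 <= x <= 1 by apply/andP; split; lra.
set t := acos x in t0 tp t2 ct *.
have tr0 : 0 < t + r by lra.
have m0 : 0 < (t + r) ^+ 2 by rewrite exprn_gt0.
have cN : - 2^-1 <= cos (t + r) by lra.
have tr1 : 0 <= t + r / 2 by lra.
pose r' := 3 / 4 * r.
have tr2 : t + r / 2 <= t + r' by rewrite /r'; lra.
have tr3 : t + r' <= pi by rewrite /r'; lra.
have tr4 : 0 <= t + r' by rewrite /r'; lra.
have cN' : - 2^-1 <= cos (t + r').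
  by apply: (le_trans cN); apply: cos_le => //; rewrite /r'; lra.
have /andP[d1 _] := cos_diff_bounds tr1 tr2 tr3 cN'.
have cle : cos (t + r') <= cos (t + r / 2) by exact: cos_le.
pose B := 2 `^ `|b| * 32 `^ `|a| : R.
have B0 : 0 < B by rewrite mulr_gt0// powR_gt0.
pose M := ((t + r) ^+ 2) `^ a / B.
have M0 : 0 <= M by rewrite divr_ge0 ?powR_ge0 ?(ltW B0).
have angle y : cos (t + r') <= y <= cos (t + r / 2) ->
    [/\ -1 <= y <= 1, - 2^-1 <= y & t + r / 2 <= acos y <= t + r'].
  move=> /andP[y0 y1].
  have yD : -1 <= y <= 1 by rewrite (le_trans (cos_geN1 _) y0) (le_trans y1 (cos_le1 _)).
  split => //; first exact: le_trans cN' y0.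
  apply/andP; split.
    rewrite -(@acos_cos (t + r / 2)) ?tr1 ?(le_trans tr2)//; apply: acos_le => //.
    by rewrite cos_le1 cos_geN1.
  rewrite -(@acos_cos (t + r')) ?tr4//; apply: acos_le => //.
  by rewrite cos_le1 cos_geN1.
have h1 : M * (cos (t + r / 2) - cos (t + r')) <= V x r.
  apply: (@le_trans _ _ (fine (mu `[cos (t + r'), cos (t + r / 2)]%classic))).
    apply: mu_itv_ge => //; rewrite ?cos_le1 ?cos_geN1// => y yi.
    have [yD yh /andP[u1 u2]] := angle y yi.
    have p0 := acos_ge0 yD; have p1 := acos_lepi yD.
    have cp : - 2^-1 <= cos (acos y) by rewrite cos_acos.
    have /andP[q1 q2] := onem_cos_bounds p0 p1 cp.
    rewrite cos_acos// in q1 q2.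
    have yh2 : - 2^-1 <= y <= 1 by rewrite yh; case/andP: yD.
    have s1 : ((t + r) / 2) ^+ 2 <= acos y ^+ 2 by apply: lerXn2r; rewrite ?nnegrE//; lra_from u1 t0 r0.
    have s2 : acos y ^+ 2 <= (t + r) ^+ 2 by apply: lerXn2r; rewrite ?nnegrE//; rewrite /r' in u2; lra_from u2 r0 t0.
    rewrite expr_div_n in s1.
    rewrite /M ler_pdivrMr// /B.
    have w1 := jacobi_weight_ge a b yh2.
    have y0 : 0 < 1 - y by lra_from q1 s1 m0.
    have w2 : ((t + r) ^+ 2) `^ a <= 32 `^ `|a| * (1 - y) `^ a.
      by apply: powR_ratio => //; lra_from q1 q2 s1 s2 m0.
    apply: (le_trans w2); rewrite [leRHS](_ : _ = 32 `^ `|a| * (2 `^ `|b| * jacobi_weight a b y)); last by ring.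
    by rewrite ler_wpM2l ?powR_ge0.
  apply: fine_measure_jacobi_le => //; first exact: measurable_jacobi_ball.
  move=> y /=; rewrite in_itv/= => yi; have [yD yh /andP[u1 u2]] := angle y yi.
  split => //; rewrite /jacobi_dist -/t ltr_norml.
  by rewrite /r' in u2; apply/andP; split; lra_from u1 u2 r0.
have h2 : (t + r) * r / 32 <= cos (t + r / 2) - cos (t + r').
  apply: le_trans d1; rewrite /r'.
  have : 0 <= t * r by rewrite mulr_ge0// ltW.
  have : 0 <= r * r by rewrite mulr_ge0// ltW.
  rewrite (_ : t + 3 / 4 * r - (t + r / 2) = r / 4); last by field.
  lra.
have h3 := ler_wpM2l M0 h2.
have B32 : 0 < 32 * B by rewrite mulr_gt0.
rewrite -(ler_pM2l B32) in h1; rewrite -(ler_pM2l B32) in h3.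
rewrite (_ : 32 * 2 `^ `|b| * 32 `^ `|a| = 32 * B); last by rewrite /B mulrA.
apply: (le_trans _ h1); apply: (le_trans _ h3).
by rewrite /vol_model /M le_eqVlt; apply/orP; left; apply/eqP; field; rewrite gt_eqF.
Qed.

Lemma vol_model_double t r : 0 <= t -> 0 < r -> vol_model t (2 * r) <= 4 * 4 `^ `|a| * vol_model t r.
Proof.
move=> t0 r0; rewrite /vol_model.
have tr : 0 < t + r by lra.
have m0 : 0 < (t + r) ^+ 2 by rewrite exprn_gt0.
have m1 : 0 < (t + 2 * r) ^+ 2 by rewrite exprn_gt0//; lra.
have q1 : (t + 2 * r) ^+ 2 <= (2 * (t + r)) ^+ 2 by apply: lerXn2r; rewrite ?nnegrE//; lra.
have q2 : (t + r) ^+ 2 <= (t + 2 * r) ^+ 2 by apply: lerXn2r; rewrite ?nnegrE//; lra.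
rewrite exprMn (_ : 2 ^+ 2 = 4) in q1; last by ring.
have q3 : ((t + 2 * r) ^+ 2) `^ a <= 4 `^ `|a| * ((t + r) ^+ 2) `^ a by apply: powR_ratio => //; lra.
rewrite [leRHS](_ : _ = (2 * r * (2 * (t + r))) * (4 `^ `|a| * ((t + r) ^+ 2) `^ a)); last by ring.
apply: ler_pM => //; rewrite ?powR_ge0 ?mulr_ge0//; try lra.
by rewrite ler_wpM2l//; lra.
Qed.

End volume.

Lemma vol_lower a b : -1 < a -> -1 < b -> exists2 c : R, 0 < c & forall x : R, 0 <= x <= 1 ->
  c <= jacobi_vol a b x 16^-1.
Proof.
move=> ha hb; pose A := 32 * 2 `^ `|b| * 32 `^ `|a| : R.
have A0 : 0 < A by rewrite !mulr_gt0// powR_gt0.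
have k0 : (0 : R) < 256 by rewrite ltr0n.
have p0 : 0 < 256 `^ `|a| := powR_gt0 `|a| k0.
exists ((256 * 256 `^ `|a|)^-1 / A).
  by apply: divr_gt0 A0; rewrite invr_gt0; exact: mulr_gt0 k0 p0.
move=> x xD.
have rD : 0 < (16^-1 : R) <= 8^-1 by apply/andP; split; lra.
have rh : 0 <= (16^-1 : R) <= 2^-1 by apply/andP; split; lra.
have [t0 _ t2 _] := acos_nneg xD rh.
rewrite ler_pdivrMr// [leRHS]mulrC; apply: (le_trans _ (vol_ge ha hb xD rD)).
rewrite /vol_model; set t := acos x in t0 t2 *.
have m0 : 0 < (t + 16^-1) ^+ 2 by rewrite exprn_gt0//; lra.
have q1 : (16^-1) ^+ 2 <= (t + 16^-1) ^+ 2 by apply: lerXn2r; rewrite ?nnegrE//; lra.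
have q2 : (t + 16^-1) ^+ 2 <= 3 ^+ 2 by apply: lerXn2r; rewrite ?nnegrE//; lra.
rewrite (_ : (16^-1 : R) ^+ 2 = 256^-1) in q1; last by field.
rewrite (_ : (3 : R) ^+ 2 = 9) in q2; last by ring.
have := @powR_ratio _ a 256 1 ((t + 16^-1) ^+ 2) ltr01 m0; rewrite powR1 => q3.
have {}q3 : 1 <= 256 `^ `|a| * ((t + 16^-1) ^+ 2) `^ a by apply: q3; lra_from q1 q2.
move: (256 `^ `|a|) p0 q3 => p p0 q3; rewrite invfM; apply: ler_pM.
- by rewrite invr_ge0 (ltW k0).
- by rewrite invr_ge0 (ltW p0).
- lra_from t0.
- by rewrite -(ler_pM2l p0) mulfV ?(gt_eqF p0).
Qed.

(** For r <= 1/16 the two-sided comparison with the model gives doubling; for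
    larger radii the ball has measure bounded below, so it is comparable to the
    whole interval.  Negative centres follow by reflection. *)
Lemma vol_doubling a b : -1 < a -> -1 < b -> exists2 C : R, 1 <= C & forall x r : R, -1 <= x <= 1 -> 0 < r ->
  [/\ 0 < jacobi_vol a b x r, jacobi_vol a b x (2 * r) <= C * jacobi_vol a b x r &
   16^-1 <= r -> fine (jacobi_measure a b DD) <= C * jacobi_vol a b x r].
Proof.
have aux a' b' : -1 < a' -> -1 < b' -> exists2 C : R, 1 <= C & forall x r : R, 0 <= x <= 1 -> 0 < r ->
  [/\ 0 < jacobi_vol a' b' x r, jacobi_vol a' b' x (2 * r) <= C * jacobi_vol a' b' x r &
   16^-1 <= r -> fine (jacobi_measure a' b' DD) <= C * jacobi_vol a' b' x r].
  move=> ha hb; have [c c0 hc] := vol_lower ha hb.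
  pose A := 32 * 2 `^ `|b'| * 32 `^ `|a'| : R.
  have A0 : 0 < A by rewrite !mulr_gt0// powR_gt0.
  pose B := 2 `^ `|b'| * (3 / (a' + 1) + 2 * 72 `^ `|a'|) : R.
  have B0 : 0 <= B.
    rewrite mulr_ge0 ?powR_ge0// addr_ge0 ?mulr_ge0 ?powR_ge0// invr_ge0; lra.
  pose T := fine (jacobi_measure a' b' DD).
  have T0 : 0 <= T by rewrite fine_ge0// measure_ge0.
  pose K := B * (4 * 4 `^ `|a'|) * A + T / c + 1.
  have K1 : 0 <= B * (4 * 4 `^ `|a'|) * A by apply: mulr_ge0; [apply: mulr_ge0 => //; rewrite mulr_ge0 ?powR_ge0|exact: ltW].
  have K2 : 0 <= T / c by rewrite divr_ge0// ltW.
  have K0 : 1 <= K by rewrite /K; lra.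
  exists K => // x r xD r0.
  have T1 : 16^-1 <= r -> c <= jacobi_vol a' b' x r.
    by move=> r1; apply: le_trans (hc x xD) _; exact: le_vol.
  have T2 : 16^-1 <= r -> T <= K * jacobi_vol a' b' x r.
    move=> /T1 h; have v0 : 0 <= jacobi_vol a' b' x r by apply: le_trans h; exact: ltW.
    have h1 : T <= T / c * jacobi_vol a' b' x r.
      by rewrite mulrAC ler_pdivlMr// ler_wpM2l.
    apply: (le_trans h1); rewrite ler_wpM2r// /K; lra.
  have [r1|r1] : 16^-1 <= r \/ r <= 16^-1 by have [?|/ltW ?] := leP 16^-1 r; [left|right].
    split; [exact: lt_le_trans (T1 r1)| |exact: T2].
    by apply: le_trans (T2 r1); exact: vol_le_total.
  have rD : 0 < r <= 8^-1 by apply/andP; split; lra.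
  have rD2 : 0 < 2 * r <= 8^-1 by apply/andP; split; lra.
  have rh : 0 <= r <= 2^-1 by apply/andP; split; lra.
  have [t0 _ t2 _] := acos_nneg xD rh.
  have vg := vol_ge ha hb xD rD; rewrite -/A in vg.
  have vm0 : 0 < vol_model a' (acos x) r.
    by rewrite /vol_model !mulr_gt0 ?powR_gt0 ?exprn_gt0//; lra.
  have v0 : 0 < jacobi_vol a' b' x r by rewrite -(pmulr_rgt0 _ A0); exact: lt_le_trans vg.
  split => //.
  have vl := vol_le ha hb xD rD2; rewrite -/B in vl.
  apply: (le_trans vl).
  apply: (@le_trans _ _ (B * (4 * 4 `^ `|a'|) * A * jacobi_vol a' b' x r)).
    have vmd := vol_model_double a' t0 r0.
    have D0 : 0 <= 4 * 4 `^ `|a'| :> R by rewrite mulr_ge0 ?powR_ge0.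
    have h1 := ler_wpM2l B0 vmd; have h2 := ler_wpM2l B0 (ler_wpM2l D0 vg).
    apply: (le_trans h1); apply: (le_trans h2).
    by rewrite le_eqVlt !mulrA eqxx.
  by rewrite ler_wpM2r ?(ltW v0)// /K; lra.
move=> ha hb; have [C C1 H] := aux a b ha hb; have [C' C1' H'] := aux b a hb ha.
have tot : fine (jacobi_measure b a DD) = fine (jacobi_measure a b DD).
  rewrite measure_jacobiN//; congr (fine (jacobi_measure a b _)).
  by apply/seteqP; split=> y /=; rewrite !in_itv/= => /andP[? ?]; apply/andP; split; lra.
exists (C + C') => [|x r xD r0]; first lra_from C1 C1'.
have mono (K V : R) : 0 <= V -> K <= C * V -> K <= (C + C') * V.
  by move=> V0 h; apply: (le_trans h); rewrite ler_wpM2r//; lra_from C1'.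
have mono' (K V : R) : 0 <= V -> K <= C' * V -> K <= (C + C') * V.
  by move=> V0 h; apply: (le_trans h); rewrite ler_wpM2r//; lra_from C1.
have [x1 x2] := andP xD.
have [x0|x0] := leP 0 x.
  have xD' : 0 <= x <= 1 by rewrite x0.
  have [h1 h2 h3] := H x r xD' r0; split; first exact: h1.
  - by apply: mono h2; exact: ltW.
  - by move=> /h3 h4; apply: mono h4; exact: ltW.
have xD' : 0 <= - x <= 1 by apply/andP; split; [lra_from x0|lra_from x1].
have [h1 h2 h3] := H' (- x) r xD' r0.
rewrite !(jacobi_volN _ _ _ xD) tot in h1 h2 h3; split; first exact: h1.
- by apply: mono' h2; exact: ltW.
- by move=> /h3 h4; apply: mono' h4; exact: ltW.
Qed.

End ball_volume.

(** * Positivity of the kernel and supersolutions *)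

Section bounded_multiplication.
Context d (T : measurableType d) (R : realType) (mu : {measure set T -> \bar R}).
Implicit Types (f g k : T -> R).

Lemma L2_bM k (M : R) g : measurable_fun setT k -> (forall x, `|k x| <= M) -> L2 mu g ->
  L2 mu (fun x => k x * g x) /\ L2nrm mu (fun x => k x * g x) <= M * L2nrm mu g.
Proof.
move=> mk kM hg; have mg := L2_measurable hg.
have M0 : 0 <= M by apply: le_trans (kM point).
have i1 : mu.-integrable setT (EFin \o (fun x => k x * g x * (k x * g x))).
  have := @integrable_bM _ _ _ mu (fun x => k x * k x) (fun x => g x * g x) (M * M).
  rewrite (_ : (fun x => k x * k x * (g x * g x)) = (fun x => k x * g x * (k x * g x))); last by apply/funext => x; ring.
  apply; [exact: measurable_funM| |exact: L2_integrableM].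
  by move=> x; rewrite normrM ler_pM.
have h1 : L2 mu (fun x => k x * g x) by apply: L2P => //; exact: measurable_funM.
split => //; rewrite -ler_sqr ?nnegrE ?mulr_ge0 ?L2nrm_ge0// exprMn !L2nrm_sqr.
rewrite /L2dot -RintegralZl//; last exact: L2_integrableM.
apply: le_Rintegral => //.
  by apply: integrable_EFinZ => //; exact: L2_integrableM.
move=> x _; rewrite (_ : k x * g x * (k x * g x) = k x ^+ 2 * (g x * g x)); last by ring.
by rewrite ler_wpM2r -?expr2 ?sqr_ge0// -(real_normK (num_real (k x))) lerXn2r ?nnegrE.
Qed.

End bounded_multiplication.

Section kernel_positivity.
Context {R : realType} (a b : R).
Hypotheses (ha : -1 < a) (hb : -1 < b).
Notation TR := (measurableTypeR R).
Notation mu := (jacobi_measure a b).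
Notation DD := (`[(-1)%R, 1%R]%classic : set TR).
Notation lam := (jacobi_eigenvalue a b).
Variable P : nat -> {poly R}.
Hypothesis HP : jacobi_polynomials a b P.
Variables (C : R) (q : nat).
Hypothesis C1 : 1 <= C.
Hypothesis PB : forall k (x : R), -1 <= x <= 1 -> `|(P k).[x]| <= C * k.+1%:R ^+ q.
Local Notation hp p := ((fun x : TR => (horner p) x) \_ DD).
Local Notation e := (fun k => hp (P k)).
Local Notation hk := (heat_kernel (e : nat -> TR -> R) lam).
Local Notation K := (jacobi_heat_kernel a b P).
Local Notation dot := (L2dot mu).
Local Notation nrm := (L2nrm mu).

Lemma heat_kernel_out (t x y : R) : ~~ (-1 <= y <= 1) -> hk t x y = 0.
Proof.
move=> yD; rewrite /heat_kernel (_ : (fun k => _) = (fun=> 0)).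
  by rewrite (_ : series _ = (fun=> 0)) ?lim_cst//; apply/funext => n; rewrite seriesEnat/= big1.
by apply/funext => k; rewrite [X in _ * X]restrictDE (negbTE yD) mulr0.
Qed.

Lemma heat_kernel_bounded t x : 0 < t -> -1 <= x <= 1 -> exists2 M : R, 0 <= M & forall y, `|hk t x y| <= M.
Proof.
move=> t0 xD; have [M hM] := kernel_bounded ha hb PB t0.
have M0 : 0 <= M by apply: le_trans (hM x x xD xD).
exists M => // y; have [yD|yD] := boolP (-1 <= y <= 1).
  by rewrite heat_kernel_D// hM.
by rewrite heat_kernel_out// normr0.
Qed.

Lemma L2dotMl (k f g : TR -> R) : dot (fun x => k x * f x) g = dot (fun x => k x * g x) f.
Proof. by rewrite /L2dot; apply: eq_Rintegral => x _; ring. Qed.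

Let quad_bound (M N h eps d1 d2 d3 n1 n2 nu : R) : 0 <= M -> 0 <= N -> h <= 1 ->
  (M * (2 * N + 1) + 1) * h <= eps -> 0 <= n1 -> n1 <= M * N -> 0 <= n2 -> n2 <= M * (N + h) ->
  0 <= nu -> nu <= h -> `|d1| <= n1 * nu -> `|d2| <= n2 * nu -> 0 <= d3 -> - eps <= d1 + d2 + d3.
Proof.
move=> M0 N0 h1 He n10 n1M n20 n2M nu0 nuh; rewrite !ler_norml => /andP[b1 _] /andP[b2 _] d30.
have c1 : n1 * nu <= M * N * h by apply: ler_pM.
have h2 : M * (N + h) <= M * (N + 1) by rewrite ler_wpM2l//; lra.
have c2 : n2 * nu <= M * (N + 1) * h by apply: ler_pM => //; exact: le_trans h2.
lra.
Qed.

(** For a polynomial f the expression is the semigroup applied to f^2, evaluated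
    at x, which is nonnegative by the maximum principle.  Density of polynomials and
    boundedness of the kernel extend it to L2. *)
Lemma kernel_quad_ge0 t x f : 0 < t -> -1 <= x <= 1 -> L2 mu f -> 0 <= dot (fun y => hk t x y * f y) f.
Proof.
move=> t0 xD hf; have [M M0 hM] := heat_kernel_bounded t0 xD.
have mk : measurable_fun setT (hk t x) := measurable_heat_kernel ha hb C1 PB x t0.
apply/ler_addgt0Pr => eps e0; rewrite addrC -lerBlDl sub0r.
pose A := M * (2 * nrm f + 1) + 1.
have n0 := L2nrm_ge0 mu f.
have A1 : 0 <= M * (2 * nrm f + 1) by rewrite mulr_ge0//; lra.
have A0 : 0 < A := ltr_wpDl A1 ltr01.
pose h := Num.min 1 (eps / A).
have h0 : 0 < h by rewrite lt_min ltr01 divr_gt0.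
have [h1 h2] : h <= 1 /\ h <= eps / A by rewrite !ge_min !lexx orbT.
have [_ /(_ h h0)[p hp]] := poly_dense ha hb hf.
have Lp := L2_hp ha hb p; have Lu := L2B hf Lp.
set g := (fun x : TR => (horner p) x) \_ DD in hp Lp Lu.
pose u z := f z - g z.
have [Lkf nkf] := L2_bM mk hM hf; have [Lkg nkg] := L2_bM mk hM Lp.
have E : dot (fun y => hk t x y * f y) f =
    dot (fun y => hk t x y * f y) u + dot (fun y => hk t x y * g y) u + dot (fun y => hk t x y * g y) g.
  have E1 : dot (fun y => hk t x y * f y) u = dot (fun y => hk t x y * f y) f - dot (fun y => hk t x y * f y) g by exact: L2dotBr.
  have E2 : dot (fun y => hk t x y * g y) u = dot (fun y => hk t x y * g y) f - dot (fun y => hk t x y * g y) g by exact: L2dotBr.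
  by rewrite E1 E2 (L2dotMl _ f g); ring.
have pos : 0 <= dot (fun y => hk t x y * g y) g.
  rewrite /L2dot Rintegral_setT_D; last first.
    by apply: measurable_funM; [exact: L2_measurable Lkg|exact: L2_measurable Lp].
  have -> : \int[mu]_(y in DD) (hk t x y * g y * g y) = \int[mu]_(y in DD) (K t x y * (p * p).[y]).
    apply: eq_Rintegral => y; rewrite inE/= in_itv/= => yD.
    by rewrite heat_kernel_D// /g restrictDE yD hornerM mulrA.
  rewrite (kernel_poly ha hb HP C1 PB)//; apply: heat_poly_ge0 => //; first exact: ltW.
  by move=> y _; rewrite hornerM -expr2 sqr_ge0.
have ng : nrm g <= nrm f + h.
  have := ler_L2nrm Lp hf; rewrite L2nrm_distC => h3; apply: (le_trans h3).
  by rewrite lerD2l ltW.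
rewrite E; apply: (quad_bound M0 n0 h1 _ (L2nrm_ge0 _ _) nkf (L2nrm_ge0 _ _) _ (L2nrm_ge0 mu u) _
  (ler_L2dot Lkf Lu) (ler_L2dot Lkg Lu) pos) => //.
- by rewrite mulrC -ler_pdivlMr.
- by apply: (le_trans nkg); rewrite ler_wpM2l.
- exact: ltW.
Qed.

(** Test with f the square root of the negative part n of the kernel: the product
    of the kernel with f^2 is - n^2. *)
Lemma kernel_ae_ge0 t x : 0 < t -> -1 <= x <= 1 ->
  hk t x = (fun y => Num.max 0 (hk t x y)) %[ae mu].
Proof.
move=> t0 xD; have [M M0 hM] := heat_kernel_bounded t0 xD.
have mk : measurable_fun setT (hk t x) := measurable_heat_kernel ha hb C1 PB x t0.
pose n y := Num.max 0 (- hk t x y).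
have mn : measurable_fun setT n by apply: measurable_maxr => //; exact: measurableT_comp.
have n0 y : 0 <= n y by rewrite le_max lexx.
have nM y : `|n y| <= M.
  by rewrite ger0_norm// ge_max M0/= (le_trans (ler_norm _))// normrN.
pose f y := Num.sqrt (n y).
have mf : measurable_fun setT f.
  by apply: measurableT_comp mn; apply: continuous_measurable_fun; exact: sqrt_continuous.
have Lf : L2 mu f.
  apply: (@jacobi_bounded_L2 _ _ _ ha hb _ (Num.sqrt M)) => // y.
  by rewrite ger0_norm ?sqrtr_ge0// ler_wsqrtr// (le_trans (ler_norm _)).
have Ln : L2 mu n by exact: (jacobi_bounded_L2 ha hb mn nM).
have := kernel_quad_ge0 t0 xD Lf.
have -> : dot (fun y => hk t x y * f y) f = - dot n n.
  have -> : - dot n n = (-1) * dot n n + dot (fun=> 0) n by rewrite L2dot0l addr0 mulN1r.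
  rewrite -L2dot_linl//; last exact: L2_0.
  apply: eq_Rintegral => y _; rewrite -mulrA -expr2 sqr_sqrtr// addr0.
  by rewrite /n; case: (leP 0 (- hk t x y)) => h; ring.
rewrite oppr_ge0 => h.
have d0 : dot n n = 0 by apply/eqP; rewrite eq_le h L2dot_ge0.
have : nrm n = 0 by rewrite /L2nrm d0 sqrtr0.
move=> /(L2nrm_eq0 Ln); apply: filterS => y /= ny _; have := ny I.
rewrite /n; have [h1|h1] := leP 0 (hk t x y) => // h2.
have : - hk t x y <= Num.max 0 (- hk t x y) by rewrite le_max lexx orbT.
rewrite h2; lra.
Qed.

(** The kernel at time t is the integral of a product of two kernels at time t/2,
    which are nonnegative almost everywhere; this removes the exceptional set. *)
Lemma kernel_ge0 t x y : 0 < t -> -1 <= x <= 1 -> -1 <= y <= 1 -> 0 <= K t x y.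
Proof.
move=> t0 xD yD; have t2 : 0 < t / 2 by lra.
have -> : t = t / 2 + t / 2 by field.
rewrite -(kernel_semigroup ha hb HP C1 PB t2 t2 xD yD).
have [M M0 hM] := heat_kernel_bounded t2 xD; have [N N0 hN] := heat_kernel_bounded t2 yD.
have mx : measurable_fun setT (hk (t / 2) x) := measurable_heat_kernel ha hb C1 PB x t2.
have my : measurable_fun setT (hk (t / 2) y) := measurable_heat_kernel ha hb C1 PB y t2.
have Lx : L2 mu (hk (t / 2) x) by exact: (jacobi_bounded_L2 ha hb mx hM).
have Ly : L2 mu (hk (t / 2) y) by exact: (jacobi_bounded_L2 ha hb my hN).
have pm (g : TR -> R) : measurable_fun setT g -> measurable_fun setT (fun y => Num.max 0 (g y) : R).
  by move=> mg; exact: measurable_maxr.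
have Lx' := L2_ae (pm _ mx) Lx (kernel_ae_ge0 t2 xD).
have Ly' := L2_ae (pm _ my) Ly (kernel_ae_ge0 t2 yD).
have -> : \int[mu]_(z in DD) (K (t / 2) x z * K (t / 2) z y) = dot (hk (t / 2) x) (hk (t / 2) y).
  rewrite /L2dot Rintegral_setT_D; last exact: measurable_funM.
  apply: eq_Rintegral => z; rewrite inE/= in_itv/= => zD.
  by rewrite !heat_kernel_D// (kernelC _ _ _ (t / 2) z y).
rewrite (L2dot_ae Lx Lx' Ly (kernel_ae_ge0 t2 xD)) L2dotC.
rewrite (L2dot_ae Ly Ly' Lx' (kernel_ae_ge0 t2 yD)).
by apply: Rintegral_ge0 => z _; rewrite mulr_ge0// le_max lexx.
Qed.

Definition bounded_meas (f : TR -> R) : Prop :=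
  measurable_fun DD f /\ exists M : R, forall x, -1 <= x <= 1 -> `|f x| <= M.

Lemma bounded_meas_integrable f (A : set TR) : bounded_meas f -> measurable A -> A `<=` DD ->
  mu.-integrable A (EFin \o f).
Proof.
move=> [mf [M hM]] mA AD; apply: (@integrable_jacobi_bounded _ _ _ ha hb _ _ M) => //.
  exact: measurable_funS mf.
by move=> x /AD; rewrite /= in_itv/= => xD; exact: hM.
Qed.

Lemma bounded_measM f g : bounded_meas f -> bounded_meas g -> bounded_meas (fun x => f x * g x).
Proof.
move=> [mf [M hM]] [mg [N hN]]; split; first exact: measurable_funM.
by exists (M * N) => x xD; rewrite normrM ler_pM ?hM ?hN.
Qed.

Lemma bounded_measD f g : bounded_meas f -> bounded_meas g -> bounded_meas (fun x => f x + g x).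
Proof.
move=> [mf [M hM]] [mg [N hN]]; split; first exact: measurable_funD.
by exists (M + N) => x xD; rewrite (le_trans (ler_normD _ _))// lerD ?hM ?hN.
Qed.

Lemma bounded_meas_cst (c : R) : bounded_meas (fun=> c).
Proof. by split; [exact: measurable_cst|exists `|c|]. Qed.

Lemma bounded_meas_horner (p : {poly R}) : bounded_meas (horner p).
Proof.
split; first exact: measurable_horner.
by have [M _ hM] := horner_bounded p; exists M.
Qed.

Lemma bounded_meas_kernel t x : 0 < t -> -1 <= x <= 1 -> bounded_meas (K t x).
Proof.
move=> t0 xD; split; first exact: (measurable_jacobi_kernel ha hb C1 PB t0 xD measurable_DD (@subset_refl _ DD)).
by have [M hM] := kernel_bounded ha hb PB t0; exists M => y; exact: hM.
Qed.

Lemma bounded_meas_cont (f : R -> R) : {within `[(-1)%R, 1%R], continuous f} -> bounded_meas f.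
Proof.
move=> cf; split; first exact: subspace_continuous_measurable_fun.
have cn : {within `[(-1)%R, 1%R], continuous (fun x : R => `|f x|)}.
  by move=> x; apply: cvg_norm; exact: cf.
have [|x0 _ hx0] := @EVT_max R _ (-1) 1 _ cn; first lra.
by exists `|f x0| => x xD; apply: hx0; rewrite in_itv.
Qed.

(** Approximate G from below by a polynomial r, uniformly within eps; the maximum
    principle bounds the semigroup on r, and positivity and unit mass bound the
    error by eps. *)
Lemma kernel_test (G G1 G2 : R -> R) (M t x : R) : 0 <= M -> 0 < t -> -1 <= x <= 1 ->
  (forall y : R, -1 <= y <= 1 -> is_derive y 1 G (G1 y)) ->
  (forall y : R, -1 <= y <= 1 -> is_derive y 1 G1 (G2 y)) ->
  (forall y : R, -1 <= y <= 1 -> jacobi_op2 a b G1 G2 y <= M * G y) ->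
  (forall y : R, -1 <= y <= 1 -> 0 <= G y) ->
  \int[mu]_(y in DD) (K t x y * G y) <= expR (2 * M * t) * G x.
Proof.
move=> M0 t0 xD dG dG1 LG G0; apply/ler_addgt0Pr => eps e0.
have cG : {within `[(-1)%R, 1%R], continuous G}.
  by apply: derivable_within_continuous => z; rewrite in_itv/= => zD; case: (dG z zD).
have cG1 : {within `[(-1)%R, 1%R], continuous G1}.
  by apply: derivable_within_continuous => z; rewrite in_itv/= => zD; case: (dG1 z zD).
have [_ [B hB]] := bounded_meas_cont cG1.
have lip y z : -1 <= y <= 1 -> -1 <= z <= 1 -> `|G y - G z| <= B * `|y - z|.
  wlog yz : y z / y <= z.
    move=> H yD zD; have [yz|/ltW zy] := leP y z; first exact: H.
    by rewrite distrC (distrC y) H.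
  move=> yD zD.
  have sub u : u \in `[y, z] -> -1 <= u <= 1.
    rewrite in_itv/=; case/andP: yD => ? _; case/andP: zD => _ ? /andP[? ?].
    by apply/andP; split; lra.
  have d (u : R) : u \in `]y, z[ -> is_derive u 1 G (G1 u).
    by move=> ui; apply: dG; apply: sub; exact: subset_itv_oo_cc ui.
  have [|c ci E] := MVT_segment yz d.
    by apply: derivable_within_continuous => u /sub uD; case: (dG u uD).
  rewrite distrC (distrC y) E normrM ler_wpM2r//; exact/hB/sub.
have e2 : 0 < eps / 2 by lra.
have [p hp] := weierstrass_lipschitz e2 lip.
(* Shifting by eps/2 makes the approximation lie below G. *)
pose r := p - (eps / 2)%:P.
have rE y : r.[y] = p.[y] - eps / 2 by rewrite /r hornerD hornerN hornerC.
have rG y : -1 <= y <= 1 -> r.[y] <= G y.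
  by move=> /hp; rewrite ler_norml rE => /andP[]; lra.
have Gr y : -1 <= y <= 1 -> G y <= r.[y] + eps.
  by move=> /hp; rewrite ler_norml rE => /andP[]; lra.
have bK := bounded_meas_kernel t0 xD.
have H := heat_poly_le ha hb HP M0 (ltW t0) dG dG1 LG G0 rG xD.
apply: (@le_trans _ _ (\int[mu]_(y in DD) (K t x y * r.[y] + K t x y * eps))).
  apply: le_Rintegral => //.
  - apply: bounded_meas_integrable => //; apply: bounded_measM => //; exact: bounded_meas_cont.
  - apply: bounded_meas_integrable => //; apply: bounded_measD; apply: bounded_measM => //.
      exact: bounded_meas_horner.
    exact: bounded_meas_cst.
  - move=> y; rewrite /= in_itv/= => yD; rewrite -mulrDr ler_wpM2l ?kernel_ge0//; exact: Gr.
rewrite RintegralD//; last first.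
- by apply: bounded_meas_integrable => //; apply: bounded_measM => //; exact: bounded_meas_cst.
- by apply: bounded_meas_integrable => //; apply: bounded_measM => //; exact: bounded_meas_horner.
rewrite (kernel_poly ha hb HP C1 PB)// RintegralZr//; last exact: bounded_meas_integrable.
by rewrite (kernel_mass ha hb HP C1 PB)// mul1r lerD2r.
Qed.

End kernel_positivity.

(** * Exponential tails *)

Section exponential_test_functions.
Context {R : realType}.
Variables (l s w : R).
Hypotheses (l0 : 0 < l) (s2 : s ^+ 2 = 1) (w2 : w ^+ 2 = 1).
Implicit Types x y : R.

(** The chord from x to the endpoint w, smoothed at scale 1/l, with w = 1 or -1.
    Unlike the angle it is a smooth function of x up to the endpoints. *)
Definition chord_smooth x := Num.sqrt (l ^- 2 + 2 * (1 - w * x)).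
Local Notation h := chord_smooth.
(** The sign s = 1 or -1 gives test functions that grow in either direction. *)
Definition chord_exp x := expR (s * l * h x).
Local Notation G := chord_exp.
Definition chord_exp1 x := (- w * s * l / h x) * G x.
Definition chord_exp2 x := (l ^+ 2 / h x ^+ 2 - s * l / h x ^+ 3) * G x.

Lemma norm_sqr1 (z : R) : z ^+ 2 = 1 -> `|z| = 1.
Proof.
move=> z2; have : `|z| ^+ 2 == 1 by rewrite real_normK ?num_real// z2.
by rewrite sqrf_eq1 => /orP[/eqP//|/eqP z1]; have := normr_ge0 z; rewrite z1 ler0N1.
Qed.

Lemma onemM_bounds x : -1 <= x <= 1 -> 0 <= 1 - w * x <= 2.
Proof.
move=> xD; have : `|w * x| <= 1 by rewrite normrM (norm_sqr1 w2) mul1r ler_norml.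
by rewrite ler_norml => /andP[? ?]; apply/andP; split; lra.
Qed.

Lemma chord_smooth_sqr x : -1 <= x <= 1 -> h x ^+ 2 = l ^- 2 + 2 * (1 - w * x).
Proof.
move=> /onemM_bounds/andP[h1 h2]; rewrite sqr_sqrtr// addr_ge0 ?mulr_ge0// invr_ge0 exprn_ge0//.
exact: ltW.
Qed.

Lemma chord_smooth_ge x : -1 <= x <= 1 -> l^-1 <= h x.
Proof.
move=> xD; have li : 0 <= l^-1 by rewrite invr_ge0 ltW.
rewrite -[leLHS](ger0_norm li) -sqrtr_sqr ler_wsqrtr// exprVn lerDl.
by have /andP[? _] := onemM_bounds xD; rewrite mulr_ge0.
Qed.

Lemma chord_smooth_gt0 x : -1 <= x <= 1 -> 0 < h x.
Proof. by move=> xD; apply: lt_le_trans (chord_smooth_ge xD); rewrite invr_gt0. Qed.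

Lemma is_derive_chord_smooth x : -1 <= x <= 1 -> is_derive x 1 h (- w / h x).
Proof.
move=> xD; have h0 := chord_smooth_gt0 xD.
have u0 : 0 < l ^- 2 + 2 * (1 - w * x) by rewrite -chord_smooth_sqr// exprn_gt0.
have d1 := is_derive1_sqrt u0.
have d2 : is_derive x 1 (fun x => l ^- 2 + 2 * (1 - w * x)) (- (2 * w)).
  by apply: is_derive_eq; rewrite /GRing.scale/=; ring.
have := is_derive1_comp (g := fun x => l ^- 2 + 2 * (1 - w * x)) d1 d2; rewrite -/(h x) => d3.
by apply: (is_derive_eq d3); rewrite -/(h x); field; rewrite gt_eqF.
Qed.

Lemma is_derive_chord_exp x : -1 <= x <= 1 -> is_derive x 1 G (chord_exp1 x).
Proof.
move=> xD; have h0 := chord_smooth_gt0 xD.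
have d1 := is_derive_expR (s * l * h x).
have d2 := is_deriveZ (s * l) (is_derive_chord_smooth xD).
have d3 := is_derive1_comp (g := fun x => s * l * h x) d1 d2.
by apply: (is_derive_eq d3); rewrite /chord_exp1 /GRing.scale/= /chord_exp; ring.
Qed.

Lemma is_derive_chord_exp1 x : -1 <= x <= 1 -> is_derive x 1 chord_exp1 (chord_exp2 x).
Proof.
move=> xD; have h0 := chord_smooth_gt0 xD.
have hn : h x != 0 by rewrite gt_eqF.
have d1 := is_deriveV hn (is_derive_chord_smooth xD).
have d2 : is_derive x 1 (fun y : R => - w * s * l / h y) (- w * s * l * (- h x ^- 2 * (- w / h x))).
  exact (is_deriveZ (- w * s * l) d1).
have d3 := is_deriveM d2 (is_derive_chord_exp xD).
apply: (is_derive_eq d3); rewrite /chord_exp1 /chord_exp2 /GRing.scale/=.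
have E : w ^+ 2 * s ^+ 2 = 1 by rewrite w2 s2 mulr1.
transitivity ((w ^+ 2 * s ^+ 2 * l ^+ 2 / h x ^+ 2 - w ^+ 2 * s * l / h x ^+ 3) * G x); last first.
  by rewrite E w2 !mul1r.
by field.
Qed.

Lemma chord_exp_ge0 x : 0 <= G x. Proof. exact: expR_ge0. Qed.

(** With h the smoothed chord, 1 - x^2 <= h^2 and 1/h <= l, so each term of L G / G
    is at most a multiple of l^2. *)
Lemma chord_exp_supersolution (a b : R) x : -1 <= x <= 1 ->
  jacobi_op2 a b chord_exp1 chord_exp2 x <= ((2 + `|b - a| + `|a + b + 2|) * l ^+ 2) * G x.
Proof.
move=> xD; have h0 := chord_smooth_gt0 xD; have hg := chord_smooth_ge xD.
have hs := chord_smooth_sqr xD; have /andP[q0 q2] := onemM_bounds xD.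
rewrite /jacobi_op2 /chord_exp1 /chord_exp2.
have -> : forall u1 u2 v1 v2 g : R, u1 * (u2 * g) + v1 * (v2 * g) = (u1 * u2 + v1 * v2) * g by move=> *; ring.
rewrite ler_wpM2r ?chord_exp_ge0//.
have lh : (h x)^-1 <= l by rewrite -[leRHS]invrK lef_pV2 ?posrE ?invr_gt0.
have hi0 : 0 < (h x)^-1 by rewrite invr_gt0.
have s1 := norm_sqr1 s2; have w1 := norm_sqr1 w2.
have q : 1 - x ^+ 2 = (1 - w * x) * (2 - (1 - w * x)) by have : (w * x) ^+ 2 = x ^+ 2; [rewrite exprMn w2 mul1r|lra].
have li2 : 0 <= l ^- 2 by rewrite invr_ge0 sqr_ge0.
have x2 : 0 <= 1 - x ^+ 2 <= h x ^+ 2.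
  rewrite q; apply/andP; split; first by rewrite mulr_ge0//; lra.
  rewrite hs; have : 0 <= (1 - w * x) * (1 - w * x) by rewrite mulr_ge0.
  lra.
have /andP[x20 x2h] := x2.
have t1 : (1 - x ^+ 2) * (l ^+ 2 / h x ^+ 2 - s * l / h x ^+ 3) <= 2 * l ^+ 2.
  have r : (1 - x ^+ 2) / h x ^+ 2 <= 1 by rewrite ler_pdivrMr ?exprn_gt0// mul1r.
  have r0 : 0 <= (1 - x ^+ 2) / h x ^+ 2 by rewrite divr_ge0// sqr_ge0.
  rewrite (_ : _ * _ = (1 - x ^+ 2) / h x ^+ 2 * (l ^+ 2 - s * l / h x)); last by field; rewrite gt_eqF.
  have u : `|l ^+ 2 - s * l / h x| <= 2 * l ^+ 2.
    apply: (le_trans (ler_normB _ _)); rewrite !normrM s1 mul1r (gtr0_norm hi0) (gtr0_norm l0).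
    have : l * (h x)^-1 <= l * l by rewrite ler_wpM2l// ltW.
    by rewrite -expr2; lra.
  apply: (@le_trans _ _ (1 * (2 * l ^+ 2))); last by rewrite mul1r.
  apply: le_trans (ler_wpM2l r0 (le_trans (ler_norm _) u)) _.
  by rewrite ler_wpM2r// mulr_ge0 ?sqr_ge0.
have t2 : (b - a - (a + b + 2) * x) * (- w * s * l / h x) <= (`|b - a| + `|a + b + 2|) * l ^+ 2.
  apply: le_trans (ler_norm _) _; rewrite !normrM normrN w1 s1 !mul1r (gtr0_norm hi0) (gtr0_norm l0).
  apply: ler_pM => //.
  - by rewrite mulr_ge0// ltW.
  - apply: (le_trans (ler_normB _ _)); rewrite lerD2l normrM ler_piMr//.
    by rewrite ler_norml.
  - by rewrite expr2 ler_wpM2l// ltW.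
by apply: le_trans (lerD t1 t2) _; rewrite -mulrDl addrA.
Qed.

(** Smoothing changes the chord by at most 1/l, hence l times the chord by at most 1. *)
Lemma chord_exp_ratio x z : -1 <= x <= 1 -> -1 <= z <= 1 ->
  expR (s * l * (Num.sqrt (2 * (1 - w * z)) - Num.sqrt (2 * (1 - w * x)))) <= expR 1 * (G z / G x).
Proof.
move=> xD zD; rewrite /chord_exp -expRN -!expRD ler_expR.
have key y : -1 <= y <= 1 -> Num.sqrt (2 * (1 - w * y)) <= h y <= Num.sqrt (2 * (1 - w * y)) + l^-1.
  move=> yD; have /andP[q0 _] := onemM_bounds yD; have hy := chord_smooth_gt0 yD.
  have q2 : 0 <= 2 * (1 - w * y) by rewrite mulr_ge0.
  have li : 0 < l^-1 by rewrite invr_gt0.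
  rewrite ler_wsqrtr ?lerDr ?invr_ge0 ?sqr_ge0//=.
  rewrite -ler_sqr ?nnegrE ?(ltW hy)//; last by rewrite addr_ge0 ?sqrtr_ge0 ?(ltW li).
  rewrite chord_smooth_sqr// sqrrD sqr_sqrtr// exprVn.
  have : 0 <= Num.sqrt (2 * (1 - w * y)) * l^-1 by rewrite mulr_ge0 ?sqrtr_ge0 ?(ltW li).
  by rewrite -mulr_natr; lra.
have /andP[x1 x2] := key x xD; have /andP[z1 z2] := key z zD.
have ll : l * l^-1 = 1 by rewrite mulfV// gt_eqF.
have key2 (u v : R) : u <= v + l^-1 -> l * u <= l * v + 1.
  by move=> h1; have := ler_wpM2l (ltW l0) h1; rewrite mulrDr ll.
have /orP[/eqP ->|/eqP ->] : (s == 1) || (s == -1) by rewrite -sqrf_eq1 s2.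
  have : l * (Num.sqrt (2 * (1 - w * z)) - Num.sqrt (2 * (1 - w * x))) <= l * (h z - h x) + 1.
    by apply: key2; lra.
  lra.
have : l * (Num.sqrt (2 * (1 - w * x)) - Num.sqrt (2 * (1 - w * z))) <= l * (h x - h z) + 1.
  by apply: key2; lra.
lra.
Qed.

End exponential_test_functions.

Section chord_distance.
Context {R : realType}.
Implicit Types x z : R.

Lemma sqrt_chord_sin x : -1 <= x <= 1 ->
  Num.sqrt (2 * (1 - 1 * x)) = 2 * sin (acos x / 2) /\ Num.sqrt (2 * (1 - -1 * x)) = 2 * cos (acos x / 2).
Proof.
move=> xD; have t0 := acos_ge0 xD; have tp := acos_lepi xD.
have s0 : 0 <= sin (acos x / 2) by apply: sin_ge0_pi; apply/andP; split; lra.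
have c0 : 0 <= cos (acos x / 2) by apply: cos_ge0_pihalf; apply/andP; split; lra.
have cd := cos_double (acos x); rewrite cos_acos// in cd.
have cs := cos2Dsin2 (acos x / 2).
split.
  rewrite -[RHS]ger0_norm ?mulr_ge0// -sqrtr_sqr; congr Num.sqrt; rewrite exprMn; lra.
rewrite -[RHS]ger0_norm ?mulr_ge0// -sqrtr_sqr; congr Num.sqrt; rewrite exprMn; lra.
Qed.

(** The vector of the two chords is twice (sin, cos) of half the angle, so points at
    angular distance r are at least r/2 apart in the plane, and one of the two chords
    changes by at least r/4, in one of the two directions. *)
Lemma dist_le_chords x z : -1 <= x <= 1 -> -1 <= z <= 1 ->
  exists w s : R, [/\ w = 1 \/ w = -1, s = 1 \/ s = -1 &
   jacobi_dist x z / 4 <= s * (Num.sqrt (2 * (1 - w * z)) - Num.sqrt (2 * (1 - w * x)))].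
Proof.
move=> xD zD; have [x1 x2] := sqrt_chord_sin xD; have [z1 z2] := sqrt_chord_sin zD.
pose d1 := 2 * sin (acos z / 2) - 2 * sin (acos x / 2).
pose d2 := 2 * cos (acos z / 2) - 2 * cos (acos x / 2).
set r := jacobi_dist x z.
have r0 : 0 <= r by exact: normr_ge0.
(* The plane vectors differ by 4 sin(r/4), and sin u >= u/2 for u = r/4 <= 1. *)
have sq : r ^+ 2 / 4 <= d1 ^+ 2 + d2 ^+ 2.
  pose u := r / 4.
  have u0 : 0 <= u by rewrite divr_ge0.
  have u1 : u <= 1.
    have := acos_ge0 xD; have := acos_lepi xD; have := acos_ge0 zD; have := acos_lepi zD.
    have := @pihalf_lt2 R => p2 a1 a2 a3 a4.
    have : r <= pi by rewrite /r /jacobi_dist ler_norml; apply/andP; split; lra.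
    by rewrite /u; lra.
  have su : u / 2 <= sin u by apply: sin_ge_half; rewrite u0.
  have E : d1 ^+ 2 + d2 ^+ 2 = 16 * sin u ^+ 2.
    have e1 : cos (r / 2) = cos (acos z / 2) * cos (acos x / 2) + sin (acos z / 2) * sin (acos x / 2).
      rewrite -cosB /r /jacobi_dist -mulrBl; case: (leP 0 (acos x - acos z)) => h.
        by rewrite (ger0_norm h) -cosN; congr cos; ring.
      by rewrite (ltr0_norm h); congr cos; ring.
    have e2 := cos_double (r / 2).
    rewrite (_ : r / 2 / 2 = u) in e2; last by rewrite /u; field.
    have := cos2Dsin2 (acos z / 2); have := cos2Dsin2 (acos x / 2).
    rewrite /d1 /d2; lra.
  have : (u / 2) ^+ 2 <= sin u ^+ 2 by apply: lerXn2r; rewrite ?nnegrE//; lra.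
  by rewrite E /u !expr_div_n; lra.
have big (d : R) : r ^+ 2 / 8 <= d ^+ 2 -> r / 4 <= d \/ r / 4 <= - d.
  move=> h; have : (r / 4) ^+ 2 <= `|d| ^+ 2.
    by rewrite real_normK ?num_real// expr_div_n; have := sqr_ge0 r; lra.
  rewrite ler_sqr ?nnegrE ?divr_ge0//; case: (leP 0 d) => h0.
    by rewrite (ger0_norm h0); left.
  by rewrite (ltr0_norm h0); right.
have [h|h] : r ^+ 2 / 8 <= d1 ^+ 2 \/ r ^+ 2 / 8 <= d2 ^+ 2.
  by have [h|h] := leP (r ^+ 2 / 8) (d1 ^+ 2); [left|right; lra].
- have [k|k] := big _ h; [exists 1, 1|exists 1, (-1)]; split; [by left|by left| |by left|by right|]; rewrite x1 z1 -/d1; lra.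
- have [k|k] := big _ h; [exists (-1), 1|exists (-1), (-1)]; split; [by right|by left| |by right|by right|]; rewrite x2 z2 -/d2; lra.
Qed.

End chord_distance.

Section kernel_tail.
Context {R : realType} (a b : R).
Hypotheses (ha : -1 < a) (hb : -1 < b).
Notation TR := (measurableTypeR R).
Notation mu := (jacobi_measure a b).
Notation DD := (`[(-1)%R, 1%R]%classic : set TR).
Variable P : nat -> {poly R}.
Hypothesis HP : jacobi_polynomials a b P.
Variables (C : R) (q : nat).
Hypothesis C1 : 1 <= C.
Hypothesis PB : forall k (x : R), -1 <= x <= 1 -> `|(P k).[x]| <= C * k.+1%:R ^+ q.
Local Notation K := (jacobi_heat_kernel a b P).

Lemma measurable_acos : measurable_fun DD (acos : TR -> R).
Proof.
have -> : DD = `]-1, 1[%classic `|` ([set (-1 : R)] `|` [set (1 : R)]) :> set TR.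
  apply/seteqP; split=> x /=; rewrite !in_itv/=.
    move=> /andP[x0 x1]; have [->|x2] := eqVneq x (-1); first by right; left.
    have [->|x3] := eqVneq x 1; first by right; right.
    by left; rewrite !lt_neqAle x0 x1 eq_sym x2 x3.
  by move=> [/andP[? ?]|[->|->]]; apply/andP; split; lra.
apply/measurable_funU; [exact: measurable_itv|by apply: measurableU; exact: measurable_set1|].
split; last first.
  apply/measurable_funU; [exact: measurable_set1|exact: measurable_set1|].
  by split; exact: measurable_fun_set1.
apply: open_continuous_measurable_fun; first exact: interval_open.
by move=> x; rewrite inE/= in_itv/=; exact: continuous_acos.
Qed.

Lemma bounded_meas_exp_dist x (l : R) : -1 <= x <= 1 -> 0 <= l ->
  bounded_meas (fun z => expR (l * jacobi_dist x z)).
Proof.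
move=> xD l0; split.
  apply: measurableT_comp; first exact: measurable_expR.
  apply: measurable_funM => //.
  apply: measurableT_comp; first exact: normr_measurable.
  by apply: measurable_funB => //; exact: measurable_acos.
exists (expR (l * pi)) => z zD; rewrite ger0_norm ?expR_ge0// ler_expR ler_wpM2l//.
have := acos_ge0 xD; have := acos_lepi xD; have := acos_ge0 zD; have := acos_lepi zD.
by move=> *; rewrite /jacobi_dist ler_norml; apply/andP; split; lra.
Qed.

Definition tail_cst : R := 2 * (2 + `|b - a| + `|a + b + 2|).

(** Sum the supersolution estimate over the two endpoints and the two signs: one of
    the four exponentials dominates exp(l rho/4). *)
Lemma kernel_tail (l t x : R) : 0 < l -> 0 < t -> -1 <= x <= 1 ->
  \int[mu]_(z in DD) (K t x z * expR (l * (jacobi_dist x z / 4))) <= 4 * expR 1 * expR (tail_cst * l ^+ 2 * t).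
Proof.
move=> l0 t0 xD.
have one2 : (1 : R) ^+ 2 = 1 by rewrite expr1n.
have mone2 : (-1 : R) ^+ 2 = 1 by rewrite sqrrN expr1n.
pose H (s w z : R) := chord_exp l s w z / chord_exp l s w x.
have G0 s w y : 0 < chord_exp l s w y by exact: expR_gt0.
have H0 s w z : 0 <= H s w z by rewrite divr_ge0 ?(ltW (G0 _ _ _)).
have bH (s w : R) : s ^+ 2 = 1 -> w ^+ 2 = 1 -> bounded_meas (H s w).
  move=> s2 w2; apply: bounded_measM; last exact: bounded_meas_cst.
  apply: bounded_meas_cont; apply: derivable_within_continuous => z; rewrite in_itv/= => zD.
  by case: (is_derive_chord_exp s l0 w2 zD).
have bK := bounded_meas_kernel ha hb C1 PB t0 xD.
have HK (s w : R) : s ^+ 2 = 1 -> w ^+ 2 = 1 ->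
    \int[mu]_(z in DD) (K t x z * H s w z) <= expR (tail_cst * l ^+ 2 * t).
  move=> s2 w2.
  pose M := (2 + `|b - a| + `|a + b + 2|) * l ^+ 2.
  have M0 : 0 <= M by rewrite mulr_ge0 ?sqr_ge0// !addr_ge0.
  have := kernel_test ha hb HP C1 PB M0 t0 xD
    (fun y yD => is_derive_chord_exp s l0 w2 yD) (fun y yD => is_derive_chord_exp1 l0 s2 w2 yD)
    (fun y yD => chord_exp_supersolution l0 s2 w2 a b yD) (fun y _ => chord_exp_ge0 l s w y).
  rewrite -ler_pdivrMr//; move=> h.
  rewrite (_ : tail_cst * l ^+ 2 * t = 2 * M * t); last by rewrite /tail_cst /M; ring.
  apply: le_trans h; rewrite -RintegralZr//; last first.
    apply: bounded_meas_integrable => //; apply: bounded_measM => //.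
    apply: bounded_meas_cont; apply: derivable_within_continuous => z; rewrite in_itv/= => zD.
    by case: (is_derive_chord_exp s l0 w2 zD).
  by rewrite le_eqVlt; apply/orP; left; apply/eqP; apply: eq_Rintegral => z _; rewrite /H mulrA.
pose S z := (H 1 1 z + H (-1) 1 z) + (H 1 (-1) z + H (-1) (-1) z).
have bS : bounded_meas S by apply: bounded_measD; apply: bounded_measD; apply: bH.
have point z : -1 <= z <= 1 -> expR (l * (jacobi_dist x z / 4)) <= expR 1 * S z.
  move=> zD; have [w [s [hw hs h]]] := dist_le_chords xD zD.
  have s2 : s ^+ 2 = 1 by case: hs => ->.
  have w2 : w ^+ 2 = 1 by case: hw => ->.
  have h1 := ler_wpM2l (ltW l0) h.
  apply: (@le_trans _ _ (expR 1 * H s w z)).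
    apply: le_trans (chord_exp_ratio l0 s2 w2 xD zD); rewrite ler_expR.
    by apply: (le_trans h1); rewrite le_eqVlt; apply/orP; left; apply/eqP; ring.
  rewrite ler_wpM2l ?expR_ge0// /S.
  by case: hw => ->; case: hs => ->; have := H0 1 1 z; have := H0 (-1) 1 z;
    have := H0 1 (-1) z; have := H0 (-1) (-1) z; lra.
apply: (@le_trans _ _ (\int[mu]_(z in DD) (expR 1 * (K t x z * S z)))).
  apply: le_Rintegral => //.
  - apply: bounded_meas_integrable => //; apply: bounded_measM => //.
    rewrite (_ : (fun z => _) = (fun z => expR (l / 4 * jacobi_dist x z))).
      by apply: bounded_meas_exp_dist => //; rewrite divr_ge0// ltW.
    by apply/funext => z; congr expR; ring.
  - apply: bounded_meas_integrable => //; apply: bounded_measM; first exact: bounded_meas_cst.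
    exact: bounded_measM.
  - move=> z; rewrite /= in_itv/= => zD.
    by rewrite [leRHS]mulrCA ler_wpM2l ?(kernel_ge0 ha hb HP C1 PB)//; exact: point.
have iKH (s w : R) : s ^+ 2 = 1 -> w ^+ 2 = 1 -> mu.-integrable DD (EFin \o (fun z => K t x z * H s w z)).
  by move=> s2 w2; apply: bounded_meas_integrable => //; apply: bounded_measM => //; exact: bH.
rewrite RintegralZl//; last first.
  by apply: bounded_meas_integrable => //; exact: bounded_measM.
rewrite [leRHS](_ : _ = expR 1 * (4 * expR (tail_cst * l ^+ 2 * t))); last by ring.
rewrite ler_wpM2l ?expR_ge0//.
under eq_Rintegral do rewrite /S !mulrDr.
have bKH (s w : R) : s ^+ 2 = 1 -> w ^+ 2 = 1 -> bounded_meas (fun z => K t x z * H s w z).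
  by move=> s2 w2; apply: bounded_measM => //; exact: bH.
rewrite RintegralD//; last 2 first.
- by apply: bounded_meas_integrable => //; apply: bounded_measD; apply: bKH.
- by apply: bounded_meas_integrable => //; apply: bounded_measD; apply: bKH.
rewrite !RintegralD//; try exact: iKH.
have := HK 1 1 one2 one2; have := HK (-1) 1 mone2 one2.
have := HK 1 (-1) one2 mone2; have := HK (-1) (-1) mone2 mone2.
move: (\int[mu]_(x0 in DD) _) (\int[mu]_(x0 in DD) _) (\int[mu]_(x0 in DD) _) (\int[mu]_(x0 in DD) _) => u1 u2 u3 u4; lra.
Qed.

End kernel_tail.

(** * A local Lipschitz estimate *)

Section interior_gradient.
Context {R : realType}.
Implicit Types (u : {poly R}) (a b A x y z r t : R).

(** When the angle of z is comparable to t, both 1-z and 1-z^2 are comparable to t^2. *)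
Lemma weight_model a b z t : 0 < t -> -1 <= z <= 1 -> - 2^-1 <= z -> t / 2 <= acos z <= 2 * t ->
  [/\ jacobi_weight a b z <= 2 `^ `|b| * 32 `^ `|a| * (t ^+ 2) `^ a,
      (t ^+ 2) `^ a <= 2 `^ `|b| * 32 `^ `|a| * jacobi_weight a b z &
      t ^+ 2 / 64 <= 1 - z ^+ 2 <= 4 * t ^+ 2].
Proof.
move=> t0 zD zh /andP[z1 z2].
have p0 := acos_ge0 zD; have p1 := acos_lepi zD.
have cp : - 2^-1 <= cos (acos z) by rewrite cos_acos.
have /andP[q1 q2] := onem_cos_bounds p0 p1 cp; rewrite cos_acos// in q1 q2.
have m0 : 0 < t ^+ 2 by rewrite exprn_gt0.
have s1 : (t / 2) ^+ 2 <= acos z ^+ 2 by apply: lerXn2r; rewrite ?nnegrE//; lra.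
have s2 : acos z ^+ 2 <= (2 * t) ^+ 2 by apply: lerXn2r; rewrite ?nnegrE//; lra.
rewrite expr_div_n in s1; rewrite exprMn in s2.
have zh2 : - 2^-1 <= z <= 1 by rewrite zh; case/andP: zD.
have [zm z1'] := andP zD.
have z0 : 0 < 1 - z by lra.
split.
- apply: le_trans (jacobi_weight_le a b zh2) _; rewrite -mulrA ler_wpM2l ?powR_ge0//.
  by apply: powR_ratio => //; lra.
- have w2 : (t ^+ 2) `^ a <= 32 `^ `|a| * (1 - z) `^ a by apply: powR_ratio => //; lra.
  apply: (le_trans w2); rewrite (mulrC (2 `^ _)) -mulrA ler_wpM2l ?powR_ge0//.
  exact: jacobi_weight_ge.
- have e1 : (1 - z) * 2^-1 <= (1 - z) * (1 + z) by rewrite ler_wpM2l//; lra.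
  have e2 : (1 - z) * (1 + z) <= (1 - z) * 2 by rewrite ler_wpM2l//; lra.
  by apply/andP; split; lra.
Qed.

(** The arithmetic of the interior estimate: with f and g the derivatives at the mean
    value point and at z, w1 and Wz the values of w (1-x^2) there and N = (t^2)^a, a
    bound on f and on the variation of the flux gives a bound on g. *)
Let flux_comparison (N t r A d B f g w1 Wz : R) : 0 < N -> 0 < t -> 0 < r -> 0 <= A -> 0 < B ->
  `|f| * (t * r / 4) <= 2 * A -> 0 <= w1 -> w1 <= 4 * B * N * t ^+ 2 ->
  0 <= d -> d <= 4 * t * r ->
  `|Wz * g - w1 * f| <= B * N * (A / r ^+ 2) * d -> N * t ^+ 2 <= 64 * B * Wz ->
  `|g| * (t * r) <= 64 * 36 * B ^+ 2 * A.
Proof.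
move=> N0 t0 r0 A0 B0 hf w10 hw d0 hd hg hW.
have tr0 : 0 < t * r by rewrite mulr_gt0.
have r20 : 0 < r ^+ 2 by rewrite exprn_gt0.
have Nt : 0 < N * t ^+ 2 by rewrite mulr_gt0// exprn_gt0.
have W0 : 0 < Wz by have := lt_le_trans Nt hW; rewrite pmulr_rgt0// mulr_gt0.
have h1 : `|w1 * f| * (t * r) <= 32 * B * N * t ^+ 2 * A.
  rewrite normrM (ger0_norm w10) -[leLHS]mulrA.
  apply: (@le_trans _ _ (4 * B * N * t ^+ 2 * (8 * A))).
    apply: ler_pM => //; last by lra.
    by rewrite mulr_ge0// ltW.
  by rewrite le_eqVlt; apply/orP; left; apply/eqP; ring.
have h2 : B * N * (A / r ^+ 2) * d * (t * r) <= 4 * B * N * t ^+ 2 * A.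
  have c0 : 0 <= B * N * (A / r ^+ 2) by rewrite !mulr_ge0 ?invr_ge0 ?(ltW B0) ?(ltW N0) ?(ltW r20).
  apply: (@le_trans _ _ (B * N * (A / r ^+ 2) * (4 * t * r) * (t * r))).
    by rewrite ler_wpM2r ?(ltW tr0)// ler_wpM2l.
  by rewrite le_eqVlt; apply/orP; left; apply/eqP; field; rewrite gt_eqF.
have h3 : Wz * `|g| <= `|Wz * g - w1 * f| + `|w1 * f|.
  by rewrite -{1}(gtr0_norm W0) -normrM -{1}(subrK (w1 * f) (Wz * g)) ler_normD.
have h4 : Wz * `|g| * (t * r) <= 36 * B * (N * t ^+ 2) * A.
  have := ler_wpM2r (ltW tr0) h3; have := ler_wpM2r (ltW tr0) hg; rewrite mulrDl => ? ?.
  lra.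
have h5 : Wz * `|g| * (t * r) <= 36 * B * (64 * B * Wz) * A.
  apply: (le_trans h4); rewrite ler_wpM2r// ler_wpM2l// mulr_ge0// ltW//.
by rewrite -(ler_pM2l W0); lra.
Qed.

(** The mean value theorem over B(x,r) gives a point xi with |u'(xi)| at most
    A / (t r) up to a constant, because the ball has length of order t r and |u| <= A.
    The flux changes from xi to z by at most the integral of w |L u|, and the weight
    is essentially constant on the ball. *)
Lemma gradient_interior a b u A x r t : -1 < a -> -1 < b -> 0 <= x <= 1 -> 0 < r <= 8^-1 -> 0 <= A -> 2 * r <= acos x -> t = acos x ->
  (forall z, -1 <= z <= 1 -> jacobi_dist x z < 4 * r -> `|u.[z]| <= A /\ r ^+ 2 * `|(jacobi_L a b u).[z]| <= A) ->
  forall z, -1 <= z <= 1 -> jacobi_dist x z <= r ->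
  `|(u^`()).[z]| * (t * r) <= 64 * 36 * (2 `^ `|b| * 32 `^ `|a|) ^+ 2 * A.
Proof.
have := @weight_model a b.
have : 0 < 2 `^ `|b| * 32 `^ `|a| by rewrite mulr_gt0// powR_gt0.
move: (2 `^ `|b| * 32 `^ `|a|) => B B0 WM.
move=> ha hb xD /andP[r0 r1] A0 tr tE H z zD zr.
have rh : 0 <= r <= 2^-1 by apply/andP; split; lra.
have [t0 tp t2 ct] := acos_nneg xD rh; rewrite -tE in t0 tp t2 ct tr.
have xD' : -1 <= x <= 1 by case/andP: xD => ? ?; apply/andP; split; lra.
have tpos : 0 < t by lra.
have cN : - 2^-1 <= cos (t + r) by lra.
have [y1 y1E] : exists y1, y1 = cos (t + r) by exists (cos (t + r)).
have [y2 y2E] : exists y2, y2 = cos (t - r) by exists (cos (t - r)).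
have yy : y1 < y2 by rewrite y1E y2E; apply: cos_lt; lra.
have y21 : y2 < 1 by rewrite y2E -cos0; apply: cos_lt; lra.
have tr1 : 0 <= t - r by lra.
have tr2 : t - r <= t + r by lra.
have /andP[d1 d2] := cos_diff_bounds tr1 tr2 tp cN; rewrite -y1E -y2E in d1 d2.
have y1N : - 2^-1 <= y1 by rewrite y1E.
have inI w : y1 <= w <= y2 -> [/\ -1 < w < 1, t - r <= acos w <= t + r, jacobi_dist x w <= r & - 2^-1 <= w].
  move=> /andP[w1 w2].
  have wh : - 2^-1 <= w := le_trans y1N w1.
  have w3 : -1 < w < 1 by apply/andP; split; [lra_from wh|exact: le_lt_trans y21].
  have wD : -1 <= w <= 1 by case/andP: w3 => ? ?; rewrite !ltW.
  have a1 : t - r <= acos w.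
    rewrite -(@acos_cos _ (t - r)) ?tr1 ?(le_trans tr2)//; apply: acos_le => //; last by rewrite -y2E.
    by rewrite cos_le1 cos_geN1.
  have a2 : acos w <= t + r.
    rewrite -(@acos_cos _ (t + r)) ?tp ?andbT; [|lra].
    by apply: acos_le => //; [rewrite cos_le1 cos_geN1|rewrite -y1E].
  split => //; first by rewrite a1.
  by rewrite /jacobi_dist -tE ler_norml; apply/andP; split; [lra_from a2|lra_from a1].
have zI : y1 <= z <= y2.
  move: zr; rewrite /jacobi_dist -tE ler_norml => /andP[v1 v2].
  have za := acos_ge0 zD; have zp := acos_lepi zD.
  rewrite -(cos_acos zD) y1E y2E; apply/andP; split; apply: cos_le => //.
    by lra_from v1.
  by lra_from v2.
have model w : y1 <= w <= y2 -> [/\ jacobi_weight a b w <= B * (t ^+ 2) `^ a,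
      (t ^+ 2) `^ a <= B * jacobi_weight a b w & t ^+ 2 / 64 <= 1 - w ^+ 2 <= 4 * t ^+ 2].
  move=> /inI[/andP[w1 w2] /andP[w3 w4] _ w5].
  apply: WM => //; first by rewrite !ltW.
  by apply/andP; split; [lra_from w3 tr|lra_from w4 tr r0].
have bnd w : y1 <= w <= y2 -> `|u.[w]| <= A /\ r ^+ 2 * `|(jacobi_L a b u).[w]| <= A.
  move=> /inI[/andP[w1 w2] _ w3 _]; apply: H; first by rewrite !ltW.
  by apply: le_lt_trans w3 _; lra_from r0.
have du (w : R) : w \in `]y1, y2[ -> is_derive w 1 (horner u) (u^`()).[w] by move=> _; exact: is_derive_horner.
have [|xi + E] := MVT yy du; first by apply: continuous_subspaceT; exact: continuous_horner.
rewrite in_itv/= => /andP[x1 x2].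
have xiI : y1 <= xi <= y2 by rewrite !ltW.
have hf : `|(u^`()).[xi]| * (t * r / 4) <= 2 * A.
  have e1 : y1 <= y1 <= y2 by rewrite lexx ltW.
  have e2 : y1 <= y2 <= y2 by rewrite lexx ltW.
  have [b1 _] := bnd _ e1; have [b2 _] := bnd _ e2.
  have h1 : `|(u^`()).[xi]| * (y2 - y1) <= 2 * A.
    rewrite -[y2 - y1]gtr0_norm ?subr_gt0// -normrM -E.
    by apply: (le_trans (ler_normB _ _)); lra_from b1 b2.
  apply: le_trans h1; rewrite ler_wpM2l//; apply: le_trans d1.
  rewrite (_ : t + r - (t - r) = 2 * r); last by ring.
  have h2 : 0 <= (t - 2 * r) * r by rewrite mulr_ge0 ?(ltW r0)// subr_ge0.
  lra_from h2.
have [wu wl /andP[ml mu]] := model _ xiI; have [wzu wzl /andP[mzl mzu]] := model _ zI.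
pose N := (t ^+ 2) `^ a.
have N0 : 0 < N by rewrite powR_gt0// exprn_gt0.
have wxi0 : 0 <= jacobi_weight a b xi := jacobi_weight_ge0 a b xi.
have wz0 : 0 <= jacobi_weight a b z := jacobi_weight_ge0 a b z.
have wpE w : y1 <= w <= y2 -> jacobi_wplus a b w = jacobi_weight a b w * (1 - w ^+ 2).
  by move=> /inI[/andP[w1 w2] _ _ _]; apply: jacobi_wplusE => //; rewrite !ltW.
have t20 : 0 <= t ^+ 2 by exact: sqr_ge0.
have r20 : 0 < r ^+ 2 by rewrite exprn_gt0.
apply: (@flux_comparison N t r A `|z - xi| B (u^`()).[xi] _ (jacobi_wplus a b xi) (jacobi_wplus a b z)) => //.
- by rewrite wpE// mulr_ge0//; lra_from ml t20.
- rewrite wpE//; rewrite -/N in wu.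
  by apply: le_trans (ler_pM wxi0 _ wu mu) _; [lra_from ml t20|rewrite le_eqVlt; apply/orP; left; apply/eqP; ring].
- have : y2 - y1 <= 4 * t * r.
    apply: (le_trans d2); rewrite (_ : t + r - (t - r) = 2 * r); last by ring.
    have h2 : 0 <= (t - r) * r by rewrite mulr_ge0 ?(ltW r0).
    lra_from h2.
  apply: le_trans; rewrite ler_norml; case/andP: zI => z1 z2; case/andP: xiI => x3 x4.
  by apply/andP; split; [lra_from z1 x4|lra_from z2 x3].
- have key p s : y1 <= p -> p <= s -> s <= y2 ->
    `|jacobi_wplus a b s * (u^`()).[s] - jacobi_wplus a b p * (u^`()).[p]| <= B * N * (A / r ^+ 2) * `|s - p|.
    move=> p1 ps s1.
    have dw (w : R) : w \in `[p, s] -> is_derive w 1 (fun w => jacobi_wplus a b w * (u^`()).[w])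
        (jacobi_weight a b w * (jacobi_L a b u).[w]).
      rewrite in_itv/= => /andP[pw ws].
      have /inI[wD _ _ _] : y1 <= w <= y2 by rewrite (le_trans p1 pw) (le_trans ws s1).
      exact: is_derive_jacobi_wplus.
    have dw' (w : R) : w \in `]p, s[ -> is_derive w 1 (fun w => jacobi_wplus a b w * (u^`()).[w])
        (jacobi_weight a b w * (jacobi_L a b u).[w]) by move=> wi; apply: dw; exact: subset_itv_oo_cc wi.
    have [|c ci ->] := MVT_segment ps dw'.
      by apply: derivable_within_continuous => w wi; case: (dw w wi).
    rewrite in_itv/= in ci.
    have cI : y1 <= c <= y2 by case/andP: ci => c1 c2; rewrite (le_trans p1 c1) (le_trans c2 s1).
    have [cu _ _] := model _ cI; have [_ cb] := bnd _ cI.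
    rewrite normrM ler_wpM2r// normrM (ger0_norm (jacobi_weight_ge0 a b c)).
    by apply: ler_pM => //; [exact: jacobi_weight_ge0|rewrite ler_pdivlMr// mulrC].
  case/andP: zI => ? ?; case/andP: xiI => ? ?.
  have [xz|/ltW zx] := leP xi z; first exact: key.
  by rewrite distrC (distrC z); exact: key.
- rewrite wpE//; rewrite -/N in wzl.
  have := ler_pM (ltW N0) _ wzl mzl; rewrite divr_ge0// => /(_ isT) h.
  lra_from h.
Qed.

End interior_gradient.

Section lipschitz.
Context {R : realType}.
Implicit Types (u : {poly R}) (a b A x y z r t eps : R).

Definition lip_cst a b : R :=
  3 * grad_cst a b + 2 * (64 * 36 * (2 `^ `|b| * 32 `^ `|a|) ^+ 2).

Lemma lip_cst_ge0 a b : -1 < a -> 0 <= lip_cst a b.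
Proof.
by move=> ha; rewrite addr_ge0// mulr_ge0 ?(ltW (grad_cst_gt0 _ ha))// mulr_ge0 ?sqr_ge0.
Qed.

(** If x is within 2r of the endpoint, the one-sided bound |u'| <= C sup |L u| applies
    on the arc up to 1, which lies in B(x,4r).  Otherwise the interior gradient
    estimate applies.  In both cases |y-x| <= max(t,s) eps r for the angles t and s of
    x and y. *)
Lemma lipschitz_right a b u A x y r eps : -1 < a -> -1 < b -> 0 <= x <= 1 -> -1 <= y <= 1 ->
  0 < r <= 8^-1 -> 0 <= A -> 0 <= eps <= 2^-1 -> jacobi_dist x y <= eps * r ->
  (forall z, -1 <= z <= 1 -> jacobi_dist x z < 4 * r -> `|u.[z]| <= A /\ r ^+ 2 * `|(jacobi_L a b u).[z]| <= A) ->
  `|u.[y] - u.[x]| <= lip_cst a b * (eps * A).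
Proof.
move=> ha hb xD yD rD A0 /andP[e0 e1] xy H; have [r0 r1] := andP rD.
have rh : 0 <= 3 * r <= 2^-1 by apply/andP; split; lra.
have [t0 tp t2 ct] := acos_nneg xD rh.
have xD' : -1 <= x <= 1 by case/andP: xD => ? ?; apply/andP; split; lra.
set t := acos x in t0 tp t2 ct.
have er : eps * r <= r / 2 by rewrite mulrC ler_wpM2l// ltW.
have er0 : 0 <= eps * r by rewrite mulr_ge0// ltW.
pose s := acos y.
have s0 : 0 <= s := acos_ge0 yD.
have sp : s <= pi := acos_lepi yD.
have st : `|t - s| <= eps * r by [].
have /andP[st1 st2] : - (eps * r) <= t - s <= eps * r by rewrite -ler_norml.
have diff : `|y - x| <= Num.max t s * (eps * r).
  have ub v w : 0 <= v -> v <= w -> w <= t + 3 * r -> w - v <= eps * r -> cos v - cos w <= w * (eps * r).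
    move=> v0 vw wt wv.
    have cw : - 2^-1 <= cos w by have := cos_le (le_trans v0 vw) wt tp; lra.
    have wp : w <= pi by exact: le_trans wt tp.
    have /andP[_ h] := cos_diff_bounds v0 vw wp cw.
    by apply: (le_trans h); rewrite ler_wpM2l ?(le_trans v0).
  rewrite -(cos_acos yD) -(cos_acos xD') -/s -/t; have [ts|ts] := leP t s.
    by rewrite distrC ger0_norm ?subr_ge0 ?cos_le//; apply: ub => //; lra.
  rewrite ger0_norm ?subr_ge0 ?cos_le ?(ltW ts)//; last exact: acos_lepi.
  by apply: ub => //; rewrite ?(ltW ts)//; lra.
have g0 := grad_cst_gt0 b ha.
have B0 : 0 <= 64 * 36 * (2 `^ `|b| * 32 `^ `|a|) ^+ 2 :> R by rewrite mulr_ge0// sqr_ge0.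
have eA : 0 <= eps * A by rewrite mulr_ge0.
have r20 : 0 < r ^+ 2 by rewrite exprn_gt0.
have ms : Num.max t s <= t + r / 2 by rewrite ge_max; apply/andP; split; [lra_from r0|lra_from st1 er].
have betw z : Num.min y x <= z <= Num.max y x -> -1 <= z <= 1 /\ Num.min t s <= acos z <= Num.max t s.
  rewrite ge_min le_max => /andP[z1 z2].
  have zD : -1 <= z <= 1.
    have [y1 y2] := andP yD; have [x1 x2] := andP xD'.
    apply/andP; split; [case/orP: z1|case/orP: z2] => z3.
    - exact: le_trans z3.
    - exact: le_trans z3.
    - exact: le_trans z3 _.
    - exact: le_trans z3 _.
  split => //; rewrite ge_min le_max; apply/andP; split; [case/orP: z2|case/orP: z1] => z3.
  - by rewrite [acos y <= _]acos_le ?orbT.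
  - by rewrite [acos x <= _]acos_le.
  - by rewrite [_ <= acos y]acos_le ?orbT.
  - by rewrite [_ <= acos x]acos_le.
have [near|far] := leP t (2 * r).
  have d z : Num.min y x <= z <= Num.max y x -> `|(u^`()).[z]| <= grad_cst a b * (A / r ^+ 2).
    move=> /betw [zD /andP[_ z2]].
    have z3 : acos z <= 3 * r by lra_from z2 ms near r0.
    apply: le_deriv_right => //.
      rewrite -(cos_acos zD) cos_le1 andbT.
      have ct2 : cos (t + 3 * r) <= cos (acos z) by apply: cos_le => //; [exact: acos_ge0|lra_from z3 t0].
      lra_from ct2 ct r1.
    move=> w /andP[zw w1]; rewrite ler_pdivlMr// mulrC.
    have wD : -1 <= w <= 1 by rewrite w1 andbT; case/andP: zD => zN _; exact: le_trans zN zw.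
    have w2 := acos_le zD wD zw; have w3 := acos_ge0 wD.
    have [//|_ h] := H w wD _; last exact: h.
    by rewrite /jacobi_dist -/t ltr_norml; apply/andP; split; [lra_from w2 z3 t0 r0|lra_from w3 near r0].
  have := horner_MVT yD xD' d => h; apply: (le_trans h).
  have c0 : 0 <= grad_cst a b * (A / r ^+ 2) by rewrite mulr_ge0 ?(ltW g0)// divr_ge0 ?(ltW r20).
  apply: le_trans (ler_wpM2l c0 diff) _.
  apply: (@le_trans _ _ (grad_cst a b * (A / r ^+ 2) * (3 * r * (eps * r)))).
    by rewrite ler_wpM2l// ler_wpM2r//; lra_from ms near r0.
  rewrite (_ : _ * _ = 3 * grad_cst a b * (eps * A)); last by field; rewrite gt_eqF.
  by rewrite ler_wpM2r// /lip_cst lerDl mulr_ge0.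
have tpos : 0 < t by lra.
have GI := gradient_interior ha hb xD rD A0 (ltW far) erefl H.
have tr0 : 0 < t * r by rewrite mulr_gt0.
have d z : Num.min y x <= z <= Num.max y x -> `|(u^`()).[z]| <= 64 * 36 * (2 `^ `|b| * 32 `^ `|a|) ^+ 2 * A / (t * r).
  move=> /betw [zD /andP[z1 z2]]; rewrite ler_pdivlMr//; apply: GI => //.
  have z3 : t - r / 2 <= acos z by apply: le_trans z1; rewrite le_min; apply/andP; split; [lra_from r0|lra_from st2 er].
  have z4 := le_trans z2 ms.
  by rewrite /jacobi_dist -/t ler_norml; apply/andP; split; [lra_from z4 r0|lra_from z3 r0].
have := horner_MVT yD xD' d => h; apply: (le_trans h).
have c0 : 0 <= 64 * 36 * (2 `^ `|b| * 32 `^ `|a|) ^+ 2 * A / (t * r).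
  by rewrite divr_ge0 ?(ltW tr0)// mulr_ge0.
apply: le_trans (ler_wpM2l c0 diff) _.
apply: (@le_trans _ _ (64 * 36 * (2 `^ `|b| * 32 `^ `|a|) ^+ 2 * A / (t * r) * (2 * t * (eps * r)))).
  by rewrite ler_wpM2l// ler_wpM2r//; lra_from ms far r0.
rewrite /lip_cst; move: (64 * 36 * _) B0 => B B0 in c0 *.
rewrite (_ : _ * _ = 2 * B * (eps * A)); last by field; rewrite !gt_eqF.
by rewrite ler_wpM2r// lerDr mulr_ge0// ltW.
Qed.

Lemma lipschitz_local a b u A x y r eps : -1 < a -> -1 < b -> -1 <= x <= 1 -> -1 <= y <= 1 ->
  0 < r <= 8^-1 -> 0 <= A -> 0 <= eps <= 2^-1 -> jacobi_dist x y <= eps * r ->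
  (forall z, -1 <= z <= 1 -> jacobi_dist x z < 4 * r -> `|u.[z]| <= A /\ r ^+ 2 * `|(jacobi_L a b u).[z]| <= A) ->
  `|u.[y] - u.[x]| <= (lip_cst a b + lip_cst b a) * (eps * A).
Proof.
move=> ha hb xD yD rD A0 eD xy H.
have [e0 _] := andP eD.
have eA : 0 <= eps * A by rewrite mulr_ge0.
have [x0|x0] := leP 0 x.
  have xD' : 0 <= x <= 1 by rewrite x0; case/andP: xD.
  apply: (le_trans (lipschitz_right ha hb xD' yD rD A0 eD xy H)).
  by rewrite ler_wpM2r// lerDl lip_cst_ge0.
have xD' : 0 <= - x <= 1 by case/andP: xD => ? ?; apply/andP; split; lra.
have yD' : -1 <= - y <= 1 by case/andP: yD => ? ?; apply/andP; split; lra.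
have H' : forall z, -1 <= z <= 1 -> jacobi_dist (- x) z < 4 * r ->
    `|(polyN u).[z]| <= A /\ r ^+ 2 * `|(jacobi_L b a (polyN u)).[z]| <= A.
  move=> z zD zr; rewrite horner_polyN jacobi_L_polyN.
  have zD' : -1 <= - z <= 1 by case/andP: zD => ? ?; apply/andP; split; lra.
  by apply: H => //; rewrite -jacobi_distN// opprK.
have xy' : jacobi_dist (- x) (- y) <= eps * r by rewrite jacobi_distN.
have := lipschitz_right hb ha xD' yD' rD A0 eD xy' H'.
rewrite !horner_polyN !opprK => h; apply: (le_trans h).
by rewrite ler_wpM2r// lerDr lip_cst_ge0.
Qed.

End lipschitz.

(** * Regularity of the kernel near the diagonal *)

Section kernel_diagonal.
Context {R : realType} (a b : R).
Hypotheses (ha : -1 < a) (hb : -1 < b).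
Notation lam := (jacobi_eigenvalue a b).
Variable P : nat -> {poly R}.
Hypothesis HP : jacobi_polynomials a b P.
Variables (C : R) (q : nat).
Hypothesis C1 : 1 <= C.
Hypothesis PB : forall k (x : R), -1 <= x <= 1 -> `|(P k).[x]| <= C * k.+1%:R ^+ q.
Local Notation K := (jacobi_heat_kernel a b P).
Implicit Types (t x y z : R).

Lemma diag_term t x k : jacobi_heat_term a b P t x x k = expR (- lam k * t) * (P k).[x] ^+ 2.
Proof. by rewrite /jacobi_heat_term -mulrA -expr2. Qed.

Lemma diag_term_ge0 t x k : 0 <= jacobi_heat_term a b P t x x k.
Proof. by rewrite diag_term mulr_ge0 ?expR_ge0 ?sqr_ge0. Qed.

Lemma kernel_diag_antitone s t x : 0 < s -> s <= t -> -1 <= x <= 1 -> K t x x <= K s x x.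
Proof.
move=> s0 st xD; have t0 : 0 < t by exact: lt_le_trans st.
apply: lim_series_le; [exact: (jacobi_kernel_cvg ha hb C1 PB)|exact: (jacobi_kernel_cvg ha hb C1 PB)|] => k.
rewrite !diag_term ler_wpM2r ?sqr_ge0// ler_expR !mulNr lerN2 ler_wpM2l//.
exact: lam_ge0.
Qed.

Lemma le_mean_sqr (c e u v : R) : `|c| <= e -> `|c * u * v| <= 2^-1 * (e * u ^+ 2 + e * v ^+ 2).
Proof.
move=> ce; rewrite -mulrA normrM; have e0 : 0 <= e by apply: le_trans ce.
have uv : `|u * v| <= 2^-1 * (u ^+ 2 + v ^+ 2).
  by rewrite ler_norml; have := sqr_ge0 (u - v); have := sqr_ge0 (u + v);
    rewrite sqrrB sqrrD => *; apply/andP; split; lra.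
apply: le_trans (ler_pM (normr_ge0 _) (normr_ge0 _) ce uv) _.
by rewrite le_eqVlt; apply/orP; left; apply/eqP; ring.
Qed.

(** The inequality 2 |P_k(x) P_k(y)| <= P_k(x)^2 + P_k(y)^2 termwise;
    it covers the truncated kernel as well as that of t L exp(tL). *)
Lemma truncated_kernel_le (c : nat -> R) t x y n : 0 < t -> -1 <= x <= 1 -> -1 <= y <= 1 ->
  (forall k, `|c k| <= expR (- lam k * t)) ->
  `|\sum_(0 <= k < n) c k * (P k).[x] * (P k).[y]| <= 2^-1 * (K t x x + K t y y).
Proof.
move=> t0 xD yD hc; apply: le_trans (ler_norm_sum _ _ _) _.
apply: (@le_trans _ _ (\sum_(0 <= k < n) 2^-1 * (jacobi_heat_term a b P t x x k + jacobi_heat_term a b P t y y k))).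
  by apply: ler_sum => k _; rewrite !diag_term; exact: le_mean_sqr.
rewrite -mulr_sumr ler_wpM2l// big_split/=.
apply: lerD; rewrite -[leLHS]/(series _ n); apply: le_series_lim;
  by [move=> k; exact: diag_term_ge0|exact: (jacobi_kernel_cvg ha hb C1 PB)].
Qed.

Lemma kernel_le_diag t x y : 0 < t -> -1 <= x <= 1 -> -1 <= y <= 1 -> K t x y <= 2^-1 * (K t x x + K t y y).
Proof.
move=> t0 xD yD; apply: limr_le; first exact: (jacobi_kernel_cvg ha hb C1 PB).
apply: nearW => n; apply: le_trans (ler_norm _) _.
by apply: truncated_kernel_le => // k; rewrite ger0_norm// expR_ge0.
Qed.

Lemma mul_expR_half (s : R) : 0 <= s -> s * expR (- s) <= expR (- (s / 2)).
Proof.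
move=> s0; have -> : - s = - (s / 2) + - (s / 2) by field.
rewrite expRD mulrA -[leRHS]mul1r ler_wpM2r ?expR_ge0// expRN ler_pdivrMr ?expR_gt0// mul1r.
have -> : s / 2 = 2%:R * (s / 4) by field.
rewrite expRM_natl; have h : 1 + s / 4 <= expR (s / 4) := expR_ge1Dx _.
have : (1 + s / 4) ^+ 2 <= expR (s / 4) ^+ 2 by apply: lerXn2r; rewrite ?nnegrE ?expR_ge0//; lra.
have := sqr_ge0 (s / 4 - 1).
rewrite sqrrB sqrrD; lra.
Qed.

(** The local Lipschitz estimate applies to the partial sums u of the kernel in the
    variable y, at radius sqrt t: both u and t L u have coefficients at most
    exp(- lambda_k t/2), so they are bounded by diagonal values at time t/2. *)
Lemma kernel_lipschitz t x y (eps A : R) : 0 < t <= 64^-1 -> -1 <= x <= 1 -> -1 <= y <= 1 ->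
  0 <= eps <= 2^-1 -> jacobi_dist x y <= eps * Num.sqrt t ->
  (forall z, -1 <= z <= 1 -> jacobi_dist x z < 4 * Num.sqrt t -> K (t / 2) z z <= A) ->
  `|K t x y - K t x x| <= (lip_cst a b + lip_cst b a) * (eps * A).
Proof.
move=> /andP[t0 t1] xD yD eD xy HA.
have t2 : 0 < t / 2 by lra.
pose r := Num.sqrt t.
have r0 : 0 < r by rewrite sqrtr_gt0.
have r1 : r <= 8^-1.
  have -> : (8^-1 : R) = Num.sqrt ((8^-1) ^+ 2) by rewrite sqrtr_sqr ger0_norm.
  by rewrite ler_wsqrtr// (_ : (8^-1 : R) ^+ 2 = 64^-1)//; field.
have rt : r ^+ 2 = t by rewrite sqr_sqrtr// ltW.
have xx : jacobi_dist x x = 0 by rewrite /jacobi_dist subrr normr0.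
have Ax : K (t / 2) x x <= A by apply: HA => //; rewrite xx mulr_gt0.
have A0 : 0 <= A by apply: le_trans Ax; exact: (kernel_ge0 ha hb HP C1 PB).
pose c k := expR (- lam k * t).
pose u n := \sum_(0 <= k < n) (c k * (P k).[x]) *: P k.
have uE n z : (u n).[z] = series (jacobi_heat_term a b P t x z) n.
  by rewrite /u horner_sum seriesEnat; apply: eq_bigr => k _; rewrite hornerZ.
(* Half of the time is given up to absorb the factor lam k * t coming from t L. *)
have half k : c k <= expR (- lam k * (t / 2)).
  by rewrite ler_expR !mulNr lerN2 ler_wpM2l ?lam_ge0//; lra.
have main n : `|(u n).[y] - (u n).[x]| <= (lip_cst a b + lip_cst b a) * (eps * A).
  apply: (@lipschitz_local R a b (u n) A x y r eps) => //; first by rewrite r0.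
  move=> z zD zr; have Az := HA z zD zr.
  have mean : 2^-1 * (K (t / 2) x x + K (t / 2) z z) <= A by lra.
  split.
    rewrite uE seriesEnat; apply: le_trans mean; apply: truncated_kernel_le => // k.
    by rewrite ger0_norm ?expR_ge0//; exact: half.
  rewrite (L_sum ha hb HP) horner_sum rt -(gtr0_norm t0) -normrM mulr_sumr.
  under eq_bigr do rewrite hornerZ.
  have -> : \sum_(0 <= k < n) t * (- lam k * (c k * (P k).[x]) * (P k).[z]) =
      \sum_(0 <= k < n) (- (lam k * t * c k)) * (P k).[x] * (P k).[z].
    by apply: eq_bigr => k _; ring.
  apply: le_trans mean; apply: truncated_kernel_le => // k.
  have lt0 : 0 <= lam k * t by rewrite mulr_ge0 ?(ltW t0)//; exact: lam_ge0.
  rewrite normrN ger0_norm; last by rewrite mulr_ge0 ?expR_ge0.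
  by have := mul_expR_half lt0; rewrite /c !mulNr !mulrA.
have cv : `|(u n).[y] - (u n).[x]| @[n --> \oo] --> `|K t x y - K t x x|.
  apply: cvg_norm; under eq_fun do rewrite !uE.
  apply: cvgB.
    exact: (jacobi_kernel_cvg ha hb C1 PB t0 xD yD).
  exact: (jacobi_kernel_cvg ha hb C1 PB t0 xD xD).
rewrite -(cvg_lim _ cv)//; apply: limr_le; first by apply/cvg_ex; eexists; exact: cv.
exact: nearW.
Qed.

End kernel_diagonal.

(** * From tails and regularity to Gaussian bounds *)

Section gaussian_bounds.
Context {R : realType}.
Notation TR := (measurableTypeR R).
Notation DD := (`[(-1)%R, 1%R]%classic : set TR).
Local Notation D x := (-1 <= x <= 1).
Variable mu : {measure set TR -> \bar R}.
Variables (rho : R -> R -> R) (K : R -> R -> R -> R).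
Implicit Types (x y z t r c l : R) (f g : TR -> R).

Definition rball x r : set TR := [set y | D y /\ rho x y < r].
Local Notation V x r := (fine (mu (rball x r))).
Local Notation I f := (\int[mu]_(z in DD) (f z : R)).

Hypothesis mu_int : forall f, bounded_meas f -> mu.-integrable DD (EFin \o f).
Hypothesis mball : forall x r, measurable (rball x r).

Hypothesis rhoC : forall x y, rho x y = rho y x.
Hypothesis rho_tri : forall x y z, rho x z <= rho x y + rho y z.
Hypothesis rho0 : forall x, rho x x = 0.
Hypothesis rho_ge0 : forall x y, 0 <= rho x y.
Hypothesis rho_le4 : forall x y, D x -> D y -> rho x y <= 4.
Hypothesis geodesic : forall x y r, D x -> D y -> 0 <= r <= rho x y ->
  exists z, [/\ D z, rho x z = r & rho z y = rho x y - r].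
Hypothesis exp_meas : forall x l, D x -> 0 <= l -> bounded_meas (fun z => expR (l * rho x z)).

Variable Cd : R.
Hypothesis Cd1 : 1 <= Cd.
Hypothesis V_gt0 : forall x r, D x -> 0 < r -> 0 < V x r.
Hypothesis V_double : forall x r, D x -> 0 < r -> V x (2 * r) <= Cd * V x r.
Hypothesis V_total : forall x r, D x -> 16^-1 <= r -> fine (mu DD) <= Cd * V x r.

Hypothesis K_ge0 : forall t x y, 0 < t -> D x -> D y -> 0 <= K t x y.
Hypothesis K_sym : forall t x y, K t x y = K t y x.
Hypothesis K_meas : forall t x, 0 < t -> D x -> bounded_meas (K t x).
Hypothesis K_mass : forall t x, 0 < t -> D x -> I (K t x) = 1.
Hypothesis K_semi : forall s t x y, 0 < s -> 0 < t -> D x -> D y ->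
  I (fun z => K s x z * K t z y) = K (s + t) x y.
Hypothesis K_anti : forall s t x, 0 < s -> s <= t -> D x -> K t x x <= K s x x.
Hypothesis K_diag : forall t x y, 0 < t -> D x -> D y -> K t x y <= 2^-1 * (K t x x + K t y y).

Variables Ct Ctau : R.
Hypotheses (Ct1 : 1 <= Ct) (Ctau0 : 0 < Ctau).
Hypothesis K_tail : forall l t x, 0 < l -> 0 < t -> D x ->
  I (fun z => K t x z * expR (l * rho x z)) <= Ct * expR (Ctau * l ^+ 2 * t).

Variable Cl : R.
Hypothesis Cl0 : 0 <= Cl.
Hypothesis K_lip : forall t x y (eps A : R), 0 < t <= 64^-1 -> D x -> D y -> 0 <= eps <= 2^-1 ->
  rho x y <= eps * Num.sqrt t ->
  (forall z, D z -> rho x z < 4 * Num.sqrt t -> K (t / 2) z z <= A) ->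
  `|K t x y - K t x x| <= Cl * (eps * A).

Variables (Ca : R) (Q : nat).
Hypothesis Ca0 : 0 <= Ca.
Hypothesis K_apriori : forall t x, 0 < t <= 1 -> D x -> K t x x <= Ca * (t ^+ Q)^-1.

Lemma I_le f g : bounded_meas f -> bounded_meas g -> (forall z, D z -> f z <= g z) -> I f <= I g.
Proof.
move=> bf bg fg; apply: le_Rintegral; [exact: measurable_DD|exact: mu_int|exact: mu_int|].
by move=> z; rewrite /= in_itv/=; exact: fg.
Qed.

Lemma I_add f g : bounded_meas f -> bounded_meas g -> I (fun z => f z + g z) = I f + I g.
Proof. by move=> bf bg; rewrite RintegralD//; [exact: mu_int|exact: mu_int]. Qed.

Lemma I_scale c f : bounded_meas f -> I (fun z => c * f z) = c * I f.
Proof. by move=> bf; rewrite RintegralZl//; exact: mu_int. Qed.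

Lemma bm_scale c f : bounded_meas f -> bounded_meas (fun z => c * f z).
Proof. by move=> bf; apply: bounded_measM => //; exact: bounded_meas_cst. Qed.

Lemma bm_ball x r : bounded_meas (\1_(rball x r) : TR -> R).
Proof.
split; first by apply: measurable_indic; exact: mball.
by exists 1 => z _; rewrite indicE; case: (_ \in _); rewrite ?normr1 ?normr0.
Qed.

Lemma rball_sub x r : rball x r `<=` DD.
Proof. by move=> y [yD _] /=; rewrite in_itv. Qed.

Lemma I_ball x r : I (\1_(rball x r) : TR -> R) = V x r.
Proof.
rewrite /Rintegral integral_indic; try exact: mball; try exact: measurable_DD.
by congr (fine (mu _)); apply/setIidPl; exact: rball_sub.
Qed.

Lemma indic_ball x r z : D z -> (\1_(rball x r) z : R) = if rho x z < r then 1 else 0.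
Proof.
move=> zD; rewrite indicE; case: ifPn => h; first by rewrite mem_set.
by rewrite memNset// => -[_ h']; rewrite h' in h.
Qed.

Lemma I_ge_ball x r c f : bounded_meas f -> (forall z, D z -> 0 <= f z) ->
  (forall z, D z -> rho x z < r -> c <= f z) -> c * V x r <= I f.
Proof.
move=> bf f0 cf; rewrite -I_ball -I_scale; last exact: bm_ball.
apply: I_le => //; first by apply: bm_scale; exact: bm_ball.
move=> z zD; rewrite indic_ball//; case: ifPn => h; first by rewrite mulr1 cf.
by rewrite mulr0 f0.
Qed.

Lemma mu_fin (A : set TR) : measurable A -> A `<=` DD -> (mu A < +oo)%E.
Proof.
move=> mA AD; apply: (@le_lt_trans _ _ (mu DD)).
  by apply: le_measure; rewrite ?inE//; exact: measurable_DD.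
have /integrableP[_] := mu_int (bounded_meas_cst 1).
under eq_integral do rewrite /= normr1.
by rewrite integral_cst// mul1e.
Qed.

Lemma V_mono (A B : set TR) : measurable A -> measurable B -> A `<=` B -> B `<=` DD -> fine (mu A) <= fine (mu B).
Proof.
move=> mA mB AB BD; apply: fine_le.
- by rewrite ge0_fin_numE ?measure_ge0// mu_fin//; exact: subset_trans BD.
- by rewrite ge0_fin_numE ?measure_ge0// mu_fin.
- by apply: le_measure; rewrite ?inE.
Qed.

Lemma V_sub x y r s : rho y x + r <= s -> V x r <= V y s.
Proof.
move=> h; apply: V_mono; [exact: mball|exact: mball| |exact: rball_sub].
move=> z [zD zr]; split => //; apply: le_lt_trans (rho_tri y x z) _.
by apply: lt_le_trans h; rewrite ltrD2l.
Qed.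

Lemma V_le x r s : r <= s -> V x r <= V x s.
Proof. by move=> rs; apply: V_sub; rewrite rho0 add0r. Qed.

Lemma V_le_total x r : V x r <= fine (mu DD).
Proof. by apply: V_mono; [exact: mball|exact: measurable_DD|exact: rball_sub|]. Qed.

Lemma V_double_iter x r n : D x -> 0 < r -> V x (2 ^+ n * r) <= Cd ^+ n * V x r.
Proof.
move=> xD r0; elim: n => [|n ih]; first by rewrite !expr0 !mul1r.
rewrite exprS -mulrA; apply: le_trans (V_double xD _) _; first by rewrite mulr_gt0// exprn_gt0.
rewrite exprS -mulrA ler_wpM2l//; exact: le_trans Cd1.
Qed.

Lemma exp2_ge (n : nat) : n.+1%:R <= 2 ^+ n :> R.
Proof. by rewrite -natrX ler_nat ltn_expl. Qed.

(** The ball B(x,r) lies in B(z, 2^n r) for n of order rho/r + 1, so doubling costs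
    an exponential in rho/r. *)
Lemma V_compare x z r : D x -> D z -> 0 < r ->
  V x r <= Cd * expR ((ln Cd + 1) * (rho x z / r)) * V z r.
Proof.
move=> xD zD r0; set p := rho x z / r.
have p0 : 0 <= p by rewrite divr_ge0 ?rho_ge0// ltW.
have pr : rho x z = p * r by rewrite /p divfK// gt_eqF.
pose n := (Num.trunc p).+1.
have /andP[n1 n2] := truncn_itv p0.
have np : n%:R <= p + 1 by rewrite /n -natr1 lerD2r.
have C0 : 0 < Cd by apply: lt_le_trans Cd1.
have l0 : 0 <= ln Cd by rewrite ln_ge0.
have h1 : V x r <= V z (2 ^+ n * r).
  apply: V_sub; rewrite rhoC pr -{2}(mul1r r) -mulrDl ler_wpM2r ?(ltW r0)//.
  by apply: le_trans (exp2_ge n); rewrite -natr1 lerD2r ltW.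
apply: (le_trans h1); apply: le_trans (V_double_iter n zD r0) _.
rewrite ler_wpM2r ?(ltW (V_gt0 _ _))//.
have E : Cd = expR (ln Cd) by rewrite lnK// posrE.
rewrite {1}E -expRM_natl {2}E -expRD ler_expR.
have : n%:R * ln Cd <= (p + 1) * ln Cd by rewrite ler_wpM2r.
lra.
Qed.

(** By regularity K_t(x,.) is at least K_t(x,x) - Cl eps A on the ball of radius
    eps sqrt t, and its integral over that ball is at most 1. *)
Lemma diag_average t x (eps A : R) : 0 < t <= 64^-1 -> D x -> 0 < eps <= 2^-1 ->
  (forall z, D z -> rho x z < 4 * Num.sqrt t -> K (t / 2) z z <= A) ->
  K t x x <= (V x (eps * Num.sqrt t))^-1 + Cl * (eps * A).
Proof.
move=> tD xD eD HA; have /andP[t0 t1] := tD; have /andP[e0 e1] := eD.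
have r0 : 0 < Num.sqrt t by rewrite sqrtr_gt0.
have er0 : 0 < eps * Num.sqrt t by rewrite mulr_gt0.
have v0 := V_gt0 xD er0.
have eD' : 0 <= eps <= 2^-1 by rewrite ltW.
rewrite -lerBlDr -(ler_pM2r v0) mulVf ?gt_eqF// -(K_mass t0 xD).
apply: I_ge_ball; [exact: K_meas|by move=> z zD; exact: K_ge0|].
move=> z zD zr; have := K_lip tD xD zD eD' (ltW zr) HA.
by rewrite ler_norml => /andP[+ _]; lra.
Qed.

Lemma V_half x z t : D x -> D z -> 0 < t -> rho x z < 4 * Num.sqrt t ->
  V x (Num.sqrt t) <= Cd ^+ 4 * V z (Num.sqrt (t / 2)).
Proof.
move=> xD zD t0 zr; have r0 : 0 < Num.sqrt t by rewrite sqrtr_gt0.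
have s0 : 0 < Num.sqrt (t / 2) by rewrite sqrtr_gt0 divr_gt0.
have rs : Num.sqrt t <= 2 * Num.sqrt (t / 2).
  have -> : 2 * Num.sqrt (t / 2) = Num.sqrt (2 ^+ 2 * (t / 2)).
    by rewrite -[X in X * _](@ger0_norm _ 2)// -sqrtr_sqr -sqrtrM ?sqr_ge0.
  by rewrite ler_wsqrtr//; lra.
apply: le_trans (V_double_iter 4 zD s0); apply: V_sub; rewrite rhoC.
rewrite (_ : 2 ^+ 4 = 16); last by ring.
lra.
Qed.

(** The volume at radius sqrt t is compared with the one at radius eps sqrt t, which
    costs the large constant Cd^m but multiplies no value of the kernel, and with the
    volumes at nearby points z, which costs Cd^4 in front of the small factor eps. *)
Lemma diag_step t x (eps M : R) (m : nat) : 0 < t <= 64^-1 -> D x -> 0 < eps <= 2^-1 -> 1 <= 2 ^+ m * eps ->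
  0 <= M -> (forall z, D z -> K (t / 2) z z * V z (Num.sqrt (t / 2)) <= M) ->
  K t x x * V x (Num.sqrt t) <= Cd ^+ m + Cl * Cd ^+ 4 * eps * M.
Proof.
move=> tD xD eD em M0 HM; have /andP[t0 t1] := tD; have /andP[e0 e1] := eD.
have r0 : 0 < Num.sqrt t by rewrite sqrtr_gt0.
have t20 : 0 < t / 2 by lra.
have s0 : 0 < Num.sqrt (t / 2) by rewrite sqrtr_gt0.
have v0 := V_gt0 xD r0.
have er0 : 0 < eps * Num.sqrt t by rewrite mulr_gt0.
have HA z : D z -> rho x z < 4 * Num.sqrt t -> K (t / 2) z z <= M * Cd ^+ 4 / V x (Num.sqrt t).
  move=> zD zr; have vz := V_gt0 zD s0.
  have h := V_half xD zD t0 zr.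
  rewrite ler_pdivlMr//; apply: le_trans (ler_wpM2l (K_ge0 t20 zD zD) h) _.
  by rewrite mulrCA mulrC ler_wpM2r ?HM// exprn_ge0// (le_trans ler01).
have := diag_average tD xD eD HA; rewrite -(ler_pM2r v0) => h; apply: (le_trans h).
rewrite mulrDl; apply: lerD; last first.
  by rewrite le_eqVlt; apply/orP; left; apply/eqP; field; rewrite gt_eqF.
rewrite mulrC ler_pdivrMr ?V_gt0//.
apply: le_trans (V_double_iter m xD er0); apply: V_le.
by rewrite mulrA -[leLHS]mul1r ler_wpM2r// ltW.
Qed.

(** Choose eps so that the step contracts by 2^(-Q-1).  The a priori bound t^(-Q)
    loses 2^Q at each halving of t, so its contribution after n steps is 2^(-n) times
    the initial one. *)
Lemma diag_upper_small : exists2 M : R, 0 < M & forall t x, 0 < t <= 64^-1 -> D x ->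
  K t x x * V x (Num.sqrt t) <= M.
Proof.
have C0 : 0 < Cd by apply: lt_le_trans Cd1.
pose B := Cl * Cd ^+ 4 + 1.
have B0 : 0 < B by rewrite ltr_wpDl// mulr_ge0// exprn_ge0// ltW.
(* Halving t multiplies the a priori bound by 2^Q; the extra factor 1/2 is the gain. *)
pose d : R := 2^-1 ^+ Q.+1.
have d0 : 0 < d by rewrite exprn_gt0.
have d2 : d <= 2^-1 by rewrite /d exprS ler_piMr//; apply: exprn_ile1 => //; lra.
pose eps := Num.min 2^-1 (d / B).
have e0 : 0 < eps by rewrite lt_min invr_gt0 ltr0n divr_gt0.
have [e1 e2] : eps <= 2^-1 /\ eps <= d / B by rewrite !ge_min !lexx orbT.
have eD : 0 < eps <= 2^-1 by rewrite e0.
pose m := (Num.trunc eps^-1).+1.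
have em : 1 <= 2 ^+ m * eps.
  have i0 : 0 <= eps^-1 by rewrite invr_ge0 ltW.
  have /andP[_ h] := truncn_itv i0.
  rewrite -ler_pdivrMr// div1r; apply: le_trans (ltW h) _.
  apply: le_trans (exp2_ge _) _; rewrite ler_weXn2l//; lra.
have Bd : Cl * Cd ^+ 4 * eps <= d.
  apply: (@le_trans _ _ (B * eps)); first by rewrite ler_wpM2r ?(ltW e0)// lerDl.
  by rewrite mulrC -ler_pdivlMr.
pose T := fine (mu DD).
have T0 : 0 <= T by rewrite fine_ge0// measure_ge0.
have Cm0 : 0 < Cd ^+ m by rewrite exprn_gt0.
(* Both halves of the bound are reproduced by one step: the constant because
   d <= 1/2, the a priori term because d is 2^(-Q-1). *)
have claim n : forall t x, 0 < t <= 64^-1 -> D x ->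
    K t x x * V x (Num.sqrt t) <= 2 * Cd ^+ m + 2^-1 ^+ n * (Ca * T * (t ^+ Q)^-1).
  elim: n => [|n ih] t x tD xD; have /andP[t0 t1] := tD.
    have t11 : 0 < t <= 1 by rewrite t0/=; lra.
    rewrite expr0 mul1r; apply: (@le_trans _ _ (Ca * T * (t ^+ Q)^-1)); last by rewrite lerDr mulr_ge0// ltW.
    rewrite mulrAC; apply: ler_pM; rewrite ?K_ge0 ?fine_ge0 ?measure_ge0//; first exact: K_apriori.
    exact: V_le_total.
  have t2D : 0 < t / 2 <= 64^-1 by apply/andP; split; lra.
  have tQ0 : 0 < t ^+ Q by rewrite exprn_gt0.
  set M := 2 * Cd ^+ m + 2^-1 ^+ n * (Ca * T * ((t / 2) ^+ Q)^-1).
  have M0 : 0 <= M.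
    apply: addr_ge0; first by rewrite mulr_ge0// ltW.
    apply: mulr_ge0; first by rewrite exprn_ge0.
    by rewrite !mulr_ge0// invr_ge0 exprn_ge0//; lra.
  have h := diag_step tD xD eD em M0 (fun z zD => ih (t / 2) z t2D zD).
  apply: (le_trans h).
  have h1 : Cl * Cd ^+ 4 * eps * M <= d * M by rewrite ler_wpM2r.
  have h2 : d * (2 * Cd ^+ m) <= Cd ^+ m.
    have : d * (2 * Cd ^+ m) <= 2^-1 * (2 * Cd ^+ m) by rewrite ler_wpM2r// mulr_ge0// ltW.
    lra.
  have h3 : d * (2^-1 ^+ n * (Ca * T * ((t / 2) ^+ Q)^-1)) = 2^-1 ^+ n.+1 * (Ca * T * (t ^+ Q)^-1).
    rewrite /d !exprS expr_div_n !exprVn; field.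
    by rewrite !expf_neq0// gt_eqF.
  apply: le_trans (lerD (lexx _) h1) _; rewrite /M mulrDr h3; lra.
exists (2 * Cd ^+ m); first by rewrite mulr_gt0.
move=> t x tD xD; have /andP[t0 t1] := tD.
apply/ler_addgt0Pr => e ep.
pose Z := Ca * T * (t ^+ Q)^-1.
have Z0 : 0 <= Z by rewrite !mulr_ge0// invr_ge0 exprn_ge0// ltW.
pose n := (Num.trunc (Z / e)).+1.
have h0 : 0 <= Z / e by rewrite divr_ge0// ltW.
have /andP[_ h] := truncn_itv h0.
apply: le_trans (claim n t x tD xD) _; rewrite lerD2l -/Z exprVn mulrC ler_pdivrMr ?exprn_gt0//.
rewrite mulrC -ler_pdivrMr//; apply: le_trans (ltW h) _.
apply: le_trans (exp2_ge _) _; rewrite ler_weXn2l//; lra.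
Qed.

Lemma diag_upper : exists2 M : R, 0 < M & forall t x, 0 < t -> D x ->
  K t x x * V x (Num.sqrt t) <= M.
Proof.
have [M M0 H] := diag_upper_small.
have C0 : 0 < Cd by apply: lt_le_trans Cd1.
exists (Cd * M) => [|t x t0 xD]; first by rewrite mulr_gt0.
have [t1|t1] := leP t 64^-1.
  apply: (@le_trans _ _ M); first by apply: H => //; rewrite t0.
  by rewrite ler_peMl// ltW.
have sD : 0 < (64^-1 : R) <= 64^-1 by apply/andP; split; lra.
have s0 : (0 : R) < 64^-1 by rewrite invr_gt0.
have E : Num.sqrt (64^-1 : R) = 8^-1.
  by rewrite (_ : (64^-1 : R) = (8^-1) ^+ 2) ?sqrtr_sqr ?ger0_norm//; field.
have h := H _ x sD xD; rewrite E in h.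
have v0 : 0 <= V x (Num.sqrt t) by rewrite fine_ge0// measure_ge0.
apply: (@le_trans _ _ (K 64^-1 x x * (Cd * V x 8^-1))); last first.
  by rewrite mulrCA ler_wpM2l// ltW.
apply: ler_pM => //; first exact: K_ge0.
  by apply: K_anti => //; exact: ltW.
by apply: le_trans (V_le_total _ _) _; apply: V_total => //; lra.
Qed.

(** The diagonal bound at z is transported to x by comparison of volumes. *)
Lemma kernel_le_exp M t x z : 0 < M -> (forall t x, 0 < t -> D x -> K t x x * V x (Num.sqrt t) <= M) ->
  0 < t -> D x -> D z ->
  K t x z <= M * Cd / V x (Num.sqrt t) * expR ((ln Cd + 1) * (rho x z / Num.sqrt t)).
Proof.
move=> M0 HM t0 xD zD; have r0 : 0 < Num.sqrt t by rewrite sqrtr_gt0.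
have vx := V_gt0 xD r0; have vz := V_gt0 zD r0.
set E := expR _.
have l0 : 0 <= ln Cd by rewrite ln_ge0.
have E1 : 1 <= E.
  rewrite -expR0 ler_expR mulr_ge0 ?divr_ge0 ?rho_ge0 ?(ltW r0)//; lra.
have h := V_compare xD zD r0; rewrite -/E in h.
have hx : K t x x <= M * Cd / V x (Num.sqrt t) * E.
  rewrite mulrAC ler_pdivlMr//; apply: le_trans (HM t x t0 xD) _.
  rewrite -mulrA ler_peMr ?(ltW M0)// -[1]mulr1; exact: ler_pM.
have hz : K t z z <= M * Cd / V x (Num.sqrt t) * E.
  rewrite -(ler_pM2r vz).
  apply: le_trans (HM t z t0 zD) _.
  rewrite [leRHS](_ : _ = M * (Cd * E * V z (Num.sqrt t)) / V x (Num.sqrt t)); last by ring.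
  by rewrite ler_pdivlMr// ler_wpM2l// ltW.
apply: le_trans (K_diag t0 xD zD) _; lra.
Qed.

(** One factor of the kernel is bounded by the diagonal bound, the other one is
    integrated against the exponential by the tail estimate. *)
Lemma kernel_square_tail M t x (k : R) : 0 < M -> (forall t x, 0 < t -> D x -> K t x x * V x (Num.sqrt t) <= M) ->
  0 < t -> D x -> 0 <= k ->
  I (fun z => K t x z ^+ 2 * expR (2 * k / Num.sqrt t * rho x z)) <=
    M * Cd / V x (Num.sqrt t) * (Ct * expR (Ctau * (2 * k + (ln Cd + 1)) ^+ 2)).
Proof.
move=> M0 HM t0 xD k0; set r := Num.sqrt t.
have r0 : 0 < r by rewrite sqrtr_gt0.
have vx := V_gt0 xD r0; have l0 : 0 <= ln Cd by rewrite ln_ge0.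
pose l := (2 * k + (ln Cd + 1)) / r.
have lp : 0 < l by rewrite divr_gt0//; lra.
have A0 : 0 <= M * Cd / V x r by rewrite divr_ge0 ?(ltW vx)// mulr_ge0 ?(ltW M0)// (le_trans ler01).
have E : l ^+ 2 * t = (2 * k + (ln Cd + 1)) ^+ 2.
  have -> : t = r ^+ 2 by rewrite sqr_sqrtr// ltW.
  by rewrite -exprMn /l divfK// gt_eqF.
have bK := K_meas t0 xD.
apply: (@le_trans _ _ (I (fun z => M * Cd / V x r * (K t x z * expR (l * rho x z))))).
  apply: I_le.
  - apply: bounded_measM; first exact: bounded_measM.
    by apply: exp_meas => //; rewrite divr_ge0 ?(ltW r0)// mulr_ge0.
  - by apply: bm_scale; apply: bounded_measM => //; apply: exp_meas => //; exact: ltW.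
  - move=> z zD; have h := kernel_le_exp M0 HM t0 xD zD.
    rewrite [leLHS](_ : _ = K t x z * (expR (2 * k / r * rho x z) * K t x z)); last by ring.
    rewrite [leRHS]mulrCA ler_wpM2l ?K_ge0//.
    apply: (@le_trans _ _ (expR (2 * k / r * rho x z) * (M * Cd / V x r * expR ((ln Cd + 1) * (rho x z / r))))).
      by rewrite ler_wpM2l ?expR_ge0.
    rewrite mulrCA -expRD le_eqVlt; apply/orP; left; apply/eqP.
    by congr (_ * expR _); rewrite /l; field; rewrite gt_eqF.
rewrite I_scale; last by apply: bounded_measM => //; apply: exp_meas => //; exact: ltW.
rewrite ler_wpM2l//; apply: le_trans (K_tail lp t0 xD) _.
by rewrite -mulrA E.
Qed.

Let amgm (s u v : R) : 0 < s -> u * v <= 2^-1 * (s * u ^+ 2 + s^-1 * v ^+ 2).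
Proof.
move=> s0; have : 0 <= s^-1 * (s * u - v) ^+ 2 by rewrite mulr_ge0 ?sqr_ge0 ?invr_ge0 ?ltW.
have -> : s^-1 * (s * u - v) ^+ 2 = s * u ^+ 2 + s^-1 * v ^+ 2 - 2 * (u * v) by field; rewrite gt_eqF.
lra.
Qed.

(** Put the weight inside the semigroup law by the triangle inequality and split the
    product of the two kernels by the arithmetic-geometric mean inequality, with the
    ratio s = sqrt (V x / V y) that balances the two volumes. *)
Lemma kernel_weighted_upper M t x y (k : R) : 0 < M -> (forall t x, 0 < t -> D x -> K t x x * V x (Num.sqrt t) <= M) ->
  0 < t -> D x -> D y -> 0 <= k ->
  K (t + t) x y * expR (k / Num.sqrt t * rho x y) <=
    M * Cd * Ct * expR (Ctau * (2 * k + (ln Cd + 1)) ^+ 2) / Num.sqrt (V x (Num.sqrt t) * V y (Num.sqrt t)).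
Proof.
move=> M0 HM t0 xD yD k0; set r := Num.sqrt t; set E := expR (Ctau * _).
have r0 : 0 < r by rewrite sqrtr_gt0.
have vx := V_gt0 xD r0; have vy := V_gt0 yD r0.
have kr : 0 <= k / r by rewrite divr_ge0// ltW.
have k2r : 0 <= 2 * k / r by rewrite divr_ge0 ?(ltW r0)// mulr_ge0.
(* With this ratio both terms contribute the same multiple of 1/sqrt(V x * V y). *)
pose s := Num.sqrt (V x r) / Num.sqrt (V y r).
have sx : 0 < Num.sqrt (V x r) by rewrite sqrtr_gt0.
have sy : 0 < Num.sqrt (V y r) by rewrite sqrtr_gt0.
have s0 : 0 < s by rewrite divr_gt0.
have bx := K_meas t0 xD; have by' := K_meas t0 yD.
have bex := exp_meas xD kr; have bey := exp_meas yD kr.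
have be2x := exp_meas xD k2r; have be2y := exp_meas yD k2r.
pose X z := K t x z ^+ 2 * expR (2 * k / r * rho x z).
pose Y z := K t y z ^+ 2 * expR (2 * k / r * rho y z).
have bX : bounded_meas X by apply: bounded_measM => //; exact: bounded_measM.
have bY : bounded_meas Y by apply: bounded_measM => //; exact: bounded_measM.
have hX : I X <= M * Cd / V x r * (Ct * E) := kernel_square_tail M0 HM t0 xD k0.
have hY : I Y <= M * Cd / V y r * (Ct * E) := kernel_square_tail M0 HM t0 yD k0.
rewrite -K_semi// mulrC -I_scale; last first.
  by apply: bounded_measM => //; under eq_fun do rewrite K_sym.
apply: (@le_trans _ _ (I (fun z => 2^-1 * s * X z + 2^-1 * s^-1 * Y z))).
  apply: I_le.
  - by apply: bm_scale; apply: bounded_measM => //; under eq_fun do rewrite K_sym.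
  - by apply: bounded_measD; exact: bm_scale.
  - move=> z zD.
    have h1 : expR (k / r * rho x y) <= expR (k / r * rho x z) * expR (k / r * rho y z).
      by rewrite -expRD ler_expR -mulrDr ler_wpM2l// (rhoC y z).
    have h2 : 0 <= K t x z * K t z y by rewrite mulr_ge0 ?K_ge0.
    apply: le_trans (ler_wpM2r h2 h1) _.
    rewrite (K_sym t z y).
    have -> : expR (k / r * rho x z) * expR (k / r * rho y z) * (K t x z * K t y z) =
       (K t x z * expR (k / r * rho x z)) * (K t y z * expR (k / r * rho y z)) by ring.
    apply: le_trans (amgm _ _ s0) _.
    have e2 u : expR (k / r * u) ^+ 2 = expR (2 * k / r * u).
      by rewrite -expRM_natl; congr expR; ring.
    by rewrite !exprMn !e2 -/(X z) -/(Y z) le_eqVlt; apply/orP; left; apply/eqP; ring.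
rewrite I_add ?I_scale//; [|exact: bm_scale|exact: bm_scale].
have h1 : 2^-1 * s * I X <= 2^-1 * s * (M * Cd / V x r * (Ct * E)) by rewrite ler_wpM2l// mulr_ge0// ltW.
have h2 : 2^-1 * s^-1 * I Y <= 2^-1 * s^-1 * (M * Cd / V y r * (Ct * E)) by rewrite ler_wpM2l// mulr_ge0// invr_ge0 ltW.
apply: le_trans (lerD h1 h2) _.
have qx : V x r = Num.sqrt (V x r) ^+ 2 by rewrite sqr_sqrtr// ltW.
have qy : V y r = Num.sqrt (V y r) ^+ 2 by rewrite sqr_sqrtr// ltW.
have alg (p q p2 q2 : R) : 0 < p -> 0 < q -> p2 = p ^+ 2 -> q2 = q ^+ 2 ->
    2^-1 * (p / q) * (M * Cd / p2 * (Ct * E)) + 2^-1 * (p / q)^-1 * (M * Cd / q2 * (Ct * E)) = M * Cd * Ct * E / (p * q).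
  by move=> p0 q0 -> ->; field; rewrite !gt_eqF.
by rewrite sqrtrM ?(ltW vx)// /s alg.
Qed.

Lemma sqrt_double t : 0 < t -> Num.sqrt (t + t) <= 2 * Num.sqrt t.
Proof.
move=> t0; rewrite -[X in X * _](@ger0_norm _ 2)// -sqrtr_sqr -sqrtrM ?sqr_ge0//.
by rewrite ler_wsqrtr//; lra.
Qed.

(** Optimise the weight: the exponent 8 Ctau k^2 - k rho / sqrt t is smallest at
    k = rho / (16 Ctau sqrt t). *)
Theorem gaussian_upper : exists c3 c4 : R, [/\ 0 < c3, 0 < c4 & forall t x y, 0 < t -> D x -> D y ->
  K t x y <= c3 * (expR (- (rho x y ^+ 2 / (c4 * t))) / Num.sqrt (V x (Num.sqrt t) * V y (Num.sqrt t)))].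
Proof.
have [M M0 HM] := diag_upper.
have C0 : 0 < Cd by apply: lt_le_trans Cd1.
have Ct0 : 0 < Ct by apply: lt_le_trans Ct1.
pose Dc := ln Cd + 1.
exists (M * Cd * Ct * expR (2 * Ctau * Dc ^+ 2) * Cd), (16 * Ctau); split.
- by rewrite !mulr_gt0 ?expR_gt0.
- by rewrite mulr_gt0.
move=> t' x y t'0 xD yD; pose t := t' / 2.
have t0 : 0 < t by rewrite /t; lra.
have tE : t' = t + t by rewrite /t; field.
rewrite tE; set r := Num.sqrt t.
have r0 : 0 < r by rewrite sqrtr_gt0.
have rt : r ^+ 2 = t by rewrite sqr_sqrtr// ltW.
have r20 : 0 < Num.sqrt (t + t) by rewrite sqrtr_gt0 addr_gt0.
have vx := V_gt0 xD r0; have vy := V_gt0 yD r0.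
have ux := V_gt0 xD r20; have uy := V_gt0 yD r20.
pose k := rho x y / (16 * Ctau * r).
have k0 : 0 <= k by rewrite divr_ge0 ?rho_ge0// !mulr_ge0 ?ltW.
have h := kernel_weighted_upper M0 HM t0 xD yD k0; rewrite -/r -/Dc in h.
have E0 : 0 < expR (k / r * rho x y) by exact: expR_gt0.
rewrite -ler_pdivlMr// -expRN in h; apply: (le_trans h).
(* By (2k + Dc)^2 <= 8 k^2 + 2 Dc^2. *)
have e1 : expR (Ctau * (2 * k + Dc) ^+ 2) <= expR (8 * Ctau * k ^+ 2) * expR (2 * Ctau * Dc ^+ 2).
  rewrite -expRD ler_expR.
  rewrite -subr_ge0 (_ : _ - _ = Ctau * (2 * k - Dc) ^+ 2); last by ring.
  by rewrite mulr_ge0 ?sqr_ge0// ltW.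
have e2 : expR (8 * Ctau * k ^+ 2) * expR (- (k / r * rho x y)) = expR (- (rho x y ^+ 2 / (16 * Ctau * (t + t)))).
  rewrite -expRD; congr expR; rewrite /k (_ : t + t = 2 * r ^+ 2); last by rewrite rt; ring.
  by field; rewrite !gt_eqF.
have v1 : (Num.sqrt (V x r * V y r))^-1 <= Cd / Num.sqrt (V x (Num.sqrt (t + t)) * V y (Num.sqrt (t + t))).
  have n1 : 0 < Num.sqrt (V x r * V y r) by rewrite sqrtr_gt0 mulr_gt0.
  have n2 : 0 < Num.sqrt (V x (Num.sqrt (t + t)) * V y (Num.sqrt (t + t))) by rewrite sqrtr_gt0 mulr_gt0.
  rewrite ler_pdivlMr// ler_pdivrMl// -(@ger0_norm _ Cd) ?(ltW C0)// -sqrtr_sqr -sqrtrM ?mulr_ge0 ?(ltW vx) ?(ltW vy)//.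
  have w z : D z -> V z (Num.sqrt (t + t)) <= Cd * V z r.
    by move=> zD; apply: le_trans (V_double zD r0); apply: V_le; exact: sqrt_double.
  rewrite ler_wsqrtr//; apply: le_trans (ler_pM (ltW ux) (ltW uy) (w x xD) (w y yD)) _.
  by rewrite le_eqVlt; apply/orP; left; apply/eqP; ring.
pose F := expR (8 * Ctau * k ^+ 2) * expR (2 * Ctau * Dc ^+ 2).
have F0 : 0 <= F by rewrite mulr_ge0 ?expR_ge0.
have G0 : 0 <= M * Cd * Ct by rewrite !mulr_ge0 ?ltW.
apply: (@le_trans _ _ (M * Cd * Ct * F * (Cd / Num.sqrt (V x (Num.sqrt (t + t)) * V y (Num.sqrt (t + t)))) * expR (- (k / r * rho x y)))).
  rewrite ler_wpM2r ?expR_ge0//; apply: ler_pM => //.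
  - by rewrite mulr_ge0 ?expR_ge0.
  - by rewrite ler_wpM2l.
by rewrite -e2 /F le_eqVlt; apply/orP; left; apply/eqP; ring.
Qed.

(** Outside a ball of radius 2^n sqrt t the weight exp(rho / sqrt t) is at least
    exp(2^n), so by the tail estimate at most half of the mass lies there. *)
Lemma tail_ball : exists n : nat, forall t x, 0 < t -> D x ->
  2^-1 <= I (fun z => K (t / 2) x z * \1_(rball x (2 ^+ n * Num.sqrt t)) z).
Proof.
have Ct0 : 0 < Ct by apply: lt_le_trans Ct1.
(* The part Ctau absorbs the exponential factor of the tail estimate; 2 Ct brings
   its constant Ct below 1/2, as 2 Ct <= exp(2 Ct). *)
pose L := Ctau + 2 * Ct.
have L0 : 0 <= L by rewrite addr_ge0 ?mulr_ge0 ?ltW.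
pose n := (Num.trunc L).+1.
have nL : L <= 2 ^+ n.
  have /andP[_ h] := truncn_itv L0.
  apply: le_trans (ltW h) _; apply: le_trans (exp2_ge _) _; rewrite ler_weXn2l//; lra.
exists n => t x t0 xD; set r := Num.sqrt t; set B := rball x _.
have r0 : 0 < r by rewrite sqrtr_gt0.
have rt : r ^+ 2 = t by rewrite sqr_sqrtr// ltW.
have t20 : 0 < t / 2 by rewrite divr_gt0.
have li : 0 < r^-1 by rewrite invr_gt0.
have bK := K_meas t20 xD; have be := exp_meas xD (ltW li); have bB := bm_ball x (2 ^+ n * r).
have h1 := K_tail li t20 xD.
have e1 : Ctau * r^-1 ^+ 2 * (t / 2) = Ctau / 2 by rewrite -rt; field; rewrite gt_eqF.
rewrite e1 in h1.
pose c := expR (- 2 ^+ n) : R.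
have c0 : 0 < c by exact: expR_gt0.
have small : c * (Ct * expR (Ctau / 2)) <= 2^-1.
  rewrite mulrCA -expRD -ler_pdivlMl//.
  apply: (@le_trans _ _ (expR (- (2 * Ct)))).
    by rewrite ler_expR; rewrite /L in nL; have := Ctau0; lra.
  rewrite expRN -invfM lef_pV2 ?posrE ?mulr_gt0 ?expR_gt0// (mulrC Ct).
  by have := expR_ge1Dx (2 * Ct); lra.
have bs : bounded_meas (fun z => K (t / 2) x z * \1_B z) by exact: bounded_measM.
have bt : bounded_meas (fun z => c * (K (t / 2) x z * expR (r^-1 * rho x z))).
  by apply: bm_scale; exact: bounded_measM.
have : I (K (t / 2) x) <= I (fun z => K (t / 2) x z * \1_B z + c * (K (t / 2) x z * expR (r^-1 * rho x z))).
  apply: I_le => //; first exact: bounded_measD.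
  move=> z zD; have k0 := K_ge0 t20 xD zD.
  rewrite indic_ball//; case: ifPn => h.
    by rewrite mulr1 lerDl; apply: mulr_ge0; [exact: ltW|rewrite mulr_ge0 ?expR_ge0].
  rewrite -leNgt in h; have h2 : 2 ^+ n <= r^-1 * rho x z by rewrite mulrC ler_pdivlMr.
  have e2 : 1 <= expR (- 2 ^+ n + r^-1 * rho x z) by rewrite -[leLHS]expR0 ler_expR; lra.
  by rewrite mulr0 add0r mulrCA -expRD ler_peMr.
rewrite I_add// I_scale; last exact: bounded_measM.
rewrite K_mass//.
have : c * I (fun z => K (t / 2) x z * expR (r^-1 * rho x z)) <= c * (Ct * expR (Ctau / 2)) by rewrite ler_wpM2l// ltW.
lra.
Qed.

(** K_t(x,x) is the integral of K_(t/2)(x,.)^2, which is at least that of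
    2 c K_(t/2)(x,.) 1_B - c^2 1_B for every c; the choice c = 1 / (2 V(B)) turns
    this into the Cauchy-Schwarz inequality on B, up to a constant. *)
Lemma diag_lower : exists2 c5 : R, 0 < c5 & forall t x, 0 < t -> D x -> c5 / V x (Num.sqrt t) <= K t x x.
Proof.
have [n H] := tail_ball.
have C0 : 0 < Cd by apply: lt_le_trans Cd1.
exists (4 * Cd ^+ n)^-1; first by rewrite invr_gt0 mulr_gt0// exprn_gt0.
move=> t x t0 xD; have r0 : 0 < Num.sqrt t by rewrite sqrtr_gt0.
have t20 : 0 < t / 2 by rewrite divr_gt0.
have bK := K_meas t20 xD.
set r := Num.sqrt t in r0 *; pose s := 2 ^+ n * r.
have s0 : 0 < s by rewrite mulr_gt0// exprn_gt0.
have vs := V_gt0 xD s0; have vx := V_gt0 xD r0.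
have h := H t x t0 xD; rewrite -/r -/s in h.
have bB := bm_ball x s.
pose c := (2 * V x s)^-1.
have c0 : 0 < c by rewrite invr_gt0 mulr_gt0.
have bs : bounded_meas (fun z => K (t / 2) x z * \1_(rball x s) z) by exact: bounded_measM.
apply: (@le_trans _ _ (2 * c * 2^-1 + - c ^+ 2 * V x s)).
  have -> : 2 * c * 2^-1 + - c ^+ 2 * V x s = (4 * V x s)^-1 by rewrite /c; field; rewrite gt_eqF.
  rewrite -invfM lef_pV2 ?posrE ?mulr_gt0 ?exprn_gt0// -mulrA ler_wpM2l//.
  exact: V_double_iter.
have E : K t x x = K (t / 2 + t / 2) x x by congr (K _ x x); field.
rewrite E -K_semi// -(I_ball x s).
apply: (@le_trans _ _ (I (fun z => 2 * c * (K (t / 2) x z * \1_(rball x s) z) + - c ^+ 2 * \1_(rball x s) z))).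
  rewrite I_add ?I_scale//; [|exact: bm_scale|exact: bm_scale].
  by rewrite lerD2r ler_wpM2l// mulr_ge0// ltW.
apply: I_le.
- by apply: bounded_measD; exact: bm_scale.
- by apply: bounded_measM => //; under eq_fun do rewrite K_sym.
- move=> z zD; rewrite indic_ball// (K_sym _ z x) -expr2; case: ifPn => _; last by rewrite !mulr0 addr0 sqr_ge0.
  rewrite !mulr1; have := sqr_ge0 (K (t / 2) x z - c); rewrite sqrrB; lra.
Qed.

(** Regularity with the diagonal upper bound as A: for eps small the oscillation is at
    most half of the diagonal lower bound. *)
Lemma near_diag_lower : exists c6 eps : R, [/\ 0 < c6, 0 < eps <= 2^-1 &
  forall t x y, 0 < t <= 64^-1 -> D x -> D y -> rho x y <= eps * Num.sqrt t ->
    c6 / V x (Num.sqrt t) <= K t x y].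
Proof.
have [c5 c50 H] := diag_lower; have [M M0 HM] := diag_upper.
have C0 : 0 < Cd by apply: lt_le_trans Cd1.
pose B := Cl * (M * Cd ^+ 4) + 1.
have B1 : 0 <= Cl * (M * Cd ^+ 4) by rewrite !mulr_ge0// ?exprn_ge0 ?ltW.
have B0 : 0 < B by rewrite /B ltr_wpDl.
pose eps := Num.min 2^-1 (c5 / 2 / B).
have e0 : 0 < eps by rewrite lt_min invr_gt0 ltr0n !divr_gt0.
have [e1 e2] : eps <= 2^-1 /\ eps <= c5 / 2 / B by rewrite !ge_min !lexx orbT.
exists (c5 / 2), eps; split; [by rewrite divr_gt0|by rewrite e0|].
move=> t x y tD xD yD xy; have /andP[t0 t1] := tD.
have r0 : 0 < Num.sqrt t by rewrite sqrtr_gt0.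
have t20 : 0 < t / 2 by rewrite divr_gt0.
have s0 : 0 < Num.sqrt (t / 2) by rewrite sqrtr_gt0.
have vx := V_gt0 xD r0.
have HA z : D z -> rho x z < 4 * Num.sqrt t -> K (t / 2) z z <= M * Cd ^+ 4 / V x (Num.sqrt t).
  move=> zD zr; have h := V_half xD zD t0 zr.
  rewrite ler_pdivlMr//; apply: le_trans (ler_wpM2l (K_ge0 t20 zD zD) h) _.
  by rewrite mulrCA mulrC ler_wpM2r ?HM// exprn_ge0// ltW.
have eD : 0 <= eps <= 2^-1 by rewrite ltW.
have := K_lip tD xD yD eD xy HA; have := H t x t0 xD.
rewrite ler_norml => h1 /andP[h2 _].
have h3 : Cl * (eps * (M * Cd ^+ 4 / V x (Num.sqrt t))) <= c5 / 2 / V x (Num.sqrt t).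
  rewrite (_ : Cl * _ = eps * (Cl * (M * Cd ^+ 4)) / V x (Num.sqrt t)); last by ring.
  rewrite ler_wpM2r ?invr_ge0 ?(ltW vx)//.
  apply: (@le_trans _ _ (eps * B)); first by rewrite ler_wpM2l ?(ltW e0)// lerDl.
  by rewrite -ler_pdivlMr.
move: h1 h2 h3; rewrite ![c5 / 2 / _]mulrAC; move: (c5 / _) (Cl * _) => u v; lra.
Qed.

(** Induction on the number of steps: by the semigroup law it is enough to integrate
    over a small ball around a point z of a geodesic, on which both kernels are
    bounded below. *)
Lemma chain_lower : exists c6 delta g : R, [/\ 0 < c6, 0 < delta, 0 < g <= 1 &
  forall (n : nat) s x y, 0 < s <= 64^-1 -> D x -> D y -> rho x y <= n.+1%:R * (delta * Num.sqrt s) ->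
    c6 * g ^+ n / V y (Num.sqrt s) <= K (n.+1%:R * s) x y].
Proof.
have [c6' [eps [c60' /andP[e0 e1] Hnear']]] := near_diag_lower.
pose c6 := Num.min c6' 1.
have c60 : 0 < c6 by rewrite lt_min c60' ltr01.
have [c61 c62] : c6 <= c6' /\ c6 <= 1 by rewrite !ge_min !lexx orbT.
have Hnear t x y : 0 < t <= 64^-1 -> D x -> D y -> rho x y <= eps * Num.sqrt t ->
    c6 / V x (Num.sqrt t) <= K t x y.
  by move=> tD xD yD xy; apply: le_trans (Hnear' t x y tD xD yD xy); rewrite ler_wpM2r.
(* In units of sqrt s, consecutive points of the chain lie within 2 delta of each
   other, and a third delta is needed for the ball around z. *)
pose delta := eps / 3.
have d0 : 0 < delta by rewrite divr_gt0.
have d1 : delta <= 2^-1 by rewrite /delta; lra.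
pose j := (Num.trunc (2 / delta)).+1.
have jd : 2 <= 2 ^+ j * delta.
  have i0 : 0 <= 2 / delta by rewrite divr_ge0// ltW.
  have /andP[_ h] := truncn_itv i0.
  rewrite -ler_pdivrMr//; apply: le_trans (ltW h) _.
  apply: le_trans (exp2_ge _) _; rewrite ler_weXn2l//; lra.
have C0 : 0 < Cd by apply: lt_le_trans Cd1.
have Cj : 0 < Cd ^+ j by rewrite exprn_gt0.
pose g := c6 / Cd ^+ j.
have g0 : 0 < g by rewrite divr_gt0.
have g1 : g <= 1.
  by rewrite ler_pdivrMr// mul1r (le_trans c62)// exprn_ege1.
exists c6, delta, g; split => //; first by rewrite g0.
elim=> [|n ih] s x y sD xD yD xy; have /andP[s0 s1] := sD;
  have r0 : 0 < Num.sqrt s by rewrite sqrtr_gt0.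
  rewrite expr0 mulr1 mul1r K_sym; apply: Hnear => //; rewrite rhoC; apply: (le_trans xy).
  by rewrite mul1r ler_wpM2r ?(ltW r0)// /delta; lra.
set r := Num.sqrt s in xy r0 *.
have dr0 : 0 < delta * r by rewrite mulr_gt0.
have [z [zD xz zy]] : exists z, [/\ D z, rho x z <= 2 * (delta * r) & rho z y <= n%:R * (delta * r)].
  have [h|h] := leP (rho x y) (2 * (delta * r)).
    by exists y; split => //; rewrite rho0 mulr_ge0// ltW.
  have rD : 0 <= 2 * (delta * r) <= rho x y by rewrite (ltW h) andbT mulr_ge0// ltW.
  have [z [zD h1 h2]] := geodesic xD yD rD; exists z; split => //; first by rewrite h1.
  rewrite h2; move: xy; rewrite -(natr1 n.+1) -(natr1 n); lra.
have vx := V_gt0 xD r0; have vy := V_gt0 yD r0; have vz := V_gt0 zD dr0.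
have ns0 : 0 < n.+1%:R * s by rewrite mulr_gt0// ltr0n.
have -> : n.+2%:R * s = s + n.+1%:R * s by rewrite -(natr1 n.+1) mulrDl mul1r addrC.
rewrite -K_semi//.
apply: (@le_trans _ _ (c6 / V x r * (c6 * g ^+ n / V y r) * V z (delta * r))).
  have hx : V x r <= Cd ^+ j * V z (delta * r).
    apply: le_trans (V_double_iter j zD dr0); apply: V_sub; rewrite rhoC.
    apply: (@le_trans _ _ (2 * r)).
      have : delta * r <= 2^-1 * r by rewrite ler_wpM2r// ltW.
      lra.
    by rewrite mulrA ler_wpM2r// ltW.
  have hg : g <= c6 / V x r * V z (delta * r).
    rewrite /g ler_pdivrMr// mulrAC -mulrA -[leLHS]mulr1.
    rewrite -mulrA ler_wpM2l ?(ltW c60)// [leRHS]mulrC ler_pdivlMr// mul1r.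
    exact: hx.
  have q0 : 0 <= c6 * g ^+ n / V y r by rewrite divr_ge0 ?(ltW vy)// mulr_ge0 ?exprn_ge0 ?ltW.
  rewrite exprS (_ : c6 * (g * g ^+ n) / V y r = g * (c6 * g ^+ n / V y r)); last by ring.
  rewrite [leRHS]mulrAC; exact: ler_wpM2r.
apply: I_ge_ball.
- by apply: bounded_measM; [exact: K_meas|under eq_fun do rewrite K_sym; exact: K_meas].
- by move=> u uD; rewrite mulr_ge0 ?K_ge0.
- move=> u uD zu; apply: ler_pM.
  + by rewrite divr_ge0 ?(ltW vx) ?(ltW c60).
  + by rewrite divr_ge0 ?(ltW vy)// mulr_ge0 ?exprn_ge0 ?ltW.
  + apply: Hnear => //; apply: le_trans (rho_tri x z u) _; rewrite -/r; rewrite /delta in xz zu; lra.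
  + apply: ih => //; apply: le_trans (rho_tri u z y) _; rewrite (rhoC u) -(natr1 n) -/r; lra.
Qed.

(** Take n of order rho^2/t steps of time t/(n+1): each one has length at most
    delta sqrt (t/(n+1)), and the product of the n constants g is a Gaussian factor. *)
Lemma lower_small : exists c1 c2 : R, [/\ 0 < c1, 0 < c2 & forall t x y, 0 < t <= 64^-1 -> D x -> D y ->
  c1 * expR (- (rho x y ^+ 2 / (c2 * t))) / V y (Num.sqrt t) <= K t x y].
Proof.
have [c6 [delta [g [c60 d0 /andP[g0 g1] H]]]] := chain_lower.
(* The 1 ensures that l > 0 also when g = 1. *)
pose l := 1 - ln g.
have l0 : 0 < l by rewrite /l subr_gt0; apply: le_lt_trans ltr01; apply: ln_le0.
exists c6, (delta ^+ 2 / l); split; [by []|by rewrite divr_gt0 ?exprn_gt0|].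
move=> t x y /andP[t0 t1] xD yD.
pose p := rho x y ^+ 2 / (delta ^+ 2 * t).
have dt0 : 0 < delta ^+ 2 * t by rewrite mulr_gt0 ?exprn_gt0.
have p0 : 0 <= p by rewrite divr_ge0 ?sqr_ge0 ?(ltW dt0).
have /andP[n1 n2] := truncn_itv p0; set n := Num.trunc p in n1 n2.
have N0 : (0 : R) < n.+1%:R by rewrite ltr0n.
pose s := t / n.+1%:R.
have s0 : 0 < s by rewrite divr_gt0.
have st : s <= t by rewrite ler_pdivrMr// ler_peMr ?(ltW t0)// ler1n.
have sD : 0 < s <= 64^-1 by rewrite s0 (le_trans st).
have r0 : 0 < Num.sqrt s by rewrite sqrtr_gt0.
have r0' : 0 < Num.sqrt t by rewrite sqrtr_gt0.
have tE : n.+1%:R * s = t by rewrite /s mulrC divfK// gt_eqF.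
have xy : rho x y <= n.+1%:R * (delta * Num.sqrt s).
  rewrite -ler_sqr ?nnegrE ?rho_ge0 ?mulr_ge0 ?(ltW N0) ?(ltW d0) ?(ltW r0)//.
  rewrite !exprMn sqr_sqrtr ?(ltW s0)//.
  rewrite (_ : n.+1%:R ^+ 2 * (delta ^+ 2 * s) = n.+1%:R * (delta ^+ 2 * (n.+1%:R * s))); last by ring.
  by rewrite tE -ler_pdivrMr// ltW.
have := H n s x y sD xD yD xy; rewrite tE; apply: le_trans.
have vs := V_gt0 yD r0; have vt := V_gt0 yD r0'.
apply: ler_pM.
- by rewrite mulr_ge0 ?expR_ge0 ?ltW.
- by rewrite invr_ge0 ltW.
- rewrite ler_wpM2l ?(ltW c60)//.
  have E : g = expR (ln g) by rewrite lnK// posrE.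
  rewrite [in leRHS]E -expRM_natl ler_expR.
  have lg : ln g <= 0 by exact: ln_le0.
  have h1 : p * ln g <= n%:R * ln g by rewrite ler_wnM2r.
  apply: le_trans h1; rewrite (_ : rho x y ^+ 2 / (delta ^+ 2 / l * t) = p * l); last first.
    by rewrite /p; field; rewrite !gt_eqF.
  by rewrite /l; lra.
- by rewrite lef_pV2 ?posrE//; apply: V_le; rewrite ler_wsqrtr.
Qed.

Let le_inv_sqrt (k u v w : R) : 0 < u -> 0 < v -> 0 <= w -> w / u <= k -> w / v <= k -> w / Num.sqrt (u * v) <= k.
Proof.
move=> u0 v0 w0 hu hv; have su : 0 < Num.sqrt u by rewrite sqrtr_gt0.
have sv : 0 < Num.sqrt v by rewrite sqrtr_gt0.
have qu : u = Num.sqrt u ^+ 2 by rewrite sqr_sqrtr// ltW.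
have qv : v = Num.sqrt v ^+ 2 by rewrite sqr_sqrtr// ltW.
rewrite sqrtrM ?(ltW u0)//; have [h|h] := leP (Num.sqrt u) (Num.sqrt v).
  apply: le_trans hu; rewrite ler_wpM2l// lef_pV2 ?posrE ?mulr_gt0// {1}qu expr2.
  by rewrite ler_wpM2l// ltW.
apply: le_trans hv; rewrite ler_wpM2l// lef_pV2 ?posrE ?mulr_gt0// {1}qv expr2.
by rewrite ler_wpM2r// ltW.
Qed.

(** For t <= 1/64 symmetrise the chain bound.  For larger t write t = u + 1/64: the
    kernel at time 1/64 is bounded below on the whole interval, whose size is bounded,
    and the kernel at time u has mass 1. *)
Theorem gaussian_lower : exists c1 c2 : R, [/\ 0 < c1, 0 < c2 & forall t x y, 0 < t -> D x -> D y ->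
  c1 * (expR (- (rho x y ^+ 2 / (c2 * t))) / Num.sqrt (V x (Num.sqrt t) * V y (Num.sqrt t))) <= K t x y].
Proof.
have [c1 [c2 [c10 c20 H]]] := lower_small.
have C0 : 0 < Cd by apply: lt_le_trans Cd1.
pose T := fine (mu DD).
pose F := expR (- (16 / (c2 * 64^-1))) : R.
have F0 : 0 < F by exact: expR_gt0.
have F1 : F <= 1 by rewrite -expR0 ler_expR oppr_le0 divr_ge0// mulr_ge0// ltW.
exists (c1 * (F / Cd)), c2; split => //; first by rewrite !mulr_gt0 ?invr_gt0.
have FC : F / Cd <= 1 by rewrite ler_pdivrMr// mul1r (le_trans F1).
move=> t x y t0 xD yD; have r0 : 0 < Num.sqrt t by rewrite sqrtr_gt0.
have vx := V_gt0 xD r0; have vy := V_gt0 yD r0.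
have [t1|t1] := leP t 64^-1.
  have tD : 0 < t <= 64^-1 by rewrite t0.
  set E := expR _.
  apply: (@le_trans _ _ (c1 * E / Num.sqrt (V x (Num.sqrt t) * V y (Num.sqrt t)))).
    rewrite mulrA ler_wpM2r ?invr_ge0 ?sqrtr_ge0// ler_wpM2r ?expR_ge0//.
    by rewrite -[leRHS]mulr1 ler_wpM2l// ltW.
  apply: le_inv_sqrt => //.
  - by rewrite mulr_ge0 ?expR_ge0 ?ltW.
  - by rewrite K_sym /E rhoC; exact: H.
  - exact: H.
have q0 : (0 : R) < 64^-1 by rewrite invr_gt0.
have qD : 0 < (64^-1 : R) <= 64^-1 by apply/andP; split; [exact: q0|exact: lexx].
have Eq : Num.sqrt (64^-1 : R) = 8^-1.
  by rewrite (_ : (64^-1 : R) = (8^-1) ^+ 2) ?sqrtr_sqr ?ger0_norm//; field.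
have big z : D z -> T <= Cd * V z (Num.sqrt t).
  move=> zD; apply: V_total => //; apply: (@le_trans _ _ 8^-1); first lra.
  by rewrite -Eq ler_wsqrtr// ltW.
have T0 : 0 < T by apply: lt_le_trans vx _; exact: V_le_total.
have low z : D z -> c1 * F / T <= K 64^-1 z y.
  move=> zD; apply: le_trans (H _ z y qD zD yD); rewrite Eq.
  have v8 : 0 < V y 8^-1 by apply: V_gt0 => //; lra.
  apply: ler_pM.
  - by rewrite mulr_ge0 ?ltW.
  - by rewrite invr_ge0 ltW.
  - rewrite ler_wpM2l ?(ltW c10)// ler_expR lerN2 ler_wpM2r ?invr_ge0 ?mulr_ge0 ?(ltW c20)//.
    have := rho_le4 zD yD; have := rho_ge0 z y => h1 h2.
    by rewrite (_ : 16 = 4 ^+ 2); [apply: lerXn2r; rewrite ?nnegrE|ring].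
  - by rewrite lef_pV2 ?posrE//; exact: V_le_total.
pose u := t - 64^-1.
have u0 : 0 < u by rewrite subr_gt0.
apply: (@le_trans _ _ (c1 * F / T)).
  rewrite (_ : c1 * (F / Cd) * _ = (c1 * F) * (expR (- (rho x y ^+ 2 / (c2 * t))) / (Cd * Num.sqrt (V x (Num.sqrt t) * V y (Num.sqrt t))))); last first.
    by field; rewrite !gt_eqF// sqrtr_gt0 mulr_gt0.
  have cF : 0 <= c1 * F by rewrite mulr_ge0 ?(ltW c10) ?(ltW F0).
  apply: (ler_wpM2l cF).
  have s0 : 0 < Num.sqrt (V x (Num.sqrt t) * V y (Num.sqrt t)) by rewrite sqrtr_gt0 mulr_gt0.
  apply: (@le_trans _ _ (1 / (Cd * Num.sqrt (V x (Num.sqrt t) * V y (Num.sqrt t))))).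
    apply: ler_wpM2r; first by rewrite invr_ge0 mulr_ge0 ?(ltW C0) ?(ltW s0).
    rewrite -[leRHS]expR0 ler_expR oppr_le0 divr_ge0 ?sqr_ge0 ?mulr_ge0 ?(ltW c20) ?(ltW t0)//.
  rewrite div1r lef_pV2 ?posrE ?mulr_gt0//.
  rewrite -{1}(ger0_norm (ltW T0)) -sqrtr_sqr -(ger0_norm (ltW C0)) -sqrtr_sqr -sqrtrM ?sqr_ge0//.
  rewrite ler_wsqrtr//.
  rewrite (_ : Cd ^+ 2 * _ = (Cd * V x (Num.sqrt t)) * (Cd * V y (Num.sqrt t))); last by ring.
  by rewrite expr2; apply: ler_pM; rewrite ?(ltW T0)//; exact: big.
have -> : t = u + 64^-1 by rewrite /u subrK.
rewrite -K_semi//.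
rewrite -[leLHS]mulr1 -[X in _ * X <= _](K_mass u0 xD) -I_scale; last exact: K_meas.
apply: I_le.
- by apply: bm_scale; exact: K_meas.
- by apply: bounded_measM; [exact: K_meas|under eq_fun do rewrite K_sym; exact: K_meas].
- by move=> z zD; rewrite mulrC ler_wpM2l ?K_ge0// low.
Qed.

End gaussian_bounds.

(** * Gaussian bounds for the Jacobi kernel *)

Section jacobi_geometry.
Context {R : realType}.
Implicit Types (x y z r : R).

(** In the angular variable the space is an interval. *)
Lemma jacobi_dist_geodesic x y r : -1 <= x <= 1 -> -1 <= y <= 1 -> 0 <= r <= jacobi_dist x y ->
  exists z, [/\ -1 <= z <= 1, jacobi_dist x z = r & jacobi_dist z y = jacobi_dist x y - r].
Proof.
move=> xD yD; rewrite /jacobi_dist.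
have := acos_ge0 xD; have := acos_lepi xD; have := acos_ge0 yD; have := acos_lepi yD.
move: (acos x) (acos y) => u v v1 v0 u1 u0 /andP[r0].
have [uv|vu] := leP u v => rh.
- have uvE : `|u - v| = v - u by rewrite distrC ger0_norm// subr_ge0.
  rewrite uvE in rh *; have wD : 0 <= u + r <= pi by apply/andP; split; lra.
  exists (cos (u + r)); rewrite acos_cos// cos_geN1 cos_le1; split=> //.
  + by rewrite distrC ger0_norm; lra.
  + by rewrite distrC ger0_norm; lra.
- have uvE : `|u - v| = u - v by rewrite ger0_norm// subr_ge0 ltW.
  rewrite uvE in rh *; have wD : 0 <= u - r <= pi by apply/andP; split; lra.
  exists (cos (u - r)); rewrite acos_cos// cos_geN1 cos_le1; split=> //.
  + by rewrite ger0_norm; lra.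
  + by rewrite ger0_norm; lra.
Qed.

Lemma jacobi_distC x y : jacobi_dist x y = jacobi_dist y x.
Proof. exact: distrC. Qed.

Lemma jacobi_dist_triangle x y z : jacobi_dist x z <= jacobi_dist x y + jacobi_dist y z.
Proof. exact: ler_distD. Qed.

Lemma jacobi_dist0 x : jacobi_dist x x = 0.
Proof. by rewrite /jacobi_dist subrr normr0. Qed.

Lemma jacobi_dist_ge0 x y : 0 <= jacobi_dist x y.
Proof. exact: normr_ge0. Qed.

Lemma jacobi_dist_le4 x y : -1 <= x <= 1 -> -1 <= y <= 1 -> jacobi_dist x y <= 4.
Proof.
move=> xD yD; rewrite /jacobi_dist.
have := acos_ge0 xD; have := acos_lepi xD; have := acos_ge0 yD; have := acos_lepi yD.
have := pihalf_lt2 R; move: (acos x) (acos y) => u v h v1 v0 u1 u0.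
by rewrite ler_norml; apply/andP; split; lra.
Qed.

End jacobi_geometry.

Theorem jacobi_gaussian_bounds (R : realType) (a b : R) (P : nat -> {poly R}) :
  -1 < a -> -1 < b -> jacobi_polynomials a b P ->
  exists c1 c2 c3 c4 : R, [/\ 0 < c1, 0 < c2, 0 < c3 & 0 < c4] /\
    forall x y t : R, -1 <= x <= 1 -> -1 <= y <= 1 -> 0 < t ->
      c1 * gaussian a b c2 t x y <= jacobi_heat_kernel a b P t x y <= c3 * gaussian a b c4 t x y.
Proof.
move=> ha hb HP.
have [C [q [C1 PB]]] := P_sup_bound ha hb HP.
have [Cd Cd1 HV] := vol_doubling ha hb.
have [A [Q [A0 HA]]] := kernel_diag_bound ha hb PB.
have mu_int (f : measurableTypeR R -> R) : bounded_meas f ->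
    (jacobi_measure a b).-integrable `[(-1)%R, 1%R] (EFin \o f).
  by move=> bf; apply: bounded_meas_integrable => //; exact: measurable_itv.
have V0 (x r : R) : -1 <= x <= 1 -> 0 < r -> 0 < jacobi_vol a b x r.
  by move=> xD r0; have [] := HV x r xD r0.
have V2 (x r : R) : -1 <= x <= 1 -> 0 < r -> jacobi_vol a b x (2 * r) <= Cd * jacobi_vol a b x r.
  by move=> xD r0; have [] := HV x r xD r0.
have VT (x r : R) : -1 <= x <= 1 -> 16^-1 <= r ->
    fine (jacobi_measure a b `[-1, 1]) <= Cd * jacobi_vol a b x r.
  move=> xD r1; have r0 : 0 < r by apply: lt_le_trans r1; rewrite invr_gt0.
  by have [_ _] := HV x r xD r0; exact.
have T0 : 0 < 16 * tail_cst a b.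
  by rewrite /tail_cst; have := normr_ge0 (b - a); have := normr_ge0 (a + b + 2); lra.
have Ct1 : 1 <= 4 * expR 1 :> R.
  have := @expR_ge1Dx R 1; lra.
have tail (l t x : R) : 0 < l -> 0 < t -> -1 <= x <= 1 ->
    \int[jacobi_measure a b]_(z in `[-1, 1]) (jacobi_heat_kernel a b P t x z * expR (l * jacobi_dist x z))
      <= 4 * expR 1 * expR (16 * tail_cst a b * l ^+ 2 * t).
  move=> l0 t0 xD; have l40 : 0 < 4 * l by rewrite mulr_gt0.
  have := kernel_tail ha hb HP C1 PB l40 t0 xD.
  have -> : tail_cst a b * (4 * l) ^+ 2 * t = 16 * tail_cst a b * l ^+ 2 * t by ring.
  apply: le_trans; rewrite le_eqVlt; apply/orP; left; apply/eqP.
  apply: eq_Rintegral => z _; congr (_ * expR _); by field.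
have L0 := addr_ge0 (lip_cst_ge0 b ha) (lip_cst_ge0 a hb).
have [c1 [c2 [c10 c20 lo]]] := gaussian_lower mu_int (@measurable_jacobi_ball R)
  (@jacobi_distC R) (@jacobi_dist_triangle R) (@jacobi_dist0 R) (@jacobi_dist_ge0 R)
  (@jacobi_dist_le4 R) (@jacobi_dist_geodesic R) (@bounded_meas_exp_dist R) Cd1 V0 V2 VT
  (kernel_ge0 ha hb HP C1 PB) (kernelC a b P) (bounded_meas_kernel ha hb C1 PB)
  (kernel_mass ha hb HP C1 PB) (kernel_semigroup ha hb HP C1 PB)
  (kernel_diag_antitone ha hb C1 PB) Ct1 T0 tail L0 (kernel_lipschitz ha hb HP C1 PB) A0 HA.
have [c3 [c4 [c30 c40 up]]] := gaussian_upper mu_int (@measurable_jacobi_ball R)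
  (@jacobi_distC R) (@jacobi_dist_triangle R) (@jacobi_dist0 R) (@jacobi_dist_ge0 R)
  (@bounded_meas_exp_dist R) Cd1 V0 V2 VT
  (kernel_ge0 ha hb HP C1 PB) (kernelC a b P) (bounded_meas_kernel ha hb C1 PB)
  (kernel_mass ha hb HP C1 PB) (kernel_semigroup ha hb HP C1 PB)
  (kernel_diag_antitone ha hb C1 PB) (kernel_le_diag ha hb C1 PB) Ct1 T0 tail L0
  (kernel_lipschitz ha hb HP C1 PB) A0 HA.
exists c1, c2, c3, c4; split => // x y t xD yD t0; rewrite lo// ?up//.
Qed.

Theorem theorem5p1 (R : realType) (a b : R) (ha : -1 < a) (hb : -1 < b) :
  [/\ essentially_self_adjoint (jacobi_measure a b) (jacobi_graph a b),
      forall f : R -> R, jacobi_dom f ->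
        0 <= - \int[jacobi_measure a b]_x (f x * jacobi_op a b f x),
      exists T : R -> (R -> R) -> (R -> R), generates (jacobi_measure a b)
        (op_closure (jacobi_measure a b) (jacobi_graph a b)) T,
      exists P : nat -> {poly R}, jacobi_polynomials a b P &
      forall P : nat -> {poly R}, jacobi_polynomials a b P ->
      [/\ forall t x y : R, 0 < t -> -1 <= x <= 1 -> -1 <= y <= 1 ->
            cvgn (series (jacobi_heat_term a b P t x y)),
          forall T : R -> (R -> R) -> (R -> R), generates (jacobi_measure a b)
              (op_closure (jacobi_measure a b) (jacobi_graph a b)) T ->
            forall t : R, 0 < t ->
              integral_operator (jacobi_measure a b) `[-1, 1] (T t)
                (jacobi_heat_kernel a b P t) &
          exists c1 c2 c3 c4 : R,
            [/\ 0 < c1, 0 < c2, 0 < c3 & 0 < c4] /\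
            forall x y t : R, -1 <= x <= 1 -> -1 <= y <= 1 -> 0 < t ->
              c1 * gaussian a b c2 t x y <= jacobi_heat_kernel a b P t x y
                <= c3 * gaussian a b c4 t x y]].
Proof.
have HP0 := jacobi_polynomials_exist ha hb.
have [C0 [q0 [C01 PB0]]] := P_sup_bound ha hb HP0.
split.
- exact: jacobi_essentially_self_adjoint HP0 _ _ C01 PB0.
- exact: jacobi_op_negative.
- exact: jacobi_semigroup_exists HP0 _ _ C01 PB0.
- by exists (gs a b).
move=> P HP; have [C [q [C1 PB]]] := P_sup_bound ha hb HP; split.
- exact: jacobi_kernel_cvg ha hb P C q C1 PB.
- exact: integral_operator_kernel HP C q C1 PB.
- exact: jacobi_gaussian_bounds.
Qed.
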